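(* Assume Hypothesis A (stated in the context) holds. There exists $k\in\mathbb{Z}_+$ such that a $k$-connected $\mathrm{GF}(4)$-representable matroid with at least $2k$ elements is contained in $\mathcal{AF}_4$ if and only if it has no minor isomorphic to any of $F_7$, $F_7^*$, $V_1$, $V_1^*$, $V_2$, $V_3$, $V_3^*$, $P_1$, $P_1^*$, $P_2$, $P_3$, $P_3^*$, $Y_9$, $Y_9^*$, the Pappus matroid, or the dual of the Pappus matroid. Moreover, assume Hypothesis B (stated in the context) holds; then there exist $k,n\in\mathbb{Z}_+$ such that a vertically $k$-connected $\mathrm{GF}(4)$-representable matroid with an $M(K_n)$-minor is contained in $\mathcal{AF}_4$ if and only if it has no minor isomorphic to any of $F_7$, $F_7^*$, $V_1$, $V_2$, $V_3$, $P_1$, $P_2$, $P_3$, $Y_9$, or the Pappus matroid.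
   Context: $\mathcal{AF}_4$ is the class of matroids representable over every field with at least $4$ elements. $F_7$ is the Fano plane; the Pappus matroid is the rank-3 matroid of the Pappus configuration. Let $\alpha\in\mathrm{GF}(4)$ satisfy $\alpha^2=\alpha+1$. The following are column matroids over $\mathrm{GF}(4)$ of the given matrices (rows separated by semicolons): $V_1$: $[1,0,0,1,0,1,1,1,1;\ 0,1,0,1,1,\alpha^2,\alpha^2,\alpha,0;\ 0,0,1,0,1,1,\alpha,1,\alpha]$. $V_2$: $[1,0,0,0,1,1,1,0;\ 0,1,0,0,\alpha^2,\alpha,\alpha,1;\ 0,0,1,0,\alpha,\alpha^2,\alpha,1;\ 0,0,0,1,\alpha^2,\alpha^2,\alpha,\alpha]$. $V_3$: $[1,0,0,0,1,0,1,1,1;\ 0,1,0,0,\alpha,1,\alpha^2,\alpha^2,1;\ 0,0,1,0,\alpha,1,\alpha,1,\alpha^2;\ 0,0,0,1,0,1,1,0,0]$. $P_1$: $[0,1,1,1,1,1,0,0,0;\ 0,1,\alpha,0,0,0,1,1,1;\ 1,0,0,1,\alpha,\alpha^2,1,\alpha,\alpha^2]$. $P_2$: $[1,0,0,0,1,0,1,1;\ 0,1,0,0,\alpha,1,1,1;\ 0,0,1,0,1,1,0,1;\ 0,0,0,1,\alpha^2,1,\alpha^2,0]$. $P_3$: $[0,1,1,1,1,1,1,0,0;\ 0,1,\alpha,\alpha^2,0,0,0,1,1;\ 1,0,0,0,1,\alpha,\alpha^2,1,\alpha]$. $Y_9$ (the Perles configuration): $[1,0,0,1,1,0,\alpha,\alpha,1;\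 0,1,0,1,0,1,\alpha,1,\alpha;\ 0,0,1,0,1,1,1,0,1]$. ''$k$-connected'' is in Tutte's sense. A matroid is vertically $k$-connected if for every $X\subseteq E$ with $r(X)+r(E-X)-r(M)<k$, $X$ or $E-X$ is spanning; $M$ is cyclically $k$-connected if $M^*$ is vertically $k$-connected. Represented matroids: for a field $\mathbb{F}$, an $\mathbb{F}$-represented matroid is a pair $(E,U)$ with $U$ a subspace of $\mathbb{F}^E$; a matrix $A$ whose row space is $U$ represents it, written $M(A)$; its dual is $(E,U^\perp)$; $\widetilde M$ is the underlying abstract matroid; $M|X=(X,U|X)$, $M\backslash X=M|(E-X)$, $M/X=(M^*\backslash X)^*$; simplicity, connectivity and minors come from $\widetilde M$. $\mathbb{F}_p$ is the prime subfield. Frame templates: for $\Gamma\le\mathbb{F}^\times$, a $\Gamma$-frame matrix has at most two nonzero entries per column, each nonzero column contains an entry $1$, and a second nonzero entry (if any) equals $-\gamma$, $\gamma\in\Gamma$. A frame template over $\mathbb{F}$ is $\Phi=(\Gamma,C,X,Y_0,Y_1,A_1,\Delta,\Lambda)$ with $\Gamma\le\mathbb{F}^\times$; $C,X,Y_0,Y_1$ pairwise disjoint finite sets; $A_1\in\mathbb{F}^{X\times(C\cup Y_0\cup Y_1)}$; $\Lambda\le\mathbb{F}^X$ and $\Delta\le\mathbb{F}^{C\cup Y_0\cup Y_1}$ additive subgroups closed under scaling by $\Gamma$. $A'\in\mathbb{F}^{B\times E}$ respects $\Phi$ if $X\subseteq B$, $C,Y_0,Y_1\subseteq E$, $A'[X,C\cup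 Y_0\cup Y_1]=A_1$, and there is $Z\subseteq E-(C\cup Y_0\cup Y_1)$ with $A'[X,Z]=0$, columns of $A'[B-X,Z]$ unit vectors, $A'[B-X,E-(C\cup Y_0\cup Y_1\cup Z)]$ a $\Gamma$-frame matrix, columns of $A'[X,E-(C\cup Y_0\cup Y_1\cup Z)]$ in $\Lambda$, rows of $A'[B-X,C\cup Y_0\cup Y_1]$ in $\Delta$. $A$ conforms to $\Phi$ if for some such $A',Z$: $A[B,E-Z]=A'[B,E-Z]$ and each column $i\in Z$ of $A$ is the sum of columns $i$ and some $j\in Y_1$ of $A'$. An $\mathbb{F}$-represented matroid conforms to $\Phi$ if isomorphic to $M(A)/C\backslash Y_1$ for some conforming $A$; $\mathcal{M}(\Phi)$ is the set of these. Hypothesis A: for every finite field $\mathbb{F}$, positive integer $m$, and minor-closed class $\mathcal{M}$ of $\mathbb{F}$-represented matroids, there exist $k\in\mathbb{Z}_+$ and frame templates $\Phi_1,\dots,\Phi_s,\Psi_1,\dots,\Psi_t$ over $\mathbb{F}$ such that $\mathcal{M}\supseteq\mathcal{M}(\Phi_i)$ for all $i$, $\mathcal{M}$ contains the duals of all members of each $\mathcal{M}(\Psi_j)$, and every simple $k$-connected $M\in\mathcal{M}$ with at least $2k$ elements such that $\widetilde M$ has no $\mathrm{PG}(m-1,\mathbb{F}_p)$-minor either lies in some $\mathcal{M}(\Phi_i)$ or has $M^*$ in some $\mathcal{M}(\Psi_j)$. Hypothesis B: same setting; there exist $k,n\in\mathbb{Z}_+$ and frame templates $\Phi_1,\dots,\Phi_s,\Psi_1,\dots,\Psi_t$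 with (1) $\mathcal{M}\supseteq\mathcal{M}(\Phi_i)$; (2) $\mathcal{M}$ contains duals of members of each $\mathcal{M}(\Psi_j)$; (3) every simple vertically $k$-connected $M\in\mathcal{M}$ with an $M(K_n)$-minor but no $\mathrm{PG}(m-1,\mathbb{F}_p)$-minor lies in some $\mathcal{M}(\Phi_i)$; (4) for every cosimple cyclically $k$-connected $M\in\mathcal{M}$ with an $M^*(K_n)$-minor but no $\mathrm{PG}(m-1,\mathbb{F}_p)$-minor, $M^*$ lies in some $\mathcal{M}(\Psi_j)$. *)

(* Defs.v *)
From HB Require Import structures.
From mathcomp Require Import all_boot all_order all_fingroup all_algebra.
From mathcomp Require Import zify.
From Stdlib Require List.

Set Implicit Arguments.
Unset Strict Implicit.
Unset Printing Implicit Defensive.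

Import GRing.Theory.

Record matroid := Matroid {
  ground :> finType;
  rk : {set ground} -> nat;
  rk_card : forall X, rk X <= #|X|;
  rk_mono : forall X Y : {set ground}, X \subset Y -> rk X <= rk Y;
  rk_submod : forall X Y, rk (X :|: Y) + rk (X :&: Y) <= rk X + rk Y }.

Definition matroid_iso (M N : matroid) : Prop :=
  exists2 f : M -> N, bijective f & forall X : {set M}, rk (f @: X) = rk X.

Section MatroidOperations.
Variable M : matroid.
Implicit Types X Y C D : {set M}.

Definition dual_rk X : nat := #|X| + rk (~: X) - rk [set: M].

Lemma rkU_card X Y : rk (X :|: Y) <= rk X + #|Y|.
Proof. by have := rk_submod X Y; have := rk_card Y; lia. Qed.

Lemma dual_rkE X : dual_rk X + rk [set: M] = #|X| + rk (~: X).
Proof.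
by rewrite /dual_rk; have := rkU_card (~: X) X; rewrite setUC setUCr; lia.
Qed.

Lemma dual_rk_card X : dual_rk X <= #|X|.
Proof. by have := dual_rkE X; have := rk_mono (subsetT (~: X)); lia. Qed.

Lemma dual_rk_mono X Y : X \subset Y -> dual_rk X <= dual_rk Y.
Proof.
move=> sXY; have := rkU_card (~: Y) (Y :\: X).
have -> : ~: Y :|: Y :\: X = ~: X.
  apply/setP=> x; rewrite !inE; have := subsetP sXY x.
  by case: (x \in X) (x \in Y) => [] [] // /(_ isT).
have := dual_rkE X; have := dual_rkE Y.
by have := cardsD Y X; rewrite (setIidPr sXY); have := subset_leq_card sXY; lia.
Qed.

Lemma dual_rk_submod X Y :
  dual_rk (X :|: Y) + dual_rk (X :&: Y) <= dual_rk X + dual_rk Y.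
Proof.
have := rk_submod (~: X) (~: Y); rewrite -setCI -setCU.
have := dual_rkE X; have := dual_rkE Y; have := dual_rkE (X :|: Y).
by have := dual_rkE (X :&: Y); have := cardsUI X Y; lia.
Qed.

Definition dual : matroid :=
  Matroid dual_rk_card dual_rk_mono dual_rk_submod.

Section Minors.
Variables D C : {set M}.
Local Notation MD := {x : M | x \notin D}.
Local Notation MC := {x : M | x \notin C}.

Definition delete_rk (X : {set MD}) : nat := rk (val @: X).

Lemma delete_rk_card (X : {set MD}) : delete_rk X <= #|X|.
Proof. by rewrite -(card_imset (mem X) val_inj) rk_card. Qed.

Lemma delete_rk_mono (X Y : {set MD}) : X \subset Y -> delete_rk X <= delete_rk Y.
Proof. by move=> sXY; apply/rk_mono/imsetS. Qed.

Lemma delete_rk_submod (X Y : {set MD}) :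
  delete_rk (X :|: Y) + delete_rk (X :&: Y) <= delete_rk X + delete_rk Y.
Proof.
rewrite /delete_rk imsetU imsetI ?rk_submod //.
by move=> x y _ _; apply: val_inj.
Qed.

Definition delete : matroid :=
  Matroid delete_rk_card delete_rk_mono delete_rk_submod.

Definition contract_rk (X : {set MC}) : nat :=
  rk (val @: X :|: C) - rk C.

Lemma contract_rk_card (X : {set MC}) : contract_rk X <= #|X|.
Proof.
rewrite /contract_rk leq_subLR setUC -(card_imset (mem X) val_inj).
exact: rkU_card.
Qed.

Lemma contract_rk_mono (X Y : {set MC}) : X \subset Y -> contract_rk X <= contract_rk Y.
Proof. by move=> sXY; apply/leq_sub2r/rk_mono/setSU/imsetS. Qed.

Lemma contract_rk_submod (X Y : {set MC}) :
  contract_rk (X :|: Y) + contract_rk (X :&: Y)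
  <= contract_rk X + contract_rk Y.
Proof.
rewrite /contract_rk imsetU imsetI; last by move=> x y _ _; apply: val_inj.
set X' := val @: X; set Y' := val @: Y.
have := rk_submod (X' :|: C) (Y' :|: C).
rewrite setUACA setUid -setUIl.
have := rk_mono (subsetUr (X' :&: Y') C).
have := rk_mono (subsetUr (X' :|: Y') C).
by have := rk_mono (subsetUr X' C); have := rk_mono (subsetUr Y' C); lia.
Qed.

Definition contract : matroid :=
  Matroid contract_rk_card contract_rk_mono contract_rk_submod.

End Minors.

Definition simple : Prop := forall X, #|X| <= 2 -> rk X = #|X|.

Definition spanning X : Prop := rk X = rk [set: M].

(* Subtraction is not truncating here, by submodularity. *)
Definition conn X : nat := rk X + rk (~: X) - rk [set: M].

Definition separation (j : nat) X : Prop :=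
  [/\ j <= #|X|, j <= #|~: X| & conn X < j].

Definition kconnected (k : nat) : Prop :=
  forall j X, 0 < j < k -> ~ separation j X.

Definition vert_kconnected (k : nat) : Prop :=
  forall X, conn X < k -> spanning X \/ spanning (~: X).

End MatroidOperations.

Definition cosimple (M : matroid) : Prop := simple (dual M).

Definition cyc_kconnected (M : matroid) (k : nat) : Prop :=
  vert_kconnected (dual M) k.

Definition has_minor (M N : matroid) : Prop :=
  exists (C : {set M}) (D : {set contract C}), matroid_iso N (delete D).

Section ColumnMatroid.
Variables (F : fieldType) (B E : finType) (A : B -> E -> F).
Implicit Types X Y : {set E}.

Definition colvec (e : E) : {ffun B -> F^o} := [ffun b => A b e].

Definition col_rk X : nat := \dim (\sum_(e in X) <[colvec e]>)%VS.

Lemma col_rk_card X : col_rk X <= #|X|.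
Proof.
rewrite /col_rk -sum1_card.
elim/big_rec2: _ => [|e n U _ le_nU]; first by rewrite dimv0.
have := dimv_sum_cap <[colvec e]> U; have := dim_vline (colvec e).
by case: (_ != _); lia.
Qed.

Lemma col_sub X Y : X \subset Y ->
  (\sum_(e in X) <[colvec e]> <= \sum_(e in Y) <[colvec e]>)%VS.
Proof.
by move=> /subsetP sXY; apply/subv_sumP=> e /sXY Ye; apply: (sumv_sup e Ye).
Qed.

Lemma col_rk_mono X Y : X \subset Y -> col_rk X <= col_rk Y.
Proof. by move=> sXY; apply/dimvS/col_sub. Qed.

Lemma col_rk_submod X Y :
  col_rk (X :|: Y) + col_rk (X :&: Y) <= col_rk X + col_rk Y.
Proof.
rewrite /col_rk -[leqRHS]dimv_sum_cap; apply: leq_add; apply: dimvS.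
  apply/subv_sumP=> e; rewrite inE => /orP[] He.
    by apply: subv_trans (addvSl _ _); apply: (sumv_sup e He).
  by apply: subv_trans (addvSr _ _); apply: (sumv_sup e He).
by rewrite subv_cap !col_sub ?subsetIl ?subsetIr.
Qed.

Definition col_matroid : matroid :=
  Matroid col_rk_card col_rk_mono col_rk_submod.

End ColumnMatroid.

Definition representable (F : fieldType) (M : matroid) : Prop :=
  exists (n : nat) (A : 'I_n -> M -> F), forall X : {set M},
    rk X = col_rk A X.

Definition AF4 (M : matroid) : Prop :=
  forall F : fieldType,
    (exists2 s : seq F, uniq s & size s = 4) -> representable F M.

(* Points of the projective geometry over the prime field: the vectors whose
   first nonzero coordinate is 1, one for each one-dimensional subspace. *)
Definition normalized (F : fieldType) (m : nat) (v : 'rV[F]_m) : bool :=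
  [exists i, (v 0 i == 1)%R && [forall j : 'I_m, (j < i) ==> (v 0 j == 0)%R]].

(* PG p m has rank m, i.e. it is PG(m-1, p). *)
Definition PG (p m : nat) : matroid :=
  @col_matroid 'F_p 'I_m {v : 'rV['F_p]_m | normalized v}
    (fun i v => val v 0%R i).

Section CompleteGraph.
Variable n : nat.

Definition edge := {e : {set 'I_n} | #|e| == 2}.
Implicit Types (X Y : {set edge}) (e : edge).

Definition adj X : rel 'I_n := fun u v => [exists e in X, val e == [set u; v]].

Definition ncomp X : nat := n_comp (adj X) 'I_n.

Definition graphic_rk X : nat := n - ncomp X.

Lemma adj_sym X : symmetric (adj X).
Proof. by move=> u v; rewrite /adj; apply: eq_existsb => e; rewrite setUC. Qed.

Lemma adj_csym X : connect_sym (adj X).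
Proof. exact/sym_connect_sym/adj_sym. Qed.

Lemma connect_adj_sub X Y u v :
  X \subset Y -> connect (adj X) u v -> connect (adj Y) u v.
Proof.
move=> /subsetP sXY; apply: connect_sub => a b /exists_inP[e Xe De].
by apply/connect1/exists_inP; exists e; rewrite ?sXY.
Qed.


Lemma ncompU1 X e u v : val e = [set u; v] ->
  ncomp (e |: X) + ~~ connect (adj X) u v = ncomp X.
Proof.
move=> De; set Y := e |: X.
have sXY : X \subset Y by apply: subsetUr.
have Yuv : connect (adj Y) u v.
  by apply/connect1/exists_inP; exists e; rewrite ?De ?inE ?eqxx.
have adjY a b : adj Y a b -> adj X a b \/ (a \in pred2 u v /\ b \in pred2 u v).
  case/exists_inP=> e'; rewrite !inE => /predU1P[->|Xe'] /eqP De'; last first.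
    by left; apply/exists_inP; exists e'; rewrite // De'.
  right; rewrite De in De'.
  by have := set21 a b; have := set22 a b; rewrite -De' !inE.
pose a : pred 'I_n := closure (adj X) (pred2 u v).
have sub_a w : w \in pred2 u v -> w \in a by apply: mem_closure.
have cl_aX : closed (adj X) a by apply/closure_closed/adj_csym.
have cl_aY : closed (adj Y) a.
  by move=> x y /adjY[/cl_aX // | [/sub_a -> /sub_a ->]].
rewrite /ncomp (n_compC a (adj X)) (n_compC a (adj Y)).
have -> : n_comp (adj X) a = (~~ connect (adj X) u v).+1.
  exact/n_comp_closure2/adj_csym.
have -> : n_comp (adj Y) a = 1.
  have -> : n_comp (adj Y) a = n_comp (adj Y) (closure (adj Y) (pred2 u v)).
    apply: eq_n_comp_r => x; apply/idP/idP => [/pred0Pn[w /andP[Xxw uvw]]|].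
      by apply/pred0Pn; exists w; apply/andP; split; first exact: connect_adj_sub Xxw.
    case/pred0Pn=> w /andP[Yxw uvw].
    by rewrite (closed_connect cl_aY Yxw) sub_a.
  by rewrite n_comp_closure2 ?Yuv //; apply: adj_csym.
have -> : n_comp (adj Y) [predC a] = n_comp (adj X) [predC a].
  apply: eq_card => x; rewrite !inE /=.
  have [ax|nax] := boolP (x \in a); first by rewrite !andbF.
  congr (_ && _); rewrite /in_mem /= /roots /fingraph.root /=.
  suff eqc : connect (adj Y) x =1 connect (adj X) x by rewrite (eq_pick eqc).
  move=> y.
  apply/idP/idP; last exact: connect_adj_sub.
  case/connectP=> p; elim: p x nax => [|z p IHp] x nax /=; first by move=> _ ->.
  case/andP=> Yxz pz Dy.
  have naz : z \notin a by rewrite -(cl_aY _ _ Yxz).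
  apply: connect_trans (IHp z naz pz Dy).
  by case: (adjY _ _ Yxz) => [/connect1 // | [/sub_a]]; rewrite (negPf nax).
by rewrite addnAC add1n.
Qed.

Lemma ncomp_le X : ncomp X <= n.
Proof. by rewrite -[leqRHS]card_ord max_card. Qed.

Definition spanned X e : bool :=
  [forall u, forall v, (val e == [set u; v]) ==> connect (adj X) u v].

Lemma edgeP e : exists u v, val e = [set u; v].
Proof. by have /cards2P[u [v [_ ->]]] := valP e; exists u, v. Qed.

Lemma graphic_rkU1 X e : graphic_rk (e |: X) = graphic_rk X + ~~ spanned X e.
Proof.
have [u [v De]] := edgeP e.
have -> : spanned X e = connect (adj X) u v.
  apply/forallP/idP=> [/(_ u)/forallP/(_ v)|Xuv a].
    by rewrite De eqxx.
  apply/forallP=> b; apply/implyP; rewrite De => /eqP Dab.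
  have : a \in [set u; v] by rewrite Dab !inE eqxx.
  have : b \in [set u; v] by rewrite Dab !inE eqxx orbT.
  rewrite !inE => /orP[] /eqP-> /orP[] /eqP-> //; rewrite ?connect0 //.
  by rewrite adj_csym.
have := ncompU1 X De; have := ncomp_le X; have := ncomp_le (e |: X).
by rewrite /graphic_rk; case: connect; rewrite /=; lia.
Qed.

Lemma spannedS X Y e : X \subset Y -> spanned X e -> spanned Y e.
Proof.
move=> sXY /forallP He; apply/forallP=> u; apply/forallP=> v; apply/implyP=> De.
by have /forallP/(_ v)/implyP/(_ De) := He u; apply: connect_adj_sub.
Qed.

Lemma graphic_rk0 : graphic_rk set0 = 0.
Proof.
rewrite /graphic_rk /ncomp.
suff -> : n_comp (adj set0) 'I_n = n by rewrite subnn.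
rewrite -[RHS]card_ord; apply: eq_card => x; rewrite !inE andbT.
suff H : connect (adj set0) x (fingraph.root (adj set0) x).
  rewrite /in_mem /= /roots.
  case/connectP: H => [[|y p]] /=; first by move=> _ ->; rewrite eqxx.
  by case/andP=> /exists_inP[e]; rewrite inE.
exact: connect_root.
Qed.

Lemma graphic_rk_marginal X Y Z : X \subset Y ->
  graphic_rk (Z :|: Y) + graphic_rk X <= graphic_rk (Z :|: X) + graphic_rk Y.
Proof.
move=> sXY; have [m] := ubnP #|Z|; elim: m Z => // m IHm Z leZ.
have [->|[e Ze]] := set_0Vmem Z; first by rewrite !set0U addnC.
rewrite -(setD1K Ze) -!setUA !graphic_rkU1.
have := IHm (Z :\ e); rewrite (cardsD1 e Z) Ze in leZ => /(_ leZ).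
have := @spannedS (Z :\ e :|: X) (Z :\ e :|: Y) e (setUS _ sXY).
by case: (spanned _ e) (spanned _ e) => [] [] // H; rewrite /=; try lia; have := H isT.
Qed.

Lemma graphic_rkU X Z :
  graphic_rk X <= graphic_rk (Z :|: X) <= graphic_rk X + #|Z|.
Proof.
have [m] := ubnP #|Z|; elim: m Z => // m IHm Z leZ.
have [->|[e Ze]] := set_0Vmem Z; first by rewrite set0U cards0 addn0 leqnn.
rewrite -{1 2}(setD1K Ze) -!setUA !graphic_rkU1.
have := IHm (Z :\ e); rewrite (cardsD1 e Z) Ze in leZ *; move=> /(_ leZ).
by case: (spanned _ e); rewrite /=; lia.
Qed.

Lemma graphic_rk_card X : graphic_rk X <= #|X|.
Proof.
by case/andP: (graphic_rkU set0 X) => _; rewrite setU0 graphic_rk0.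
Qed.

Lemma graphic_rk_mono X Y : X \subset Y -> graphic_rk X <= graphic_rk Y.
Proof.
by move=> sXY; case/andP: (graphic_rkU X Y); rewrite (setUidPl sXY).
Qed.

Lemma graphic_rk_submod X Y :
  graphic_rk (X :|: Y) + graphic_rk (X :&: Y) <= graphic_rk X + graphic_rk Y.
Proof.
have := graphic_rk_marginal X (subsetIr X Y).
by rewrite (setUidPl (subsetIl X Y)).
Qed.

(* M(K_n), given by its rank function r(X) = n - (number of components). *)
Definition MK : matroid :=
  Matroid graphic_rk_card graphic_rk_mono graphic_rk_submod.

End CompleteGraph.

(* The simple matroid of rank at most 3 on {0, ..., n-1} in which a triple is
   dependent exactly when it lies on one of the lines in L. *)
Section Configuration.
Variables (n : nat) (L : seq (seq nat)).
Implicit Types X Y : {set 'I_n}.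

Definition lines_ok : bool :=
  all (fun l : seq nat => all (fun l' : seq nat =>
    (l == l') || (size [seq i <- l | i \in l'] <= 1)) L) L.

Hypothesis okL : lines_ok.

Definition on_line X (l : seq nat) : bool := [forall i in X, val i \in l].

Definition collinear X : bool := has (on_line X) L.

Definition config_rk X : nat :=
  if #|X| <= 2 then #|X| else if collinear X then 2 else 3.

Lemma on_lineS X Y l : X \subset Y -> on_line Y l -> on_line X l.
Proof.
by move=> /subsetP sXY /forall_inP Yl; apply/forall_inP=> i /sXY/Yl.
Qed.

Lemma collinearS X Y : X \subset Y -> collinear Y -> collinear X.
Proof. by move=> sXY; apply: sub_has => l; apply: on_lineS. Qed.

Lemma config_rk_card X : config_rk X <= #|X|.
Proof. by rewrite /config_rk; case: ifP => //; case: collinear; lia. Qed.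

Lemma config_rk_le3 X : config_rk X <= 3.
Proof. by rewrite /config_rk; case: ifP => [|_]; [lia | case: ifP]. Qed.

Lemma config_rk_mono X Y : X \subset Y -> config_rk X <= config_rk Y.
Proof.
move=> sXY; have := subset_leq_card sXY; have := collinearS sXY.
rewrite /config_rk; case: (leqP #|Y| 2); case: (leqP #|X| 2); try lia.
  by case: (collinear Y); lia.
by case: (collinear X); case: (collinear Y) => // _ _ /(_ isT).
Qed.

Lemma lines_meet l l' (i j : 'I_n) : l \in L -> l' \in L -> i != j ->
  val i \in l -> val j \in l -> val i \in l' -> val j \in l' -> l = l'.
Proof.
move=> Ll Ll' nij il jl il' jl'; move/allP: okL => /(_ l Ll)/allP/(_ l' Ll').
case/predU1P=> //; rewrite leqNgt => /negP[].
have/uniq_leq_size-> // : uniq [:: val i; val j].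
  by rewrite /= inE (inj_eq val_inj) nij.
by move=> x; rewrite !inE mem_filter => /pred2P[]->; rewrite ?il ?il' ?jl ?jl'.
Qed.

Lemma config_rk_submod X Y :
  config_rk (X :|: Y) + config_rk (X :&: Y) <= config_rk X + config_rk Y.
Proof.
have [sXY|nXY] := boolP (X \subset Y).
  by rewrite (setUidPr sXY) (setIidPl sXY) addnC.
have [sYX|nYX] := boolP (Y \subset X).
  by rewrite (setUidPl sYX) (setIidPr sYX).
have cUI := cardsUI X Y.
have ltX : #|X :&: Y| < #|X|.
  by rewrite proper_card // properE subsetIl subsetI subxx.
have ltY : #|X :&: Y| < #|Y|.
  by rewrite proper_card // properE subsetIr subsetI subxx andbT.
have := config_rk_card (X :|: Y); have := config_rk_card (X :&: Y).
have := config_rk_le3 (X :|: Y).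
have := config_rk_mono (subsetIl X Y); have := config_rk_mono (subsetIr X Y).
case: (leqP #|X :&: Y| 1) => [le1|gt1].
  rewrite [config_rk X]/config_rk [config_rk Y]/config_rk.
  by case: (leqP #|X| 2) => ?; case: (leqP #|Y| 2) => ?;
    case: (collinear X); case: (collinear Y) => ? ? ? ? ?; lia.
have cX : config_rk X = if collinear X then 2 else 3.
  by rewrite /config_rk ifF //; lia.
have cY : config_rk Y = if collinear Y then 2 else 3.
  by rewrite /config_rk ifF //; lia.
rewrite cX cY; case: (boolP (collinear X)) => [/hasP[l Ll Xl]|]; last by lia.
case: (boolP (collinear Y)) => [/hasP[l' Ll' Yl]|]; last by lia.
have [i [j [Ii Ij nij]]] : exists i j, [/\ i \in X :&: Y, j \in X :&: Y & i != j].
  by have /card_gt1P[i [j [? ? ?]]] := gt1; exists i, j.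
move: Ii Ij; rewrite !inE => /andP[Xi Yi] /andP[Xj Yj].
have Dl : l = l' := lines_meet Ll Ll' nij (forall_inP Xl _ Xi)
  (forall_inP Xl _ Xj) (forall_inP Yl _ Yi) (forall_inP Yl _ Yj).
have -> : config_rk (X :|: Y) = 2; last by lia.
rewrite /config_rk ifF; last by lia.
rewrite (_ : collinear _) //; apply/hasP; exists l => //.
apply/forall_inP=> k; rewrite inE => /orP[Xk|Yk].
  exact: (forall_inP Xl).
by rewrite Dl; apply: (forall_inP Yl).
Qed.

Definition config_matroid : matroid :=
  Matroid config_rk_card config_rk_mono config_rk_submod.

End Configuration.

Definition F7 : matroid :=
  @config_matroid 7 [:: [:: 0; 1; 3]; [:: 1; 2; 4]; [:: 2; 3; 5]; [:: 3; 4; 6];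
    [:: 4; 5; 0]; [:: 5; 6; 1]; [:: 6; 0; 2]] isT.

(* 0,1,2 and 3,4,5 are the two triples of collinear points; 6, 7 and 8 are the
   intersections 04.13, 05.23 and 15.24. *)
Definition Pappus : matroid :=
  @config_matroid 9 [:: [:: 0; 1; 2]; [:: 3; 4; 5]; [:: 6; 7; 8];
    [:: 0; 4; 6]; [:: 1; 3; 6]; [:: 0; 5; 7]; [:: 2; 3; 7];
    [:: 1; 5; 8]; [:: 2; 4; 8]] isT.

Section Quaternary.
Variables (F : fieldType) (a : F).
Local Open Scope ring_scope.

(* The matrix is given by its list of rows. *)
Definition rows_matroid (s : seq (seq F)) : matroid :=
  @col_matroid F 'I_(size s) 'I_(size (head [::] s)) 
    (fun i j => nth 0 (nth [::] s i) j).

Local Notation b := (a ^+ 2).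

Definition V1 := rows_matroid
  [:: [:: 1; 0; 0; 1; 0; 1; 1; 1; 1];
      [:: 0; 1; 0; 1; 1; b; b; a; 0];
      [:: 0; 0; 1; 0; 1; 1; a; 1; a]].

Definition V2 := rows_matroid
  [:: [:: 1; 0; 0; 0; 1; 1; 1; 0];
      [:: 0; 1; 0; 0; b; a; a; 1];
      [:: 0; 0; 1; 0; a; b; a; 1];
      [:: 0; 0; 0; 1; b; b; a; a]].

Definition V3 := rows_matroid
  [:: [:: 1; 0; 0; 0; 1; 0; 1; 1; 1];
      [:: 0; 1; 0; 0; a; 1; b; b; 1];
      [:: 0; 0; 1; 0; a; 1; a; 1; b];
      [:: 0; 0; 0; 1; 0; 1; 1; 0; 0]].

Definition P1 := rows_matroid
  [:: [:: 0; 1; 1; 1; 1; 1; 0; 0; 0];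
      [:: 0; 1; a; 0; 0; 0; 1; 1; 1];
      [:: 1; 0; 0; 1; a; b; 1; a; b]].

Definition P2 := rows_matroid
  [:: [:: 1; 0; 0; 0; 1; 0; 1; 1];
      [:: 0; 1; 0; 0; a; 1; 1; 1];
      [:: 0; 0; 1; 0; 1; 1; 0; 1];
      [:: 0; 0; 0; 1; b; 1; b; 0]].

Definition P3 := rows_matroid
  [:: [:: 0; 1; 1; 1; 1; 1; 1; 0; 0];
      [:: 0; 1; a; b; 0; 0; 0; 1; 1];
      [:: 1; 0; 0; 0; 1; a; b; 1; a]].

Definition Y9 := rows_matroid
  [:: [:: 1; 0; 0; 1; 1; 0; a; a; 1];
      [:: 0; 1; 0; 1; 0; 1; a; 1; a];
      [:: 0; 0; 1; 0; 1; 1; 1; 0; 1]].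

Definition excluded_highly_connected : seq matroid :=
  [:: F7; dual F7; V1; dual V1; V2; V3; dual V3; P1; dual P1; P2;
      P3; dual P3; Y9; dual Y9; Pappus; dual Pappus].

Definition excluded_vertically_connected : seq matroid :=
  [:: F7; dual F7; V1; V2; V3; P1; P2; P3; Y9; Pappus].

End Quaternary.

Definition has_minor_in (L : seq matroid) (M : matroid) : Prop :=
  exists2 N, List.In N L & has_minor M N.

Record rmatroid (F : fieldType) := RMatroid {
  rground : finType;
  rspace : {vspace {ffun rground -> F^o}} }.

Section Represented.
Variable F : fieldType.

Section Restriction.
Variables (E E' : finType) (f : E' -> E).

Definition pullback (u : {ffun E -> F^o}) : {ffun E' -> F^o} :=
  [ffun x => u (f x)].

Fact pullback_is_linear : linear pullback.
Proof. by move=> c u v; apply/ffunP=> x; rewrite !ffunE. Qed.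

HB.instance Definition _ :=
  GRing.isLinear.Build F {ffun E -> F^o} {ffun E' -> F^o} _ pullback
    pullback_is_linear.

End Restriction.

(* U|X, for X a set of coordinates. *)
Definition restr (E : finType) (X : {set E}) (U : {vspace {ffun E -> F^o}}) :
    {vspace {ffun {x : E | x \in X} -> F^o}} :=
  (linfun (pullback (@sval E (fun x => x \in X))) @: U)%VS.

Section Orthogonal.
Variable E : finType.
Implicit Types (u v : {ffun E -> F^o}) (U : {vspace {ffun E -> F^o}}).

Definition dotp u v : F^o := (\sum_e u e * v e)%R.

Fact dotp_is_linear u : linear (dotp u).
Proof.
move=> c v w; rewrite /dotp scaler_sumr -big_split; apply: eq_bigr => e _ /=.
by rewrite !ffunE mulrDr; congr (_ + _)%R; rewrite mulrCA.
Qed.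

HB.instance Definition _ u :=
  GRing.isLinear.Build F {ffun E -> F^o} F^o _ (dotp u) (dotp_is_linear u).

Definition perp U : {vspace {ffun E -> F^o}} :=
  (\bigcap_(i < \dim U) lker (linfun (dotp (tnth (vbasis U) i))))%VS.

Lemma dotpC u v : dotp u v = dotp v u.
Proof. by apply: eq_bigr => e _; rewrite mulrC. Qed.

Lemma perpP U v :
  reflect (forall u, u \in U -> dotp u v = 0%R) (v \in perp U).
Proof.
apply: (iffP idP) => [|Uv]; last first.
  rewrite memvE; apply/subv_bigcapP=> i _.
  by rewrite -memvE memv_ker lfunE /= Uv ?vbasis_mem ?mem_tnth.
rewrite memvE => /subv_bigcapP Uv u /coord_vbasis ->.
rewrite dotpC linear_sum big1 // => i _; rewrite linearZ /= dotpC.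
have := Uv i isT; rewrite -memvE memv_ker lfunE /= (tnth_nth 0%R) => /eqP->.
by rewrite scaler0.
Qed.

End Orthogonal.

Section UnderlyingMatroid.
Variable M : rmatroid F.
Local Notation E := (rground M).
Local Notation U := (rspace M).
Implicit Types X Y : {set E}.

(* dim (U|X) is the rank of the columns indexed by X in any matrix with row
   space U. *)
Definition urk X : nat := \dim (restr X U).

Definition vanishing X : {vspace {ffun E -> F^o}} :=
  lker (linfun (pullback (@sval E (fun x => x \in X)))).

Lemma vanishingP X (u : {ffun E -> F^o}) :
  reflect (forall x, x \in X -> u x = 0%R) (u \in vanishing X).
Proof.
rewrite memv_ker lfunE /=; apply: (iffP eqP) => [/ffunP u0 x Xx|u0].
  by have := u0 (exist _ x Xx); rewrite !ffunE.
by apply/ffunP=> -[x Xx]; rewrite !ffunE u0.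
Qed.

Lemma urkE X : urk X + \dim (U :&: vanishing X) = \dim U.
Proof. by rewrite addnC limg_ker_dim. Qed.

Lemma urk_card X : urk X <= #|X|.
Proof.
apply: leq_trans (dimvS (subvf _)) _; rewrite dimvf.
by rewrite /dim /= card_sig muln1.
Qed.

Lemma vanishingS X Y : X \subset Y -> (vanishing Y <= vanishing X)%VS.
Proof.
move=> /subsetP sXY; apply/subvP=> u /vanishingP u0.
by apply/vanishingP=> x /sXY/u0.
Qed.

Lemma urk_mono X Y : X \subset Y -> urk X <= urk Y.
Proof.
move=> sXY; have := dimvS (capvS (subvv U) (vanishingS sXY)).
by have := urkE X; have := urkE Y; lia.
Qed.

Lemma urk_submod X Y : urk (X :|: Y) + urk (X :&: Y) <= urk X + urk Y.
Proof.
have := dimv_sum_cap (U :&: vanishing X) (U :&: vanishing Y).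
have : (U :&: vanishing X + U :&: vanishing Y <= U :&: vanishing (X :&: Y))%VS.
  by rewrite subv_add !capvS ?vanishingS ?subsetIl ?subsetIr.
have : ((U :&: vanishing X) :&: (U :&: vanishing Y)
        <= U :&: vanishing (X :|: Y))%VS.
  apply/subvP=> u; rewrite !memv_cap.
  case/andP=> /andP[-> /vanishingP uX] /andP[_ /vanishingP uY] /=.
  by apply/vanishingP=> x; rewrite inE => /orP[/uX|/uY].
move=> /dimvS + /dimvS.
have := urkE X; have := urkE Y; have := urkE (X :|: Y).
by have := urkE (X :&: Y); lia.
Qed.

Definition underlying : matroid := Matroid urk_card urk_mono urk_submod.

End UnderlyingMatroid.

Definition row_space (B E : finType) (A : B -> E -> F) :
    {vspace {ffun E -> F^o}} := (\sum_b <[ [ffun e => A b e : F^o] ]>)%VS.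

(* M(A) *)
Definition rmatroid_of (B E : finType) (A : B -> E -> F) : rmatroid F :=
  RMatroid (row_space A).

Lemma row_space_dim_le (B E : finType) (A : B -> E -> F) :
  \dim (row_space A) <= \dim (row_space (fun e b => A b e)).
Proof.
set W := row_space (fun e b => A b e).
pose w e : {ffun B -> F^o} := [ffun b => A b e].
have Ww e : w e \in W by rewrite memvE; apply: (sumv_sup e).
pose c (i : 'I_(\dim W)) : {ffun E -> F^o} := [ffun e => coord (vbasis W) i (w e)].
apply: (@leq_trans (\dim <<[seq c i | i : 'I_(\dim W)]>>%VS)); last first.
  by apply: leq_trans (dim_span _) _; rewrite size_map size_enum_ord.
apply/dimvS/subv_sumP=> b _; rewrite -memvE.
suff -> : [ffun e => A b e : F^o] = (\sum_(i < \dim W) (vbasis W)`_i b *: c i)%R.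
  apply: memv_suml => i _; apply/memvZ/memv_span.
  by apply: map_f; rewrite mem_enum.
apply/ffunP=> e; rewrite sum_ffunE !ffunE.
have /ffunP/(_ b) := coord_vbasis (Ww e); rewrite sum_ffunE ffunE => ->.
by apply: eq_bigr => i _; rewrite !ffunE; apply: mulrC.
Qed.

Lemma restr_row_space (B E : finType) (A : B -> E -> F) (X : {set E}) :
  restr X (row_space A)
  = row_space (fun b (e : {x : E | x \in X}) => A b (val e)).
Proof.
rewrite /restr limg_sum; apply: eq_bigr => b _.
by rewrite limg_line lfunE /=; congr <[_]>%VS; apply/ffunP=> e; rewrite !ffunE.
Qed.

Lemma urk_rmatroid_of (B E : finType) (A : B -> E -> F) (X : {set E}) :
  @urk (rmatroid_of A) X = col_rk A X.
Proof.
rewrite /urk /= restr_row_space /col_rk.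
have -> : (\sum_(e in X) <[colvec A e]>)%VS
        = row_space (fun (e : {x : E | x \in X}) b => A b (val e)).
  by rewrite /row_space (big_sub (mem X)).
by apply/eqP; rewrite eqn_leq !row_space_dim_le.
Qed.

Definition rdual (M : rmatroid F) : rmatroid F := RMatroid (perp (rspace M)).

Definition rdelete (M : rmatroid F) (D : {set rground M}) : rmatroid F :=
  RMatroid (restr (~: D) (rspace M)).

Definition rcontract (M : rmatroid F) (C : {set rground M}) : rmatroid F :=
  rdual (@rdelete (rdual M) C).

(* A relabelling of the ground set combined with a nonzero scaling of the
   coordinates: represented matroids are identified up to projective
   equivalence.  Frame templates normalise columns (each nonzero column of a
   Gamma-frame matrix has an entry 1), so membership in M(Phi) is only
   meaningful up to such scalings. *)
Definition riso (M N : rmatroid F) : Prop :=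
  exists (f : rground M -> rground N) (c : rground M -> F),
    [/\ bijective f, forall e, c e != 0%R &
        forall u : {ffun rground N -> F^o},
          (u \in rspace N) = ([ffun e => c e * u (f e) : F^o]%R \in rspace M)].

Definition minor_closed (P : rmatroid F -> Prop) : Prop :=
  [/\ forall M N, riso M N -> P M -> P N,
      forall M (D : {set rground M}), P M -> P (rdelete D)
    & forall M (C : {set rground M}), P M -> P (rcontract C)].

End Represented.

Section Templates.
Variable F : finFieldType.
Local Open Scope ring_scope.

Definition unit_scaling_closed (G : {set {unit F}}) (T : finType)
    (S : {set {ffun T -> F}}) : Prop :=
  forall g v, g \in G -> v \in S -> [ffun t => val g * v t] \in S.

(* The pairwise disjoint sets C, X, Y0, Y1 are finite types, and their unions
   are sum types. *)
Record template := Template {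
  tG : {group {unit F}};
  tC : finType;
  tX : finType;
  tY0 : finType;
  tY1 : finType;
  tA1 : tX -> tC + tY0 + tY1 -> F;
  tDelta : {set {ffun tC + tY0 + tY1 -> F}};
  tLambda : {set {ffun tX -> F}};
  tDelta_zmod : zmod_closed tDelta;
  tLambda_zmod : zmod_closed tLambda;
  tDelta_scale : unit_scaling_closed tG tDelta;
  tLambda_scale : unit_scaling_closed tG tLambda }.

(* c is a column of a G-frame matrix. *)
Definition frame_column (G : {set {unit F}}) (B : finType) (c : B -> F) : Prop :=
  (#|[set b | (c b != 0)%R]| <= 2)%N /\
  ((exists b, c b != 0) ->
   exists2 b, c b = 1 & forall b', b' != b -> c b' != 0 ->
     exists2 g, g \in G & c b' = - val g).

(* Matrices respecting or conforming to a template have rows indexed by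
   tX + B (with B standing for the complement of X in the set of rows) and
   columns indexed by (tC + tY0 + tY1) + E (with E standing for the complement
   of C, Y0, Y1 in the set of columns). *)
Section Conforming.
Variables (Phi : template) (B E : finType).
Local Notation rows := (tX Phi + B)%type.
Local Notation special := (tC Phi + tY0 Phi + tY1 Phi)%type.
Local Notation columns := (special + E)%type.

Definition respects_with (A' : rows -> columns -> F) (Z : {set E}) : Prop :=
  [/\ forall x s, A' (inl x) (inl s) = tA1 x s,
      forall z, z \in Z ->
        (forall x, A' (inl x) (inr z) = 0) /\
        (exists b0, forall b, A' (inr b) (inr z) = (b == b0)%:R),
      forall e, e \notin Z -> frame_column (tG Phi) (fun b => A' (inr b) (inr e)),
      forall e, e \notin Z -> [ffun x => A' (inl x) (inr e)] \in tLambda Phi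
    & forall b, [ffun s => A' (inr b) (inl s)] \in tDelta Phi].

Definition matrix_conforms (A : rows -> columns -> F) : Prop :=
  exists (A' : rows -> columns -> F) (Z : {set E}),
    [/\ respects_with A' Z,
        forall r s, A r (inl s) = A' r (inl s),
        forall r e, e \notin Z -> A r (inr e) = A' r (inr e)
      & forall z, z \in Z -> exists j : tY1 Phi,
          forall r, A r (inr z) = A' r (inr z) + A' r (inl (inr j))].

Definition in_C (e : columns) : bool :=
  if e is inl (inl (inl _)) then true else false.

Definition in_Y1 (e : columns) : bool :=
  if e is inl (inr _) then true else false.

(* M(A)/C\Y1 *)
Definition contract_delete (A : rows -> columns -> F) : rmatroid F :=
  let MC := @rcontract F (rmatroid_of A) [set e | in_C e] in
  @rdelete F MC [set e | in_Y1 (val e)].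

End Conforming.

Definition conforms (Phi : template) (M : rmatroid F) : Prop :=
  exists (B E : finType)
    (A : tX Phi + B -> (tC Phi + tY0 Phi + tY1 Phi) + E -> F),
    matrix_conforms A /\ riso (contract_delete A) M.

End Templates.

Definition HypothesisA : Prop :=
  forall (F : finFieldType) (p m : nat) (P : rmatroid F -> Prop),
    p \in [pchar F]%R -> 0 < m -> minor_closed P ->
  exists (k s t : nat) (Phi : 'I_s -> template F) (Psi : 'I_t -> template F),
  [/\ 0 < k,
      forall i M, conforms (Phi i) M -> P M,
      forall j M, conforms (Psi j) M -> P (rdual M)
    & forall M : rmatroid F, P M ->
        simple (underlying M) -> kconnected (underlying M) k ->
        2 * k <= #|underlying M| -> ~ has_minor (underlying M) (PG p m) ->
        (exists i, conforms (Phi i) M) \/ (exists j, conforms (Psi j) (rdual M))].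

Definition HypothesisB : Prop :=
  forall (F : finFieldType) (p m : nat) (P : rmatroid F -> Prop),
    p \in [pchar F]%R -> 0 < m -> minor_closed P ->
  exists (k n s t : nat) (Phi : 'I_s -> template F) (Psi : 'I_t -> template F),
  [/\ 0 < k /\ 0 < n,
      forall i M, conforms (Phi i) M -> P M,
      forall j M, conforms (Psi j) M -> P (rdual M),
      forall M : rmatroid F, P M ->
        simple (underlying M) -> vert_kconnected (underlying M) k ->
        has_minor (underlying M) (MK n) ->
        ~ has_minor (underlying M) (PG p m) ->
        exists i, conforms (Phi i) M
    & forall M : rmatroid F, P M ->
        cosimple (underlying M) -> cyc_kconnected (underlying M) k ->
        has_minor (underlying M) (dual (MK n)) ->
        ~ has_minor (underlying M) (PG p m) ->
        exists j, conforms (Psi j) (rdual M)].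

(* Main.v *)
(* The excluded matroids are not representable over GF(5) or GF(7), and AF4 is closed under minors
   and duals, which gives one direction.  For the other, the hypothesis reduces the question to the
   matroids conforming to a template [Phi] all of whose members avoid F7, V1, P1, P3, Y9 and the
   Pappus matroid.  Modulo the columns of [C], the columns in [Lambda] then vanish and the unit
   vectors of the rows outside [X] stay independent, since otherwise F7 appears; connectivity makes
   the elements outside [Y0] spanning, and after adding rows for a basis of [Y1] every element
   becomes a zero-sum vector over GF(4) on the vertices of a clique whose edges are also present.

   It remains to lift such a configuration to every field with at least four elements.  Avoiding F7
   forces the vectors that are not edges to be, up to scaling, (1, a, a^2) or (1, 1, a, a) on three
   or four vertices, and a finite search, in which each discarded combination carries an explicit
   excluded minor, shows that they all belong to one of 17 families placed on at most five core
   vertices.  Each family lifts to Z[t] such that all relevant subdeterminants are, up to sign,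
   products of t, t - 1, t + 1 and t - 2, and every field with at least four elements contains a
   suitable t. *)
From Stdlib Require Import BinNat BinInt.
From HB Require Import structures.
From mathcomp Require Import all_boot all_order all_fingroup all_algebra.
From mathcomp Require Import zify ssrZ ring.
From Stdlib Require List FunctionalExtensionality.
Require Import Defs.
Set Implicit Arguments.
Unset Strict Implicit.
Unset Printing Implicit Defensive.
Import GRing.Theory.

(** * Minors and representations *)

Section MinorBasics.
Implicit Types M N L : matroid.

(** Conformity to a template gives no direct hold on a matroid: what is known is that every member
    of M(Phi) avoids the excluded minors. These are therefore sought in other members, whose
    matrices have additional rows and columns chosen freely within the template; only the columns of
    [C], [Y0] and [Y1] cannot be multiplied. Those of [C] are contracted, and those of [Y1], though
    deleted, are recovered by contracting elements of [Z]. Those of [Y0] remain, and connectivity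
    places them in the span of the other elements.

    The parameter m = 3 in both hypotheses comes from the Fano plane being PG(2,2). The templates of
    the dual class are treated by the same argument, because the list for high connectivity contains
    the duals of the rank-3 matroids found by the search.

    The lift must handle cliques of any size. It does so because the families are closed under
    eliminating a vertex outside the core: two vectors through that vertex leave an edge, a vector
    of the family or a vector on the core. Only the finitely many core vectors need a check of
    subdeterminants. *)

Lemma rk0 M : rk (set0 : {set M}) = 0.
Proof. by have := rk_card (set0 : {set M}); rewrite cards0; lia. Qed.

(** Trades the nested subset types of [contract] and [delete] for an injection [g] and a contracted
    set [C]: the deleted elements are those neither in the image of [g] nor in [C]. The rank
    condition is a sum, so no truncated subtraction survives. *)
Lemma minorP M N : has_minor M N <->
  exists (g : N -> M) (C : {set M}), [/\ injective g, forall x, g x \notin C &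
    forall X : {set N}, rk (g @: X :|: C) = rk X + rk C].
Proof.
split=> [[C [D [f bij_f rk_f]]]|[g [C [inj_g gC rk_g]]]].
  pose g (x : N) : M := sval (sval (f x)).
  exists g, C; split=> [x y /val_inj/val_inj/(bij_inj bij_f) //|x|X].
    exact: (svalP (sval (f x))).
  rewrite -(rk_f X).
  have -> : rk (f @: X) = rk (sval @: (sval @: (f @: X)) :|: C) - rk C by [].
  rewrite -!imset_comp subnK //; exact/rk_mono/subsetUr.
pose D := [set y : contract C | sval y \notin codom g].
have gD x : (exist (fun z => z \notin C) (g x) (gC x) : contract C) \notin D.
  by rewrite inE negbK; apply: codom_f.
pose f (x : N) : delete D := exist (fun z => z \notin D) _ (gD x).
exists C, D, f.
  have inj_f : injective f by move=> x y [] /inj_g.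
  have surj (y : delete D) : {x | f x == y}.
    have Dy := svalP y; rewrite inE negbK in Dy.
    by exists (iinv Dy); apply/eqP/val_inj/val_inj; rewrite /= f_iinv.
  exists (fun y => sval (surj y)) => [x|y]; last exact/eqP/(svalP (surj y)).
  by apply/inj_f/eqP/(svalP (surj _)).
move=> X.
have -> : rk (f @: X) = rk (sval @: (sval @: (f @: X)) :|: C) - rk C by [].
by rewrite -!imset_comp (eq_imset (g := g)) // rk_g addnK.
Qed.

Lemma minor_trans M N L : has_minor M N -> has_minor N L -> has_minor M L.
Proof.
move=> /minorP[g [C [ig gC rg]]] /minorP[h [D [ih hD rh]]]; apply/minorP.
exists (g \o h), (g @: D :|: C); split=> [|x|X]; first exact: inj_comp.
  by rewrite inE negb_or /= gC andbT mem_imset // hD.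
rewrite setUA imset_comp -imsetU !rg rh; lia.
Qed.

Lemma iso_minor M N : matroid_iso N M -> has_minor M N.
Proof.
case=> f bf rf; apply/minorP; exists f, set0; split=> [|x|X]; first exact: bij_inj.
  by rewrite inE.
by rewrite setU0 rf rk0 addn0.
Qed.

Lemma matroid_iso_sym M N : matroid_iso M N -> matroid_iso N M.
Proof.
case=> f [f' fK f'K] rf; exists f'; first by exists f.
by move=> X; rewrite -rf -imset_comp (eq_imset (g := id)) ?imset_id.
Qed.

Lemma minor_rk M N : has_minor M N -> rk [set: N] <= rk [set: M].
Proof.
case/minorP=> g [C [_ _ rg]]; have := rg setT.
by have := rk_mono (subsetT (g @: setT :|: C)); lia.
Qed.

(** The same injection works: the dual contracts what was deleted, namely everything outside the
    image of [g] and [C], and deletes [C]. *)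
Lemma minor_dual M N : has_minor M N -> has_minor (dual M) (dual N).
Proof.
case/minorP=> g [C [ig gC rg]]; apply/minorP.
pose D := ~: (g @: setT :|: C).
have gD x : g x \notin D by rewrite !inE negbK imset_f ?inE.
exists (g : dual N -> dual M), (D : {set dual M}); split=> // X.
have cD : [disjoint g @: X & D].
  by apply/pred0P=> y /=; apply/negbTE/negP=> /andP[/imsetP[x _ ->]]; apply/negP.
have cX : ~: (g @: X :|: D) = g @: (~: X) :|: C.
  apply/setP=> y; rewrite !inE negb_or negbK.
  have [/imsetP[x _ ->]|ny] := boolP (y \in g @: setT).
    by rewrite !(mem_imset, inE) //= (negbTE (gC x)) orbF andbT.
  have -> : (y \in g @: X) = false.
    by apply: contraNF ny => /imsetP[x _ ->]; apply: imset_f.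
  suff -> : (y \in g @: (~: X)) = false by [].
  by apply: contraNF ny => /imsetP[x _ ->]; apply: imset_f.
change (@dual_rk M (g @: X :|: D) = @dual_rk N X + @dual_rk M D).
have := @dual_rkE M (g @: X :|: D); have := @dual_rkE M D.
have := @dual_rkE N X; rewrite cX setCK !rg.
rewrite cardsU disjoint_setI0 // cards0 card_imset //=; lia.
Qed.

Lemma dualK M : matroid_iso M (dual (dual M)).
Proof.
exists (id : M -> dual (dual M)); first by exists id.
move=> X; rewrite imset_id.
have := @dual_rkE (dual M) X; have := @dual_rkE M (~: X); have := @dual_rkE M setT.
rewrite setCK setCT; have := cardsC X; have := rk_card (set0 : {set M}).
rewrite cards0 cardsT -[rk (~: X : {set dual M})]/(dual_rk (~: X)).
rewrite -[rk ([set: dual M])]/(@dual_rk M setT).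
rewrite -[rk (X : {set dual (dual M)})]/(@dual_rk (dual M) X).
by rewrite /=; lia.
Qed.

End MinorBasics.

(** * Linear representations modulo a subspace *)

Section VectorRank.
Variable F : fieldType.
Implicit Types W : vectType F.

Definition sp W (I : finType) (v : I -> W) (X : {set I}) : {vspace W} :=
  (\sum_(e in X) <[v e]>)%VS.

Lemma mem_sp W (I : finType) (v : I -> W) (X : {set I}) e :
  e \in X -> v e \in sp v X.
Proof. by move=> Xe; rewrite memvE; apply: (sumv_sup e). Qed.

Lemma sp_sub W (I : finType) (v : I -> W) (X : {set I}) (U : {vspace W}) :
  (forall e, e \in X -> v e \in U) -> (sp v X <= U)%VS.
Proof. by move=> h; apply/subv_sumP=> e /h; rewrite -memvE. Qed.

Lemma spU W (I : finType) (v : I -> W) (X Y : {set I}) :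
  sp v (X :|: Y) = (sp v X + sp v Y)%VS.
Proof.
apply/eqP; rewrite eqEsubv subv_add; apply/and3P; split.
- apply: sp_sub => e; rewrite inE => /orP[] /(mem_sp v) h.
    exact: subvP (addvSl _ _) _ h.
  exact: subvP (addvSr _ _) _ h.
- by apply: sp_sub => e Xe; apply: mem_sp; rewrite inE Xe.
- by apply: sp_sub => e Xe; apply: mem_sp; rewrite inE Xe orbT.
Qed.

Lemma spS W (I : finType) (v : I -> W) (X Y : {set I}) :
  X \subset Y -> (sp v X <= sp v Y)%VS.
Proof. by move=> /subsetP s; apply: sp_sub => e /s; apply: mem_sp. Qed.

Lemma sp_limg W W' (I : finType) (v : I -> W) (f : 'Hom(W, W')) (X : {set I}) :
  (f @: sp v X)%VS = sp (fun e => f (v e)) X.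
Proof. by rewrite /sp limg_sum; apply: eq_bigr => e _; rewrite limg_line. Qed.

Lemma sp_imset W (I J : finType) (v : J -> W) (g : I -> J) (X : {set I}) :
  sp v (g @: X) = sp (fun e => v (g e)) X.
Proof.
apply/eqP; rewrite eqEsubv; apply/andP; split.
  apply: sp_sub => _ /imsetP[e Xe ->]; exact: (mem_sp (fun e => v (g e))).
by apply: sp_sub => e Xe; apply/mem_sp/imset_f.
Qed.

(* Vectors taken modulo U0; dim U0 is added on the left to avoid subtraction. *)
Definition repr_mod (M : matroid) W (v : M -> W) (U0 : {vspace W}) : Prop :=
  forall X : {set M}, rk X + \dim U0 = \dim (U0 + sp v X).

(** One hypothesis covers two facts: for [f x = 0] it makes [f] injective on [S], and in general it
    makes the image of [S] meet [U1] only in 0. *)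
Lemma dim_add_inj W W' (f : 'Hom(W', W)) (U1 : {vspace W}) (S : {vspace W'}) :
  (forall x, x \in S -> f x \in U1 -> x = 0%R) ->
  \dim (U1 + f @: S) = \dim U1 + \dim S.
Proof.
move=> inj; rewrite dimv_disjoint_sum; last first.
  apply/eqP; rewrite -subv0; apply/subvP=> y; rewrite memv_cap memv0.
  by case/andP=> U1y /memv_imgP[x Sx Dy]; rewrite Dy (inj x) ?linear0 -?Dy.
rewrite limg_dim_eq //; apply/eqP; rewrite -subv0; apply/subvP=> x.
rewrite memv_cap memv_ker memv0 => /andP[Sx /eqP fx]; apply/eqP/inj => //.
by rewrite fx mem0v.
Qed.

(** The criterion behind every minor found with vectors. Modulo [U0] and the contracted vectors, the
    element [g i] is a nonzero multiple of [f (w i)]; the last hypothesis says that [f] stays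
    injective on the span of the [w i] in this quotient, so ranks are preserved. *)
Lemma repr_minor (M T : matroid) W W' (v : M -> W) (U0 : {vspace W})
    (w : T -> W') (g : T -> M) (C : {set M}) (f : 'Hom(W', W)) :
  repr_mod v U0 -> (forall X : {set T}, rk X = \dim (sp w X)) ->
  injective g -> (forall i, g i \notin C) ->
  (forall i, exists2 c : F, (c != 0)%R &
     (v (g i) - c *: f (w i))%R \in (U0 + sp v C)%VS) ->
  (forall x, x \in sp w setT -> f x \in (U0 + sp v C)%VS -> x = 0%R) ->
  has_minor M T.
Proof.
move=> rM rT ig gC vg inj; apply/minorP; exists g, C; split=> // X.
have hX : \dim (U0 + sp v C + sp v (g @: X)) = \dim (U0 + sp v C) + rk X.
  rewrite rT -(@dim_add_inj _ _ f); last first.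
    by move=> x Xx; apply: inj; apply: subvP (spS _ (subsetT X)) _ Xx.
  congr (\dim _); rewrite sp_imset sp_limg.
  move: (U0 + sp v C)%VS vg => U1 vg.
  apply/eqP; rewrite eqEsubv; apply/andP.
  split; rewrite subv_add addvSl /=; apply: sp_sub => i Xi; have [c c0 Uc] := vg i.
    rewrite -[v (g i)](subrK (c *: f (w i))%R) memv_add //.
    exact/memvZ/(mem_sp (fun e => f (w e))).
  (* Doubling [U1] gives one copy to absorb the difference [v (g i) - c *: f (w i)] and one to stay
     beside the span. *)
  rewrite memvE -(addvv U1) -addvA -memvE -[f (w i)](scalerK c0).
  have -> : (c *: f (w i) = - (v (g i) - c *: f (w i)) + v (g i))%R.
    by rewrite opprB subrK.
  rewrite scalerDr memv_add ?memvZ ?memvN //.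
  by apply: subvP (addvSr _ _) _ _; apply: (mem_sp (fun e => v (g e))).
have := rM (g @: X :|: C); have := rM C.
by rewrite spU [(sp v (g @: X) + _)%VS]addvC addvA hX; lia.
Qed.

(** The map [\1 - projv U0] has kernel exactly [U0], so it realizes the quotient inside [W]; reading
    the images in a basis of [W] gives a matrix. *)
Lemma representable_mod (M : matroid) W (v : M -> W) (U0 : {vspace W}) :
  repr_mod v U0 -> representable F M.
Proof.
move=> rM; pose f := (\1%VF - projv U0)%R.
have kf : (lker f = U0)%VS.
  apply/vspaceP=> x; rewrite memv_ker add_lfunE opp_lfunE id_lfunE subr_eq0.
  by apply/eqP/idP=> [->|/projv_id //]; apply: memv_proj.
pose b := vbasis (fullv : {vspace W}).
pose A (i : 'I_(\dim {:W})) (e : M) : F := coord b i (f (v e)).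
exists (\dim {:W}), A => X.
pose h (x : W) : {ffun 'I_(\dim {:W}) -> F^o} := [ffun i => coord b i x].
have lh : linear h.
  by move=> c x y; apply/ffunP=> i; rewrite !ffunE linearP.
pose hL := GRing.isLinear.Build F W {ffun 'I_(\dim {:W}) -> F^o} _ h lh.
pose h' : {linear W -> {ffun 'I_(\dim {:W}) -> F^o}} := HB.pack h hL.
have kh : (lker (linfun h') = 0)%VS.
  apply/eqP; rewrite -subv0; apply/subvP=> x; rewrite memv_ker lfunE memv0 /=.
  move=> /eqP/ffunP hx; rewrite (coord_vbasis (memvf x)) big1 ?eqxx // => i _.
  by have := hx i; rewrite !ffunE => ->; rewrite scale0r.
have -> : col_rk A X = \dim (linfun h' @: (f @: sp v X))%VS.
  rewrite /col_rk !sp_limg; congr (\dim _); apply: eq_bigr => e _; congr <[_]>%VS.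
  by apply/ffunP=> i; rewrite lfunE /= !ffunE.
rewrite limg_dim_eq ?kh ?capv0 //.
have := limg_ker_dim f (U0 + sp v X); rewrite kf (capv_idPr (addvSl _ _)).
rewrite limgD; have -> : (f @: U0 = 0)%VS.
  by apply/eqP; rewrite -lkerE kf.
by rewrite add0v; have := rM X; lia.
Qed.

(** An element [e] of the minor is represented by the column of [g e], taken modulo the span of the
    columns in [C]. *)
Lemma representable_minor M N : has_minor M N -> representable F M -> representable F N.
Proof.
case/minorP=> g [C [ig gC rg]] [n [A rA]].
apply: (@representable_mod N _ (fun e => colvec A (g e)) (sp (colvec A) C)) => X.
have -> : sp (fun e : N => colvec A (g e)) X = sp (colvec A) (g @: X).
  by rewrite (sp_imset (colvec A)).
have -> : (sp (colvec A) C + sp (colvec A) (g @: X))%VS = sp (colvec A) (C :|: g @: X).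
  by rewrite spU.
by rewrite setUC -[\dim _]rA -[\dim _]rA -rg.
Qed.

End VectorRank.

Lemma AF4_minor M N : has_minor M N -> AF4 M -> AF4 N.
Proof. by move=> h AM F hF; apply: representable_minor h (AM F hF). Qed.

(** * Ranks, duals and minors of represented matroids *)

Section RepresentedRank.
Variable F : fieldType.
Implicit Types M N : rmatroid F.

Lemma dim_ffunE (E : finType) : \dim {: {ffun E -> F^o}} = #|E|.
Proof. by rewrite dimvf /dim /= muln1. Qed.

(** Pulling back along [f] kills exactly the vectors that vanish on its image, so both dimensions
    fall short of that of the row space by the same amount. *)
Lemma urk_img M (E' : finType) (f : E' -> rground M) :
  \dim (linfun (pullback f) @: rspace M) = urk (f @: setT).
Proof.
have e1 := limg_ker_dim (linfun (pullback f)) (rspace M).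
have e2 := urkE (f @: setT).
apply: (@addnI (\dim (rspace M :&: lker (linfun (pullback f))))).
rewrite e1 -e2 addnC; congr (\dim (_ :&: _) + _); apply/vspaceP=> u; apply/vanishingP/idP=> [u0|].
  by rewrite memv_ker lfunE; apply/eqP/ffunP=> x; rewrite !ffunE u0 ?imset_f.
rewrite memv_ker lfunE => /eqP/ffunP u0 _ /imsetP[x _ ->].
by have := u0 x; rewrite !ffunE.
Qed.

Lemma urk_rdelete M (D : {set rground M}) (X : {set rground (rdelete D)}) :
  urk X = urk (val @: X).
Proof.
pose f (x : {x : rground (rdelete D) | x \in X}) : rground M := sval (sval x).
have -> : val @: X = f @: setT.
  apply/setP=> y; apply/imsetP/imsetP=> [[x Xx ->]|[x _ ->]].
    by exists (exist _ x Xx).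
  by exists (sval x) => //; apply: (svalP x).
rewrite -urk_img /urk /restr -limg_comp; congr (\dim (_ @: _)).
apply/lfunP=> u; rewrite comp_lfunE !lfunE /=.
by apply/ffunP=> x; rewrite !ffunE.
Qed.

(** The scaled pullback [h] is injective and carries the part of the row space of [N] vanishing on
    [f @: P] onto the part of the row space of [M] vanishing on [P]. By [urkE], ranks are
    differences of such dimensions. *)
Lemma riso_urk M N : riso M N -> matroid_iso (underlying M) (underlying N).
Proof.
case=> f [c [bf c0 eqU]]; exists f => // X; have [f' fK f'K] := bf.
pose h (u : {ffun rground N -> F^o}) : {ffun rground M -> F^o} :=
  [ffun e => (c e * u (f e))%R].
have lh : linear h.
  move=> a u v; apply/ffunP=> e; rewrite !ffunE mulrDr; congr (_ + _)%R.
  by rewrite /GRing.scale /= mulrCA.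
pose hL := GRing.isLinear.Build F _ _ _ h lh.
pose h' : {linear {ffun rground N -> F^o} -> {ffun rground M -> F^o}} := HB.pack h hL.
have kh : (lker (linfun h') = 0)%VS.
  apply/eqP; rewrite -subv0; apply/subvP=> u; rewrite memv_ker lfunE memv0 /=.
  move=> /eqP/ffunP hu; apply/eqP/ffunP=> y; have := hu (f' y).
  rewrite !ffunE f'K => /eqP; rewrite mulf_eq0 (negPf (c0 _)) /=.
  by move/eqP.
have imU (P : {set rground M}) :
    (linfun h' @: (rspace N :&: vanishing (f @: P)) = rspace M :&: vanishing P)%VS.
  apply/vspaceP=> w; apply/memv_imgP/idP=> [[u + ->]|].
    rewrite !memv_cap lfunE /= => /andP[]; rewrite eqU => -> /vanishingP u0.
    by apply/vanishingP=> x Px; rewrite ffunE u0 ?mulr0 ?imset_f.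
  rewrite memv_cap => /andP[Uw /vanishingP w0].
  pose u : {ffun rground N -> F^o} := [ffun y => ((c (f' y))^-1 * w (f' y))%R].
  have hu : h u = w by apply/ffunP=> e; rewrite !ffunE fK mulVKf.
  exists u; last by rewrite lfunE /= hu.
  rewrite memv_cap eqU; apply/andP; split; first by rewrite -[X in X \in _]/(h u) hu.
  by apply/vanishingP=> _ /imsetP[x Px ->]; rewrite ffunE fK w0 ?mulr0.
have dimU P : \dim (rspace M :&: vanishing P) = \dim (rspace N :&: vanishing (f @: P)).
  by rewrite -imU limg_dim_eq // kh capv0.
have van0 (R : rmatroid F) : @vanishing F R set0 = fullv.
  by apply/vspaceP=> u; rewrite memvf; apply/vanishingP=> x; rewrite inE.
have := dimU set0; rewrite imset0 !van0 !capvf => dU.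
have := @urkE F M X; have := @urkE F N (f @: X); rewrite dU dimU => h1 h2.
exact: addIn (etrans h1 (esym h2)).
Qed.

Section Perp.
Variable E : finType.
Implicit Types U V : {vspace {ffun E -> F^o}}.

Definition deltaf (x : E) : {ffun E -> F^o} := [ffun y => (y == x)%:R%R].

Lemma dotp_delta (x : E) (v : {ffun E -> F^o}) : dotp (deltaf x) v = v x.
Proof.
rewrite /dotp (bigD1 x) //= ffunE eqxx mul1r big1 ?addr0 // => y /negPf xy.
by rewrite ffunE xy mul0r.
Qed.

(** The perpendicular is the kernel of the map taking a vector to its products with a basis of [U].
    That this map is onto is the equality of row rank and column rank: its image contains the
    transposed columns, whose span has dimension at least [\dim U] by [row_space_dim_le]. *)
Lemma dim_perp U : \dim (perp U) + \dim U = #|E|.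
Proof.
pose b (i : 'I_(\dim U)) := tnth (vbasis U) i.
pose h (v : {ffun E -> F^o}) : {ffun 'I_(\dim U) -> F^o} := [ffun i => dotp (b i) v].
have lh : linear h.
  by move=> a u v; apply/ffunP=> e; rewrite !ffunE linearP.
pose hL := GRing.isLinear.Build F _ _ _ h lh.
pose h' : {linear {ffun E -> F^o} -> {ffun 'I_(\dim U) -> F^o}} := HB.pack h hL.
have -> : perp U = lker (linfun h').
  apply/vspaceP=> v; rewrite memv_ker lfunE /=; apply/idP/eqP=> [/perpP Uv|/ffunP hv].
    by apply/ffunP=> i; rewrite !ffunE Uv ?vbasis_mem ?mem_tnth.
  rewrite memvE; apply/subv_bigcapP=> i _; rewrite -memvE memv_ker lfunE /=.
  by have := hv i; rewrite !ffunE => ->.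
pose A (i : 'I_(\dim U)) (e : E) : F := b i e.
have dA : \dim (row_space A) = \dim U.
  congr (\dim _); rewrite /row_space -[RHS](span_basis (vbasisP U)) span_def.
  rewrite big_tuple; apply: eq_bigr => i _; congr <[_]>%VS.
  by apply/ffunP=> e; rewrite ffunE.
have le1 := row_space_dim_le A; rewrite dA in le1.
have le2 : \dim (row_space (fun e i => A i e)) <= \dim (limg (linfun h')).
  apply/dimvS/subv_sumP=> e _; rewrite -memvE; apply/memv_imgP.
  exists (deltaf e); rewrite ?memvf // lfunE /=; apply/ffunP=> i.
  by rewrite !ffunE dotpC dotp_delta.
have le3 : \dim (limg (linfun h')) <= \dim U.
  by apply: leq_trans (dimvS (subvf _)) _; rewrite dim_ffunE card_ord.
have e : \dim (limg (linfun h')) = \dim U.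
  by apply/eqP; rewrite eqn_leq le3 (leq_trans le1 le2).
apply: etrans (etrans (limg_ker_dim (linfun h') fullv) (dim_ffunE E)).
by rewrite capfv; apply: (congr1 (addn _) (esym e)).
Qed.

Lemma perpD U V : perp (U + V) = (perp U :&: perp V)%VS.
Proof.
apply/vspaceP=> v; rewrite memv_cap; apply/perpP/andP=> [h|[/perpP hU /perpP hV]].
  split; apply/perpP=> u Uu; apply: h.
    exact: subvP (addvSl _ _) _ Uu.
  exact: subvP (addvSr _ _) _ Uu.
move=> _ /memv_addP[u1 U1 [u2 U2 ->]].
by rewrite dotpC linearD /= ![dotp v _]dotpC hU // hV // addr0.
Qed.

End Perp.

Lemma perp_vanishing M (X : {set rground M}) : perp (vanishing (~: X)) = vanishing X.
Proof.
apply/vspaceP=> v; apply/perpP/vanishingP=> [h x Xx|h u /vanishingP u0].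
  rewrite -(dotp_delta x); apply: h; apply/vanishingP=> y; rewrite inE ffunE.
  by case: eqP => // ->; rewrite Xx.
rewrite /dotp big1 // => x _; have [/h->|nX] := boolP (x \in X); first by rewrite mulr0.
by rewrite u0 ?mul0r // inE.
Qed.

(** Only a lower bound is computed directly. The bounds for [X] and for its complement add up to the
    total that [dim_perp] prescribes, so both are equalities. *)
Lemma dim_vanishing M (X : {set rground M}) : \dim (@vanishing F M X) = #|~: X|.
Proof.
have le (Y : {set rground M}) : #|~: Y| <= \dim (@vanishing F M Y).
  have := @urkE F (RMatroid {: {ffun rground M -> F^o}}) Y.
  rewrite capfv dim_ffunE; have := @urk_card F (RMatroid {: {ffun rground M -> F^o}}) Y.
  by have := cardsC Y; rewrite /vanishing /=; lia.
have := dim_perp (@vanishing F M (~: X)); rewrite perp_vanishing.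
by have := le X; have := le (~: X); rewrite setCK; have := cardsC X; lia.
Qed.

Lemma urk_setT M : urk (setT : {set rground M}) = \dim (rspace M).
Proof.
have := @urkE F M setT; suff -> : @vanishing F M setT = 0%VS by rewrite capv0 dimv0 addn0.
apply/eqP; rewrite -subv0; apply/subvP=> u /vanishingP u0; rewrite memv0.
by apply/eqP/ffunP=> x; rewrite u0 ?inE // ffunE.
Qed.

(** The part of the perpendicular of [U] that vanishes on [X] is the perpendicular of
    [U + vanishing (~: X)], and the dimension of that sum follows from the modular law. *)
Lemma urk_rdual M (X : {set rground M}) :
  urk (X : {set rground (rdual M)}) = @dual_rk (underlying M) X.
Proof.
have := @dual_rkE (underlying M) X; have := @urkE F (rdual M) X; rewrite /=.
have -> : @vanishing F (rdual M) X = @vanishing F M X by [].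
have -> : (perp (rspace M) :&: @vanishing F M X =
           perp (rspace M + @vanishing F M (~: X)))%VS.
  by rewrite perpD perp_vanishing.
have := dim_perp (rspace M); have := dim_perp (rspace M + @vanishing F M (~: X))%VS.
have := dimv_sum_cap (rspace M) (@vanishing F M (~: X)).
rewrite dim_vanishing setCK; have := @urkE F M (~: X).
rewrite urk_setT; lia.
Qed.

Lemma urk_rcontract M (C : {set rground M}) (X : {set rground (rcontract C)}) :
  urk X + @urk F M C = @urk F M (val @: X :|: C).
Proof.
pose N := @rdelete F (rdual M) C.
rewrite [urk X](@urk_rdual N X).
have h := @dual_rkE (underlying N) X.
have {h} : @dual_rk (underlying N) X + @urk F N setT = #|X| + @urk F N (~: X) := h.
rewrite !urk_rdelete !urk_rdual.
have := @dual_rkE (underlying M) (val @: ([set: rground N])).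
have := @dual_rkE (underlying M) (val @: (~: X : {set rground N})).
have -> : ~: (val @: ([set: rground N])) = C.
  apply/setP=> y; rewrite inE; apply/negP/idP=> [h|Cy /imsetP[x _ Dy]].
    apply: contraT => Cy; case: h; apply/imsetP.
    have Cy' : y \in ~: C by rewrite inE.
    by exists (exist (fun z => z \in ~: C) y Cy').
  by have := svalP x; rewrite inE -[sval x]/(val x) -Dy Cy.
have -> : ~: (val @: (~: X : {set rground N})) = val @: X :|: C.
  apply/setP=> y; rewrite !inE; have [Cy|Cy] := boolP (y \in C).
    rewrite orbT; apply/negP=> /imsetP[x _ Dy].
    by have := svalP x; rewrite inE -[sval x]/(val x) -Dy Cy.
  have Cy' : y \in ~: C by rewrite inE.
  rewrite orbF -[y]/(val (exist (fun z => z \in ~: C) y Cy')).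
  by rewrite !(mem_imset _ _ val_inj) inE negbK.
rewrite !(card_imset _ val_inj) -![rk _]/(@urk F M _).
have ar a b c d e f g h i j : a + b = c + d -> e + b = f + g -> h + e = i + a ->
    i + c = j -> f = j -> h + g = d by lia.
by move=> h2 h1 h3; apply: (ar _ _ _ _ _ _ _ _ _ _ h2 h1 h3 (cardsC _)); rewrite cardsT.
Qed.

Lemma representable_underlying M : representable F (underlying M).
Proof.
pose A (i : 'I_(\dim (rspace M))) (e : rground M) : F := tnth (vbasis (rspace M)) i e.
exists (\dim (rspace M)), A => X; rewrite -(urk_rmatroid_of A X) /rmatroid_of.
suff -> : row_space A = rspace M by case: M A X.
rewrite /row_space -[RHS](span_basis (vbasisP _)) span_def.
rewrite big_tuple; apply: eq_bigr => i _; congr <[_]>%VS.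
by apply/ffunP=> e; rewrite ffunE.
Qed.

Lemma representable_rmatroid (M : matroid) : representable F M ->
  exists R : rmatroid F, matroid_iso M (underlying R).
Proof.
case=> n [A rA]; exists (rmatroid_of A); exists (id : M -> M); first by exists id.
by move=> X; rewrite imset_id rA; apply: urk_rmatroid_of.
Qed.

Lemma underlying_rdual M : matroid_iso (underlying (rdual M)) (dual (underlying M)).
Proof.
exists (id : rground M -> rground M); first by exists id.
by move=> X; rewrite imset_id; apply/esym/urk_rdual.
Qed.

Lemma representable_dual (M : matroid) : representable F M -> representable F (dual M).
Proof.
move=> /representable_rmatroid[R iR].
apply: (@representable_minor _ (underlying (rdual R))); last exact: representable_underlying.
apply: minor_trans (minor_dual (iso_minor iR)).
exact/iso_minor/matroid_iso_sym/underlying_rdual.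
Qed.

Definition avoids (L : seq matroid) M : Prop := ~ has_minor_in L (underlying M).

Lemma has_minor_in_trans (L : seq matroid) (M N : matroid) :
  has_minor M N -> has_minor_in L N -> has_minor_in L M.
Proof. by move=> h [T LT NT]; exists T => //; apply: minor_trans NT. Qed.

(** Hypotheses A and B are applied to this class, for each of the two excluded lists. *)
Lemma avoids_minor_closed (L : seq matroid) : minor_closed (avoids L).
Proof.
split=> [M N iMN|M D|M C] aM h; apply: aM; apply: has_minor_in_trans h.
- exact/iso_minor/matroid_iso_sym/riso_urk.
- apply/minorP; exists (fun x : rground (rdelete D) => val x), set0.
  split=> [||X]; [exact: val_inj|by move=> x; rewrite inE|].
  rewrite setU0 rk0 addn0; exact/esym/urk_rdelete.
- apply/minorP; exists (fun x : rground (rcontract C) => val x), C.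
  split=> [||X]; [exact: val_inj| |exact/esym/urk_rcontract].
  by move=> x; have := svalP x; rewrite inE.
Qed.

End RepresentedRank.

Lemma AF4_dual M : AF4 M -> AF4 (dual M).
Proof. by move=> AM F hF; apply/representable_dual/AM. Qed.

Lemma AF4_undual M : AF4 (dual M) -> AF4 M.
Proof. by move/AF4_dual; apply: AF4_minor; apply/iso_minor/dualK. Qed.

Section TemplateRank.
Variables (F : finFieldType) (Phi : template F) (B E : finType).
Variable A : tX Phi + B -> (tC Phi + tY0 Phi + tY1 Phi) + E -> F.

Definition Cset : {set (tC Phi + tY0 Phi + tY1 Phi) + E} := [set e | in_C e].

(** Members of M(Phi) are handled in this form from here on: columns of [A], taken modulo the span
    of the columns in [C]. *)
Lemma contract_delete_repr :
  @repr_mod F (underlying (contract_delete A)) _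
    (fun e => colvec A (val (val e))) (sp (colvec A) Cset).
Proof.
move=> X; rewrite -[rk X]/(urk X) /contract_delete.
rewrite [urk X](urk_rdelete X).
have -> : sp (fun e : underlying (contract_delete A) => colvec A (val (val e))) X
        = sp (colvec A) (val @: (val @: X)).
  by rewrite -imset_comp (sp_imset (colvec A)).
have -> : (sp (colvec A) Cset + sp (colvec A) (val @: (val @: X))%SET)%VS
        = sp (colvec A) (val @: (val @: X) :|: Cset) by rewrite spU addvC.
rewrite -[\dim (sp _ _)](urk_rmatroid_of A) -[RHS](urk_rmatroid_of A).
exact: urk_rcontract.
Qed.

End TemplateRank.

(** * Vectors over GF(4) in coordinates *)

(** A bare enumeration on which certificates and searches compute by reduction; [gval] interprets it
    in an arbitrary field with four elements. *)
Inductive g4 : predArgType := g0 | g1 | ga | gb.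

Definition g4_eqb (x y : g4) : bool :=
  match x, y with g0, g0 | g1, g1 | ga, ga | gb, gb => true | _, _ => false end.

Lemma g4_eqP : Equality.axiom g4_eqb.
Proof. by case; case; constructor. Qed.

HB.instance Definition _ := hasDecEq.Build g4 g4_eqP.

Definition gadd (x y : g4) : g4 :=
  match x, y with
  | g0, _ => y | _, g0 => x
  | g1, g1 | ga, ga | gb, gb => g0
  | g1, ga | ga, g1 => gb
  | g1, gb | gb, g1 => ga
  | ga, gb | gb, ga => g1
  end.

Definition gmul (x y : g4) : g4 :=
  match x, y with
  | g0, _ | _, g0 => g0
  | g1, _ => y | _, g1 => x
  | ga, ga => gb | gb, gb => ga
  | ga, gb | gb, ga => g1
  end.

Definition gunits : seq g4 := [:: g1; ga; gb].

Fixpoint vadd (l l' : seq g4) : seq g4 :=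
  match l, l' with
  | x :: s, y :: s' => gadd x y :: vadd s s'
  | [::], _ => l' | _, [::] => l
  end.

Definition vscale (c : g4) (l : seq g4) : seq g4 := map (gmul c) l.

Fixpoint gdot (l l' : seq g4) : g4 :=
  if l is x :: s then if l' is y :: s' then gadd (gmul x y) (gdot s s') else g0 else g0.

Fixpoint vcomb (cs : seq g4) (ls : seq (seq g4)) : seq g4 :=
  if cs is c :: cs' then
    if ls is l :: ls' then vadd (vscale c l) (vcomb cs' ls') else [::] else [::].

Lemma nth_vadd l l' i : nth g0 (vadd l l') i = gadd (nth g0 l i) (nth g0 l' i).
Proof.
elim: l l' i => [|x l IH] [|y l'] [|i] //=; first [by case: x | by case: (nth _ _ _)].
Qed.

Lemma nth_vscale c l i : nth g0 (vscale c l) i = gmul c (nth g0 l i).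
Proof.
have [h|h] := ltnP i (size l); first by rewrite (nth_map g0).
by rewrite !nth_default ?size_map //; case: c.
Qed.

Section Gval.
Variables (F4 : finFieldType) (cardF4 : #|F4| = 4) (a : F4).
Hypothesis a_def : (a ^+ 2 = a + 1)%R.
Local Open Scope ring_scope.

Definition gval (x : g4) : F4 :=
  match x with g0 => 0 | g1 => 1 | ga => a | gb => a ^+ 2 end.

Lemma a_neq0 : a != 0.
Proof.
apply/eqP=> a0; have := a_def; rewrite a0 expr0n add0r => /esym/eqP.
by rewrite oner_eq0.
Qed.

Lemma a_neq1 : a != 1.
Proof.
apply/eqP=> a1; have /eqP := a_def; rewrite a1 expr1n -subr_eq subrr.
by rewrite eq_sym oner_eq0.
Qed.

Lemma a1_neq0 : a + 1 != 0.
Proof. by rewrite -a_def expf_neq0 ?a_neq0. Qed.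

Lemma F4_enum (x : F4) : x \in [:: 0; 1; a; a + 1].
Proof.
have U : uniq [:: 0; 1; a; a + 1].
  rewrite /= !inE !negb_or eq_sym oner_eq0 eq_sym a_neq0 eq_sym a1_neq0 /=.
  rewrite eq_sym a_neq1 /= -[X in X != _ + _]add0r (inj_eq (addIr 1)) eq_sym a_neq0 /=.
  by rewrite -[X in X != _]addr0 (inj_eq (addrI a)) eq_sym oner_eq0.
have := uniq_min_size U (_ : {subset [:: 0; 1; a; a + 1] <= enum F4}).
case=> [y _||_ ->]; rewrite ?mem_enum //.
by rewrite -cardE cardF4.
Qed.

Lemma F4_addxx (x : F4) : x + x = 0.
Proof.
suff t2 : 1 + 1 = 0 :> F4 by rewrite -[x]mulr1 -mulrDr t2 mulr0.
have := F4_enum (1 + 1); rewrite !inE => /or4P[] /eqP // e.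
- by have /eqP := e; rewrite -[X in _ == X]addr0 (inj_eq (addrI 1)) oner_eq0.
- have /eqP := a_def; rewrite -e expr2 mulrDr mulr1 (inj_eq (addrI _)) -[X in _ == X]addr0.
  by rewrite (inj_eq (addrI _)) oner_eq0.
by have /eqP := e; rewrite (inj_eq (addIr _)) eq_sym (negPf a_neq1).
Qed.

Lemma F4_opp (x : F4) : - x = x.
Proof. by apply/eqP; rewrite eq_sym -addr_eq0 F4_addxx. Qed.

Lemma gvalD x y : gval (gadd x y) = gval x + gval y.
Proof.
have h : a + (a + 1) = 1 by rewrite addrA F4_addxx add0r.
have h' : 1 + (a + 1) = a by rewrite addrCA F4_addxx addr0.
case: x y => [] [] /=; rewrite ?(add0r, addr0, F4_addxx) ?a_def //.
- by rewrite addrC.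
- by rewrite addrC h'.
- by rewrite addrC h.
Qed.

Lemma a3 : a * a ^+ 2 = 1.
Proof. by rewrite a_def mulrDr mulr1 -expr2 a_def addrAC F4_addxx add0r. Qed.

Lemma gvalM x y : gval (gmul x y) = gval x * gval y.
Proof.
case: x y => [] [] /=; rewrite ?(mul0r, mulr0, mul1r, mulr1) ?a3 //.
  by rewrite mulrC a3.
by rewrite expr2 -mulrA -expr2 a3 mulr1.
Qed.

Lemma gval_eq0 x : (gval x == 0) = (x == g0).
Proof.
case: x => /=; rewrite ?eqxx ?oner_eq0 ?(negPf a_neq0) //.
by rewrite a_def (negPf a1_neq0).
Qed.

Lemma gval_inj : injective gval.
Proof.
move=> x y /eqP; rewrite -subr_eq0 F4_opp -gvalD gval_eq0.
by case: x y => [] [].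
Qed.

Lemma gval_surj (x : F4) : exists y, gval y = x.
Proof.
have := F4_enum x; rewrite !inE => /or4P[] /eqP->.
- by exists g0.
- by exists g1.
- by exists ga.
- by exists gb; rewrite /= a_def.
Qed.

Section Emb.
Variable V : finType.
Implicit Types (xs : seq V) (l : seq g4).

(** A vertex outside [xs] has index [size xs], where a list no longer than [xs] returns the default
    [g0]; the vector then vanishes off [xs]. Shorter lists are padded with zeros. *)
Definition emb xs l : {ffun V -> F4^o} := [ffun x => gval (nth g0 l (index x xs))].

Lemma embD xs l l' : emb xs (vadd l l') = emb xs l + emb xs l'.
Proof. by apply/ffunP=> x; rewrite !ffunE nth_vadd gvalD. Qed.

Lemma embZ xs c l : emb xs (vscale c l) = gval c *: emb xs l.
Proof. by apply/ffunP=> x; rewrite !ffunE nth_vscale gvalM. Qed.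

Lemma emb_nil xs : emb xs [::] = 0.
Proof. by apply/ffunP=> x; rewrite !ffunE nth_nil. Qed.

Lemma emb_comb xs cs ls :
  emb xs (vcomb cs ls) = \sum_(i < minn (size cs) (size ls))
     gval (nth g0 cs i) *: emb xs (nth [::] ls i).
Proof.
elim: cs ls => [|c cs IH] [|l ls] /=; rewrite ?min0n ?minn0 ?big_ord0 ?emb_nil //.
by rewrite minnSS big_ord_recl embD embZ IH.
Qed.

Lemma emb_inj xs l l' : uniq xs -> size l = size xs -> size l' = size xs ->
  emb xs l = emb xs l' -> l = l'.
Proof.
move=> U s s' /ffunP e; apply: (@eq_from_nth _ g0); first by rewrite s s'.
move=> i; rewrite s => lt; case: xs lt e U s s' => // x xs lt e U s s'.
have := e (nth x (x :: xs) i); rewrite !ffunE index_uniq //.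
exact: gval_inj.
Qed.

Definition embf xs l (f : {ffun V -> F4^o}) : F4^o :=
  \sum_(i < size xs) gval (nth g0 l i) * f (tnth (in_tuple xs) i).

Fact embf_linear xs l : linear (embf xs l).
Proof.
move=> c u v; rewrite /embf scaler_sumr -big_split; apply: eq_bigr => i _ /=.
by rewrite !ffunE mulrDr; congr (_ + _); rewrite /GRing.scale /= mulrCA.
Qed.

HB.instance Definition _ xs l :=
  GRing.isLinear.Build F4 {ffun V -> F4^o} F4^o _ (embf xs l) (embf_linear xs l).

Lemma gval_dot l l' n : (size l <= n)%N -> (size l' <= n)%N ->
  gval (gdot l l') = \sum_(i < n) gval (nth g0 l i) * gval (nth g0 l' i).
Proof.
elim: l l' n => [|x l IH] l' n s s'.
  by rewrite big1 // => i _; rewrite nth_nil mul0r.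
case: l' n s s' => [|y l'] [|n] //= s s'.
  by rewrite big1 // => i _; rewrite nth_nil mulr0.
by rewrite gvalD gvalM big_ord_recl (IH l' n).
Qed.

Lemma embf_emb xs l l' : uniq xs -> (size l <= size xs)%N -> (size l' <= size xs)%N ->
  embf xs l (emb xs l') = gval (gdot l l').
Proof.
move=> U s s'; rewrite (gval_dot s s'); apply: eq_bigr => i _.
by rewrite ffunE (tnth_nth (tnth (in_tuple xs) i)) index_uniq.
Qed.

End Emb.

Section VectorMatroid.
Variables (V I : finType) (w : I -> {ffun V -> F4^o}).

Definition vm : matroid := col_matroid (fun x (i : I) => w i x : F4).

Lemma vm_rk (X : {set I}) : rk (X : {set vm}) = \dim (sp w X).
Proof.
rewrite -[rk _]/(col_rk _ _) /col_rk; congr (\dim _); apply: eq_bigr => i _.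
by congr <[_]>%VS; apply/ffunP=> x; rewrite ffunE.
Qed.

Lemma vm_repr : repr_mod (w : vm -> _) 0.
Proof. by move=> X; rewrite vm_rk dimv0 addn0 add0v. Qed.

Definition has_vec (u : {ffun V -> F4^o}) : Prop :=
  exists i, exists2 c : F4, c != 0 & w i = c *: u.

Definition crows (c : seq (seq g4)) : matroid := rows_matroid (map (map gval) c).

Definition tcol (c : seq (seq g4)) j : seq g4 := [seq nth g0 r j | r <- c].

Definition nonprop (l l' : seq g4) : bool := all (fun c => vscale c l != l') gunits.

(** The functionals [lam] are dual to [th ++ con], which makes these vectors independent without a
    rank computation. They also give the coordinates of each element in this basis; the leading
    [size c] of them, its coordinates modulo [con], must form a nonzero multiple of the
    corresponding column of [c]. *)
Definition cert_ok m (c : seq (seq g4)) (els con th lam : seq (seq g4)) : bool :=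
  let bs := th ++ con in
  let n := size (head [::] c) in
  [&& all (fun r => size r == n) c, all (fun l => size l == m) (els ++ bs ++ lam),
      size els == n, size th == size c, size lam == size bs,
      pairwise nonprop (els ++ con),
      all (fun i => all (fun j =>
        gdot (nth [::] lam i) (nth [::] bs j) == if i == j then g1 else g0)
          (iota 0 (size bs))) (iota 0 (size bs)) &
      all (fun j => let e := nth [::] els j in let co := [seq gdot l e | l <- lam] in
        (vcomb co bs == e) &&
        has (fun k => take (size c) co == vscale k (tcol c j)) gunits) (iota 0 n)].

Lemma cert_minor xs (c : seq (seq g4)) els con th lam : uniq xs ->
  cert_ok (size xs) c els con th lam ->
  (forall l, l \in els ++ con -> has_vec (emb xs l)) ->
  has_minor vm (crows c).
Proof.
move=> U /and5P[/allP szc szs /eqP sel /eqP sth /and4P[/eqP slam np dl hel]] hN.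
set bs := th ++ con in szs slam dl hel; set n := size (head [::] c) in szc sel hel.
have {}szs l : l \in els ++ bs ++ lam -> size l = size xs by move/(allP szs)/eqP.
have szel j : (j < n)%N -> size (nth [::] els j) = size xs.
  by move=> lt; apply: szs; rewrite mem_cat mem_nth ?sel.
have szbs j : (j < size bs)%N -> size (nth [::] bs j) = size xs.
  by move=> lt; apply: szs; rewrite !mem_cat -mem_cat mem_nth ?orbT.
have szlam j : (j < size bs)%N -> size (nth [::] lam j) = size xs.
  by move=> lt; apply: szs; rewrite !mem_cat [_ \in lam]mem_nth ?slam ?orbT.
have Ldelta i j : (i < size bs)%N -> (j < size bs)%N ->
    embf xs (nth [::] lam i) (emb xs (nth [::] bs j)) = (i == j)%:R.
  move=> li lj; rewrite embf_emb ?szlam ?szbs //.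
  have /allP/(_ i) := dl; rewrite mem_iota => /(_ li)/allP/(_ j).
  by rewrite mem_iota => /(_ lj)/eqP->; case: eqP.
have n_eq : size (head [::] (map (map gval) c)) = n.
  by rewrite /n; case: (c) => //= r c'; rewrite size_map.
have szec l : l \in els ++ con -> size l = size xs.
  by move=> h; apply: szs; move: h; rewrite !mem_cat => /orP[] ->; rewrite ?orbT.
(* The ratio of the two multipliers is the value of a nonzero code, which [nonprop] rules out. This
   makes the choice [g] injective and keeps it off the contracted set. *)
have sep p q k k' : (p < q)%N -> (q < size (els ++ con))%N -> k != 0 -> k' != 0 ->
    k *: emb xs (nth [::] (els ++ con) p) = k' *: emb xs (nth [::] (els ++ con) q) -> False.
  move=> ltp ltq k0 k0' e; have [y Dy] := gval_surj (k'^-1 * k).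
  have y0 : y \in gunits.
    by have : gval y != 0; [rewrite Dy mulf_neq0 ?invr_neq0|rewrite gval_eq0; case: (y)].
  have lp : (p < size (els ++ con))%N by apply: ltn_trans ltq.
  have /(pairwiseP [::]) /(_ p q lp ltq ltp) /allP/(_ y y0)/eqP := np; apply.
  apply: (@emb_inj _ xs) => //; rewrite ?size_map ?szec ?mem_nth //.
  by rewrite embZ Dy -scalerA e scalerA mulVf ?scale1r.
have hNel (j : crows c) : exists i : I, exists2 k : F4, k != 0 &
    w i = k *: emb xs (nth [::] els j).
  by apply: hN; rewrite mem_cat mem_nth // sel -n_eq.
have [g gP] := fin_all_exists hNel.
have ltel (j : crows c) : (j < size els)%N by rewrite sel -n_eq.
have nthel (j : crows c) : nth [::] els j = nth [::] (els ++ con) j.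
  by rewrite nth_cat ltel.
(* All elements parallel to a vector of [con] are contracted together. *)
pose C : {set vm} := [set i | has (fun l =>
  [exists k : F4, (k != 0) && (w i == k *: emb xs l)]) con].
pose fF (y : {ffun 'I_(size (map (map gval) c)) -> F4^o}) : {ffun V -> F4^o} :=
  \sum_i y i *: emb xs (nth [::] th i).
have lF : linear fF.
  move=> k y z; rewrite /fF scaler_sumr -big_split; apply: eq_bigr => i _ /=.
  by rewrite !ffunE scalerDl scalerA.
pose fL := GRing.isLinear.Build F4 _ _ _ fF lF.
pose f : {linear {ffun 'I_(size (map (map gval) c)) -> F4^o} -> {ffun V -> F4^o}} :=
  HB.pack fF fL.
have ltth (i : 'I_(size (map (map gval) c))) : (i < size th)%N by rewrite sth -(size_map (map gval)).
have szb : size bs = (size th + size con)%N by rewrite size_cat.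
have ltbs (i : 'I_(size (map (map gval) c))) : (i < size bs)%N.
  by rewrite szb; apply: leq_trans (ltth i) (leq_addr _ _).
pose A (i : 'I_(size (map (map gval) c))) (j : crows c) : F4 :=
  nth 0 (nth [::] (map (map gval) c) i) j.
apply: (@repr_minor F4 vm (crows c) _ _ (w : vm -> _) 0%VS (colvec A) g C (linfun f)).
- exact: vm_repr.
- by [].
- move=> j j' e; apply/val_inj; have [k k0 Dk] := gP j; have [k' k0' Dk'] := gP j'.
  have lts (i : crows c) : (i < size (els ++ con))%N by rewrite size_cat ltn_addr ?ltel.
  rewrite e Dk' !nthel in Dk; have [lt|lt|//] := ltngtP j j'.
    by case: (sep j j' k k' lt (lts j') k0 k0' (esym Dk)).
  by case: (sep j' j k' k lt (lts j) k0' k0 Dk).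
- move=> j; rewrite inE; apply/hasPn=> l cl; apply/existsP=> -[k' /andP[k0' /eqP Dk']].
  have [k k0 Dk] := gP j; rewrite Dk' nthel in Dk.
  have ll : (index l con < size con)%N by rewrite index_mem.
  have el : l = nth [::] (els ++ con) (size els + index l con).
    by rewrite nth_cat ltnNge leq_addr /= addKn nth_index.
  case: (sep j (size els + index l con)%N k k') => //; rewrite -?el //.
    exact: leq_trans (ltel j) (leq_addr _ _).
  by rewrite size_cat ltn_add2l.
- move=> j; have [k k0 ->] := gP j.
  have /allP/(_ (j : nat)) := hel; rewrite mem_iota -n_eq ltn_ord => /(_ isT).
  set e := nth [::] els j; set co := [seq gdot l e | l <- lam].
  case/andP=> /eqP De /hasP[y yu /eqP Dco].
  have y0 : gval y != 0 by rewrite gval_eq0; case: (y) yu.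
  exists (k * gval y); first by rewrite mulf_neq0.
  rewrite -scalerA -scalerBr memvZ // add0v -{1}De emb_comb.
  have -> : minn (size co) (size bs) = (size th + size con)%N.
    by rewrite size_map slam minnn szb.
  set Z := linfun f (colvec A j); rewrite big_split_ord /=.
  have -> : \sum_(i < size th) gval (nth g0 co i) *: emb xs (nth [::] bs i)
          = gval y *: Z.
    rewrite /Z lfunE /= /fF scaler_sumr.
    pose G (i : nat) := gval y *: ((nth 0 (nth [::] (map (map gval) c) i) j : F4^o)
      *: emb xs (nth [::] th i)).
    transitivity (\sum_(i < size (map (map gval) c)) G i); last first.
      by apply: eq_bigr => i _; rewrite ffunE.
    rewrite size_map -sth; apply: eq_bigr => i _; rewrite /G scalerA.
    have -> : nth [::] bs i = nth [::] th i by rewrite nth_cat ltn_ord.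
    congr (_ *: _); have ltc : (i < size c)%N by rewrite -sth.
    have -> : nth g0 co i = gmul y (nth g0 (nth [::] c i) j).
      by rewrite -(nth_take _ ltc) Dco nth_vscale (nth_map [::]).
    rewrite gvalM; congr (_ * _); rewrite (nth_map [::]) // (nth_map g0) //.
    by rewrite (eqP (szc _ (mem_nth _ ltc))) -n_eq.
  rewrite [X in X - _]addrC addrK; apply: memv_suml => i _; apply: memvZ.
  have cl : nth [::] bs (size th + i) \in con.
    by rewrite nth_cat ltnNge leq_addr /= addKn mem_nth.
  have [i0 [k1 k10 Di0]] : has_vec (emb xs (nth [::] bs (size th + i))).
    by apply: hN; rewrite mem_cat cl orbT.
  rewrite -[emb _ _](scalerK k10) -Di0; apply/memvZ/mem_sp; rewrite inE.
  by apply/hasP; exists (nth [::] bs (size th + i)) => //; apply/existsP; exists k1;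
    rewrite k10 Di0 eqxx.
(* The functional dual to the [i]-th vector of [th] vanishes on the contracted span and takes the
   value [x i] at [f x]; hence [x i = 0]. *)
move=> x _; rewrite add0v => fx; apply/ffunP=> i; rewrite ffunE.
have : f x \in lker (linfun (embf xs (nth [::] lam i))).
  move: fx; rewrite lfunE => fx; suff /subvP/(_ _ fx) :
    (sp w C <= lker (linfun (embf xs (nth [::] lam i))))%VS by [].
  apply: sp_sub => i0; rewrite inE => /hasP[l cl /existsP[k]].
  case/andP=> k0 /eqP->; rewrite memv_ker lfunE /= linearZ /=.
  have -> : l = nth [::] bs (size th + index l con).
    by rewrite nth_cat ltnNge leq_addr /= addKn nth_index.
  rewrite Ldelta ?ltbs //; last by rewrite szb ltn_add2l index_mem.
  by rewrite ltn_eqF ?scaler0 // (leq_trans (ltth i)) ?leq_addr.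
rewrite memv_ker lfunE /= /fF linear_sum (bigD1 i) //= big1 => [|j ji].
  have -> : nth [::] th i = nth [::] bs i by rewrite nth_cat ltth.
  rewrite linearZ /= Ldelta // eqxx addr0.
  by move=> /eqP; rewrite /GRing.scale /= mulr1.
rewrite linearZ /=.
have -> : nth [::] th j = nth [::] bs j by rewrite nth_cat ltth.
by rewrite Ldelta // eq_sym (inj_eq val_inj) (negPf ji) scaler0.
Qed.

End VectorMatroid.
End Gval.

(** * The excluded matroids are not in AF4 *)

Section CodeRank.
Variables (K : fieldType) (T : Type) (val : T -> K).
Variables (zero : T) (mul sub : T -> T -> T) (isz : T -> bool).
Hypothesis val0 : val zero = 0%R.
Hypothesis valM : forall x y, val (mul x y) = (val x * val y)%R.
Hypothesis valB : forall x y, val (sub x y) = (val x - val y)%R.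
Hypothesis iszE : forall x, isz x = (val x == 0%R).
Local Open Scope ring_scope.

(** Elimination without division: [w] is a pivot at [x], and the cross-multiplied vectors all vanish
    at [x], so the line of [w] meets their span only in 0. *)
Lemma elim_dim (V : finType) (x : V) (w : {ffun V -> K^o}) (L : seq {ffun V -> K^o}) :
  w x != 0 ->
  \dim <<w :: L>> =
    (\dim <<[seq (w x : K) *: u - (u x : K) *: w | u : {ffun V -> K^o} <- L]>>).+1.
Proof.
move=> wx; set L' := map _ L.
have -> : <<w :: L>>%VS = (<[w]> + <<L'>>)%VS.
  rewrite span_cons; apply/eqP; rewrite eqEsubv !subv_add !addvSl /=.
  apply/andP; split; apply/span_subvP=> u.
    move=> Lu; have L'u : (w x : K) *: u - (u x : K) *: w \in <<L'>>%VS.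
      by apply: memv_span; apply/mapP; exists u.
    rewrite -[u](scalerK wx) memvZ // -[_ *: u](subrK ((u x : K) *: w)) addrC.
    by rewrite memv_add // memvZ ?memv_line.
  case/mapP=> u' Lu' ->; rewrite addrC memv_add //; last exact/memvZ/memv_span.
  by rewrite memvN memvZ ?memv_line.
rewrite dimv_disjoint_sum; last first.
  apply/eqP; rewrite -subv0; apply/subvP=> v; rewrite memv_cap memv0.
  case/andP=> /vlineP[k ->] L'v.
  pose ev (u : {ffun V -> K^o}) : K^o := u x.
  have lev : linear ev by move=> c u v'; rewrite /ev !ffunE.
  pose eL := GRing.isLinear.Build K _ _ _ ev lev.
  pose e : {linear {ffun V -> K^o} -> K^o} := HB.pack ev eL.
  have /subvP/(_ _ L'v) : (<<L'>> <= lker (linfun e))%VS.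
    apply/span_subvP=> _ /mapP[u _ ->]; rewrite memv_ker lfunE /= /ev !ffunE.
    by rewrite /GRing.scale /= mulrC subrr.
  rewrite memv_ker lfunE /= /ev !ffunE => /eqP kw; suff -> : k = 0 by rewrite scale0r.
  by move/eqP: kw; rewrite /GRing.scale /= mulf_eq0 (negPf wx) orbF => /eqP.
suff w0 : w != 0 by rewrite dim_vline w0.
by apply: contraNneq wx => ->; rewrite ffunE.
Qed.

Definition cvec n (l : seq T) : {ffun 'I_n -> K^o} := [ffun i : 'I_n => val (nth zero l i)].

Definition celim n j (w u : seq T) : seq T :=
  mkseq (fun i => sub (mul (nth zero w j) (nth zero u i)) (mul (nth zero u j) (nth zero w i))) n.

Lemma cvec_elim n (j : 'I_n) w u : cvec n (celim n j w u) =
  (cvec n w j : K) *: cvec n u - (cvec n u j : K) *: cvec n w.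
Proof.
by apply/ffunP=> i; rewrite !ffunE nth_mkseq // valB !valM.
Qed.

Fixpoint cpivot j (L acc : seq (seq T)) : option (seq T * seq (seq T)) :=
  if L is l :: L' then
    if isz (nth zero l j) then cpivot j L' (l :: acc) else Some (l, catrev acc L')
  else None.

Fixpoint crank n (js : seq nat) (L : seq (seq T)) : nat :=
  if js is j :: js' then
    if cpivot j L [::] is Some (w, L') then (crank n js' (map (celim n j w) L')).+1
    else crank n js' L
  else 0.

Lemma In_catrev (S : Type) (x : S) s t :
  List.In x (catrev s t) <-> List.In x s \/ List.In x t.
Proof. by elim: s t => [|y s IH] t /=; rewrite ?IH /=; tauto. Qed.

Lemma In_cat (S : Type) (x : S) s t :
  List.In x (s ++ t) <-> List.In x s \/ List.In x t.
Proof. by elim: s => [|y s IH] /=; rewrite ?IH /=; tauto. Qed.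

Lemma cpivotP n (j : 'I_n) L acc : (forall l, List.In l acc -> cvec n l j = 0) ->
  match cpivot j L acc with
  | Some (w, L') => [/\ cvec n w j != 0, List.In w (L ++ acc),
      (forall l, List.In l L' -> List.In l (L ++ acc)) &
      <<[seq cvec n l | l <- L ++ acc]>>%VS = <<[seq cvec n l | l <- w :: L']>>%VS]
  | None => forall l, List.In l L -> cvec n l j = 0
  end.
Proof.
elim: L acc => [|l L IH] acc hacc //=.
have [h|h] := boolP (isz _).
  have lj : cvec n l j = 0 by apply/eqP; rewrite ffunE -iszE h.
  have : forall l0, List.In l0 (l :: acc) -> cvec n l0 j = 0.
    by move=> l0 /= [<-|/hacc].
  move/IH; case: (cpivot _ _ _) => [[w L']|] h'.
    have sub' l0 : List.In l0 (L ++ l :: acc) -> List.In l0 (l :: L ++ acc).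
      by rewrite /= !In_cat /=; tauto.
    case: h' => w0 /sub' wL sL' <-; split=> // [l0 /sL'/sub' //|]; apply: eq_span => u.
    by rewrite /= !map_cat inE !mem_cat inE orbCA.
  by move=> l0 [<-|/h'].
split; [by rewrite ffunE -iszE|by left| |].
  by move=> l0; rewrite In_catrev /= In_cat; tauto.
apply: eq_span => u; rewrite /= !map_cat !inE !mem_cat catrevE map_cat mem_cat.
by rewrite map_rev mem_rev; congr (_ || _); rewrite orbC.
Qed.

(** The invariant is that all vectors vanish at the coordinates outside [js]. Clearing the
    coordinate [j] with a pivot, or finding no pivot there, allows [j] to be dropped from the
    list. *)
Lemma crank_dim n js L : {subset js <= iota 0 n} ->
  (forall l i, List.In l L -> (i < n)%N -> i \notin js -> val (nth zero l i) = 0) ->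
  \dim <<[seq cvec n l | l <- L]>> = crank n js L.
Proof.
elim: js L => [|j js IH] L sj hL /=.
  apply/eqP; rewrite dimv_eq0 -subv0; apply/span_subvP=> u.
  elim: L hL => //= l L IHL hL; rewrite inE => /predU1P[->|/IHL]; last first.
    by apply=> l' i h; apply: hL; right.
  by rewrite memv0; apply/eqP/ffunP=> i; rewrite !ffunE hL //; left.
have jn : (j < n)%N by have := sj j; rewrite inE eqxx mem_iota => /(_ isT).
have sj' : {subset js <= iota 0 n} by move=> k kj; apply: sj; rewrite inE kj orbT.
have := @cpivotP n (Ordinal jn) L [::]; rewrite cats0 /=.
case: (cpivot _ _ _) => [[w L']|] h.
  have [//|w0 wL sL' ->] := h; rewrite /= (elim_dim _ w0) -map_comp.
  rewrite -(IH (map (celim n j w) L')) //; first last.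
    move=> l i /List.in_map_iff[u [<- Lu]] ltn nij.
    rewrite nth_mkseq // valB !valM; have [->|nj] := eqVneq i j.
      by rewrite mulrC subrr.
    have nij' : i \notin j :: js by rewrite inE negb_or nj.
    by rewrite (hL u i (sL' u Lu) ltn nij') (hL w i wL ltn nij') !mulr0 subrr.
  rewrite -map_comp; congr (\dim <<_>>).+1; apply: eq_map => u /=.
  by rewrite -cvec_elim.
apply: IH => // l i Ll ltn nij; have [->|nj] := eqVneq i j.
  by have := h _ l Ll; rewrite ffunE; apply.
by apply: hL => //; rewrite inE negb_or nj.
Qed.

End CodeRank.

(** * Residues modulo 5 and 7 as enumerations with explicit tables *)

Inductive z5 : predArgType := z5_0 | z5_1 | z5_2 | z5_3 | z5_4.

Definition z5nat (x : z5) : nat :=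
  match x with z5_0 => 0 | z5_1 => 1 | z5_2 => 2 | z5_3 => 3 | z5_4 => 4 end.

Definition z5sub (x y : z5) : z5 :=
  match x with
  | z5_0 => match y with z5_0 => z5_0 | z5_1 => z5_4 | z5_2 => z5_3 | z5_3 => z5_2 | z5_4 => z5_1 end
  | z5_1 => match y with z5_0 => z5_1 | z5_1 => z5_0 | z5_2 => z5_4 | z5_3 => z5_3 | z5_4 => z5_2 end
  | z5_2 => match y with z5_0 => z5_2 | z5_1 => z5_1 | z5_2 => z5_0 | z5_3 => z5_4 | z5_4 => z5_3 end
  | z5_3 => match y with z5_0 => z5_3 | z5_1 => z5_2 | z5_2 => z5_1 | z5_3 => z5_0 | z5_4 => z5_4 end
  | z5_4 => match y with z5_0 => z5_4 | z5_1 => z5_3 | z5_2 => z5_2 | z5_3 => z5_1 | z5_4 => z5_0 end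
  end.

Definition z5mul (x y : z5) : z5 :=
  match x with
  | z5_0 => match y with z5_0 => z5_0 | z5_1 => z5_0 | z5_2 => z5_0 | z5_3 => z5_0 | z5_4 => z5_0 end
  | z5_1 => match y with z5_0 => z5_0 | z5_1 => z5_1 | z5_2 => z5_2 | z5_3 => z5_3 | z5_4 => z5_4 end
  | z5_2 => match y with z5_0 => z5_0 | z5_1 => z5_2 | z5_2 => z5_4 | z5_3 => z5_1 | z5_4 => z5_3 end
  | z5_3 => match y with z5_0 => z5_0 | z5_1 => z5_3 | z5_2 => z5_1 | z5_3 => z5_4 | z5_4 => z5_2 end
  | z5_4 => match y with z5_0 => z5_0 | z5_1 => z5_4 | z5_2 => z5_3 | z5_3 => z5_2 | z5_4 => z5_1 end
  end.

Definition z50b (x : z5) : bool := if x is z5_0 then true else false.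

Inductive z7 : predArgType := z7_0 | z7_1 | z7_2 | z7_3 | z7_4 | z7_5 | z7_6.

Definition z7nat (x : z7) : nat :=
  match x with z7_0 => 0 | z7_1 => 1 | z7_2 => 2 | z7_3 => 3 | z7_4 => 4 | z7_5 => 5 | z7_6 => 6 end.

Definition z7sub (x y : z7) : z7 :=
  match x with
  | z7_0 => match y with z7_0 => z7_0 | z7_1 => z7_6 | z7_2 => z7_5 | z7_3 => z7_4 | z7_4 => z7_3 | z7_5 => z7_2 | z7_6 => z7_1 end
  | z7_1 => match y with z7_0 => z7_1 | z7_1 => z7_0 | z7_2 => z7_6 | z7_3 => z7_5 | z7_4 => z7_4 | z7_5 => z7_3 | z7_6 => z7_2 end
  | z7_2 => match y with z7_0 => z7_2 | z7_1 => z7_1 | z7_2 => z7_0 | z7_3 => z7_6 | z7_4 => z7_5 | z7_5 => z7_4 | z7_6 => z7_3 end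
  | z7_3 => match y with z7_0 => z7_3 | z7_1 => z7_2 | z7_2 => z7_1 | z7_3 => z7_0 | z7_4 => z7_6 | z7_5 => z7_5 | z7_6 => z7_4 end
  | z7_4 => match y with z7_0 => z7_4 | z7_1 => z7_3 | z7_2 => z7_2 | z7_3 => z7_1 | z7_4 => z7_0 | z7_5 => z7_6 | z7_6 => z7_5 end
  | z7_5 => match y with z7_0 => z7_5 | z7_1 => z7_4 | z7_2 => z7_3 | z7_3 => z7_2 | z7_4 => z7_1 | z7_5 => z7_0 | z7_6 => z7_6 end
  | z7_6 => match y with z7_0 => z7_6 | z7_1 => z7_5 | z7_2 => z7_4 | z7_3 => z7_3 | z7_4 => z7_2 | z7_5 => z7_1 | z7_6 => z7_0 end
  end.

Definition z7mul (x y : z7) : z7 :=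
  match x with
  | z7_0 => match y with z7_0 => z7_0 | z7_1 => z7_0 | z7_2 => z7_0 | z7_3 => z7_0 | z7_4 => z7_0 | z7_5 => z7_0 | z7_6 => z7_0 end
  | z7_1 => match y with z7_0 => z7_0 | z7_1 => z7_1 | z7_2 => z7_2 | z7_3 => z7_3 | z7_4 => z7_4 | z7_5 => z7_5 | z7_6 => z7_6 end
  | z7_2 => match y with z7_0 => z7_0 | z7_1 => z7_2 | z7_2 => z7_4 | z7_3 => z7_6 | z7_4 => z7_1 | z7_5 => z7_3 | z7_6 => z7_5 end
  | z7_3 => match y with z7_0 => z7_0 | z7_1 => z7_3 | z7_2 => z7_6 | z7_3 => z7_2 | z7_4 => z7_5 | z7_5 => z7_1 | z7_6 => z7_4 end
  | z7_4 => match y with z7_0 => z7_0 | z7_1 => z7_4 | z7_2 => z7_1 | z7_3 => z7_5 | z7_4 => z7_2 | z7_5 => z7_6 | z7_6 => z7_3 end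
  | z7_5 => match y with z7_0 => z7_0 | z7_1 => z7_5 | z7_2 => z7_3 | z7_3 => z7_1 | z7_4 => z7_6 | z7_5 => z7_4 | z7_6 => z7_2 end
  | z7_6 => match y with z7_0 => z7_0 | z7_1 => z7_6 | z7_2 => z7_5 | z7_3 => z7_4 | z7_4 => z7_3 | z7_5 => z7_2 | z7_6 => z7_1 end
  end.

Definition z70b (x : z7) : bool := if x is z7_0 then true else false.

(** * Vector representations of rank-3 configurations *)

Section ConfigVectors.
Variables (K : fieldType) (W : vectType K) (n : nat) (L : seq (seq nat)).
Hypothesis okL : lines_ok L.
Variable v : 'I_n -> W.

(** Singletons, pairs and triples settle a rank function bounded by 3. If every triple of [X]
    through a fixed pair is collinear, all points of [X] lie on the one line through that pair,
    because two lines of [L] share at most one point. *)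
Lemma config_vec :
  (forall i, \dim (sp v [set i]) = 1) ->
  (forall i j, i != j -> \dim (sp v [set i; j]) = 2) ->
  (forall X : {set 'I_n}, \dim (sp v X) <= 3) ->
  (forall i j k, i != j -> i != k -> j != k ->
    \dim (sp v [set i; j; k]) = if collinear L [set i; j; k] then 2 else 3) ->
  forall X, config_rk L X = \dim (sp v X).
Proof.
move=> d1 d2 d3 dc X; rewrite /config_rk; case: leqP => [le2|gt2].
  have [c|c|c] : [\/ #|X| = 0, #|X| = 1 | #|X| = 2].
    by move: le2; case: #|X| => [|[|[|]]] //; [constructor 1|constructor 2|constructor 3].
  - by move/eqP: c; rewrite cards_eq0 => /eqP->; rewrite cards0 /sp big_set0 dimv0.
  - by move/eqP: c => /cards1P[x ->]; rewrite cards1 d1.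
  - by move/eqP: c => /cards2P[x [y [xy ->]]]; rewrite cards2 xy d2.
have /card_gt1P[i [j [Xi Xj ij]]] : 1 < #|X| by lia.
have sub (k : 'I_n) : k \in X -> [set i; j; k] \subset X.
  by move=> Xk; rewrite !subUset !sub1set Xi Xj Xk.
have [/hasP[l Ll Xl]|nc] := boolP (collinear L X).
  apply/eqP; rewrite eq_sym eqn_leq; apply/andP; split; last first.
    by rewrite -(d2 i j ij); apply/dimvS/spS; rewrite subUset !sub1set Xi Xj.
  rewrite -(d2 i j ij); apply/dimvS/sp_sub => k Xk.
  have [<-|ik] := eqVneq i k; first by apply: mem_sp; rewrite !inE eqxx.
  have [<-|jk] := eqVneq j k; first by apply: mem_sp; rewrite !inE eqxx orbT.
  have := dc i j k ij ik jk; rewrite ifT; last first.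
    by apply/hasP; exists l => //; apply: on_lineS Xl; apply: sub.
  move=> d; have /eqP -> : sp v [set i; j] == sp v [set i; j; k].
    by rewrite eqEdim d d2 // leqnn andbT; apply/spS/subsetUl.
  by apply: mem_sp; rewrite !inE eqxx orbT.
apply/eqP; rewrite eq_sym eqn_leq d3 /=.
have [[k [Xk ik jk ck]]|none] : (exists k, [/\ k \in X, i != k, j != k &
    ~~ collinear L [set i; j; k]]) \/
  (forall k, k \in X -> i != k -> j != k -> collinear L [set i; j; k]).
- have [/existsP[k /and4P[? ? ? ?]]|/existsPn none] := boolP [exists k,
    [&& k \in X, i != k, j != k & ~~ collinear L [set i; j; k]]].
    by left; exists k.
  by right=> k Xk ik jk; have := none k; rewrite Xk ik jk /= negbK.
- by have := dc i j k ij ik jk; rewrite (negPf ck) => <-; apply/dimvS/spS/sub.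
have /existsP[k0 /and3P[Xk0 ik0 jk0]] : [exists k, [&& k \in X, i != k & j != k]].
  apply: contraT => /existsPn h; have : X \subset [set i; j].
    apply/subsetP=> k Xk; rewrite !inE; have := h k; rewrite Xk /= negb_and !negbK.
    by case/orP=> /eqP->; rewrite eqxx ?orbT.
  by move/subset_leq_card; rewrite cards2; case: (i != j); lia.
have /hasP[l Ll /forall_inP h0] := none k0 Xk0 ik0 jk0.
have il : val i \in l by apply: h0; rewrite !inE eqxx.
have jl : val j \in l by apply: h0; rewrite !inE eqxx orbT.
case/negP: nc; apply/hasP; exists l => //; apply/forall_inP=> k Xk.
have [<-//|ik] := eqVneq i k; have [<-//|jk] := eqVneq j k.
have /hasP[l' Ll' /forall_inP h1] := none k Xk ik jk.
have -> : l = l'.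
  apply: (lines_meet okL Ll Ll' ij il jl); apply: h1; by rewrite !inE eqxx ?orbT.
by apply: h1; rewrite !inE eqxx orbT.
Qed.

End ConfigVectors.

Lemma sp_span (K : fieldType) (W : vectType K) (I : finType) (v : I -> W)
  (X : {set I}) (s : seq I) : X =i s -> sp v X = <<map v s>>%VS.
Proof.
move=> eqX; apply/eqP; rewrite eqEsubv; apply/andP; split.
  by apply: sp_sub => e; rewrite eqX => se; apply/memv_span/map_f.
by apply/span_subvP=> _ /mapP[e se ->]; apply: mem_sp; rewrite eqX.
Qed.

Lemma eq_span_scale (K : fieldType) (W : vectType K) (S : eqType) (f g : S -> W) (ks : seq S) :
  (forall k, k \in ks -> exists2 s : K, (s != 0)%R & f k = (s *: g k)%R) ->
  <<map f ks>>%VS = <<map g ks>>%VS.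
Proof.
elim: ks => //= k ks IH h; rewrite !span_cons IH => [|k' kk]; last first.
  by apply: h; rewrite inE kk orbT.
have [s s0 ->] := h k (mem_head _ _).
congr (_ + _)%VS; apply/eqP; rewrite eqEsubv -!memvE memvZ ?memv_line //=.
by rewrite -{1}[g k](scalerK s0) memvZ ?memv_line.
Qed.

Lemma In_mem (S : eqType) (x : S) s : List.In x s -> x \in s.
Proof.
by elim: s => //= y s IH [->|/IH h]; rewrite inE ?eqxx // h orbT.
Qed.

Definition grank r (L : seq (seq g4)) : nat :=
  crank g0 gmul gadd (fun x => x == g0) r (iota 0 r) L.

(* [all] and [has] with short-circuit evaluation: [&&] and [||] are strict
   under call-by-value reduction. *)
Fixpoint allf (S : Type) (p : S -> bool) (s : seq S) : bool :=
  if s is x :: s' then if p x then allf p s' else false else true.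

Lemma allfE (S : Type) (p : S -> bool) s : allf p s = all p s.
Proof. by elim: s => //= x s ->; case: (p x). Qed.

Fixpoint hasf (S : Type) (p : S -> bool) (s : seq S) : bool :=
  if s is x :: s' then if p x then true else hasf p s' else false.

Lemma hasfE (S : Type) (p : S -> bool) s : hasf p s = has p s.
Proof. by elim: s => //= x s ->; case: (p x). Qed.

Fixpoint subs (S : Type) k (s : seq S) : seq (seq S) :=
  if k is k'.+1 then
    if s is x :: s' then map (cons x) (subs k' s') ++ subs k s' else [::]
  else [:: [::]].

Lemma subs_In (S : Type) k (s q : seq S) : List.In q (subs k s) ->
  size q = k /\ forall x, List.In x q -> List.In x s.
Proof.
elim: s k q => [|y s IH] [|k] q //=; try by case=> // <-.
move/In_cat=> []; last by case/IH=> sz h; split=> // x /h; right.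
case/List.in_map_iff=> q' [<- /IH[sz h]]; split; first by rewrite /= sz.
by move=> x [<-|/h]; [left|right].
Qed.

Section CrowsRank.
Variables (F4 : finFieldType) (cardF4 : #|F4| = 4) (a : F4).
Hypothesis a_def : (a ^+ 2 = a + 1)%R.
Local Notation gval := (gval a).

Definition gvec r (l : seq g4) := cvec gval g0 r l.

Lemma grankE r L : \dim <<map (gvec r) L>> = grank r L.
Proof.
apply: crank_dim => //.
- exact: gvalM a_def.
- by move=> x y; rewrite (gvalD cardF4 a_def) (F4_opp cardF4 a_def).
- by move=> x; rewrite (gval_eq0 a_def).
- by move=> l i _ ltn; rewrite mem_iota ltn.
Qed.

Definition cfg_check (c : seq (seq g4)) n (L : seq (seq nat)) : bool :=
  let R s := grank (size c) (map (tcol c) s) in let N := iota 0 n in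
  [&& all (fun i => R [:: i] == 1) N,
      all (fun i => all (fun j => (i == j) || (R [:: i; j] == 2)) N) N &
      all (fun i => all (fun j => all (fun k => [|| i == j, i == k, j == k |
        R [:: i; j; k] == if has (fun l => [&& i \in l, j \in l & k \in l]) L
                          then 2 else 3]) N) N) N].

Lemma cfg_checkP c n L (okL : lines_ok L) : size c = 3 -> cfg_check c n L ->
  forall X : {set 'I_n}, config_rk L X = \dim (sp (fun j : 'I_n => gvec (size c) (tcol c j)) X).
Proof.
move=> szc /and3P[/allP h1 /allP h2 /allP h3]; set v := fun j : 'I_n => _.
have inN (i : 'I_n) : val i \in iota 0 n by rewrite mem_iota /=.
have dE (s : seq 'I_n) (X : {set 'I_n}) : X =i s ->
    \dim (sp v X) = grank (size c) (map (tcol c) (map val s)).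
  by move/sp_span->; rewrite -grankE -!map_comp.
apply: config_vec => //.
- by move=> i; rewrite (dE [:: i]) => [|x]; [apply/eqP/h1/inN|rewrite !inE].
- move=> i j ij; rewrite (dE [:: i; j]) => [|x]; last by rewrite !inE.
  by have /allP/(_ _ (inN j)) := h2 _ (inN i); rewrite (inj_eq val_inj) (negPf ij) => /eqP.
- move=> X; apply: leq_trans (dimvS (subvf _)) _.
  by rewrite dimvf /dim /= card_ord muln1 szc.
move=> i j k ij ik jk; rewrite (dE [:: i; j; k]) => [|x]; last by rewrite !inE orbA.
have /allP/(_ _ (inN j))/allP/(_ _ (inN k)) := h3 _ (inN i).
rewrite !(inj_eq val_inj) (negPf ij) (negPf ik) (negPf jk) /= => /eqP->.
congr (if _ then _ else _); apply: eq_has => l.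
apply/and3P/forall_inP=> [[li lj lk] x|h]; last by split; apply: h; rewrite !inE eqxx ?orbT.
by rewrite !inE => /orP[/orP[]|] /eqP->.
Qed.

(** The columns follow the labelling of the points in [F7]. As the entries are 0 and 1, the matrix
    is read again over GF(2) when F7 is located in the projective plane of order 2. *)
Definition F7c : seq (seq g4) :=
  [:: [:: g1; g0; g0; g1; g0; g1; g1]; [:: g0; g1; g0; g1; g1; g1; g0];
      [:: g0; g0; g1; g0; g1; g1; g1]].

Let F7L := [:: [:: 0; 1; 3]; [:: 1; 2; 4]; [:: 2; 3; 5]; [:: 3; 4; 6];
  [:: 4; 5; 0]; [:: 5; 6; 1]; [:: 6; 0; 2]].

Lemma F7_iso : matroid_iso F7 (crows a F7c).
Proof.
exists (id : 'I_7 -> 'I_7); first by exists id.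
move=> X; rewrite imset_id -[RHS]/(config_rk F7L X).
have chk : cfg_check F7c 7 F7L by vm_compute.
rewrite (cfg_checkP (isT : lines_ok F7L) (erefl : size F7c = 3) chk).
rewrite -[LHS]/(\dim (sp _ X)); congr (\dim _); apply: eq_bigr => j _; congr <[_]>%VS.
apply/ffunP=> i; rewrite !ffunE /=.
by case: i => [[|[|[|]]] //= ?]; case: j => [[|[|[|[|[|[|[|]]]]]]] //= ?].
Qed.

Definition Papc : seq (seq g4) := 
  [:: [:: g0; g0; g0; g1; g1; g1; g1; g1; g1];
      [:: g0; g1; g1; g0; g1; gb; g1; gb; ga];
      [:: g1; g0; g1; g0; ga; g1; g0; gb; g1]].

Let PapL := [:: [:: 0; 1; 2]; [:: 3; 4; 5]; [:: 6; 7; 8]; [:: 0; 4; 6]; [:: 1; 3; 6];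
  [:: 0; 5; 7]; [:: 2; 3; 7]; [:: 1; 5; 8]; [:: 2; 4; 8]].

Lemma Pappus_iso : matroid_iso Pappus (crows a Papc).
Proof.
exists (id : 'I_9 -> 'I_9); first by exists id.
move=> X; rewrite imset_id -[RHS]/(config_rk PapL X).
have chk : cfg_check Papc 9 PapL by vm_compute.
rewrite (cfg_checkP (isT : lines_ok PapL) (erefl : size Papc = 3) chk).
rewrite -[LHS]/(\dim (sp _ X)); congr (\dim _); apply: eq_bigr => j _; congr <[_]>%VS.
apply/ffunP=> i; rewrite !ffunE /=.
by case: i => [[|[|[|]]] //= ?]; case: j => [[|[|[|[|[|[|[|[|[|]]]]]]]]] //= ?].
Qed.

(** * Nonrepresentability over a small field by exhaustive search *)

Section NonRep.
Variables (K : fieldType) (T : eqType) (val : T -> K).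
Variables (zero one : T) (mul sub : T -> T -> T) (isz : T -> bool) (els : seq T).
Hypothesis val0 : val zero = 0%R.
Hypothesis val1 : val one = 1%R.
Hypothesis valM : forall x y, val (mul x y) = (val x * val y)%R.
Hypothesis valB : forall x y, val (sub x y) = (val x - val y)%R.
Hypothesis iszE : forall x, isz x = (val x == 0%R).
Hypothesis val_surj : forall x : K, exists2 t, t \in els & val t = x.
Hypothesis val_inj' : injective val.

Fixpoint all_vecs r : seq (seq T) :=
  if r is r'.+1 then [seq t :: v | t <- els, v <- all_vecs r'] else [:: [::]].

Fixpoint normalv (v : seq T) : bool :=
  if v is t :: v' then if isz t then normalv v' else t == one else false.

Definition krank r (L : seq (seq T)) := crank zero mul sub isz r (iota 0 r) L.

(** Only bases are compared: each choice of [r - 1] elements placed earlier must form a basis with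
    [j] on both sides or on neither. *)
Definition consistent (c : seq (seq g4)) r asg j (v : seq T) : bool :=
  allf (fun q : seq (nat * seq T) =>
    (krank r (v :: map snd q) == r) == (grank r (map (tcol c) (j :: map fst q)) == r))
    (subs r.-1 asg).

Fixpoint nosol c r pts (asg : seq (nat * seq T)) (rest : seq nat) : bool :=
  if rest is j :: rest' then
    allf (fun v => if consistent c r asg j v then nosol c r pts ((j, v) :: asg) rest'
                   else true) pts
  else false.

Definition unitv r i : seq T := mkseq (fun k => if k == i then one else zero) r.

(* k1 completes the basis to a frame: its coordinates are scaled to 1. *)
Definition nonrep_check (c : seq (seq g4)) (bas : seq nat) k1 (rest : seq nat) : bool :=
  let r := size c in let n := size (head [::] c) in
  [&& 0 < r, all (fun k => (k \notin bas) && (k != k1)) rest, all (fun l => size l == n) c,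
      size bas == r, uniq (k1 :: bas), all (fun j => j < n) (k1 :: bas ++ rest),
      all (fun i => grank r (map (tcol c) (k1 :: [seq nth 0 bas j | j <- iota 0 r & j != i])) == r)
        (iota 0 r),
      grank r (map (tcol c) bas) == r, all (fun j => grank r [:: tcol c j] == 1) rest &
      nosol c r [seq v <- all_vecs r | normalv v]
        ((k1, nseq r one) :: [seq (nth 0 bas i, unitv r i) | i <- iota 0 r]) rest].

Lemma all_vecsP r v : size v = r -> {subset v <= els} -> v \in all_vecs r.
Proof.
elim: r v => [|r IH] [|t v] //= [sz] sub'; apply/allpairsP; exists (t, v).
by split=> //=; [apply: sub'; rewrite inE eqxx|apply: IH => // x vx; apply: sub'; rewrite inE vx orbT].
Qed.

Lemma krankE r L : \dim <<map (cvec val zero r) L>> = krank r L.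
Proof. by apply: crank_dim => // l i _ ltn; rewrite mem_iota ltn. Qed.

(** A genuine representation [z] is a branch that the search cannot discard: each of its vectors is
    among the candidates and passes [consistent]. *)
Lemma nosolP c r asg rest (z : nat -> seq T) (ok : pred nat) :
  0 < r ->
  (forall k, ok k -> z k \in all_vecs r) ->
  (forall k, k \in rest -> ok k && normalv (z k)) ->
  (forall ks, all ok ks -> krank r (map z ks) = grank r (map (tcol c) ks)) ->
  (forall q, List.In q asg -> ok q.1 /\ q.2 = z q.1) ->
  nosol c r [seq v <- all_vecs r | normalv v] asg rest = false.
Proof.
move=> r0 zin hrest hrk; elim: rest asg hrest => //= j rest IH asg hrest hasg.
have /andP[okj nj] := hrest j (mem_head _ _).
rewrite allfE; apply/negbTE/allPn; exists (z j); first by rewrite mem_filter nj zin.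
rewrite ifT; first rewrite IH // => [k kr|q [<- //|/hasg //]].
  by apply: hrest; rewrite inE kr orbT.
rewrite /consistent allfE; apply/allP=> q qs.
have {}qs : List.In q (subs r.-1 asg).
  by elim: (subs _ _) qs => //= s ss IHs; rewrite inE => /predU1P[->|/IHs]; [left|right].
have [_ sub'] := subs_In qs.
have -> : map snd q = map z (map fst q).
  rewrite -map_comp; elim: q sub' {qs} => //= x q IHq sub'.
  rewrite IHq => [|y yq]; last by apply: sub'; right.
  by have [_ ->] := hasg x (sub' x (or_introl erefl)).
rewrite -map_cons hrk ?eqxx //= okj /=.
elim: q sub' {qs} => //= x q IHq sub'; rewrite IHq => [|y yq]; last by apply: sub'; right.
by have [-> _] := hasg x (sub' x (or_introl erefl)).
Qed.

Lemma codes_of (ys : seq K) : exists2 z, {subset z <= els} & map val z = ys.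
Proof.
elim: ys => [|y ys [z sz <-]]; first by exists [::].
have [t et <-] := val_surj y; exists (t :: z) => // x.
by rewrite inE => /predU1P[->|/sz].
Qed.

Lemma normal_codes (ys : seq K) : has (fun y => y != 0%R) ys ->
  exists z (s : K), [/\ (s != 0)%R, {subset z <= els}, map val z = map ( *%R s) ys & normalv z].
Proof.
elim: ys => //= y ys IH; have [-> /=|y0 _] := eqVneq y 0%R.
  case/IH=> z [s [s0 sz e nz]]; have [t et t0] := val_surj 0%R.
  exists (t :: z), s; split=> //=; last by rewrite iszE t0 eqxx.
    by move=> x; rewrite inE => /predU1P[->|/sz].
  by rewrite t0 mulr0 e.
have [z sz e] := codes_of (map ( *%R y^-1%R) ys); have [t et t1] := val_surj 1%R.
exists (t :: z), (y^-1)%R; split=> //=; rewrite ?invr_neq0 //.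
- by move=> x; rewrite inE => /predU1P[->|/sz].
- by rewrite t1 e mulVf.
- by rewrite iszE t1 oner_eq0; apply/eqP/val_inj'; rewrite t1.
Qed.

(** A representation over [K] can be normalized first: the basis [bas] goes to the unit vectors, the
    element [k1] to the all-ones vector, and every remaining column is scaled to have first nonzero
    entry 1. The finite enumeration then misses no representation. *)
Lemma nonrepP c bas k1 rest : nonrep_check c bas k1 rest -> ~ representable K (crows a c).
Proof.
case/and5P=> r0 /allP nbr /allP szc /eqP szb /and5P[/andP[k1b ub] /allP ltn /allP fr gb /andP[/allP g1' ns]] [m [A rA]].
set r := size c in r0 szb fr gb ns g1'; set n := size (head [::] c) in szc ltn.
have n_eq : size (head [::] (map (map gval) c)) = n.
  by rewrite /n; case: (c) => //= l c'; rewrite size_map.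
have n0 : 0 < n.
  by have := ltn k1 (mem_head _ _); case: (n).
pose j0 : crows a c := cast_ord (esym n_eq) (Ordinal n0).
pose J k : crows a c := insubd j0 k.
have JE k : k < n -> \val (J k) = k by move=> lt; rewrite val_insubd; move: lt; rewrite -{1}n_eq => ->.
pose u k := colvec A (J k).
pose R0 := size (map (map gval) c).
have R0E : R0 = r by rewrite /R0 size_map.
have dimE ks : all (fun k => k < n) ks -> \dim <<map u ks>> = grank r (map (tcol c) ks).
  move=> /allP okk; rewrite -R0E -grankE -map_comp.
  pose X : {set crows a c} := [set j | j \in map J ks].
  have eX : X =i map J ks by move=> j; rewrite inE.
  have := rA X; rewrite -[col_rk _ _]/(\dim (sp (colvec A) X)) (sp_span _ eX) -map_comp.
  move=> <-; rewrite -[rk X]/(\dim (sp (colvec _) X)) (sp_span _ eX) -map_comp.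
  congr (\dim <<_>>); apply/eq_in_map=> k kk; apply/ffunP=> i; rewrite !ffunE.
  have ltc : i < size c by rewrite -(size_map (map gval)).
  rewrite /= (nth_map [::]) // (nth_map g0) ?JE ?okk //; last first.
    by rewrite (eqP (szc _ (mem_nth _ ltc))) okk.
  by rewrite /tcol (nth_map [::]).
have ltb b : b \in bas -> b < n by move=> h; apply: ltn; rewrite inE mem_cat h orbT.
have ltk1 : k1 < n by apply/ltn/mem_head.
have allb : all (fun k => k < n) bas by apply/allP.
pose tb := [tuple of map u (in_tuple bas)].
have dtb : \dim <<tb>> = size bas by rewrite dimE // (eqP gb) szb.
have ftb : free tb by rewrite /free dtb size_tuple.
have utb k : k < n -> u k \in <<tb>>%VS.
  move=> lt; have : (<<tb>> <= <<u k :: tb>>)%VS by rewrite span_cons addvSr.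
  have le : \dim <<u k :: tb>> <= \dim <<tb>>.
    rewrite dtb -map_cons dimE /= ?lt // -R0E -grankE.
    by apply: leq_trans (dimvS (subvf _)) _; rewrite dim_ffunE card_ord R0E szb.
  move=> sub'; have /eqP -> : (<<tb>> == <<u k :: tb>>)%VS by rewrite eqEdim sub' le.
  by apply: memv_span; rewrite inE eqxx.
pose q := size bas.
pose d (i : 'I_q) : K := coord tb i (u k1).
(* Exchanging the [i]-th basis element for [k1] gives a basis again, so [k1] has no zero coordinate
   and the axes can be rescaled by [d]. *)
have d0 i : d i != 0%R.
  apply/eqP=> di; have iq : \val i \in iota 0 r by rewrite mem_iota /= -szb ltn_ord.
  have := fr _ iq; rewrite -dimE; last first.
    rewrite /= ltk1; apply/allP=> _ /mapP[j + ->]; rewrite mem_filter mem_iota /= => /andP[_ jr].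
    by apply/ltb/mem_nth; rewrite szb.
  set s := [seq nth 0 bas j | j <- iota 0 r & j != \val i]; have szs : size s = r.-1.
    have -> : s = [seq nth 0 bas j | j <- rem (\val i) (iota 0 r)].
      by rewrite rem_filter ?iota_uniq.
    by rewrite size_map size_rem // size_iota.
  suff -> : <<map u (k1 :: s)>>%VS = <<map u s>>%VS.
    by have := dim_span (map u s); rewrite size_map szs; case: (r) r0 => // r'; lia.
  rewrite /= span_cons; apply/addv_idPr; rewrite -memvE (coord_span (utb k1 ltk1)).
  apply: memv_suml => j _; have [->|ji] := eqVneq j i; first by rewrite -/(d i) di scale0r mem0v.
  apply/memvZ/memv_span; rewrite (nth_map 0) //; apply/map_f/mapP; exists (\val j) => //.
  by rewrite mem_filter mem_iota /= -szb ltn_ord andbT.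
pose x k : {ffun 'I_q -> K^o} := [ffun i => ((d i)^-1 * coord tb i (u k))%R].
pose th (y : {ffun 'I_q -> K^o}) := (\sum_(i < q) (d i * y i : K) *: tb`_i)%R.
have lth : linear th.
  move=> s y y'; rewrite /th scaler_sumr -big_split; apply: eq_bigr => i _ /=.
  by rewrite !ffunE mulrDr scalerDl scalerA; congr (_ *: _ + _)%R; rewrite /GRing.scale /= mulrCA.
pose thM := GRing.isLinear.Build K _ _ _ th lth.
pose th' : {linear {ffun 'I_q -> K^o} -> {ffun 'I_m -> K^o}} := HB.pack th thM.
have thx k : k < n -> th (x k) = u k.
  move=> lt; rewrite [RHS](coord_span (utb k lt)); apply: eq_bigr => i _.
  by rewrite ffunE mulVKf.
have kth : (lker (linfun th') = 0)%VS.
  apply/eqP; rewrite -subv0; apply/subvP=> y; rewrite memv_ker lfunE memv0 => /eqP hy.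
  apply/eqP/ffunP=> i; rewrite ffunE; move/freeP: ftb => /(_ (fun i => d i * y i)%R hy i)/eqP.
  by rewrite mulf_eq0 (negPf (d0 i)) => /eqP.
have dimx ks : all (fun k => k < n) ks -> \dim <<map x ks>> = grank r (map (tcol c) ks).
  move=> okk; rewrite -dimE // -(@limg_dim_eq _ _ _ (linfun th')) ?kth ?capv0 //.
  rewrite limg_span -map_comp; congr (\dim <<_>>); apply/eq_in_map=> k kk.
  by transitivity (th (x k)); [apply: lfunE|apply: thx; apply: (allP okk)].
have hz (j : crows a c) : exists z : seq T, [/\ size z = q, {subset z <= els},
    (exists2 s : K, (s != 0)%R & cvec val zero q z = (s *: x (\val j))%R) &
    x (\val j) != 0%R -> normalv z].
  pose ys := [seq (x (\val j) i : K) | i <- enum 'I_q].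
  have nys (i : 'I_q) : nth 0%R ys i = x (\val j) i.
    by rewrite (nth_map i) ?size_enum_ord // nth_ord_enum.
  have szys : size ys = q by rewrite size_map size_enum_ord.
  have [h|h] := boolP (has (fun y => y != 0%R) ys).
    have [z [s [s0 sz e nz]]] := normal_codes h; have szz : size z = q.
      by rewrite -szys -(size_map ( *%R s)) -e size_map.
    exists z; split=> //; exists s => //; apply/ffunP=> i; rewrite !ffunE.
    rewrite -(nth_map _ 0%R) ?szz // e (nth_map 0%R) ?szys // nys.
    by rewrite ffunE.
  have [z sz e] := codes_of ys; have szz : size z = q by rewrite -szys -e size_map.
  exists z; split=> //.
    exists 1%R; rewrite ?oner_eq0 // scale1r; apply/ffunP=> i; rewrite ffunE.
    by rewrite -(nth_map _ 0%R) ?szz // e nys.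
  case/negP; apply/eqP/ffunP=> i; rewrite [RHS]ffunE -nys.
  by move/hasPn: h => /(_ _ (mem_nth 0%R (_ : i < size ys))); rewrite szys negbK => /(_ (ltn_ord i))/eqP.
have [z0 z0P] := fin_all_exists hz.
pose z k := if k \in bas then unitv q (index k bas) else if k == k1 then nseq q one else z0 (J k).
have zx k : k < n -> exists2 s : K, (s != 0)%R & cvec val zero q (z k) = (s *: x k)%R.
  move=> lt; rewrite /z; case: ifP => kb; last first.
    case: eqP => [->|_]; last by have [_ _ + _] := z0P (J k); rewrite JE.
    exists 1%R; rewrite ?oner_eq0 // scale1r; apply/ffunP=> i; rewrite !ffunE.
    by rewrite nth_nseq ltn_ord val1 mulVf.
  have ik : index k bas < q by rewrite index_mem.
  exists (d (Ordinal ik)) => //; apply/ffunP=> i; rewrite !ffunE.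
  rewrite nth_mkseq // (fun_if val) val0 val1 /GRing.scale /=.
  have -> : u k = (tb`_(Ordinal ik))%R.
    by rewrite /= (nth_map 0) // nth_index.
  rewrite coord_free //; have -> : ((i : nat) == index k bas) = (i == Ordinal ik) by [].
  rewrite ?[Ordinal ik == i]eq_sym; case: eqP => [->|_]; last by rewrite !mulr0.
  by rewrite mulr1 mulfV.
have zin k : k < n -> z k \in all_vecs q.
  move=> lt; rewrite /z; case: ifP => kb; last first.
    case: eqP => [_|_]; last by have [? ? _ _] := z0P (J k); apply: all_vecsP.
    apply: all_vecsP; first by rewrite size_nseq.
    by move=> y; rewrite mem_nseq => /andP[_ /eqP->]; have [t et] := val_surj 1%R;
      rewrite -val1 => /val_inj' <-.
  apply: all_vecsP; first by rewrite size_mkseq.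
  have e0 : zero \in els by have [t et] := val_surj 0%R; rewrite -val0 => /val_inj' <-.
  have e1 : one \in els by have [t et] := val_surj 1%R; rewrite -val1 => /val_inj' <-.
  by move=> y /mapP[i _ ->]; case: ifP.
move: ns; rewrite -szb -/q (@nosolP c q _ rest z (fun k => k < n)) //.
- by rewrite /q szb.
- move=> k kr; have lt : k < n by apply: ltn; rewrite inE mem_cat kr !orbT.
  rewrite lt /=; have /andP[nb n1] := nbr k kr; rewrite /z (negPf nb) (negPf n1).
  have [_ _ _] := z0P (J k); apply; rewrite JE //.
  have := g1' k kr; rewrite -(dimx [:: k]) ?map_cons /= ?lt //.
  by rewrite span_seq1 dim_vline; case: (x k == 0%R).
- move=> ks okk; rewrite -[LHS]krankE -map_comp [in RHS]/q szb -dimx //.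
  congr (\dim _); apply: eq_span_scale => k kk.
  by apply: zx; apply: (allP okk).
- move=> p [<-|/List.in_map_iff[i [<- ii]]] /=.
    by split=> //; rewrite /z eqxx (negPf k1b).
  have iq : i < q by have := In_mem ii; rewrite mem_iota.
  by split; [apply/ltb/mem_nth|rewrite /z mem_nth // index_uniq].
Qed.

End NonRep.
End CrowsRank.

Definition V1c : seq (seq g4) :=
  [:: [:: g1; g0; g0; g1; g0; g1; g1; g1; g1];
      [:: g0; g1; g0; g1; g1; gb; gb; ga; g0];
      [:: g0; g0; g1; g0; g1; g1; ga; g1; ga]].

Definition V2c : seq (seq g4) :=
  [:: [:: g1; g0; g0; g0; g1; g1; g1; g0];
      [:: g0; g1; g0; g0; gb; ga; ga; g1];
      [:: g0; g0; g1; g0; ga; gb; ga; g1];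
      [:: g0; g0; g0; g1; gb; gb; ga; ga]].

Definition V3c : seq (seq g4) :=
  [:: [:: g1; g0; g0; g0; g1; g0; g1; g1; g1];
      [:: g0; g1; g0; g0; ga; g1; gb; gb; g1];
      [:: g0; g0; g1; g0; ga; g1; ga; g1; gb];
      [:: g0; g0; g0; g1; g0; g1; g1; g0; g0]].

Definition P1c : seq (seq g4) :=
  [:: [:: g0; g1; g1; g1; g1; g1; g0; g0; g0];
      [:: g0; g1; ga; g0; g0; g0; g1; g1; g1];
      [:: g1; g0; g0; g1; ga; gb; g1; ga; gb]].

Definition P2c : seq (seq g4) :=
  [:: [:: g1; g0; g0; g0; g1; g0; g1; g1];
      [:: g0; g1; g0; g0; ga; g1; g1; g1];
      [:: g0; g0; g1; g0; g1; g1; g0; g1];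
      [:: g0; g0; g0; g1; gb; g1; gb; g0]].

Definition P3c : seq (seq g4) :=
  [:: [:: g0; g1; g1; g1; g1; g1; g1; g0; g0];
      [:: g0; g1; ga; gb; g0; g0; g0; g1; g1];
      [:: g1; g0; g0; g0; g1; ga; gb; g1; ga]].

Definition Y9c : seq (seq g4) :=
  [:: [:: g1; g0; g0; g1; g1; g0; ga; ga; g1];
      [:: g0; g1; g0; g1; g0; g1; ga; g1; ga];
      [:: g0; g0; g1; g0; g1; g1; g1; g0; g1]].

Definition z5val (x : z5) : 'F_5 := ((z5nat x)%:R)%R.

Definition z5_eqb (x y : z5) : bool := z5nat x == z5nat y.

Lemma z5_eqP : Equality.axiom z5_eqb.
Proof. by case; case; constructor. Qed.

HB.instance Definition _ := hasDecEq.Build z5 z5_eqP.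

Definition z5els : seq z5 := [:: z5_0; z5_1; z5_2; z5_3; z5_4].

Lemma z5_nonrep (F4 : finFieldType) (cardF4 : #|F4| = 4) (a : F4)
    (a_def : (a ^+ 2 = a + 1)%R) c bas k1 rest :
  nonrep_check z5_0 z5_1 z5mul z5sub z50b z5els c bas k1 rest ->
  ~ AF4 (crows a c).
Proof.
move=> chk /(_ 'F_5)[].
  by exists [:: 0; 1; 1 + 1; 1 + 1 + 1]%R.
move=> n [A rA]; apply: (nonrepP cardF4 a_def (val := z5val) _ _ _ _ _ _ _ chk); last by exists n, A.
- by [].
- by [].
- by case; case; apply/eqP; vm_compute.
- by case; case; apply/eqP; vm_compute.
- by case; vm_compute.
- case=> [[|[|[|[|[|]]]]] //= lt]; [exists z5_0|exists z5_1|exists z5_2|exists z5_3|exists z5_4];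
    rewrite // /z5val; apply/val_inj; by vm_compute.
- by case; case => // /eqP; vm_compute.
Qed.

Definition z7val (x : z7) : 'F_7 := ((z7nat x)%:R)%R.

Definition z7_eqb (x y : z7) : bool := z7nat x == z7nat y.

Lemma z7_eqP : Equality.axiom z7_eqb.
Proof. by case; case; constructor. Qed.

HB.instance Definition _ := hasDecEq.Build z7 z7_eqP.

Definition z7els : seq z7 := [:: z7_0; z7_1; z7_2; z7_3; z7_4; z7_5; z7_6].

Lemma z7_nonrep (F4 : finFieldType) (cardF4 : #|F4| = 4) (a : F4)
    (a_def : (a ^+ 2 = a + 1)%R) c bas k1 rest :
  nonrep_check z7_0 z7_1 z7mul z7sub z70b z7els c bas k1 rest ->
  ~ AF4 (crows a c).
Proof.
move=> chk /(_ 'F_7)[].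
  by exists [:: 0; 1; 1 + 1; 1 + 1 + 1]%R.
move=> n [A rA]; apply: (nonrepP cardF4 a_def (val := z7val) _ _ _ _ _ _ _ chk); last by exists n, A.
- by [].
- by [].
- by case; case; apply/eqP; vm_compute.
- by case; case; apply/eqP; vm_compute.
- by case; vm_compute.
- case=> [[|[|[|[|[|[|[|]]]]]]] //= lt]; [exists z7_0|exists z7_1|exists z7_2|exists z7_3|exists z7_4|exists z7_5|exists z7_6];
    rewrite // /z7val; apply/val_inj; by vm_compute.
- by case; case => // /eqP; vm_compute.
Qed.

Section NotAF4.
Variables (F4 : finFieldType) (cardF4 : #|F4| = 4) (a : F4).
Hypothesis a_def : (a ^+ 2 = a + 1)%R.

Lemma not_AF4_F7 : ~ AF4 (F7).
Proof.
move/(AF4_minor (iso_minor (matroid_iso_sym (F7_iso cardF4 a_def)))).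
apply: (z5_nonrep cardF4 a_def (c := F7c) (bas := [:: 0; 1; 2]) (k1 := 5) (rest := [:: 3; 4; 6]) _).
by vm_compute.
Qed.

Lemma not_AF4_Pap : ~ AF4 (Pappus).
Proof.
move/(AF4_minor (iso_minor (matroid_iso_sym (Pappus_iso cardF4 a_def)))).
apply: (z5_nonrep cardF4 a_def (c := Papc) (bas := [:: 0; 1; 3]) (k1 := 8) (rest := [:: 2; 4; 5; 6; 7]) _).
by vm_compute.
Qed.

Lemma not_AF4_V1 : ~ AF4 (V1 a).
Proof.
by apply: (z5_nonrep cardF4 a_def (c := V1c) (bas := [:: 0; 1; 2]) (k1 := 5) (rest := [:: 3; 4; 6; 7; 8]) _); vm_compute.
Qed.

Lemma not_AF4_V2 : ~ AF4 (V2 a).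
Proof.
by apply: (z5_nonrep cardF4 a_def (c := V2c) (bas := [:: 0; 1; 2; 3]) (k1 := 4) (rest := [:: 5; 6; 7]) _); vm_compute.
Qed.

Lemma not_AF4_V3 : ~ AF4 (V3 a).
Proof.
by apply: (z5_nonrep cardF4 a_def (c := V3c) (bas := [:: 0; 1; 2; 3]) (k1 := 6) (rest := [:: 4; 5; 7; 8]) _); vm_compute.
Qed.

Lemma not_AF4_P1 : ~ AF4 (P1 a).
Proof.
by apply: (z5_nonrep cardF4 a_def (c := P1c) (bas := [:: 0; 1; 2]) (k1 := 3) (rest := [:: 4; 5; 6; 7; 8]) _); vm_compute.
Qed.

Lemma not_AF4_P2 : ~ AF4 (P2 a).
Proof.
by apply: (z5_nonrep cardF4 a_def (c := P2c) (bas := [:: 0; 1; 2; 3]) (k1 := 4) (rest := [:: 5; 6; 7]) _); vm_compute.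
Qed.

Lemma not_AF4_P3 : ~ AF4 (P3 a).
Proof.
by apply: (z5_nonrep cardF4 a_def (c := P3c) (bas := [:: 0; 1; 2]) (k1 := 4) (rest := [:: 3; 5; 6; 7; 8]) _); vm_compute.
Qed.

(** Here the field is GF(7): the golden-ratio equation [x^2 = x + 1], which governs the Perles
    configuration, has the root 3 modulo 5 but no root modulo 7. *)
Lemma not_AF4_Y9 : ~ AF4 (Y9 a).
Proof.
by apply: (z7_nonrep cardF4 a_def (c := Y9c) (bas := [:: 0; 1; 2]) (k1 := 6) (rest := [:: 3; 4; 5; 7; 8]) _); vm_compute.
Qed.

End NotAF4.

(** * Cliques with additional vectors *)

(** The members of rank 3 of the two lists. Every excluded minor produced by the search is one of
    them, and their duals occur in the list for high connectivity. *)
Definition rank3_excluded (F : fieldType) (a : F) : seq matroid :=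
  [:: F7; V1 a; P1 a; P3 a; Y9 a; Pappus].

Section Config.
Variables (F4 : finFieldType) (cardF4 : #|F4| = 4) (a : F4).
Hypothesis a_def : (a ^+ 2 = a + 1)%R.
Local Notation gval := (gval a).
Local Notation emb := (emb a).
Local Open Scope ring_scope.

Definition gcof (x : F4) : g4 :=
  if x == 0 then g0 else if x == 1 then g1 else if x == a then ga else gb.

Lemma gcofK x : gval (gcof x) = x.
Proof.
rewrite /gcof; have := F4_enum cardF4 a_def x; rewrite !inE.
case: eqP => [-> //|_] /=; case: eqP => [-> //|_] /=; case: eqP => [-> //|_] /= /eqP->.
by rewrite /= a_def.
Qed.

Lemma gvalK x : gcof (gval x) = x.
Proof. by apply: (gval_inj cardF4 a_def); rewrite gcofK. Qed.

Lemma gcof_eq0 x : (gcof x == g0) = (x == 0).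
Proof. by rewrite -(gval_eq0 a_def) gcofK. Qed.

Section Fixed.
Variable V : finType.
Local Notation vec := {ffun V -> F4^o}.

Definition edgev (x y : V) : vec := deltaf F4 x + deltaf F4 y.

Lemma edgevE x y z : edgev x y z = (z == x)%:R + (z == y)%:R.
Proof. by rewrite !ffunE. Qed.

Definition avoiding (I : finType) (w : I -> vec) : Prop :=
  ~ has_minor_in (rank3_excluded a) (vm w).

(** In characteristic 2 the vectors [edgev x y] represent the cycle matroid of the complete graph on
    [D]; a config is this clique with further zero-sum vectors. Since [has_vec] allows scalings,
    only the lines spanned by the vectors matter. *)
Record config (D : {set V}) (I : finType) (w : I -> vec) : Prop := Config {
  config_supp : forall i x, x \notin D -> w i x = 0;
  config_sum : forall i, \sum_x w i x = 0;
  config_clique : forall x y, x \in D -> y \in D -> x != y -> has_vec w (edgev x y);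
  config_avoid : avoiding w }.

Definition supp (u : vec) : {set V} := [set x | u x != 0].

Section Merge.
Variables (D : {set V}) (I : finType) (w : I -> vec) (i1 : I) (c1 : F4) (x y : V).
Hypothesis cw : config D w.
Hypotheses (xD : x \in D) (yD : y \in D) (xy : x != y) (c10 : c1 != 0).
Hypothesis w1 : w i1 = c1 *: edgev x y.

Definition mergev (i : {i | i != i1}) : vec := w (sval i) + (w (sval i) x : F4) *: edgev x y.

Lemma mergev_x i : mergev i x = 0.
Proof. by rewrite !ffunE eqxx (negPf xy) addr0 /GRing.scale /= mulr1 (F4_addxx cardF4 a_def). Qed.

Lemma mergev_y i : mergev i y = w (sval i) y + w (sval i) x.
Proof. by rewrite !ffunE eqxx eq_sym (negPf xy) add0r /GRing.scale /= mulr1. Qed.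

Lemma mergev_z i z : z != x -> z != y -> mergev i z = w (sval i) z.
Proof.
by move=> zx zy; rewrite !ffunE (negPf zx) (negPf zy) addr0 /GRing.scale /= mulr0 addr0.
Qed.

(** Contracting the edge [xy] identifies [x] with [y]: the entry at [x] is added to the one at [y].
    The edges avoiding [x] survive, and the result is a minor, so it still avoids the excluded
    matroids. *)
Lemma config_merge : config (D :\ x) mergev.
Proof.
have x1 : w i1 x != 0.
  by rewrite w1 !ffunE eqxx (negPf xy) addr0 /GRing.scale /= mulr1.
split=> [i z|i|x' y'|].
- rewrite in_setD1 negb_and negbK => /orP[/eqP->|zD]; first exact: mergev_x.
  have zx : z != x by apply: contraNneq zD => ->.
  have zy : z != y by apply: contraNneq zD => ->.
  by rewrite mergev_z // (config_supp cw).
- rewrite -[RHS](config_sum cw (sval i)).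
  rewrite (bigD1 x) //= (bigD1 y) 1?eq_sym //= mergev_x mergev_y add0r.
  have -> : \sum_z w (sval i) z = w (sval i) x + (w (sval i) y +
      \sum_(z | (z != x) && (z != y)) w (sval i) z).
    by rewrite (bigD1 x) //= (bigD1 y) 1?eq_sym.
  rewrite addrA [w _ x + _]addrC; congr (_ + _).
  by apply: eq_bigr => z /andP[zx zy]; rewrite mergev_z.
- rewrite !in_setD1 => /andP[xx' x'D] /andP[xy' y'D] /(config_clique cw x'D y'D)[i [c c0 wi]].
  have ex : w i x = 0.
    by rewrite wi !ffunE eq_sym (negPf xx') eq_sym (negPf xy') addr0 /GRing.scale /= mulr0.
  have ii : i != i1 by apply: contraNneq x1 => <-; rewrite ex.
  by exists (exist _ i ii), c => //; rewrite /mergev /= ex scale0r addr0.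
move=> h; apply: (config_avoid cw); apply: has_minor_in_trans h.
apply: (@repr_minor F4 (vm w) (vm mergev) _ _ (w : vm w -> _) 0%VS mergev
  (fun i : vm mergev => sval i : vm w) [set (i1 : vm w)] \1%VF).
- exact: vm_repr.
- exact: vm_rk.
- exact: val_inj.
- by move=> i; rewrite inE; apply: (svalP i).
- move=> i; exists 1; rewrite ?oner_eq0 // scale1r id_lfunE add0v /mergev opprD addNKr.
  have -> : edgev x y = c1^-1 *: w i1 by rewrite w1 scalerA mulVf ?scale1r.
  by rewrite memvN !memvZ //; apply: (mem_sp (w : vm w -> _)); rewrite inE.
move=> u su; rewrite id_lfunE add0v /sp big_set1 => /vlineP[k uk].
pose ev (u : vec) : F4^o := u x.
have lev : linear ev by move=> c v v'; rewrite /ev !ffunE.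
pose eL := GRing.isLinear.Build F4 _ _ _ ev lev.
pose e : {linear vec -> F4^o} := HB.pack ev eL.
have /subvP/(_ _ su) : (sp mergev setT <= lker (linfun e))%VS.
  by apply: sp_sub => i _; rewrite memv_ker lfunE /= /ev mergev_x.
rewrite memv_ker lfunE /= /ev uk !ffunE => /eqP k0.
suff -> : k = 0 by rewrite scale0r.
by apply/eqP; move/eqP: k0; rewrite /GRing.scale /= mulf_eq0 (negPf x1) orbF.
Qed.

End Merge.
End Fixed.
End Config.

(** * Codes, tries and certificates for excluded patterns *)

Definition dig (n : BinNums.N) : g4 :=
  match BinNat.N.modulo n 4%num with
  | BinNums.N0 => g0
  | BinNums.Npos BinNums.xH => g1
  | BinNums.Npos (BinNums.xO BinNums.xH) => ga
  | _ => gb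
  end.

Fixpoint dec m (n : BinNums.N) : seq g4 :=
  if m is m'.+1 then dig n :: dec m' (BinNat.N.div n 4%num) else [::].

Definition gcode (x : g4) : BinNums.N :=
  match x with g0 => 0%num | g1 => 1%num | ga => 2%num | gb => 3%num end.

(* Base 4, least significant digit first, with a final digit 1 that records the length. *)
Fixpoint enc (l : seq g4) : BinNums.N :=
  if l is x :: s then BinNat.N.add (gcode x) (BinNat.N.mul 4%num (enc s)) else 1%num.

Inductive trie (A : Type) := TE | TN of option A & trie A & trie A.
Arguments TE {A}.

Fixpoint tfind A p (t : trie A) : option A :=
  if t is TN o l r then
    match p with
    | BinNums.xH => o
    | BinNums.xO p' => tfind p' l
    | BinNums.xI p' => tfind p' r
    end
  else None.

Fixpoint tadd A p (v : A) (t : trie A) : trie A :=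
  let: (o, l, r) := if t is TN o l r then (o, l, r) else (None, TE, TE) in
  match p with
  | BinNums.xH => TN (Some v) l r
  | BinNums.xO p' => TN o (tadd p' v l) r
  | BinNums.xI p' => TN o l (tadd p' v r)
  end.

Lemma tfind_TE A p : tfind p (@TE A) = None.
Proof. by case: p. Qed.

Lemma tadd_inv A (P : A -> Prop) p v (t : trie A) :
  (forall q x, tfind q t = Some x -> P x) -> P v ->
  forall q x, tfind q (tadd p v t) = Some x -> P x.
Proof.
elim: p t => [p IH|p IH|] t ht Pv q x.
- case: t ht => [|o l r] ht; case: q => [q|q|] /=; rewrite ?tfind_TE //.
  + by apply: IH => // q' x'; rewrite tfind_TE.
  + by apply: IH => // q' x' h; apply: (ht (BinNums.xI q')).
  + exact: (ht (BinNums.xO q)).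
  + exact: (ht BinNums.xH).
- case: t ht => [|o l r] ht; case: q => [q|q|] /=; rewrite ?tfind_TE //.
  + by apply: IH => // q' x'; rewrite tfind_TE.
  + exact: (ht (BinNums.xI q)).
  + by apply: IH => // q' x' h; apply: (ht (BinNums.xO q')).
  + exact: (ht BinNums.xH).
case: t ht => [|o l r] ht; case: q => [q|q|] /=; rewrite ?tfind_TE //; try by case=> <-.
- exact: (ht (BinNums.xI q)).
- exact: (ht (BinNums.xO q)).
Qed.

Definition gcol (q : seq (seq g4)) i : seq g4 := [seq nth g0 r i | r <- q].

Definition nzl (l : seq g4) : bool := hasf (fun x => if x is g0 then false else true) l.

(** Up to relabelling the vertices, a list of vectors is the multiset of its columns, one per
    vertex. Sorting gives a canonical form; vertices with a zero column are dropped. *)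
Definition scols k (q : seq (seq g4)) : seq (seq g4) :=
  sort (fun c c' => BinNat.N.leb (enc c) (enc c')) [seq c <- map (gcol q) (iota 0 k) | nzl c].

(** Only a hash: matches are confirmed by comparing the sorted columns. The base 4096 = 4^6 exceeds
    the code of a column of five entries, and at most five vectors are compared at a time. *)
Definition qkey (sc : seq (seq g4)) : BinNums.positive :=
  if foldl (fun acc c => BinNat.N.add (BinNat.N.mul acc 4096%num) (enc c)) 1%num sc
    is BinNums.Npos p then p else BinNums.xH.

Definition qmatch k (q q' : seq (seq g4)) (sc' : seq (seq g4)) : bool :=
  if scols k q == sc' then size q == size q' else false.

Definition mkedge m i j : seq g4 :=
  mkseq (fun k => if (k == i) || (k == j) then g1 else g0) m.

Definition edges m : seq (seq g4) := [seq mkedge m i j | i <- iota 0 m, j <- iota 0 i].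

(* Certificate that the clique and the vectors [e_rows] on [e_m] vertices have the matroid [e_T] of
   [targets] as a minor: [e_con] is contracted, [e_els] are the elements of the minor, [e_th] is a
   basis modulo [e_con], and [e_lam] is the family of functionals dual to [e_th ++ e_con]. *)
Record entry := Entry {
  e_m : nat; e_T : nat; e_rows : seq BinNums.N; e_els : seq BinNums.N;
  e_con : seq BinNums.N; e_th : seq BinNums.N; e_lam : seq BinNums.N }.

Definition rows_of (e : entry) := map (dec (e_m e)) (e_rows e).

Definition targets : seq (seq (seq g4)) := [:: F7c; V1c; P1c; P3c; Y9c; Papc].

(** Beyond the certificate itself, every vector it uses must be a listed row or an edge, as these
    are the vectors known to be present. *)
Definition entry_ok (e : entry) : bool :=
  let D := map (dec (e_m e)) in
  (e_T e < size targets) &&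
  (cert_ok (e_m e) (nth [::] targets (e_T e)) (D (e_els e)) (D (e_con e)) (D (e_th e))
    (D (e_lam e)) &&
  all (fun l => (l \in D (e_rows e)) || (l \in edges (e_m e))) (D (e_els e) ++ D (e_con e))).

Lemma perm_map_ex (S : eqType) (x0 : nat) (g : nat -> S) (s : seq S) (t : seq nat) :
  perm_eq s (map g t) -> exists2 t', perm_eq t' t & s = map g t'.
Proof.
move/(perm_iotaP (g x0)) => [Is pI ->]; exists (map (nth x0 t) Is).
  apply: perm_trans (perm_map _ pI) _; rewrite size_map map_nth_iota0 //.
  by rewrite take_size.
rewrite -map_comp; apply/eq_in_map=> i; rewrite (perm_mem pI) mem_iota size_map /= => lt.
by rewrite (nth_map x0).
Qed.

(** * Matching vectors with recorded patterns *)

Section Matching.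
Variables (F4 : finFieldType) (cardF4 : #|F4| = 4) (a : F4).
Hypothesis a_def : (a ^+ 2 = a + 1)%R.
Local Notation gval := (gval a).
Local Notation emb := (emb a).
Variables (V : finType) (D : {set V}) (I : finType) (w : I -> {ffun V -> F4^o}).
Hypothesis cw : config a D w.

Lemma emb_edge (xs : seq V) i j x0 : uniq xs -> j < i < size xs ->
  emb xs (mkedge (size xs) i j) = edgev F4 (nth x0 xs i) (nth x0 xs j).
Proof.
move=> U /andP[ji ilt]; have jlt := ltn_trans ji ilt.
apply/ffunP=> x; rewrite edgevE ffunE.
have [xin|xout] := boolP (x \in xs).
  rewrite nth_mkseq ?index_mem //.
  have ix k : k < size xs -> (index x xs == k) = (x == nth x0 xs k).
    move=> kl; apply/eqP/eqP=> [<-|->]; first by rewrite nth_index.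
    by rewrite index_uniq.
  rewrite !ix //; case: eqP => [->|_] /=; last by case: eqP; rewrite /= ?add0r ?addr0.
  by rewrite nth_uniq // gtn_eqF // addr0.
rewrite nth_default; last by rewrite size_mkseq leqNgt index_mem.
have nx k : k < size xs -> (x == nth x0 xs k) = false.
  by move=> kl; apply: contraNF xout => /eqP->; apply: mem_nth.
by rewrite !nx // addr0.
Qed.

Lemma targets_excl T : T < size targets -> forall M : matroid,
  has_minor M (crows a (nth [::] targets T)) ->
  has_minor_in (rank3_excluded a) M.
Proof.
move=> lt M; have In N : List.In N (rank3_excluded a) -> has_minor M N ->
    has_minor_in (rank3_excluded a) M by exists N.
case: T lt => [_ h|T lt].
  apply: (In F7); first by left.
  exact: minor_trans h (iso_minor (F7_iso cardF4 a_def)).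
case: T lt => [_ h|T lt].
  by apply: (In (V1 a) _ h); right; left.
case: T lt => [_ h|T lt].
  by apply: (In (P1 a) _ h); do 2 right; left.
case: T lt => [_ h|T lt].
  by apply: (In (P3 a) _ h); do 3 right; left.
case: T lt => [_ h|T lt].
  by apply: (In (Y9 a) _ h); do 4 right; left.
case: T lt => [_ h|T lt].
  apply: (In Pappus); first by do 5 right; left.
  exact: minor_trans h (iso_minor (Pappus_iso cardF4 a_def)).
by [].
Qed.

Definition Bad m (q : seq (seq g4)) : Prop := forall xs : seq V, uniq xs ->
  {subset xs <= D} -> size xs = m -> (forall r, r \in q -> has_vec w (emb xs r)) -> False.

Lemma entry_bad e : entry_ok e -> Bad (e_m e) (rows_of e).
Proof.
move=> /and3P[lt ck /allP hel] xs U sD szx hv; apply: (config_avoid cw).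
apply: (targets_excl lt); rewrite -{1}szx in ck.
apply: (cert_minor cardF4 a_def U ck) => l /hel /orP[lr|]; first exact: hv.
rewrite -szx => /allpairsPdep[i [j [+ + ->]]]; rewrite !mem_iota /= !add0n => il ji.
have x0 : V by case: (xs) il.
rewrite (emb_edge x0) ?ji //; apply: (config_clique cw); rewrite ?sD ?mem_nth //.
  exact: ltn_trans il.
by rewrite nth_uniq ?gtn_eqF //; apply: ltn_trans il.
Qed.

Lemma has_vecZ (c : F4) u : c != 0%R -> has_vec w (c *: u)%R -> has_vec w u.
Proof.
move=> c0 [i [k k0 wi]]; exists i, (k * c)%R; first by rewrite mulf_neq0.
by rewrite wi scalerA.
Qed.

Definition variant (rows : seq (seq g4)) (perm : seq nat) (sc : seq g4) : seq (seq g4) :=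
  [seq vscale (nth g1 sc i) (nth [::] rows (nth 0 perm i)) | i <- iota 0 (size rows)].

(** Neither the order of the vectors nor nonzero scalings affect [has_vec], so one certificate
    condemns all reordered and rescaled forms. Storing these forms reduces matching to a comparison
    of columns. *)
Lemma bad_variant m rows perm sc : Bad m rows -> perm_eq perm (iota 0 (size rows)) ->
  all (fun c => c != g0) sc -> Bad m (variant rows perm sc).
Proof.
move=> bad pp /allP usc xs U sD szx hv; apply: (bad xs U sD szx) => r rr.
have lt : index r rows < size rows by rewrite index_mem.
have szp : size perm = size rows by rewrite (perm_size pp) size_iota.
have ip : index r rows \in perm by rewrite (perm_mem pp) mem_iota.
pose i := index (index r rows) perm.
have ilt : i < size rows by rewrite -szp index_mem.
apply: (@has_vecZ (gval (nth g1 sc i))).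
  rewrite (gval_eq0 a_def); have [isz|isz] := ltnP i (size sc); first exact/usc/mem_nth.
  by rewrite nth_default.
rewrite -(embZ cardF4 a_def); apply: hv; apply/mapP; exists i; first by rewrite mem_iota.
by rewrite nth_index // nth_index.
Qed.

Lemma nzlE l : nzl l = has (fun x => x != g0) l.
Proof. by rewrite /nzl hasfE; apply: eq_has => -[]. Qed.

(** Equal sorted columns yield an injection [f] from the vertices of [q'] to positions of [q] that
    carries one list of vectors to the other. The positions outside its image have zero columns, so
    the embedded vectors agree everywhere. *)
Lemma match_bad m q' sc' k q xs : Bad m q' -> all (fun r => size r == m) q' ->
  perm_eq sc' (map (gcol q') (iota 0 m)) -> qmatch k q q' sc' ->
  uniq xs -> {subset xs <= D} -> size xs = k ->
  (forall r, r \in q -> size r <= k /\ has_vec w (emb xs r)) -> False.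
Proof.
move=> bad /allP sq' psc' + U sD szx hq; rewrite /qmatch; case: eqP => // esc /eqP szq.
pose js := [seq i <- iota 0 k | nzl (gcol q i)].
have : perm_eq (map (gcol q') (iota 0 m)) (map (gcol q) js).
  rewrite perm_sym; apply: perm_trans psc'; rewrite -esc perm_sym /scols.
  by rewrite perm_sort filter_map.
case/(perm_map_ex 0) => f pf ef.
have szf : size f = m by have := congr1 size ef; rewrite !size_map size_iota.
have Uf : uniq f by rewrite (perm_uniq pf) filter_uniq ?iota_uniq.
have fk i : i \in f -> i < k by rewrite (perm_mem pf) mem_filter mem_iota => /andP[].
case Dxs : xs => [|x0 xs0].
  have k0 : k = 0 by rewrite -szx Dxs.
  have f0 : f = [::] by case: (f) fk => // i f' /(_ i (mem_head _ _)); rewrite k0.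
  apply: (bad [::]) => //; first by rewrite -szf f0.
  move=> r rq'; have rq : nth [::] q (index r q') \in q by rewrite mem_nth // szq index_mem.
  have [szr] := hq _ rq; rewrite k0 leqn0 size_eq0 in szr; rewrite (eqP szr) Dxs.
  have := sq' r rq'; rewrite -szf f0 size_eq0 => /eqP->.
  by rewrite !emb_nil.
pose xs' := map (nth x0 xs) f.
apply: (bad xs').
- rewrite map_inj_in_uniq // => i j /fk fi /fk fj /eqP; rewrite nth_uniq ?szx //.
  by move/eqP.
- by move=> x /mapP[i /fk fi ->]; apply/sD/mem_nth; rewrite szx.
- by rewrite size_map.
move=> r rq'; pose t := index r q'.
have tlt : t < size q' by rewrite index_mem.
have rq : nth [::] q t \in q by rewrite mem_nth ?szq.
have [szr hv] := hq _ rq; suff -> : emb xs' r = emb xs (nth [::] q t) by [].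
have colE p : p < m -> nth g0 r p = nth g0 (nth [::] q t) (nth 0 f p).
  move=> pm; have := congr1 (fun s => nth [::] s p) ef.
  rewrite (nth_map 0) ?size_iota // nth_iota // add0n (nth_map 0) ?szf //.
  move/(congr1 (fun s => nth g0 s t)); rewrite !(nth_map [::]) ?szq //.
  by rewrite nth_index.
apply/ffunP=> x; rewrite !ffunE; congr (gval _).
have [xx'|xx'] := boolP (x \in xs').
  have ix : index x xs' < m by rewrite -szf -(size_map (nth x0 xs) f) index_mem.
  rewrite colE //; congr (nth g0 _ _).
  have := nth_index x0 xx'; rewrite (nth_map 0) ?szf // => e.
  by rewrite -{2}e index_uniq // szx fk // mem_nth // szf.
have szx' : size xs' = m by rewrite size_map.
have -> : nth g0 r (index x xs') = g0.
  by rewrite nth_default // (eqP (sq' r rq')) -szx' leqNgt index_mem.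
have [xx|xx] := boolP (x \in xs); last first.
  by rewrite nth_default // (leq_trans szr) // -szx leqNgt index_mem.
have ilt : index x xs < k by rewrite -szx index_mem.
have nj : index x xs \notin js.
  rewrite -(perm_mem pf); apply: contra xx' => h; apply/mapP; exists (index x xs) => //.
  by rewrite nth_index.
move: nj; rewrite mem_filter mem_iota /= ilt andbT nzlE => /hasPn h.
apply/esym/eqP; have := h (nth g0 (nth [::] q t) (index x xs)); rewrite negbK; apply.
by apply/mapP; exists (nth [::] q t).
Qed.

End Matching.

(** * The search for non-graphic vectors *)

(* [Nd i pi ch]: all vectors found so far belong to family [i] placed on the vertices [pi];
   [ch] lists, by their codes [enc], the vectors outside that family that lead to a new node. *)
Inductive tree := Nd of nat & seq nat & seq (BinNums.N * tree).

(* [zpoly]: coefficients in an indeterminate [t], constant term first.  A family on [f_m] core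
   vertices consists of the vectors [f_N] on the core and of the vectors that have one entry 1
   outside the core and a part in [f_S] on it.  The core parts over GF(4) are codes for [dec]; each
   one comes with its lift, and the lift of an outer entry 1 is the extra polynomial in [f_S],
   the lifted core part being negated. *)
Definition zpoly := seq BinNums.Z.

Record fam := Fam {
  f_m : nat;
  f_N : seq (BinNums.N * seq zpoly);
  f_S : seq (BinNums.N * zpoly * seq zpoly) }.

Local Open Scope Z_scope.
(** Seventeen families with vectors beyond the edges, then the graphic one with empty core. The
    entries of each lift add up to 0, and putting the generator of GF(4) for [t] returns the
    original vector up to a scalar. *)
Definition families : seq fam := [::
  Fam 2 [::]
    [:: (14%num, [:: 1], [:: [:: 0; (-1)]; [:: 1; 1]]); (11%num, [:: 1; (-1)], [:: [:: 0; (-1)];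
      [:: 1]])];
  Fam 3 [:: (57%num, [:: [:: 1]; [:: 0; 1]; [:: (-1); (-1)]]); (45%num, [:: [:: (-1); 1]; [:: 0;
      (-1)]; [:: 1]])]
    [:: (14%num, [:: (-1); (-1)], [:: [:: (-1)]; [:: 0; (-1)]; [::]]); (55%num, [:: 0; (-1)], [::
      [:: (-1)]; [:: 0; (-1)]; [:: 1]])];
  Fam 3 [:: (57%num, [:: [:: (-1); 1]; [:: 1]; [:: 0; (-1)]]); (45%num, [:: [:: 0; 1]; [:: 1]; [::
      (-1); (-1)]])]
    [:: (38%num, [:: (-1)], [:: [:: 0; (-1)]; [:: (-1)]; [:: 0; 1]]); (11%num, [:: (-1); (-1)],
      [:: [:: 0; (-1)]; [:: (-1)]; [::]])];
  Fam 3 [:: (57%num, [:: [:: (-1); 1]; [:: 1]; [:: 0; (-1)]]); (45%num, [:: [:: (-1); 0; 1]; [::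
      1]; [:: 0; 0; (-1)]])]
    [:: (14%num, [:: 0; (-1)], [:: [:: 1; (-1)]; [:: (-1)]; [::]]); (35%num, [:: 1], [:: [:: 1;
      (-1)]; [::]; [:: 0; 1]])];
  Fam 3 [:: (57%num, [:: [:: (-1); 1]; [:: 1]; [:: 0; (-1)]]); (45%num, [:: [:: (-1); 1]; [:: 0;
      (-1)]; [:: 1]])]
    [:: (50%num, [:: 0; (-1)], [:: [:: 1; (-1)]; [::]; [:: (-1)]]); (14%num, [:: 0; (-1)], [:: [::
      1; (-1)]; [:: (-1)]; [::]])];
  Fam 3 [:: (57%num, [:: [:: (-1); 1]; [:: 1]; [:: 0; (-1)]]); (45%num, [:: [:: (-1); 1]; [:: 0;
      (-1)]; [:: 1]])]
    [:: (35%num, [:: 1], [:: [:: 1; (-1)]; [::]; [:: 0; 1]]); (11%num, [:: 1], [:: [:: 1; (-1)];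
      [:: 0; 1]; [::]])];
  Fam 4 [:: (165%num, [:: [:: 1]; [:: (-1)]; [:: 0; 1]; [:: 0; (-1)]]); (57%num, [:: [:: (-1); 1];
      [:: 1]; [:: 0; (-1)]; [::]]); (141%num, [:: [:: 1]; [:: (-1); 1]; [::]; [:: 0; (-1)]])]
    [::];
  Fam 4 [:: (245%num, [:: [:: 1]; [:: (-1)]; [:: 1; (-1)]; [:: (-1); 1]]); (201%num, [:: [:: 1];
      [:: 0; (-1)]; [::]; [:: (-1); 1]]); (45%num, [:: [:: 0; 1]; [:: (-1)]; [:: 1; (-1)]; [::]])]
    [::];
  Fam 4 [:: (165%num, [:: [:: (-1); 1]; [:: 1; (-1)]; [:: (-1)]; [:: 1]]); (245%num, [:: [:: 0;
      1]; [:: 0; (-1)]; [:: (-1)]; [:: 1]]); (57%num, [:: [:: 0; 1]; [:: 1; (-1)]; [:: (-1)];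
      [::]])]
    [::];
  Fam 4 [:: (180%num, [:: [::]; [:: 0; 1]; [:: 1]; [:: (-1); (-1)]]); (225%num, [:: [:: 0; 1];
      [::]; [:: 1; (-1)]; [:: (-1)]]); (57%num, [:: [:: 1; 1]; [:: (-1)]; [:: 0; (-1)]; [::]]);
      (141%num, [:: [:: 1]; [:: (-1); 1]; [::]; [:: 0; (-1)]])]
    [::];
  Fam 4 [:: (165%num, [:: [:: 1]; [:: (-1)]; [:: 0; 1]; [:: 0; (-1)]]); (245%num, [:: [:: 0; 1];
      [:: 0; (-1)]; [:: 1]; [:: (-1)]]); (153%num, [:: [:: 1]; [:: 0; 1]; [:: (-1)]; [:: 0;
      (-1)]]); (221%num, [:: [:: 0; 1]; [:: 1]; [:: 0; (-1)]; [:: (-1)]])]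
    [::];
  Fam 4 [:: (225%num, [:: [:: (-1); 1]; [::]; [:: 1]; [:: 0; (-1)]]); (201%num, [:: [:: (-1); 1];
      [:: 1]; [::]; [:: 0; (-1)]]); (57%num, [:: [:: (-1); 1]; [:: 1]; [:: 0; (-1)]; [::]]);
      (45%num, [:: [:: (-1); 1]; [:: 0; (-1)]; [:: 1]; [::]])]
    [:: (131%num, [:: 1], [:: [:: 1; (-1)]; [::]; [::]; [:: 0; 1]])];
  Fam 4 [:: (177%num, [:: [:: (-1); 1]; [::]; [:: 0; (-1)]; [:: 1]]); (57%num, [:: [:: (-1); 1];
      [:: 1]; [:: 0; (-1)]; [::]]); (141%num, [:: [:: (-1); 1]; [:: 0; (-1)]; [::]; [:: 1]]);
      (45%num, [:: [:: (-1); 1]; [:: 0; (-1)]; [:: 1]; [::]])]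
    [:: (194%num, [:: 0; (-1)], [:: [:: 1; (-1)]; [::]; [::]; [:: (-1)]])];
  Fam 4 [:: (201%num, [:: [:: 1]; [:: 0; 1]; [::]; [:: (-1); (-1)]]); (153%num, [:: [:: 1]; [:: 0;
      1]; [:: (-1)]; [:: 0; (-1)]]); (105%num, [:: [:: 1]; [:: 0; 1]; [:: 0; (-1)]; [:: (-1)]]);
      (57%num, [:: [:: 1]; [:: 0; 1]; [:: (-1); (-1)]; [::]])]
    [:: (14%num, [:: (-1); (-1)], [:: [:: (-1)]; [:: 0; (-1)]; [::]; [::]])];
  Fam 5 [:: (612%num, [:: [::]; [:: 1]; [:: 0; 1]; [:: (-1)]; [:: 0; (-1)]]); (897%num, [:: [:: 1;
      1]; [::]; [::]; [:: (-1)]; [:: 0; (-1)]]); (57%num, [:: [:: 1; 1]; [:: (-1)]; [:: 0; (-1)];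
      [::]; [::]])]
    [::];
  Fam 5 [:: (897%num, [:: [:: (-1); 1]; [::]; [::]; [:: 1]; [:: 0; (-1)]]); (705%num, [:: [::
      (-1); 1]; [::]; [::]; [:: 0; (-1)]; [:: 1]]); (57%num, [:: [:: (-1); 1]; [:: 1]; [:: 0;
      (-1)]; [::]; [::]]); (45%num, [:: [:: (-1); 1]; [:: 0; (-1)]; [:: 1]; [::]; [::]])]
    [::];
  Fam 5 [:: (705%num, [:: [:: (-1); 1]; [::]; [::]; [:: 0; (-1)]; [:: 1]]); (201%num, [:: [::
      (-1); 1]; [:: 1]; [::]; [:: 0; (-1)]; [::]]); (57%num, [:: [:: (-1); 1]; [:: 1]; [:: 0;
      (-1)]; [::]; [::]]); (525%num, [:: [:: (-1); 1]; [:: 0; (-1)]; [::]; [::]; [:: 1]]);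
      (45%num, [:: [:: (-1); 1]; [:: 0; (-1)]; [:: 1]; [::]; [::]])]
    [::];
  Fam 0 [::] [::]].
Local Close Scope Z_scope.

Definition table : seq entry := [::
  Entry 4 0 ([:: 85])%num
    ([:: 5; 17; 65; 20; 80; 85; 68])%num ([::])%num
    ([:: 5; 17; 65])%num
    ([:: 4; 16; 64])%num;
  Entry 5 0 ([:: 917])%num
    ([:: 5; 17; 257; 20; 272; 917; 260])%num ([:: 320])%num
    ([:: 5; 17; 65])%num
    ([:: 4; 16; 320; 256])%num;
  Entry 8 0 ([:: 42240; 165])%num
    ([:: 20480; 320; 4352; 165; 4160; 16448; 16640])%num ([:: 17; 257; 1028; 42240])%num
    ([:: 5; 130; 8194])%num
    ([:: 50180; 192; 61440; 16; 49408; 50176; 49152])%num;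
  Entry 7 0 ([:: 14592; 165])%num
    ([:: 5120; 272; 320; 4112; 80; 165; 4160])%num ([:: 257; 1028; 14592])%num
    ([:: 5; 34; 130])%num
    ([:: 13316; 48; 192; 8448; 13312; 8192])%num;
  Entry 7 2 ([:: 10560; 8229])%num
    ([:: 4160; 260; 1028; 5120; 1088; 4352; 68; 8229; 4100])%num ([:: 17; 65; 10560])%num
    ([:: 3840; 3588; 3585])%num
    ([:: 3328; 4; 9476; 16; 12352; 12288])%num;
  Entry 7 2 ([:: 15680; 8229])%num
    ([:: 4160; 272; 1040; 80; 4112; 8229; 5120; 4352; 1088])%num ([:: 17; 68; 15680])%num
    ([:: 2817; 2560; 2820])%num
    ([:: 5444; 2304; 8260; 16; 8256; 8192])%num;
  Entry 6 2 ([:: 3648; 2085])%num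
    ([:: 1280; 20; 2085; 68; 260; 1028; 80; 272; 1040])%num ([:: 65; 3648])%num
    ([:: 519; 531; 514])%num
    ([:: 4; 16; 2836; 2112; 2048])%num;
  Entry 7 2 ([:: 15680; 12341])%num
    ([:: 4160; 260; 1028; 68; 4100; 12341; 5120; 4352; 1088])%num ([:: 17; 65; 15680])%num
    ([:: 2820; 2560; 2817])%num
    ([:: 4; 2304; 13572; 16; 8256; 8192])%num;
  Entry 6 0 ([:: 3648; 3125])%num
    ([:: 5; 257; 1280; 260; 1025; 1028; 3125])%num ([:: 80; 3648])%num
    ([:: 5; 257; 544])%num
    ([:: 4; 1360; 1264; 2112; 2048])%num;
  Entry 6 0 ([:: 2640; 2565])%num
    ([:: 260; 272; 320; 20; 1280; 2565; 68])%num ([:: 257; 2640])%num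
    ([:: 5; 17; 65])%num
    ([:: 4; 3088; 3136; 1280; 3072])%num;
  Entry 6 0 ([:: 2640; 3845])%num
    ([:: 1280; 68; 260; 3845; 320; 1088; 1028])%num ([:: 17; 2640])%num
    ([:: 130; 204; 780])%num
    ([:: 1996; 2568; 2560; 3088; 3072])%num;
  Entry 6 0 ([:: 3920; 3845])%num
    ([:: 260; 272; 320; 20; 1280; 3845; 68])%num ([:: 257; 3920])%num
    ([:: 5; 17; 65])%num
    ([:: 4; 2064; 2112; 1280; 2048])%num;
  Entry 6 2 ([:: 2640; 2181])%num
    ([:: 320; 20; 1028; 1280; 1088; 272; 68; 2181; 260])%num ([:: 17; 2640])%num
    ([:: 897; 900; 960])%num
    ([:: 2372; 4; 832; 3088; 3072])%num;
  Entry 6 4 ([:: 2640; 3269])%num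
    ([:: 1280; 272; 68; 1088; 20; 3269; 1028; 1040; 260])%num ([:: 17; 2640])%num
    ([:: 65; 771; 68])%num
    ([:: 3140; 2560; 4; 3088; 3072])%num;
  Entry 5 0 ([:: 912; 645])%num
    ([:: 5; 17; 320; 20; 257; 260; 645])%num ([:: 912])%num
    ([:: 5; 17; 240])%num
    ([:: 4; 336; 384; 512])%num;
  Entry 5 0 ([:: 912; 965])%num
    ([:: 5; 17; 65; 20; 320; 965; 68])%num ([:: 912])%num
    ([:: 5; 17; 65])%num
    ([:: 4; 528; 832; 512])%num;
  Entry 6 2 ([:: 3648; 57])%num
    ([:: 65; 272; 1028; 20; 80; 68; 257; 1280; 1025])%num ([:: 3648; 57])%num
    ([:: 198; 705; 195])%num
    ([:: 52; 2816; 1972; 2048; 32])%num;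
  Entry 6 2 ([:: 2640; 2121])%num
    ([:: 272; 65; 1025; 1280; 1040; 320; 17; 2121; 257])%num ([:: 20; 2640])%num
    ([:: 840; 777; 780])%num
    ([:: 3136; 1364; 788; 3088; 3072])%num;
  Entry 6 2 ([:: 3920; 2121])%num
    ([:: 1088; 20; 260; 68; 1028; 2121; 1280; 1040; 320])%num ([:: 5; 3920])%num
    ([:: 561; 544; 624])%num
    ([:: 1360; 528; 2112; 4; 2048])%num;
  Entry 5 2 ([:: 912; 393])%num
    ([:: 320; 5; 393; 17; 65; 257; 20; 68; 260])%num ([:: 912])%num
    ([:: 177; 180; 160])%num
    ([:: 340; 4; 912; 512])%num;
  Entry 5 0 ([:: 660; 977])%num
    ([:: 5; 320; 65; 977; 257; 260; 68])%num ([:: 660])%num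
    ([:: 15; 40; 195])%num
    ([:: 40; 560; 640; 768])%num;
  Entry 5 4 ([:: 660; 609])%num
    ([:: 320; 80; 5; 260; 17; 609; 257; 272; 65])%num ([:: 660])%num
    ([:: 40; 80; 10])%num
    ([:: 496; 320; 1020; 768])%num;
  Entry 5 2 ([:: 980; 609])%num
    ([:: 260; 17; 65; 5; 257; 609; 320; 272; 68])%num ([:: 980])%num
    ([:: 177; 160; 180])%num
    ([:: 340; 144; 516; 512])%num;
  Entry 5 4 ([:: 980; 881])%num
    ([:: 320; 68; 257; 272; 65; 881; 17; 80; 5])%num ([:: 980])%num
    ([:: 40; 204; 105])%num
    ([:: 100; 40; 340; 512])%num;
  Entry 7 2 ([:: 14592; 12432; 12297])%num
    ([:: 4160; 257; 1025; 1088; 1040; 320; 17; 12297; 65])%num ([:: 20; 14592; 12432])%num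
    ([:: 456; 201; 204])%num
    ([:: 3328; 5460; 212; 11280; 3072; 11264])%num;
  Entry 6 2 ([:: 3648; 2832; 3081])%num
    ([:: 1280; 5; 3081; 17; 257; 65; 20; 260; 68])%num ([:: 3648; 2832])%num
    ([:: 225; 228; 240])%num
    ([:: 1364; 4; 720; 3584; 2816])%num;
  Entry 6 2 ([:: 3648; 3108; 801])%num
    ([:: 260; 80; 3108; 68; 1028; 1280; 20; 801; 272])%num ([:: 5; 3648])%num
    ([:: 834; 786; 771])%num
    ([:: 2112; 16; 3664; 4; 2048])%num;
  Entry 6 0 ([:: 3648; 3108; 1841])%num
    ([:: 80; 320; 1088; 272; 3648; 1841; 3108])%num ([:: 5; 65])%num
    ([:: 17; 257; 2050])%num
    ([:: 16; 256; 3072; 4; 64])%num;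
  Entry 6 0 ([:: 3648; 2340; 561])%num
    ([:: 80; 320; 1088; 561; 3648; 2340; 1040])%num ([:: 5; 65])%num
    ([:: 17; 771; 1025])%num
    ([:: 16; 512; 1024; 4; 64])%num;
  Entry 6 0 ([:: 3648; 804; 2097])%num
    ([:: 20; 68; 260; 80; 1028; 2097; 804])%num ([:: 5; 3648])%num
    ([:: 17; 65; 514])%num
    ([:: 16; 2112; 2816; 4; 2048])%num;
  Entry 5 0 ([:: 912; 900; 297])%num
    ([:: 68; 80; 320; 20; 912; 297; 900])%num ([:: 65])%num
    ([:: 5; 17; 771])%num
    ([:: 4; 16; 512; 64])%num;
  Entry 5 2 ([:: 912; 900; 57])%num
    ([:: 68; 257; 912; 20; 65; 80; 260; 320; 900])%num ([:: 57])%num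
    ([:: 141; 396; 136])%num
    ([:: 372; 256; 180; 32])%num;
  Entry 5 0 ([:: 912; 708; 57])%num
    ([:: 65; 257; 260; 320; 272; 708; 912])%num ([:: 57])%num
    ([:: 195; 771; 260])%num
    ([:: 128; 536; 52; 32])%num;
  Entry 5 2 ([:: 912; 660; 777])%num
    ([:: 272; 68; 660; 20; 777; 260; 80; 912; 320])%num ([:: 17])%num
    ([:: 774; 834; 771])%num
    ([:: 4; 64; 580; 16])%num;
  Entry 5 0 ([:: 912; 660; 201])%num
    ([:: 260; 272; 320; 20; 912; 660; 201])%num ([:: 257])%num
    ([:: 5; 17; 130])%num
    ([:: 4; 16; 192; 256])%num;
  Entry 5 0 ([:: 912; 900; 125])%num
    ([:: 260; 272; 320; 20; 912; 125; 900])%num ([:: 257])%num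
    ([:: 5; 17; 130])%num
    ([:: 4; 16; 192; 256])%num;
  Entry 5 0 ([:: 912; 980; 525])%num
    ([:: 68; 80; 320; 20; 912; 980; 525])%num ([:: 65])%num
    ([:: 5; 17; 771])%num
    ([:: 4; 16; 512; 64])%num;
  Entry 5 2 ([:: 912; 980; 141])%num
    ([:: 80; 260; 980; 272; 320; 912; 20; 68; 141])%num ([:: 17])%num
    ([:: 387; 135; 130])%num
    ([:: 256; 4; 452; 16])%num;
  Entry 5 0 ([:: 660; 657; 645])%num
    ([:: 68; 80; 320; 20; 657; 660; 645])%num ([:: 65])%num
    ([:: 5; 17; 514])%num
    ([:: 4; 16; 768; 64])%num;
  Entry 5 0 ([:: 980; 977; 965])%num
    ([:: 68; 80; 320; 20; 977; 980; 965])%num ([:: 65])%num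
    ([:: 5; 17; 771])%num
    ([:: 4; 16; 512; 64])%num;
  Entry 4 0 ([:: 228; 225; 165])%num
    ([:: 5; 65; 80; 68; 225; 228; 165])%num ([::])%num
    ([:: 5; 65; 160])%num
    ([:: 4; 80; 48])%num;
  Entry 4 0 ([:: 228; 225; 245])%num
    ([:: 5; 17; 80; 20; 225; 228; 245])%num ([::])%num
    ([:: 5; 17; 240])%num
    ([:: 4; 80; 128])%num;
  Entry 4 2 ([:: 228; 225; 105])%num
    ([:: 80; 5; 105; 17; 65; 225; 20; 68; 228])%num ([::])%num
    ([:: 177; 180; 160])%num
    ([:: 84; 4; 144])%num;
  Entry 4 4 ([:: 228; 165; 153])%num
    ([:: 20; 80; 17; 68; 5; 65; 153; 228; 165])%num ([::])%num
    ([:: 60; 240; 51])%num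
    ([:: 8; 128; 168])%num;
  Entry 4 3 ([:: 228; 245; 153])%num
    ([:: 20; 65; 245; 153; 68; 80; 228; 5; 17])%num ([::])%num
    ([:: 108; 45; 40])%num
    ([:: 64; 84; 36])%num;
  Entry 4 4 ([:: 228; 245; 221])%num
    ([:: 80; 228; 65; 68; 17; 221; 5; 20; 245])%num ([::])%num
    ([:: 80; 156; 65])%num
    ([:: 24; 8; 84])%num;
  Entry 4 1 ([:: 165; 153; 105])%num
    ([:: 165; 20; 5; 153; 17; 65; 68; 105; 80])%num ([::])%num
    ([:: 95; 40; 10])%num
    ([:: 64; 240; 124])%num;
  Entry 4 1 ([:: 245; 153; 105])%num
    ([:: 5; 17; 245; 20; 105; 153; 65; 68; 80])%num ([::])%num
    ([:: 15; 51; 90])%num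
    ([:: 200; 160; 64])%num;
  Entry 5 2 ([:: 912; 720; 900; 777])%num
    ([:: 320; 17; 20; 65; 68; 900; 80; 912; 720])%num ([:: 777])%num
    ([:: 15; 30; 78])%num
    ([:: 344; 16; 64; 512])%num;
  Entry 5 2 ([:: 912; 720; 900; 141])%num
    ([:: 320; 17; 20; 272; 720; 912; 257; 900; 260])%num ([:: 141])%num
    ([:: 27; 10; 267])%num
    ([:: 16; 348; 256; 192])%num;
  Entry 5 2 ([:: 912; 900; 804; 705])%num
    ([:: 320; 20; 804; 5; 68; 900; 17; 80; 912])%num ([:: 705])%num
    ([:: 135; 147; 130])%num
    ([:: 4; 16; 468; 768])%num;
  Entry 5 2 ([:: 912; 900; 228; 705])%num
    ([:: 320; 20; 228; 5; 900; 260; 17; 912; 272])%num ([:: 705])%num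
    ([:: 68; 80; 65])%num
    ([:: 4; 16; 596; 768])%num;
  Entry 5 2 ([:: 912; 708; 801; 777])%num
    ([:: 320; 5; 777; 17; 801; 65; 20; 708; 68])%num ([:: 912])%num
    ([:: 225; 228; 240])%num
    ([:: 340; 4; 208; 512])%num;
  Entry 5 2 ([:: 912; 708; 177; 201])%num
    ([:: 320; 5; 201; 17; 257; 177; 20; 260; 708])%num ([:: 912])%num
    ([:: 65; 68; 80])%num
    ([:: 340; 4; 528; 512])%num;
  Entry 4 0 ([:: 228; 180; 165; 245])%num
    ([:: 17; 65; 228; 80; 165; 180; 245])%num ([::])%num
    ([:: 17; 65; 228])%num
    ([:: 24; 76; 4])%num;
  Entry 4 5 ([:: 228; 177; 165; 245])%num
    ([:: 5; 20; 17; 228; 65; 165; 68; 245; 177])%num ([::])%num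
    ([:: 120; 60; 15])%num
    ([:: 64; 96; 168])%num;
  Entry 4 4 ([:: 228; 177; 165; 201])%num
    ([:: 17; 177; 201; 65; 165; 228; 5; 80; 20])%num ([::])%num
    ([:: 34; 99; 135])%num
    ([:: 120; 72; 4])%num;
  Entry 4 4 ([:: 228; 177; 245; 201])%num
    ([:: 68; 80; 177; 228; 245; 17; 201; 20; 5])%num ([::])%num
    ([:: 204; 80; 99])%num
    ([:: 8; 236; 168])%num;
  Entry 4 2 ([:: 228; 225; 201; 57])%num
    ([:: 17; 228; 201; 65; 80; 225; 57; 20; 5])%num ([::])%num
    ([:: 99; 27; 34])%num
    ([:: 64; 12; 120])%num;
  Entry 4 0 ([:: 228; 177; 201; 57])%num
    ([:: 65; 68; 80; 201; 228; 57; 177])%num ([::])%num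
    ([:: 195; 68; 160])%num
    ([:: 168; 4; 48])%num;
  Entry 4 4 ([:: 228; 177; 153; 221])%num
    ([:: 153; 221; 228; 68; 5; 65; 20; 17; 177])%num ([::])%num
    ([:: 153; 221; 156])%num
    ([:: 52; 96; 68])%num;
  Entry 4 4 ([:: 228; 177; 105; 125])%num
    ([:: 20; 65; 17; 105; 5; 177; 228; 125; 68])%num ([::])%num
    ([:: 60; 130; 51])%num
    ([:: 8; 192; 40])%num;
  Entry 4 2 ([:: 228; 180; 225; 177; 201])%num
    ([:: 80; 5; 201; 17; 225; 177; 20; 228; 180])%num ([::])%num
    ([:: 65; 68; 80])%num
    ([:: 84; 4; 16])%num].

(* Reorderings (base 8 digits) and rescalings (base 4 digits) of the rows of each table entry. *)
Definition variants : seq (BinNums.N * seq (BinNums.N * BinNums.N)) := [::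
  (2, [:: (8, 5); (8, 7)]);
  (3, [:: (8, 5); (1, 5); (1, 7)]);
  (4, [:: (8, 5); (8, 7)]);
  (5, [:: (8, 5); (8, 6); (1, 9); (1, 11)]);
  (6, [:: (8, 5); (8, 6); (8, 14); (8, 7); (1, 5); (1, 9); (1, 13); (1, 7); (1, 11); (1, 15)]);
  (7, [:: (8, 9); (8, 10)]);
  (8, [:: (8, 9); (8, 6); (8, 10); (8, 11); (1, 5); (1, 9); (1, 13); (1, 6); (1, 10); (1, 14)]);
  (9, [:: (8, 5); (8, 7); (8, 15)]);
  (10, [:: (8, 9); (8, 7); (8, 11); (1, 5); (1, 6); (1, 14)]);
  (11, [:: (8, 9); (8, 6); (8, 10)]);
  (12, [:: (8, 5); (8, 13); (8, 7); (8, 15); (1, 5); (1, 7); (1, 15)]);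
  (13, [:: (8, 5); (8, 9); (8, 7); (8, 11); (1, 5); (1, 6); (1, 14)]);
  (14, [:: (8, 5); (8, 6); (8, 14); (8, 7); (8, 15); (1, 5); (1, 9); (1, 13); (1, 7); (1, 11); (1,
   15)]);
  (15, [:: (8, 9); (8, 6); (8, 10); (8, 7); (8, 11); (1, 5); (1, 9); (1, 13); (1, 6); (1, 10); (1,
   14)]);
  (16, [:: (8, 5)]);
  (17, [:: (8, 5); (8, 13); (8, 7); (8, 15)]);
  (18, [:: (8, 5); (8, 13); (8, 6); (8, 14)]);
  (19, [:: (8, 5); (8, 6); (8, 14); (8, 7); (8, 15); (1, 5); (1, 9); (1, 13); (1, 7); (1, 11); (1,
   15)]);
  (20, [:: (8, 5); (8, 9); (8, 7); (8, 11); (1, 5); (1, 6); (1, 14)]);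
  (21, [:: (8, 5); (8, 13); (8, 7); (8, 15)]);
  (22, [:: (8, 5); (8, 13); (8, 6); (8, 14); (1, 5); (1, 9); (1, 7); (1, 11)]);
  (23, [:: (8, 5); (8, 9); (8, 6); (8, 10)]);
  (24, [:: (136, 37); (136, 25); (136, 41); (136, 57); (136, 45); (136, 22); (136, 38); (136, 54);
   (136, 26); (136, 42); (136, 58); (136, 30); (136, 46); (136, 62); (136, 39); (136, 27); (136,
   43); (136, 59); (136, 47)]);
  (25, [:: (136, 37); (136, 29); (136, 45); (136, 61); (136, 22); (136, 38); (136, 54); (136, 30);
   (136, 46); (136, 62); (136, 39); (136, 27); (136, 43); (136, 59); (80, 53); (80, 25); (80, 57);
   (80, 61); (80, 22); (80, 54); (80, 26); (80, 58); (80, 30); (80, 62); (80, 39); (80, 27); (80,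
   43); (80, 47); (129, 37); (129, 25); (129, 41); (129, 57); (129, 45); (129, 30); (129, 46); (129,
   62); (129, 23); (129, 39); (129, 55); (129, 27); (129, 43); (129, 59); (17, 37); (17, 25); (17,
   41); (17, 57); (17, 45); (17, 54); (17, 26); (17, 58); (17, 62); (17, 23); (17, 39); (17, 27);
   (17, 43); (17, 31); (17, 47); (66, 37); (66, 53); (66, 25); (66, 57); (66, 29); (66, 45); (66,
   22); (66, 54); (66, 26); (66, 58); (66, 30); (66, 46); (66, 39); (66, 55); (66, 27); (66, 59);
   (66, 31); (66, 47); (10, 37); (10, 53); (10, 25); (10, 57); (10, 29); (10, 45); (10, 22); (10,
   38); (10, 54); (10, 26); (10, 58); (10, 30); (10, 46); (10, 39); (10, 55); (10, 27); (10, 59);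
   (10, 31); (10, 47)]);
  (26, [:: (136, 53); (136, 29); (136, 61); (136, 54); (136, 26); (136, 42); (136, 58); (136, 30);
   (136, 62); (136, 39); (136, 55); (136, 43); (136, 31); (136, 47); (136, 63); (80, 53); (80, 29);
   (80, 61); (80, 38); (80, 54); (80, 42); (80, 30); (80, 46); (80, 62); (80, 55); (80, 27); (80,
   43); (80, 59); (80, 31); (80, 63); (129, 37); (129, 29); (129, 45); (129, 61); (129, 38); (129,
   26); (129, 42); (129, 58); (129, 30); (129, 46); (129, 39); (129, 55); (129, 59); (129, 31);
   (129, 47); (129, 63); (17, 53); (17, 25); (17, 57); (17, 61); (17, 38); (17, 54); (17, 26); (17,
   42); (17, 58); (17, 46); (17, 55); (17, 27); (17, 59); (17, 31); (17, 47); (17, 63); (66, 37);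
   (66, 25); (66, 41); (66, 57); (66, 45); (66, 38); (66, 42); (66, 30); (66, 46); (66, 62); (66,
   39); (66, 55); (66, 27); (66, 43); (66, 59); (66, 63); (10, 37); (10, 25); (10, 41); (10, 57);
   (10, 45); (10, 38); (10, 54); (10, 26); (10, 42); (10, 58); (10, 62); (10, 39); (10, 43); (10,
   31); (10, 47); (10, 63)]);
  (27, [:: (136, 47)]);
  (28, [:: (136, 53); (136, 23); (136, 55); (80, 29); (80, 23); (80, 31)]);
  (29, [:: (136, 37); (136, 29); (136, 45); (136, 61); (136, 38); (136, 54); (136, 58); (136, 30);
   (136, 46); (136, 62); (136, 39); (136, 27); (136, 43); (136, 59); (136, 31); (136, 47); (80, 53);
   (80, 25); (80, 57); (80, 61); (80, 54); (80, 26); (80, 58); (80, 30); (80, 46); (80, 62); (80,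
   39); (80, 55); (80, 27); (80, 43); (80, 59); (80, 47)]);
  (30, [:: (136, 26); (136, 31); (80, 38); (80, 55)]);
  (31, [:: (136, 21); (136, 37); (136, 53); (136, 41); (136, 45); (136, 22); (136, 54); (136, 26);
   (136, 42); (136, 58); (136, 23); (136, 55); (136, 31); (136, 47); (136, 63); (80, 21); (80, 25);
   (80, 41); (80, 57); (80, 29); (80, 22); (80, 38); (80, 42); (80, 30); (80, 46); (80, 23); (80,
   55); (80, 59); (80, 31); (80, 63); (129, 21); (129, 37); (129, 53); (129, 57); (129, 61); (129,
   38); (129, 26); (129, 42); (129, 58); (129, 23); (129, 39); (129, 31); (129, 47); (129, 63); (17,
   21); (17, 25); (17, 29); (17, 45); (17, 61); (17, 22); (17, 38); (17, 26); (17, 42); (17, 46);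
   (17, 23); (17, 55); (17, 27); (17, 59); (17, 63); (66, 37); (66, 53); (66, 25); (66, 41); (66,
   29); (66, 61); (66, 22); (66, 38); (66, 54); (66, 42); (66, 62); (66, 23); (66, 27); (66, 43);
   (66, 31); (66, 63); (10, 37); (10, 53); (10, 25); (10, 41); (10, 29); (10, 61); (10, 22); (10,
   26); (10, 42); (10, 30); (10, 62); (10, 23); (10, 39); (10, 55); (10, 43); (10, 63)]);
  (32, [:: (136, 21); (136, 37); (136, 53); (136, 41); (136, 45); (136, 22); (136, 54); (136, 30);
   (136, 46); (136, 62); (136, 23); (136, 55); (136, 27); (136, 43); (136, 59); (80, 21); (80, 25);
   (80, 41); (80, 57); (80, 29); (80, 22); (80, 54); (80, 58); (80, 30); (80, 62); (80, 23); (80,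
   39); (80, 43); (80, 31); (80, 47); (129, 21); (129, 37); (129, 53); (129, 57); (129, 61); (129,
   22); (129, 38); (129, 30); (129, 46); (129, 62); (129, 39); (129, 27); (129, 43); (129, 59); (17,
   21); (17, 25); (17, 29); (17, 45); (17, 61); (17, 22); (17, 54); (17, 26); (17, 58); (17, 62);
   (17, 23); (17, 39); (17, 27); (17, 43); (17, 47); (66, 37); (66, 53); (66, 25); (66, 57); (66,
   29); (66, 45); (66, 22); (66, 38); (66, 54); (66, 58); (66, 46); (66, 23); (66, 27); (66, 59);
   (66, 31); (66, 47); (10, 37); (10, 53); (10, 25); (10, 57); (10, 29); (10, 45); (10, 22); (10,
   26); (10, 58); (10, 30); (10, 46); (10, 23); (10, 39); (10, 55); (10, 59); (10, 47)]);
  (33, [:: (136, 55); (136, 63); (80, 29); (66, 23)]);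
  (34, [:: (136, 54); (136, 62); (80, 29); (66, 23)]);
  (35, [:: (136, 37)]);
  (36, [:: (136, 53); (136, 26); (136, 58); (80, 38); (80, 46); (80, 47); (66, 41); (66, 43); (66,
   47); (10, 41); (10, 43)]);
  (37, [:: (136, 53); (136, 59); (80, 46); (80, 47); (66, 43); (66, 47)]);
  (38, [:: (136, 21)]);
  (39, [:: (136, 42)]);
  (40, [:: (136, 21); (136, 58); (136, 63); (80, 22); (80, 46); (80, 63); (66, 53); (66, 29); (66,
   63)]);
  (41, [:: (136, 21); (136, 42); (136, 47); (80, 21); (80, 37); (80, 42); (66, 53); (66, 29); (66,
   62)]);
  (42, [:: (136, 61); (136, 22); (136, 26); (136, 63); (80, 21); (80, 29); (80, 61); (80, 63); (129,
   25); (129, 26); (129, 55); (129, 63); (17, 38); (17, 31); (17, 63); (66, 29); (66, 55); (66, 63);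
   (10, 53); (10, 31); (10, 63)]);
  (43, [:: (136, 53); (136, 62); (136, 23); (136, 31); (80, 21); (80, 29); (80, 62); (80, 55); (129,
   53); (129, 29); (129, 59); (129, 31); (17, 29); (17, 55); (17, 47); (66, 21); (66, 61); (66, 23);
   (66, 59); (10, 61); (10, 23); (10, 47)]);
  (44, [:: (136, 21); (136, 53); (136, 58); (136, 23); (136, 27); (80, 21); (80, 29); (80, 46); (80,
   39); (129, 53); (129, 29); (129, 58); (129, 30); (17, 29); (17, 54); (17, 46); (66, 21); (66,
   45); (66, 23); (66, 43); (10, 21); (10, 37); (10, 23); (10, 43)]);
  (45, [:: (136, 21); (136, 37); (136, 42); (136, 23); (136, 27); (80, 21); (80, 25); (80, 42); (80,
   23); (80, 39); (129, 37); (129, 29); (129, 42); (129, 30); (17, 21); (17, 53); (17, 25); (17,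
   54); (66, 21); (66, 45); (66, 22); (66, 42); (10, 21); (10, 37); (10, 22); (10, 42)]);
  (46, [:: (136, 21); (136, 61); (136, 55); (136, 31)]);
  (47, [:: (136, 21); (136, 61); (136, 54); (136, 30)]);
  (48, [:: (1672, 94); (1672, 222); (1672, 174); (1224, 158); (1224, 235); (1224, 123); (1616, 118);
   (1616, 246); (1616, 186); (1112, 93); (1112, 186); (1112, 111); (664, 105); (664, 93); (664,
   222); (664, 187); (1665, 126); (1665, 91); (1665, 219); (1665, 171); (1217, 222); (1217, 238);
   (1217, 126); (1217, 155); (1217, 171); (1217, 123); (1553, 213); (1553, 126); (1553, 190); (1553,
   254); (1553, 103); (1553, 231); (1553, 171); (209, 117); (209, 109); (209, 222); (209, 238);
   (209, 254); (209, 183); (209, 155); (209, 171); (1049, 93); (1049, 250); (1049, 126); (1049,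
   167); (1049, 171); (1049, 111); (153, 121); (153, 93); (153, 250); (153, 167); (153, 171); (153,
   159); (1602, 213); (1602, 121); (1602, 249); (1602, 86); (1602, 150); (1602, 186); (1602, 111);
   (1602, 175); (1602, 239); (706, 117); (706, 249); (706, 86); (706, 102); (706, 218); (706, 234);
   (706, 159); (706, 175); (706, 191); (1546, 213); (1546, 109); (1546, 237); (1546, 86); (1546,
   150); (1546, 174); (1546, 123); (1546, 187); (1546, 251); (202, 117); (202, 189); (202, 86);
   (202, 158); (202, 174); (202, 103); (202, 219); (202, 235); (202, 251); (538, 93); (538, 237);
   (538, 86); (538, 230); (538, 90); (538, 234); (538, 183); (538, 187); (538, 191); (90, 93); (90,
   189); (90, 86); (90, 182); (90, 90); (90, 186); (90, 231); (90, 91); (90, 235); (90, 239); (1091,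
   149); (1091, 185); (1091, 237); (1091, 150); (1091, 186); (1091, 238); (1091, 87); (1091, 123);
   (1091, 111); (643, 101); (643, 233); (643, 189); (643, 102); (643, 234); (643, 190); (643, 87);
   (643, 219); (1035, 249); (1035, 173); (1035, 150); (1035, 250); (1035, 174); (1035, 87); (1035,
   123); (1035, 111); (139, 101); (139, 249); (139, 173); (139, 174); (139, 87); (139, 159); (531,
   233); (531, 189); (531, 90); (531, 234); (531, 190); (531, 231); (83, 185); (83, 237); (83, 186);
   (83, 183)]);
  (49, [:: (1672, 110); (1672, 238); (1672, 155); (1672, 123); (1224, 158); (1224, 174); (1224,
   251); (720, 121); (720, 250); (720, 191); (1112, 221); (1112, 186); (1112, 107); (1112, 239);
   (664, 109); (664, 238); (664, 191); (1665, 158); (1665, 126); (1665, 254); (1665, 107); (1217,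
   94); (1217, 222); (1217, 110); (1217, 254); (1217, 155); (1217, 171); (1553, 149); (1553, 221);
   (1553, 182); (1553, 126); (1553, 254); (1553, 167); (1553, 235); (209, 101); (209, 125); (209,
   214); (209, 230); (209, 254); (209, 167); (209, 187); (1049, 89); (1049, 221); (1049, 118);
   (1049, 122); (1049, 254); (1049, 171); (153, 89); (153, 125); (153, 214); (153, 218); (153, 254);
   (153, 175); (1602, 149); (1602, 185); (1602, 173); (1602, 122); (1602, 250); (1602, 87); (1602,
   215); (1602, 111); (1602, 239); (706, 101); (706, 233); (706, 157); (706, 173); (706, 118); (706,
   218); (706, 250); (706, 87); (706, 159); (706, 191); (1546, 149); (1546, 185); (1546, 173);
   (1546, 110); (1546, 238); (1546, 87); (1546, 215); (1546, 123); (1546, 251); (202, 101); (202,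
   217); (202, 233); (202, 173); (202, 158); (202, 190); (202, 87); (202, 119); (202, 219); (202,
   251); (538, 181); (538, 89); (538, 233); (538, 185); (538, 230); (538, 94); (538, 238); (538,
   87); (538, 183); (538, 95); (538, 191); (90, 229); (90, 89); (90, 233); (90, 185); (90, 182);
   (90, 190); (90, 87); (90, 95); (90, 239); (1091, 185); (1091, 109); (1091, 86); (1091, 186);
   (1091, 110); (1091, 215); (1091, 187); (1091, 239); (643, 117); (643, 233); (643, 157); (643,
   189); (643, 86); (643, 158); (643, 103); (643, 235); (643, 191); (1035, 213); (1035, 121); (1035,
   249); (1035, 173); (1035, 86); (1035, 122); (1035, 174); (1035, 251); (1035, 175); (139, 117);
   (139, 217); (139, 249); (139, 173); (139, 86); (139, 218); (139, 251); (139, 175); (531, 181);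
   (531, 233); (531, 182); (531, 91); (531, 235); (531, 191); (83, 229); (83, 185); (83, 230); (83,
   187); (83, 239)]);
  (50, [:: (1672, 249); (1672, 214); (1672, 106); (1672, 234); (1672, 159); (1672, 175); (1672,
   191); (1224, 117); (1224, 249); (1224, 186); (1224, 159); (1224, 111); (1224, 175); (1224, 239);
   (1616, 86); (1616, 106); (1616, 187); (720, 86); (720, 186); (720, 103); (720, 219); (720, 235);
   (1112, 93); (1112, 237); (1112, 174); (1112, 183); (1112, 187); (1112, 251); (664, 189); (664,
   174); (664, 231); (664, 91); (664, 235); (664, 251); (1217, 117); (1217, 246); (1217, 186);
   (1553, 106); (1553, 94); (1553, 222); (1553, 187); (209, 186); (209, 94); (209, 111); (1049, 93);
   (1049, 222); (1049, 174); (153, 157); (153, 174); (153, 235); (153, 123); (1602, 89); (1602,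
   217); (1602, 189); (1602, 106); (1602, 234); (1602, 190); (1602, 103); (1602, 231); (1602, 191);
   (706, 89); (706, 154); (706, 186); (706, 151); (706, 183); (706, 239); (1546, 101); (1546, 229);
   (1546, 189); (1546, 106); (1546, 234); (1546, 190); (1546, 91); (1546, 219); (1546, 191); (202,
   149); (202, 181); (202, 237); (202, 154); (202, 186); (202, 238); (202, 91); (202, 111); (538,
   101); (538, 249); (538, 109); (538, 166); (538, 174); (538, 151); (538, 251); (538, 159); (90,
   149); (90, 249); (90, 157); (90, 166); (90, 250); (90, 174); (90, 103); (90, 123); (90, 251);
   (90, 111); (1091, 229); (1091, 169); (1091, 189); (1091, 190); (1091, 254); (1091, 87); (1091,
   231); (1091, 171); (643, 181); (643, 169); (643, 237); (643, 94); (643, 238); (643, 254); (643,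
   183); (643, 171); (1035, 126); (1035, 87); (1035, 219); (1035, 171); (139, 222); (139, 238);
   (139, 126); (139, 171); (531, 118); (531, 250); (531, 171); (531, 95); (83, 169); (83, 109); (83,
   250); (83, 126); (83, 151); (83, 171); (83, 95)]);
  (51, [:: (1672, 106); (1672, 234); (1672, 175); (1616, 106); (1616, 234); (1616, 187); (720, 182);
   (720, 103); (720, 219); (1112, 89); (1112, 249); (1112, 237); (1112, 174); (664, 189); (664,
   158); (664, 235); (1665, 217); (1665, 246); (1665, 106); (1665, 234); (1665, 119); (1665, 183);
   (1665, 175); (1217, 101); (1217, 121); (1217, 246); (1217, 186); (1217, 215); (1217, 231); (1217,
   159); (1217, 175); (1553, 106); (1553, 187); (1553, 95); (209, 186); (209, 190); (209, 235);
   (209, 95); (209, 111); (1049, 89); (1049, 109); (1049, 174); (1049, 183); (1049, 219); (1049,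
   187); (153, 157); (153, 174); (153, 190); (153, 231); (153, 235); (153, 123); (1602, 217); (1602,
   93); (1602, 157); (1602, 106); (1602, 234); (1602, 190); (1602, 231); (1602, 119); (1602, 183);
   (706, 121); (706, 185); (706, 93); (706, 109); (706, 186); (706, 222); (706, 238); (706, 215);
   (706, 231); (706, 183); (1546, 229); (1546, 117); (1546, 181); (1546, 106); (1546, 234); (1546,
   190); (1546, 219); (1546, 95); (1546, 159); (202, 213); (202, 229); (202, 186); (202, 222); (202,
   238); (202, 123); (202, 95); (202, 111); (538, 117); (538, 121); (538, 173); (538, 250); (538,
   215); (538, 219); (538, 159); (90, 213); (90, 217); (90, 250); (90, 119); (90, 123); (1091, 86);
   (1091, 246); (1091, 190); (1091, 231); (643, 94); (643, 238); (643, 183); (643, 155); (1035,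
   117); (1035, 189); (1035, 86); (1035, 222); (1035, 190); (1035, 103); (1035, 171); (139, 238);
   (139, 126); (139, 151); (139, 187); (531, 117); (531, 249); (531, 221); (531, 118); (531, 250);
   (531, 94); (531, 222); (531, 167); (83, 213); (83, 249); (83, 125); (83, 214); (83, 250); (83,
   94); (83, 126); (83, 175)]);
  (52, [:: (1672, 245); (1672, 125); (1672, 189); (1672, 86); (1672, 230); (1672, 94); (1672, 174);
   (1672, 231); (1672, 171); (1672, 187); (1224, 245); (1224, 93); (1224, 237); (1224, 174); (1224,
   183); (1224, 171); (1224, 235); (1616, 125); (1616, 86); (1616, 218); (1616, 186); (1616, 103);
   (1616, 219); (720, 221); (720, 237); (720, 214); (720, 234); (720, 122); (720, 151); (720, 187);
   (720, 175); (1112, 117); (1112, 249); (1112, 221); (1112, 186); (1112, 103); (1112, 171); (1112,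
   235); (1112, 159); (664, 245); (664, 249); (664, 125); (664, 214); (664, 234); (664, 110); (664,
   151); (664, 187); (664, 175); (1665, 245); (1665, 89); (1665, 233); (1665, 190); (1665, 183);
   (1665, 171); (1217, 245); (1217, 185); (1217, 238); (1217, 87); (1217, 231); (1217, 171); (1553,
   101); (1553, 233); (1553, 221); (1553, 190); (1553, 171); (1553, 95); (1553, 159); (209, 185);
   (209, 125); (209, 234); (209, 110); (209, 151); (209, 171); (209, 95); (1049, 118); (1049, 186);
   (1049, 250); (1049, 87); (1049, 219); (1049, 171); (153, 214); (153, 234); (153, 122); (153,
   171); (1602, 89); (1602, 109); (1602, 218); (1602, 186); (1602, 174); (1602, 183); (1602, 175);
   (706, 157); (706, 234); (706, 122); (706, 190); (706, 231); (706, 175); (1546, 101); (1546, 121);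
   (1546, 230); (1546, 246); (1546, 186); (1546, 174); (1546, 215); (1546, 187); (1546, 159); (202,
   217); (202, 182); (202, 246); (202, 234); (202, 174); (202, 119); (202, 107); (538, 234); (538,
   110); (538, 190); (538, 219); (538, 187); (538, 95); (90, 234); (90, 186); (90, 158); (90, 107);
   (90, 95); (1091, 117); (1091, 246); (1091, 186); (1035, 93); (1035, 174); (139, 157); (139, 234);
   (139, 122); (139, 174); (531, 222); (531, 107); (531, 187); (531, 95); (83, 186); (83, 110); (83,
   95)]);
  (53, [:: (1672, 169); (1672, 87); (1672, 247); (1224, 153); (1224, 235); (1616, 118); (1616, 87);
   (1616, 175); (720, 214); (720, 238); (720, 126); (720, 151); (1112, 165); (1112, 103); (1112,
   235)]);
  (54, [:: (1672, 190); (1672, 187); (1224, 85); (1616, 190); (1616, 175); (1112, 85); (1091, 85)]);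
  (55, [:: (1672, 190); (1672, 187); (1224, 85); (1616, 190); (1616, 175); (1112, 85); (1602, 187);
   (1602, 175); (1091, 85)]);
  (56, [:: (1224, 117); (1217, 85); (1217, 117); (1049, 85); (1049, 93); (1091, 85); (1091, 87);
   (1035, 85); (1035, 87)]);
  (57, [:: (1112, 171); (1217, 174); (1217, 171); (1049, 186); (1049, 171); (1091, 186); (1091,
   174); (1035, 186); (1035, 174)]);
  (58, [:: (1672, 85); (1672, 253); (1672, 86); (1672, 170); (1672, 159); (1224, 85); (1224, 249);
   (1224, 154); (1224, 170); (1224, 111); (1616, 85); (1616, 253); (1616, 86); (1616, 234); (1616,
   183); (720, 154); (720, 186); (720, 87); (720, 235); (1112, 85); (1112, 237); (1112, 166); (1112,
   87); (1112, 251); (664, 125); (664, 166); (664, 87); (664, 235); (664, 251)]);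
  (59, [:: (1672, 85); (1672, 249); (1672, 110); (1672, 155); (1672, 171); (1224, 85); (1224, 253);
   (1224, 158); (1224, 87); (1224, 171); (1616, 85); (1616, 237); (1616, 86); (1616, 250); (1616,
   167); (720, 125); (720, 86); (720, 234); (720, 250); (720, 167); (1112, 85); (1112, 253); (1112,
   182); (1112, 87); (1112, 235); (664, 86); (664, 234); (664, 155); (664, 187); (1091, 85); (1091,
   185); (1091, 93); (1091, 238); (1091, 247); (643, 89); (643, 234); (643, 158); (643, 190); (643,
   119)]);
  (60, [:: (1672, 189); (1672, 190); (1224, 87); (1224, 91); (1616, 189); (1616, 190); (1112, 87);
   (1112, 103); (1546, 159)]);
  (61, [:: (1672, 185); (1672, 187); (1224, 86); (1224, 94); (1616, 173); (1616, 175); (1112, 86);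
   (1112, 118); (1602, 167); (1602, 175); (1546, 155); (1546, 187)]);
  (62, [:: (18000, 341); (18000, 985); (14416, 954); (14416, 623); (17104, 341); (17104, 762);
   (6352, 954); (6352, 751); (13072, 470); (13072, 671); (5904, 505); (5904, 703); (17496, 341);
   (17496, 925); (10328, 359); (10328, 939); (17048, 341); (17048, 750); (6296, 942); (6296, 763);
   (8984, 750); (8984, 407); (5400, 445); (5400, 763); (17937, 985); (14353, 638); (14353, 939);
   (2257, 493); (2257, 942); (12561, 734); (1809, 445); (1809, 747); (17930, 341); (17930, 982);
   (16586, 341); (16586, 702); (2250, 487); (12554, 413); (1802, 750); (1802, 439); (17475, 341);
   (17475, 919); (10307, 365); (10307, 942); (17027, 341); (17027, 747); (6275, 766); (6275, 939);
   (8963, 413); (8963, 747); (5379, 766); (5379, 439); (17419, 341); (17419, 919); (10251, 377);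
   (10251, 954); (16523, 341); (16523, 687); (2187, 502); (2187, 954); (8459, 473); (8459, 687);
   (1291, 502); (1291, 687)])]%num.

(** Guides the search from [start4], for the case that some vector has four nonzero entries; [tree3]
    does so from [start3] when there is none. Both trees are mere data, as [run] checks every
    node. *)
Definition tree4 : tree := Nd 1 [:: 0; 2; 1] [:: (457%num, Nd 1 [:: 0; 3; 1] [:: (301%num, Nd 6 [::
  0; 1; 3; 2] [::]); (484%num, Nd 2 [:: 3; 1; 2] [::]); (436%num, Nd 1 [:: 1; 3; 0] [:: (484%num,
  Nd 2 [:: 3; 1; 2] [::]); (381%num, Nd 13 [:: 1; 3; 0; 2] [::]); (1444%num, Nd 2 [:: 3; 1; 2]
  [::])]); (501%num, Nd 8 [:: 0; 1; 3; 2] [::]); (381%num, Nd 13 [:: 1; 3; 0; 2] [::]); (1924%num,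
  Nd 1 [:: 1; 3; 0] [:: (1252%num, Nd 2 [:: 3; 1; 2] [::]); (1149%num, Nd 13 [:: 1; 3; 0; 2] [::]);
  (1444%num, Nd 2 [:: 3; 1; 2] [::]); (5284%num, Nd 2 [:: 3; 1; 2] [::])]); (1444%num, Nd 2 [:: 3;
  1; 2] [::])]); (397%num, Nd 1 [:: 0; 3; 1] [:: (313%num, Nd 6 [:: 0; 1; 2; 3] [::]); (481%num, Nd
  2 [:: 3; 0; 2] [::]); (436%num, Nd 1 [:: 1; 3; 0] [::]); (501%num, Nd 8 [:: 1; 0; 3; 2] [::]);
  (409%num, Nd 13 [:: 0; 3; 1; 2] [::]); (1924%num, Nd 1 [:: 1; 3; 0] [::]); (1441%num, Nd 2 [:: 3;
  0; 2] [::])]); (433%num, Nd 1 [:: 0; 3; 1] [:: (301%num, Nd 2 [:: 2; 0; 3] [::]); (481%num, Nd 2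
  [:: 2; 0; 3] [:: (397%num, Nd 2 [:: 3; 0; 2] [::]); (1921%num, Nd 2 [:: 3; 0; 2] [::])]);
  (484%num, Nd 7 [:: 2; 3; 0; 1] [::]); (501%num, Nd 8 [:: 3; 2; 0; 1] [::]); (409%num, Nd 13 [::
  0; 3; 1; 2] [::]); (1825%num, Nd 2 [:: 2; 0; 3] [::]); (1441%num, Nd 2 [:: 2; 0; 3] [::
  (1165%num, Nd 2 [:: 3; 0; 2] [::]); (1921%num, Nd 2 [:: 3; 0; 2] [::]); (7297%num, Nd 2 [:: 3; 0;
  2] [::])])]); (484%num, Nd 1 [:: 1; 2; 0] [:: (457%num, Nd 2 [:: 3; 1; 2] [::]); (433%num, Nd 7
  [:: 2; 3; 0; 1] [::]); (436%num, Nd 2 [:: 2; 1; 3] [:: (457%num, Nd 2 [:: 3; 1; 2] [::]);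
  (1924%num, Nd 2 [:: 3; 1; 2] [::])]); (501%num, Nd 8 [:: 2; 3; 1; 0] [::]); (477%num, Nd 13 [::
  1; 2; 0; 3] [::]); (1924%num, Nd 2 [:: 3; 1; 2] [::]); (1444%num, Nd 2 [:: 2; 1; 3] [::
  (1225%num, Nd 2 [:: 3; 1; 2] [::]); (1924%num, Nd 2 [:: 3; 1; 2] [::]); (7300%num, Nd 2 [:: 3; 1;
  2] [::])])]); (436%num, Nd 1 [:: 1; 3; 0] [:: (313%num, Nd 2 [:: 2; 1; 3] [::]); (481%num, Nd 7
  [:: 2; 3; 1; 0] [::]); (484%num, Nd 2 [:: 2; 1; 3] [:: (457%num, Nd 2 [:: 3; 1; 2] [::]);
  (1924%num, Nd 2 [:: 3; 1; 2] [::])]); (501%num, Nd 8 [:: 3; 2; 1; 0] [::]); (381%num, Nd 13 [::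
  1; 3; 0; 2] [::]); (1828%num, Nd 2 [:: 2; 1; 3] [::]); (1444%num, Nd 2 [:: 2; 1; 3] [::
  (1225%num, Nd 2 [:: 3; 1; 2] [::]); (1924%num, Nd 2 [:: 3; 1; 2] [::]); (7300%num, Nd 2 [:: 3; 1;
  2] [::])])]); (501%num, Nd 10 [:: 0; 1; 2; 3] [:: (313%num, Nd 8 [:: 0; 1; 2; 3] [::]); (301%num,
  Nd 8 [:: 1; 0; 2; 3] [::]); (457%num, Nd 8 [:: 0; 1; 3; 2] [::]); (397%num, Nd 8 [:: 1; 0; 3; 2]
  [::]); (481%num, Nd 8 [:: 2; 3; 0; 1] [::]); (433%num, Nd 8 [:: 3; 2; 0; 1] [::]); (484%num, Nd 8
  [:: 2; 3; 1; 0] [::]); (436%num, Nd 8 [:: 3; 2; 1; 0] [::]); (361%num, Nd 10 [:: 0; 1; 3; 2]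
  [::]); (381%num, Nd 10 [:: 0; 1; 3; 2] [::])]); (409%num, Nd 13 [:: 0; 3; 1; 2] [:: (501%num, Nd
  10 [:: 0; 1; 2; 3] [::]); (477%num, Nd 10 [:: 0; 1; 2; 3] [::])]); (477%num, Nd 13 [:: 1; 2; 0;
  3] [:: (501%num, Nd 10 [:: 0; 1; 2; 3] [::]); (409%num, Nd 10 [:: 0; 1; 2; 3] [::])]); (361%num,
  Nd 13 [:: 0; 2; 1; 3] [:: (501%num, Nd 10 [:: 0; 1; 3; 2] [::]); (381%num, Nd 10 [:: 0; 1; 3; 2]
  [::])]); (381%num, Nd 13 [:: 1; 3; 0; 2] [:: (501%num, Nd 10 [:: 0; 1; 3; 2] [::]); (361%num, Nd
  10 [:: 0; 1; 3; 2] [::])]); (1921%num, Nd 1 [:: 0; 3; 1] [:: (1249%num, Nd 2 [:: 3; 0; 2] [::]);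
  (1828%num, Nd 14 [:: 4; 0; 3; 1; 2] [::]); (1177%num, Nd 13 [:: 0; 3; 1; 2] [::]); (1441%num, Nd
  2 [:: 3; 0; 2] [::]); (5281%num, Nd 2 [:: 3; 0; 2] [::])]); (1828%num, Nd 1 [:: 1; 2; 0] [::
  (1921%num, Nd 14 [:: 4; 0; 3; 1; 2] [::]); (1204%num, Nd 2 [:: 2; 1; 3] [::]); (1245%num, Nd 13
  [:: 1; 2; 0; 3] [::]); (1444%num, Nd 2 [:: 2; 1; 3] [::]); (5284%num, Nd 2 [:: 2; 1; 3] [::])]);
  (1924%num, Nd 1 [:: 1; 3; 0] [:: (1825%num, Nd 14 [:: 4; 0; 2; 1; 3] [::]); (1252%num, Nd 2 [::
  3; 1; 2] [::]); (1149%num, Nd 13 [:: 1; 3; 0; 2] [::]); (1444%num, Nd 2 [:: 3; 1; 2] [::]);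
  (5284%num, Nd 2 [:: 3; 1; 2] [::])]); (1669%num, Nd 1 [:: 0; 3; 1] [:: (1204%num, Nd 1 [:: 1; 3;
  0] [::]); (1924%num, Nd 1 [:: 1; 3; 0] [::]); (7300%num, Nd 1 [:: 1; 3; 0] [::])]); (1441%num, Nd
  2 [:: 2; 0; 3] [:: (1165%num, Nd 2 [:: 3; 0; 2] [::]); (1921%num, Nd 2 [:: 3; 0; 2] [::]);
  (7297%num, Nd 2 [:: 3; 0; 2] [::])]); (1444%num, Nd 2 [:: 2; 1; 3] [:: (1225%num, Nd 2 [:: 3; 1;
  2] [::]); (1924%num, Nd 2 [:: 3; 1; 2] [::]); (7300%num, Nd 2 [:: 3; 1; 2] [::])])].

Definition tree3 : tree := Nd 0 [:: 0; 1] [:: (481%num, Nd 0 [:: 0; 2] [:: (457%num, Nd 3 [:: 0; 1;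
  3] [:: (301%num, Nd 4 [:: 0; 1; 2] [:: (1729%num, Nd 11 [:: 0; 1; 2; 3] [::])]); (433%num, Nd 5
  [:: 0; 2; 3] [:: (1801%num, Nd 12 [:: 0; 2; 3; 1] [::])]); (1825%num, Nd 4 [:: 0; 1; 2] [::
  (1585%num, Nd 16 [:: 0; 2; 4; 3; 1] [::])]); (1585%num, Nd 5 [:: 0; 2; 3] [:: (1825%num, Nd 16
  [:: 0; 2; 4; 3; 1] [::])])]); (397%num, Nd 3 [:: 0; 1; 3] [:: (301%num, Nd 3 [:: 0; 2; 1] [::]);
  (433%num, Nd 3 [:: 0; 3; 2] [::]); (436%num, Nd 9 [:: 0; 1; 2; 3] [::]); (1549%num, Nd 3 [:: 0;
  2; 1] [::]); (1825%num, Nd 3 [:: 0; 2; 1] [::]); (1585%num, Nd 3 [:: 0; 3; 2] [::]); (1921%num,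
  Nd 3 [:: 0; 3; 2] [::])]); (484%num, Nd 3 [:: 2; 3; 1] [:: (301%num, Nd 5 [:: 2; 0; 1] [::
  (1936%num, Nd 12 [:: 2; 0; 1; 3] [::])]); (433%num, Nd 4 [:: 2; 0; 3] [:: (1828%num, Nd 11 [:: 2;
  0; 3; 1] [::])]); (1825%num, Nd 5 [:: 2; 0; 1] [:: (1585%num, Nd 16 [:: 2; 0; 4; 1; 3] [::])]);
  (1585%num, Nd 4 [:: 2; 0; 3] [:: (1825%num, Nd 16 [:: 2; 0; 4; 1; 3] [::])])]); (436%num, Nd 3
  [:: 2; 0; 3] [:: (301%num, Nd 3 [:: 2; 1; 0] [::]); (397%num, Nd 9 [:: 0; 1; 2; 3] [::]);
  (484%num, Nd 3 [:: 2; 3; 1] [::]); (1825%num, Nd 3 [:: 2; 1; 0] [::]); (1828%num, Nd 3 [:: 2; 3;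
  1] [::]); (1588%num, Nd 3 [:: 2; 1; 0] [::]); (1936%num, Nd 3 [:: 2; 3; 1] [::])]); (1801%num, Nd
  3 [:: 0; 1; 3] [:: (1069%num, Nd 4 [:: 0; 1; 2] [::]); (1201%num, Nd 12 [:: 0; 2; 3; 1] [::
  (1825%num, Nd 16 [:: 0; 2; 3; 4; 1] [::])]); (1825%num, Nd 4 [:: 0; 1; 2] [:: (1201%num, Nd 16
  [:: 0; 2; 3; 4; 1] [::])]); (7201%num, Nd 4 [:: 0; 1; 2] [::])]); (1549%num, Nd 3 [:: 0; 2; 1]
  [::]); (1921%num, Nd 3 [:: 0; 3; 2] [::]); (1729%num, Nd 3 [:: 0; 1; 3] [:: (1069%num, Nd 11 [::
  0; 1; 2; 3] [:: (1585%num, Nd 16 [:: 0; 2; 1; 3; 4] [::])]); (1201%num, Nd 5 [:: 0; 2; 3] [::]);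
  (1585%num, Nd 5 [:: 0; 2; 3] [:: (1069%num, Nd 16 [:: 0; 2; 1; 3; 4] [::])]); (6193%num, Nd 5 [::
  0; 2; 3] [::])]); (1828%num, Nd 3 [:: 2; 3; 1] [:: (1069%num, Nd 5 [:: 2; 0; 1] [::]); (1201%num,
  Nd 11 [:: 2; 0; 3; 1] [:: (1825%num, Nd 16 [:: 2; 0; 3; 1; 4] [::])]); (1825%num, Nd 5 [:: 2; 0;
  1] [:: (1201%num, Nd 16 [:: 2; 0; 3; 1; 4] [::])]); (7201%num, Nd 5 [:: 2; 0; 1] [::])]);
  (1588%num, Nd 3 [:: 2; 1; 0] [::]); (1936%num, Nd 3 [:: 2; 3; 1] [:: (1069%num, Nd 12 [:: 2; 0;
  1; 3] [:: (1585%num, Nd 16 [:: 2; 0; 1; 4; 3] [::])]); (1201%num, Nd 4 [:: 2; 0; 3] [::]);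
  (1585%num, Nd 4 [:: 2; 0; 3] [:: (1069%num, Nd 16 [:: 2; 0; 1; 4; 3] [::])]); (6193%num, Nd 4 [::
  2; 0; 3] [::])]); (1744%num, Nd 3 [:: 2; 0; 3] [::])]); (433%num, Nd 0 [:: 0; 2] [:: (457%num, Nd
  3 [:: 0; 1; 2] [:: (397%num, Nd 4 [:: 0; 1; 3] [:: (1585%num, Nd 11 [:: 0; 1; 3; 2] [::])]);
  (481%num, Nd 5 [:: 0; 2; 3] [:: (1801%num, Nd 12 [:: 0; 2; 3; 1] [::])]); (1921%num, Nd 4 [:: 0;
  1; 3] [:: (1729%num, Nd 16 [:: 0; 3; 4; 2; 1] [::])]); (1729%num, Nd 5 [:: 0; 2; 3] [::
  (1921%num, Nd 16 [:: 0; 3; 4; 2; 1] [::])])]); (397%num, Nd 3 [:: 0; 3; 2] [:: (301%num, Nd 5 [::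
  0; 1; 2] [:: (1921%num, Nd 12 [:: 0; 1; 2; 3] [::])]); (457%num, Nd 4 [:: 0; 1; 3] [:: (1585%num,
  Nd 11 [:: 0; 1; 3; 2] [::])]); (1801%num, Nd 4 [:: 0; 1; 3] [:: (1549%num, Nd 16 [:: 0; 1; 4; 2;
  3] [::])]); (1549%num, Nd 5 [:: 0; 1; 2] [:: (1801%num, Nd 16 [:: 0; 1; 4; 2; 3] [::])])]);
  (484%num, Nd 3 [:: 2; 0; 1] [:: (481%num, Nd 4 [:: 2; 0; 3] [:: (1828%num, Nd 11 [:: 2; 0; 3; 1]
  [::])]); (436%num, Nd 5 [:: 2; 1; 3] [:: (1585%num, Nd 12 [:: 2; 1; 3; 0] [::])]); (1936%num, Nd
  4 [:: 2; 0; 3] [:: (1744%num, Nd 16 [:: 2; 3; 4; 1; 0] [::])]); (1744%num, Nd 5 [:: 2; 1; 3] [::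
  (1936%num, Nd 16 [:: 2; 3; 4; 1; 0] [::])])]); (436%num, Nd 3 [:: 2; 0; 3] [:: (301%num, Nd 4 [::
  2; 0; 1] [:: (1744%num, Nd 11 [:: 2; 0; 1; 3] [::])]); (484%num, Nd 5 [:: 2; 1; 3] [:: (1585%num,
  Nd 12 [:: 2; 1; 3; 0] [::])]); (1828%num, Nd 5 [:: 2; 1; 3] [:: (1588%num, Nd 16 [:: 2; 1; 4; 3;
  0] [::])]); (1588%num, Nd 4 [:: 2; 0; 1] [:: (1828%num, Nd 16 [:: 2; 1; 4; 3; 0] [::])])]);
  (1801%num, Nd 3 [:: 0; 1; 2] [:: (1165%num, Nd 4 [:: 0; 1; 3] [:: (1549%num, Nd 16 [:: 0; 1; 4;
  2; 3] [::])]); (1549%num, Nd 11 [:: 0; 1; 4; 2] [:: (1165%num, Nd 16 [:: 0; 1; 4; 2; 3] [::])]);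
  (1249%num, Nd 12 [:: 0; 2; 3; 1] [:: (1825%num, Nd 16 [:: 0; 2; 3; 4; 1] [::])]); (1825%num, Nd 5
  [:: 0; 2; 4] [:: (1249%num, Nd 16 [:: 0; 2; 3; 4; 1] [::])]); (1921%num, Nd 4 [:: 0; 1; 3] [::
  (1825%num, Nd 5 [:: 0; 2; 4] [::]); (1585%num, Nd 5 [:: 0; 2; 4] [::]); (6193%num, Nd 5 [:: 0; 2;
  4] [::]); (6913%num, Nd 5 [:: 0; 2; 4] [::])]); (7297%num, Nd 4 [:: 0; 1; 3] [::]); (6913%num, Nd
  5 [:: 0; 2; 4] [::])]); (1549%num, Nd 3 [:: 0; 4; 2] [:: (1069%num, Nd 5 [:: 0; 1; 2] [::]);
  (1165%num, Nd 5 [:: 0; 1; 2] [:: (1801%num, Nd 16 [:: 0; 1; 4; 2; 3] [::])]); (1801%num, Nd 11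
  [:: 0; 1; 4; 2] [:: (1165%num, Nd 16 [:: 0; 1; 4; 2; 3] [::])]); (6157%num, Nd 5 [:: 0; 1; 2]
  [::])]); (1921%num, Nd 3 [:: 0; 3; 2] [:: (1069%num, Nd 12 [:: 0; 1; 2; 3] [:: (1825%num, Nd 16
  [:: 0; 2; 1; 4; 3] [::])]); (1225%num, Nd 4 [:: 0; 1; 3] [:: (1729%num, Nd 16 [:: 0; 3; 4; 2; 1]
  [::])]); (1801%num, Nd 4 [:: 0; 1; 3] [:: (1825%num, Nd 5 [:: 0; 2; 4] [::]); (1585%num, Nd 5 [::
  0; 2; 4] [::]); (6193%num, Nd 5 [:: 0; 2; 4] [::]); (6913%num, Nd 5 [:: 0; 2; 4] [::])]);
  (1825%num, Nd 5 [:: 0; 2; 4] [:: (1069%num, Nd 16 [:: 0; 2; 1; 4; 3] [::])]); (1729%num, Nd 11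
  [:: 0; 3; 4; 2] [:: (1225%num, Nd 16 [:: 0; 3; 4; 2; 1] [::])]); (7177%num, Nd 4 [:: 0; 1; 3]
  [::]); (6913%num, Nd 5 [:: 0; 2; 4] [::])]); (1729%num, Nd 3 [:: 0; 4; 2] [:: (1225%num, Nd 5 [::
  0; 2; 3] [:: (1921%num, Nd 16 [:: 0; 3; 4; 2; 1] [::])]); (1249%num, Nd 5 [:: 0; 2; 3] [::]);
  (1921%num, Nd 11 [:: 0; 3; 4; 2] [:: (1225%num, Nd 16 [:: 0; 3; 4; 2; 1] [::])]); (6337%num, Nd 5
  [:: 0; 2; 3] [::])]); (1828%num, Nd 3 [:: 2; 0; 1] [:: (1249%num, Nd 11 [:: 2; 0; 3; 1] [::
  (1825%num, Nd 16 [:: 2; 0; 3; 1; 4] [::])]); (1825%num, Nd 4 [:: 2; 0; 4] [:: (1249%num, Nd 16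
  [:: 2; 0; 3; 1; 4] [::])]); (1204%num, Nd 5 [:: 2; 1; 3] [:: (1588%num, Nd 16 [:: 2; 1; 4; 3; 0]
  [::])]); (1588%num, Nd 12 [:: 2; 1; 4; 0] [:: (1204%num, Nd 16 [:: 2; 1; 4; 3; 0] [::])]);
  (1744%num, Nd 4 [:: 2; 0; 4] [:: (1252%num, Nd 5 [:: 2; 1; 3] [::]); (1204%num, Nd 5 [:: 2; 1; 3]
  [::]); (7204%num, Nd 5 [:: 2; 1; 3] [::]); (6352%num, Nd 5 [:: 2; 1; 3] [::])]); (6352%num, Nd 5
  [:: 2; 1; 3] [::]); (7696%num, Nd 4 [:: 2; 0; 4] [::])]); (1588%num, Nd 3 [:: 2; 0; 4] [::
  (1069%num, Nd 4 [:: 2; 0; 1] [::]); (1204%num, Nd 4 [:: 2; 0; 1] [:: (1828%num, Nd 16 [:: 2; 1;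
  4; 3; 0] [::])]); (1828%num, Nd 12 [:: 2; 1; 4; 0] [:: (1204%num, Nd 16 [:: 2; 1; 4; 3; 0]
  [::])]); (6196%num, Nd 4 [:: 2; 0; 1] [::])]); (1936%num, Nd 3 [:: 2; 0; 4] [:: (1249%num, Nd 4
  [:: 2; 0; 3] [::]); (1252%num, Nd 4 [:: 2; 0; 3] [:: (1744%num, Nd 16 [:: 2; 3; 4; 1; 0] [::])]);
  (1744%num, Nd 12 [:: 2; 3; 4; 0] [:: (1252%num, Nd 16 [:: 2; 3; 4; 1; 0] [::])]); (7312%num, Nd 4
  [:: 2; 0; 3] [::])]); (1744%num, Nd 3 [:: 2; 0; 3] [:: (1069%num, Nd 11 [:: 2; 0; 1; 3] [::
  (1825%num, Nd 16 [:: 2; 0; 1; 3; 4] [::])]); (1825%num, Nd 4 [:: 2; 0; 4] [:: (1069%num, Nd 16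
  [:: 2; 0; 1; 3; 4] [::])]); (1252%num, Nd 5 [:: 2; 1; 3] [:: (1936%num, Nd 16 [:: 2; 3; 4; 1; 0]
  [::])]); (1828%num, Nd 4 [:: 2; 0; 4] [:: (1252%num, Nd 5 [:: 2; 1; 3] [::]); (1204%num, Nd 5 [::
  2; 1; 3] [::]); (7204%num, Nd 5 [:: 2; 1; 3] [::]); (6352%num, Nd 5 [:: 2; 1; 3] [::])]);
  (1936%num, Nd 12 [:: 2; 3; 4; 0] [:: (1252%num, Nd 16 [:: 2; 3; 4; 1; 0] [::])]); (7204%num, Nd 5
  [:: 2; 1; 3] [::]); (7696%num, Nd 4 [:: 2; 0; 4] [::])]); (7681%num, Nd 3 [:: 0; 4; 2] [::
  (7177%num, Nd 5 [:: 0; 2; 5] [::]); (7201%num, Nd 5 [:: 0; 2; 5] [::]); (7297%num, Nd 5 [:: 0; 2;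
  5] [::]); (6913%num, Nd 11 [:: 0; 4; 5; 2] [::]); (27649%num, Nd 5 [:: 0; 2; 5] [::])]);
  (7696%num, Nd 3 [:: 2; 0; 5] [:: (4897%num, Nd 4 [:: 2; 0; 4] [::]); (4900%num, Nd 4 [:: 2; 0; 4]
  [::]); (4816%num, Nd 4 [:: 2; 0; 4] [::]); (6928%num, Nd 12 [:: 2; 4; 5; 0] [::]); (29200%num, Nd
  4 [:: 2; 0; 4] [::])])]); (484%num, Nd 0 [:: 1; 2] [:: (457%num, Nd 3 [:: 1; 2; 0] [:: (397%num,
  Nd 5 [:: 1; 0; 3] [:: (1828%num, Nd 12 [:: 1; 0; 3; 2] [::])]); (436%num, Nd 4 [:: 1; 2; 3] [::
  (1801%num, Nd 11 [:: 1; 2; 3; 0] [::])]); (1924%num, Nd 4 [:: 1; 2; 3] [:: (1732%num, Nd 16 [::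
  1; 3; 4; 0; 2] [::])]); (1732%num, Nd 5 [:: 1; 0; 3] [:: (1924%num, Nd 16 [:: 1; 3; 4; 0; 2]
  [::])])]); (397%num, Nd 3 [:: 1; 2; 3] [:: (301%num, Nd 4 [:: 1; 0; 2] [:: (1732%num, Nd 11 [::
  1; 0; 2; 3] [::])]); (457%num, Nd 5 [:: 1; 0; 3] [:: (1828%num, Nd 12 [:: 1; 0; 3; 2] [::])]);
  (1801%num, Nd 5 [:: 1; 0; 3] [:: (1549%num, Nd 16 [:: 1; 0; 4; 3; 2] [::])]); (1549%num, Nd 4 [::
  1; 0; 2] [:: (1801%num, Nd 16 [:: 1; 0; 4; 3; 2] [::])])]); (481%num, Nd 3 [:: 2; 3; 1] [::
  (301%num, Nd 5 [:: 2; 0; 1] [:: (1936%num, Nd 12 [:: 2; 0; 1; 3] [::])]); (433%num, Nd 4 [:: 2;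
  0; 3] [:: (1828%num, Nd 11 [:: 2; 0; 3; 1] [::])]); (1825%num, Nd 5 [:: 2; 0; 1] [:: (1585%num,
  Nd 16 [:: 2; 0; 4; 1; 3] [::])]); (1585%num, Nd 4 [:: 2; 0; 3] [:: (1825%num, Nd 16 [:: 2; 0; 4;
  1; 3] [::])])]); (433%num, Nd 3 [:: 2; 0; 1] [:: (481%num, Nd 4 [:: 2; 0; 3] [:: (1828%num, Nd 11
  [:: 2; 0; 3; 1] [::])]); (436%num, Nd 5 [:: 2; 1; 3] [:: (1585%num, Nd 12 [:: 2; 1; 3; 0]
  [::])]); (1936%num, Nd 4 [:: 2; 0; 3] [:: (1744%num, Nd 16 [:: 2; 3; 4; 1; 0] [::])]); (1744%num,
  Nd 5 [:: 2; 1; 3] [:: (1936%num, Nd 16 [:: 2; 3; 4; 1; 0] [::])])]); (1801%num, Nd 3 [:: 1; 2; 0]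
  [:: (1165%num, Nd 5 [:: 1; 0; 3] [:: (1549%num, Nd 16 [:: 1; 0; 4; 3; 2] [::])]); (1549%num, Nd
  12 [:: 1; 0; 4; 2] [:: (1165%num, Nd 16 [:: 1; 0; 4; 3; 2] [::])]); (1204%num, Nd 11 [:: 1; 2; 3;
  0] [:: (1588%num, Nd 16 [:: 1; 2; 3; 0; 4] [::])]); (1588%num, Nd 4 [:: 1; 2; 4] [:: (1204%num,
  Nd 16 [:: 1; 2; 3; 0; 4] [::])]); (1732%num, Nd 4 [:: 1; 2; 4] [:: (1225%num, Nd 5 [:: 1; 0; 3]
  [::]); (1165%num, Nd 5 [:: 1; 0; 3] [::]); (7177%num, Nd 5 [:: 1; 0; 3] [::]); (6340%num, Nd 5
  [:: 1; 0; 3] [::])]); (6340%num, Nd 5 [:: 1; 0; 3] [::]); (7684%num, Nd 4 [:: 1; 2; 4] [::])]);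
  (1549%num, Nd 3 [:: 1; 2; 4] [:: (1069%num, Nd 4 [:: 1; 0; 2] [::]); (1165%num, Nd 4 [:: 1; 0; 2]
  [:: (1801%num, Nd 16 [:: 1; 0; 4; 3; 2] [::])]); (1801%num, Nd 12 [:: 1; 0; 4; 2] [:: (1165%num,
  Nd 16 [:: 1; 0; 4; 3; 2] [::])]); (6157%num, Nd 4 [:: 1; 0; 2] [::])]); (1825%num, Nd 3 [:: 2; 4;
  1] [:: (1069%num, Nd 5 [:: 2; 0; 1] [::]); (1249%num, Nd 5 [:: 2; 0; 1] [:: (1585%num, Nd 16 [::
  2; 0; 4; 1; 3] [::])]); (1585%num, Nd 11 [:: 2; 0; 4; 1] [:: (1249%num, Nd 16 [:: 2; 0; 4; 1; 3]
  [::])]); (7201%num, Nd 5 [:: 2; 0; 1] [::])]); (1585%num, Nd 3 [:: 2; 0; 1] [:: (1249%num, Nd 4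
  [:: 2; 0; 3] [:: (1825%num, Nd 16 [:: 2; 0; 4; 1; 3] [::])]); (1825%num, Nd 11 [:: 2; 0; 4; 1]
  [:: (1249%num, Nd 16 [:: 2; 0; 4; 1; 3] [::])]); (1204%num, Nd 12 [:: 2; 1; 3; 0] [:: (1588%num,
  Nd 16 [:: 2; 1; 3; 4; 0] [::])]); (1588%num, Nd 5 [:: 2; 1; 4] [:: (1204%num, Nd 16 [:: 2; 1; 3;
  4; 0] [::])]); (1936%num, Nd 4 [:: 2; 0; 3] [:: (1828%num, Nd 5 [:: 2; 1; 4] [::]); (1588%num, Nd
  5 [:: 2; 1; 4] [::]); (7204%num, Nd 5 [:: 2; 1; 4] [::]); (6928%num, Nd 5 [:: 2; 1; 4] [::])]);
  (7312%num, Nd 4 [:: 2; 0; 3] [::]); (6928%num, Nd 5 [:: 2; 1; 4] [::])]); (1924%num, Nd 3 [:: 1;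
  2; 4] [:: (1225%num, Nd 4 [:: 1; 2; 3] [:: (1732%num, Nd 16 [:: 1; 3; 4; 0; 2] [::])]);
  (1204%num, Nd 4 [:: 1; 2; 3] [::]); (1732%num, Nd 12 [:: 1; 3; 4; 2] [:: (1225%num, Nd 16 [:: 1;
  3; 4; 0; 2] [::])]); (7300%num, Nd 4 [:: 1; 2; 3] [::])]); (1732%num, Nd 3 [:: 1; 2; 3] [::
  (1069%num, Nd 11 [:: 1; 0; 2; 3] [:: (1588%num, Nd 16 [:: 1; 2; 0; 3; 4] [::])]); (1225%num, Nd 5
  [:: 1; 0; 3] [:: (1924%num, Nd 16 [:: 1; 3; 4; 0; 2] [::])]); (1801%num, Nd 4 [:: 1; 2; 4] [::
  (1225%num, Nd 5 [:: 1; 0; 3] [::]); (1165%num, Nd 5 [:: 1; 0; 3] [::]); (7177%num, Nd 5 [:: 1; 0;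
  3] [::]); (6340%num, Nd 5 [:: 1; 0; 3] [::])]); (1588%num, Nd 4 [:: 1; 2; 4] [:: (1069%num, Nd 16
  [:: 1; 2; 0; 3; 4] [::])]); (1924%num, Nd 12 [:: 1; 3; 4; 2] [:: (1225%num, Nd 16 [:: 1; 3; 4; 0;
  2] [::])]); (7177%num, Nd 5 [:: 1; 0; 3] [::]); (7684%num, Nd 4 [:: 1; 2; 4] [::])]); (1936%num,
  Nd 3 [:: 2; 3; 1] [:: (1069%num, Nd 12 [:: 2; 0; 1; 3] [:: (1588%num, Nd 16 [:: 2; 1; 0; 4; 3]
  [::])]); (1201%num, Nd 4 [:: 2; 0; 3] [:: (1744%num, Nd 16 [:: 2; 3; 4; 1; 0] [::])]); (1585%num,
  Nd 4 [:: 2; 0; 3] [:: (1828%num, Nd 5 [:: 2; 1; 4] [::]); (1588%num, Nd 5 [:: 2; 1; 4] [::]);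
  (7204%num, Nd 5 [:: 2; 1; 4] [::]); (6928%num, Nd 5 [:: 2; 1; 4] [::])]); (1588%num, Nd 5 [:: 2;
  1; 4] [:: (1069%num, Nd 16 [:: 2; 1; 0; 4; 3] [::])]); (1744%num, Nd 11 [:: 2; 3; 4; 1] [::
  (1201%num, Nd 16 [:: 2; 3; 4; 1; 0] [::])]); (6193%num, Nd 4 [:: 2; 0; 3] [::]); (6928%num, Nd 5
  [:: 2; 1; 4] [::])]); (1744%num, Nd 3 [:: 2; 4; 1] [:: (1201%num, Nd 5 [:: 2; 1; 3] [::
  (1936%num, Nd 16 [:: 2; 3; 4; 1; 0] [::])]); (1204%num, Nd 5 [:: 2; 1; 3] [::]); (1936%num, Nd 11
  [:: 2; 3; 4; 1] [:: (1201%num, Nd 16 [:: 2; 3; 4; 1; 0] [::])]); (6352%num, Nd 5 [:: 2; 1; 3]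
  [::])]); (7684%num, Nd 3 [:: 1; 2; 5] [:: (4873%num, Nd 4 [:: 1; 2; 4] [::]); (4660%num, Nd 4 [::
  1; 2; 4] [::]); (4804%num, Nd 4 [:: 1; 2; 4] [::]); (6916%num, Nd 12 [:: 1; 4; 5; 2] [::]);
  (29188%num, Nd 4 [:: 1; 2; 4] [::])]); (7696%num, Nd 3 [:: 2; 4; 1] [:: (6193%num, Nd 5 [:: 2; 1;
  5] [::]); (6196%num, Nd 5 [:: 2; 1; 5] [::]); (7312%num, Nd 5 [:: 2; 1; 5] [::]); (6928%num, Nd
  11 [:: 2; 4; 5; 1] [::]); (27664%num, Nd 5 [:: 2; 1; 5] [::])])]); (436%num, Nd 0 [:: 1; 2] [::
  (457%num, Nd 3 [:: 1; 3; 0] [:: (301%num, Nd 5 [:: 1; 0; 2] [:: (1924%num, Nd 12 [:: 1; 0; 2; 3]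
  [::])]); (484%num, Nd 4 [:: 1; 2; 3] [:: (1801%num, Nd 11 [:: 1; 2; 3; 0] [::])]); (1828%num, Nd
  4 [:: 1; 2; 3] [:: (1588%num, Nd 16 [:: 1; 2; 4; 0; 3] [::])]); (1588%num, Nd 5 [:: 1; 0; 2] [::
  (1828%num, Nd 16 [:: 1; 2; 4; 0; 3] [::])])]); (397%num, Nd 3 [:: 1; 0; 2] [:: (457%num, Nd 3 [::
  1; 3; 0] [::]); (481%num, Nd 9 [:: 0; 1; 2; 3] [::]); (484%num, Nd 3 [:: 1; 2; 3] [::]);
  (1801%num, Nd 3 [:: 1; 3; 0] [::]); (1828%num, Nd 3 [:: 1; 2; 3] [::]); (1924%num, Nd 3 [:: 1; 3;
  0] [::]); (1732%num, Nd 3 [:: 1; 2; 3] [::])]); (481%num, Nd 3 [:: 2; 0; 3] [:: (301%num, Nd 3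
  [:: 2; 1; 0] [::]); (397%num, Nd 9 [:: 0; 1; 2; 3] [::]); (484%num, Nd 3 [:: 2; 3; 1] [::]);
  (1825%num, Nd 3 [:: 2; 1; 0] [::]); (1828%num, Nd 3 [:: 2; 3; 1] [::]); (1588%num, Nd 3 [:: 2; 1;
  0] [::]); (1936%num, Nd 3 [:: 2; 3; 1] [::])]); (433%num, Nd 3 [:: 2; 0; 3] [:: (301%num, Nd 4
  [:: 2; 0; 1] [:: (1744%num, Nd 11 [:: 2; 0; 1; 3] [::])]); (484%num, Nd 5 [:: 2; 1; 3] [::
  (1585%num, Nd 12 [:: 2; 1; 3; 0] [::])]); (1828%num, Nd 5 [:: 2; 1; 3] [:: (1588%num, Nd 16 [::
  2; 1; 4; 3; 0] [::])]); (1588%num, Nd 4 [:: 2; 0; 1] [:: (1828%num, Nd 16 [:: 2; 1; 4; 3; 0]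
  [::])])]); (1801%num, Nd 3 [:: 1; 3; 0] [:: (1069%num, Nd 5 [:: 1; 0; 2] [::]); (1252%num, Nd 11
  [:: 1; 2; 3; 0] [:: (1588%num, Nd 16 [:: 1; 2; 3; 0; 4] [::])]); (1588%num, Nd 5 [:: 1; 0; 2] [::
  (1252%num, Nd 16 [:: 1; 2; 3; 0; 4] [::])]); (6196%num, Nd 5 [:: 1; 0; 2] [::])]); (1549%num, Nd
  3 [:: 1; 0; 2] [::]); (1825%num, Nd 3 [:: 2; 1; 0] [::]); (1585%num, Nd 3 [:: 2; 0; 3] [::
  (1069%num, Nd 4 [:: 2; 0; 1] [::]); (1252%num, Nd 12 [:: 2; 1; 3; 0] [:: (1588%num, Nd 16 [:: 2;
  1; 3; 4; 0] [::])]); (1588%num, Nd 4 [:: 2; 0; 1] [:: (1252%num, Nd 16 [:: 2; 1; 3; 4; 0]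
  [::])]); (6196%num, Nd 4 [:: 2; 0; 1] [::])]); (1924%num, Nd 3 [:: 1; 3; 0] [:: (1069%num, Nd 12
  [:: 1; 0; 2; 3] [:: (1828%num, Nd 16 [:: 1; 2; 0; 4; 3] [::])]); (1252%num, Nd 4 [:: 1; 2; 3]
  [::]); (1828%num, Nd 4 [:: 1; 2; 3] [:: (1069%num, Nd 16 [:: 1; 2; 0; 4; 3] [::])]); (7204%num,
  Nd 4 [:: 1; 2; 3] [::])]); (1732%num, Nd 3 [:: 1; 2; 3] [::]); (1936%num, Nd 3 [:: 2; 3; 1]
  [::]); (1744%num, Nd 3 [:: 2; 0; 3] [:: (1069%num, Nd 11 [:: 2; 0; 1; 3] [:: (1828%num, Nd 16 [::
  2; 1; 0; 3; 4] [::])]); (1252%num, Nd 5 [:: 2; 1; 3] [::]); (1828%num, Nd 5 [:: 2; 1; 3] [::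
  (1069%num, Nd 16 [:: 2; 1; 0; 3; 4] [::])]); (7204%num, Nd 5 [:: 2; 1; 3] [::])])]); (1921%num,
  Nd 3 [:: 0; 1; 4] [:: (1069%num, Nd 11 [:: 0; 1; 2; 4] [:: (1165%num, Nd 12 [:: 0; 1; 2; 3] [::
  (1801%num, Nd 16 [:: 0; 1; 2; 4; 3] [::])]); (1201%num, Nd 12 [:: 0; 1; 2; 3] [:: (1825%num, Nd
  16 [:: 0; 2; 1; 4; 3] [::])]); (1729%num, Nd 15 [:: 0; 1; 2; 3; 4] [::]); (7297%num, Nd 12 [:: 0;
  1; 2; 3] [::])]); (1165%num, Nd 3 [:: 0; 3; 2] [:: (1069%num, Nd 12 [:: 0; 1; 2; 3] [::
  (1801%num, Nd 16 [:: 0; 1; 2; 4; 3] [::])]); (1225%num, Nd 4 [:: 0; 1; 3] [::]); (1801%num, Nd 4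
  [:: 0; 1; 3] [:: (1069%num, Nd 16 [:: 0; 1; 2; 4; 3] [::])]); (7177%num, Nd 4 [:: 0; 1; 3]
  [::])]); (1249%num, Nd 3 [:: 0; 3; 2] [::]); (1201%num, Nd 3 [:: 0; 3; 2] [:: (1069%num, Nd 12
  [:: 0; 1; 2; 3] [:: (1825%num, Nd 16 [:: 0; 2; 1; 4; 3] [::])]); (1225%num, Nd 4 [:: 0; 1; 3] [::
  (1729%num, Nd 16 [:: 0; 3; 4; 2; 1] [::])]); (1801%num, Nd 4 [:: 0; 1; 3] [:: (1825%num, Nd 5 [::
  0; 2; 4] [::]); (1585%num, Nd 5 [:: 0; 2; 4] [::]); (6193%num, Nd 5 [:: 0; 2; 4] [::]);
  (6913%num, Nd 5 [:: 0; 2; 4] [::])]); (1825%num, Nd 5 [:: 0; 2; 4] [:: (1069%num, Nd 16 [:: 0; 2;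
  1; 4; 3] [::])]); (1729%num, Nd 11 [:: 0; 3; 4; 2] [:: (1225%num, Nd 16 [:: 0; 3; 4; 2; 1]
  [::])]); (7177%num, Nd 4 [:: 0; 1; 3] [::]); (6913%num, Nd 5 [:: 0; 2; 4] [::])]); (1585%num, Nd
  3 [:: 0; 3; 2] [:: (1801%num, Nd 5 [:: 0; 2; 4] [:: (1729%num, Nd 16 [:: 0; 4; 3; 2; 1] [::])]);
  (1825%num, Nd 5 [:: 0; 2; 4] [::]); (1729%num, Nd 11 [:: 0; 3; 4; 2] [:: (1801%num, Nd 16 [:: 0;
  4; 3; 2; 1] [::])]); (6913%num, Nd 5 [:: 0; 2; 4] [::])]); (1729%num, Nd 11 [:: 0; 3; 4; 2] [::
  (1069%num, Nd 15 [:: 0; 1; 2; 3; 4] [::]); (1225%num, Nd 12 [:: 0; 3; 4; 1] [:: (1201%num, Nd 16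
  [:: 0; 3; 4; 2; 1] [::])]); (1801%num, Nd 12 [:: 0; 3; 4; 1] [:: (1585%num, Nd 16 [:: 0; 4; 3; 2;
  1] [::])]); (7177%num, Nd 12 [:: 0; 3; 4; 1] [::])]); (6193%num, Nd 3 [:: 0; 3; 2] [:: (4873%num,
  Nd 5 [:: 0; 2; 4] [::]); (4897%num, Nd 5 [:: 0; 2; 4] [::]); (4801%num, Nd 11 [:: 0; 3; 4; 2]
  [::]); (6913%num, Nd 5 [:: 0; 2; 4] [::]); (25345%num, Nd 5 [:: 0; 2; 4] [::])]); (7297%num, Nd 3
  [:: 0; 3; 2] [:: (4141%num, Nd 12 [:: 0; 1; 2; 3] [::]); (4297%num, Nd 4 [:: 0; 1; 3] [::]);
  (4873%num, Nd 4 [:: 0; 1; 3] [::]); (7177%num, Nd 4 [:: 0; 1; 3] [::]); (28681%num, Nd 4 [:: 0;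
  1; 3] [::])])]); (1924%num, Nd 3 [:: 1; 2; 4] [:: (1069%num, Nd 11 [:: 1; 0; 2; 4] [:: (1225%num,
  Nd 12 [:: 1; 0; 2; 3] [:: (1549%num, Nd 16 [:: 1; 0; 2; 4; 3] [::])]); (1204%num, Nd 12 [:: 1; 0;
  2; 3] [:: (1828%num, Nd 16 [:: 1; 2; 0; 4; 3] [::])]); (1732%num, Nd 15 [:: 1; 0; 2; 3; 4] [::]);
  (7300%num, Nd 12 [:: 1; 0; 2; 3] [::])]); (1225%num, Nd 3 [:: 1; 3; 0] [:: (1069%num, Nd 12 [::
  1; 0; 2; 3] [:: (1549%num, Nd 16 [:: 1; 0; 2; 4; 3] [::])]); (1549%num, Nd 5 [:: 1; 0; 4] [::
  (1069%num, Nd 16 [:: 1; 0; 2; 4; 3] [::])]); (1252%num, Nd 4 [:: 1; 2; 3] [:: (1732%num, Nd 16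
  [:: 1; 3; 4; 0; 2] [::])]); (1828%num, Nd 4 [:: 1; 2; 3] [:: (1801%num, Nd 5 [:: 1; 0; 4] [::]);
  (1549%num, Nd 5 [:: 1; 0; 4] [::]); (7177%num, Nd 5 [:: 1; 0; 4] [::]); (6916%num, Nd 5 [:: 1; 0;
  4] [::])]); (1732%num, Nd 11 [:: 1; 3; 4; 0] [:: (1252%num, Nd 16 [:: 1; 3; 4; 0; 2] [::])]);
  (7204%num, Nd 4 [:: 1; 2; 3] [::]); (6916%num, Nd 5 [:: 1; 0; 4] [::])]); (1165%num, Nd 3 [:: 1;
  3; 0] [::]); (1801%num, Nd 3 [:: 1; 3; 0] [:: (1549%num, Nd 5 [:: 1; 0; 4] [::]); (1828%num, Nd 5
  [:: 1; 0; 4] [:: (1732%num, Nd 16 [:: 1; 4; 3; 0; 2] [::])]); (1732%num, Nd 11 [:: 1; 3; 4; 0]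
  [:: (1828%num, Nd 16 [:: 1; 4; 3; 0; 2] [::])]); (6916%num, Nd 5 [:: 1; 0; 4] [::])]); (1204%num,
  Nd 3 [:: 1; 3; 0] [:: (1069%num, Nd 12 [:: 1; 0; 2; 3] [:: (1828%num, Nd 16 [:: 1; 2; 0; 4; 3]
  [::])]); (1252%num, Nd 4 [:: 1; 2; 3] [::]); (1828%num, Nd 4 [:: 1; 2; 3] [:: (1069%num, Nd 16
  [:: 1; 2; 0; 4; 3] [::])]); (7204%num, Nd 4 [:: 1; 2; 3] [::])]); (1732%num, Nd 11 [:: 1; 3; 4;
  0] [:: (1069%num, Nd 15 [:: 1; 0; 2; 3; 4] [::]); (1252%num, Nd 12 [:: 1; 3; 4; 2] [:: (1225%num,
  Nd 16 [:: 1; 3; 4; 0; 2] [::])]); (1828%num, Nd 12 [:: 1; 3; 4; 2] [:: (1801%num, Nd 16 [:: 1; 4;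
  3; 0; 2] [::])]); (7204%num, Nd 12 [:: 1; 3; 4; 2] [::])]); (7177%num, Nd 3 [:: 1; 3; 0] [::
  (4621%num, Nd 5 [:: 1; 0; 4] [::]); (4900%num, Nd 5 [:: 1; 0; 4] [::]); (4804%num, Nd 11 [:: 1;
  3; 4; 0] [::]); (6916%num, Nd 5 [:: 1; 0; 4] [::]); (25348%num, Nd 5 [:: 1; 0; 4] [::])]);
  (7300%num, Nd 3 [:: 1; 3; 0] [:: (4141%num, Nd 12 [:: 1; 0; 2; 3] [::]); (4324%num, Nd 4 [:: 1;
  2; 3] [::]); (4900%num, Nd 4 [:: 1; 2; 3] [::]); (7204%num, Nd 4 [:: 1; 2; 3] [::]); (28708%num,
  Nd 4 [:: 1; 2; 3] [::])])]); (1936%num, Nd 3 [:: 2; 0; 4] [:: (1069%num, Nd 11 [:: 2; 0; 1; 4]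
  [:: (1249%num, Nd 12 [:: 2; 0; 1; 3] [:: (1585%num, Nd 16 [:: 2; 0; 1; 4; 3] [::])]); (1252%num,
  Nd 12 [:: 2; 0; 1; 3] [:: (1588%num, Nd 16 [:: 2; 1; 0; 4; 3] [::])]); (1744%num, Nd 15 [:: 2; 0;
  1; 3; 4] [::]); (7312%num, Nd 12 [:: 2; 0; 1; 3] [::])]); (1249%num, Nd 3 [:: 2; 3; 1] [::
  (1069%num, Nd 12 [:: 2; 0; 1; 3] [:: (1585%num, Nd 16 [:: 2; 0; 1; 4; 3] [::])]); (1201%num, Nd 4
  [:: 2; 0; 3] [::]); (1585%num, Nd 4 [:: 2; 0; 3] [:: (1069%num, Nd 16 [:: 2; 0; 1; 4; 3] [::])]);
  (6193%num, Nd 4 [:: 2; 0; 3] [::])]); (1252%num, Nd 3 [:: 2; 3; 1] [:: (1069%num, Nd 12 [:: 2; 0;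
  1; 3] [:: (1588%num, Nd 16 [:: 2; 1; 0; 4; 3] [::])]); (1201%num, Nd 4 [:: 2; 0; 3] [::
  (1744%num, Nd 16 [:: 2; 3; 4; 1; 0] [::])]); (1585%num, Nd 4 [:: 2; 0; 3] [:: (1828%num, Nd 5 [::
  2; 1; 4] [::]); (1588%num, Nd 5 [:: 2; 1; 4] [::]); (7204%num, Nd 5 [:: 2; 1; 4] [::]);
  (6928%num, Nd 5 [:: 2; 1; 4] [::])]); (1588%num, Nd 5 [:: 2; 1; 4] [:: (1069%num, Nd 16 [:: 2; 1;
  0; 4; 3] [::])]); (1744%num, Nd 11 [:: 2; 3; 4; 1] [:: (1201%num, Nd 16 [:: 2; 3; 4; 1; 0]
  [::])]); (6193%num, Nd 4 [:: 2; 0; 3] [::]); (6928%num, Nd 5 [:: 2; 1; 4] [::])]); (1204%num, Nd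
  3 [:: 2; 3; 1] [::]); (1828%num, Nd 3 [:: 2; 3; 1] [:: (1585%num, Nd 5 [:: 2; 1; 4] [::
  (1744%num, Nd 16 [:: 2; 4; 3; 1; 0] [::])]); (1588%num, Nd 5 [:: 2; 1; 4] [::]); (1744%num, Nd 11
  [:: 2; 3; 4; 1] [:: (1585%num, Nd 16 [:: 2; 4; 3; 1; 0] [::])]); (6928%num, Nd 5 [:: 2; 1; 4]
  [::])]); (1744%num, Nd 11 [:: 2; 3; 4; 1] [:: (1069%num, Nd 15 [:: 2; 0; 1; 3; 4] [::]);
  (1201%num, Nd 12 [:: 2; 3; 4; 0] [:: (1252%num, Nd 16 [:: 2; 3; 4; 1; 0] [::])]); (1585%num, Nd
  12 [:: 2; 3; 4; 0] [:: (1828%num, Nd 16 [:: 2; 4; 3; 1; 0] [::])]); (6193%num, Nd 12 [:: 2; 3; 4;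
  0] [::])]); (7204%num, Nd 3 [:: 2; 3; 1] [:: (4657%num, Nd 5 [:: 2; 1; 4] [::]); (4660%num, Nd 5
  [:: 2; 1; 4] [::]); (4816%num, Nd 11 [:: 2; 3; 4; 1] [::]); (6928%num, Nd 5 [:: 2; 1; 4] [::]);
  (25360%num, Nd 5 [:: 2; 1; 4] [::])]); (7312%num, Nd 3 [:: 2; 3; 1] [:: (4141%num, Nd 12 [:: 2;
  0; 1; 3] [::]); (4273%num, Nd 4 [:: 2; 0; 3] [::]); (4657%num, Nd 4 [:: 2; 0; 3] [::]);
  (6193%num, Nd 4 [:: 2; 0; 3] [::]); (24625%num, Nd 4 [:: 2; 0; 3] [::])])])].

(** * The checker for the search trees *)

Definition fN (f : fam) : seq (seq g4) := [seq dec (f_m f) x.1 | x <- f_N f].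
Definition fS (f : fam) : seq (seq g4) := [seq dec (f_m f) x.1.1 | x <- f_S f].

Fixpoint perm_code n (c : BinNums.N) : seq nat :=
  if n is n'.+1 then N.to_nat (N.modulo c 8) :: perm_code n' (N.div c 8) else [::].

Record pattern := Pattern { pt_m : nat; pt_q : seq (seq g4); pt_sc : seq (seq g4) }.

Definition pattern_of m q := Pattern m q (scols m q).

Definition pattern_ok (p : pattern) : bool :=
  if allf (fun r => size r == pt_m p) (pt_q p) then
    perm_eq (pt_sc p) (map (gcol (pt_q p)) (iota 0 (pt_m p))) else false.

Definition add_variant (e : entry) (ptrie : trie pattern) (v : BinNums.N * BinNums.N) :=
  let rows := rows_of e in let n := size rows in
  let perm := perm_code n v.1 in let sc := dec n v.2 in
  if perm_eq perm (iota 0 n) then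
    if allf (fun c => c != g0) sc then
      let p := pattern_of (e_m e) (variant rows perm sc) in
      if pattern_ok p then tadd (qkey (pt_sc p)) p ptrie else ptrie
    else ptrie
  else ptrie.

(** Certificates and variants are checked before insertion and dropped if a check fails, so whatever
    is found in the trie is a verified obstruction. *)
Definition pattern_trie : trie pattern :=
  foldl (fun t v => let e := nth (Entry 0 6 [::] [::] [::] [::] [::]) table (N.to_nat v.1) in
    if entry_ok e then foldl (add_variant e) t v.2 else t) TE variants.

Definition bad_config (T : trie pattern) k (q : seq (seq g4)) : bool :=
  let sc := scols k q in
  if tfind (qkey sc) T is Some p then
    if sc == pt_sc p then size q == size (pt_q p) else false
  else false.

(** The vector [l] is rejected when it forms a stored pattern together with one to four of the
    vectors chosen before. *)
Definition isbad T k (L : seq (seq g4)) (l : seq g4) : bool :=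
  hasf (fun n => hasf (fun s => bad_config T k (l :: s)) (subs n L)) [:: 1; 2; 3; 4].

Definition gle (x y : g4) := N.leb (gcode x) (gcode y).

(* The ways to spread [p] over [k] old coordinates followed by new ones. *)
Fixpoint place k (p : seq g4) : seq (seq g4) :=
  if k is k'.+1 then
    map (cons g0) (place k' p) ++ (if p is x :: p' then map (cons x) (place k' p') else [::])
  else [:: p].

Definition outs (pi : seq nat) (l : seq g4) : seq nat :=
  [seq i <- iota 0 (size l) | (i \notin pi) && (nth g0 l i != g0)].

Definition infam (f : fam) (pi : seq nat) (l : seq g4) : bool :=
  let core := [seq nth g0 l i | i <- pi] in
  match outs pi l with
  | [::] => hasf (fun c => vscale c core \in fN f) gunits
  | [:: i] => hasf (fun c => if gmul c (nth g0 l i) == g1 then vscale c core \in fS f else false)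
                gunits
  | _ => false
  end.

Fixpoint lookup (c : BinNums.N) (ch : seq (BinNums.N * tree)) : option tree :=
  if ch is (c', t) :: ch' then if N.eqb c c' then Some t else lookup c ch' else None.

Definition fam0 := Fam 0 [::] [::].

Section Search.
Variables (T : trie pattern) (rmax : nat) (pats : seq (seq g4)).

(** A node passes if each admissible vector outside its family leads to a child or is bad with
    earlier vectors. Requiring sorted entries on the new vertices loses nothing, since these can be
    listed in any order; [root_check] justifies the bound [rmax] on their number. The argument [n]
    is fuel. *)
Fixpoint run n t k L : bool :=
  if n is n'.+1 then
    let: Nd fi pi ch := t in
    let f := nth fam0 families fi in
    if uniq pi && all (fun i => i < k) pi && (size pi == f_m f) then
      allf (fun p => allf (fun l =>
        if (size l - k <= rmax) && sorted gle (drop k l) then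
          if infam f pi l then true else
          if lookup (enc l) ch is Some t' then run n' t' (size l) (l :: L)
          else isbad T (size l) L l
        else true) (place k p)) pats
    else false
  else false.

(** Bounds how far a vector can stray from the start: with more than [rmax] vertices outside those
    of [start], it is already bad together with [start]. *)
Definition root_check (start : seq g4) : bool :=
  allf (fun p => allf (fun l =>
    if (size l - size start <= rmax) || ~~ sorted gle (drop (size start) l) then true
    else isbad T (size l) [:: start] l) (place (size start) p)) pats.

End Search.

Fixpoint uvecs n : seq (seq g4) :=
  if n is n'.+1 then flatten [seq map (cons x) (uvecs n') | x <- gunits] else [:: [::]].

Definition gsum (l : seq g4) : g4 := foldr gadd g0 l.

Definition pats3 := [seq p <- map (cons g1) (uvecs 2) | gsum p == g0].
(** The constant pattern is absent because [config_small] rules it out. *)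
Definition pats4 := [seq p <- map (cons g1) (uvecs 3) | (gsum p == g0) && ~~ constant p].

Definition start3 := [:: g1; ga; gb].
Definition start4 := [:: g1; g1; ga; ga].

Lemma root4_ok : root_check pattern_trie 1 (pats3 ++ pats4) start4.
Proof. by vm_cast_no_check (erefl true). Qed.

Lemma run4_ok : run pattern_trie 1 (pats3 ++ pats4) 12 tree4 (size start4) [:: start4].
Proof. by vm_cast_no_check (erefl true). Qed.

Lemma root3_ok : root_check pattern_trie 2 pats3 start3.
Proof. by vm_cast_no_check (erefl true). Qed.

Lemma run3_ok : run pattern_trie 2 pats3 12 tree3 (size start3) [:: start3].
Proof. by vm_cast_no_check (erefl true). Qed.

Lemma foldl_inv (S T : Type) (P : T -> Prop) (f : T -> S -> T) :
  (forall t x, P t -> P (f t x)) -> forall s t, P t -> P (foldl f t s).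
Proof. by move=> h; elim=> //= x s IH t Pt; apply/IH/h. Qed.

Lemma mem_uvecs n l : (l \in uvecs n) = (size l == n) && all (fun x => x != g0) l.
Proof.
elim: n l => [|n IH] l /=; first by case: l.
apply/idP/andP=> [|[]].
  rewrite !mem_cat in_nil orbF => /or3P[] /mapP[l' + ->]; rewrite IH => /andP[/eqP<- h] /=;
  by rewrite eqxx h.
case: l => // x l; rewrite eqSS => sl /=/andP[x0 al].
have lu : l \in uvecs n by rewrite IH sl al.
by rewrite !mem_cat; case: x x0 => // _; rewrite map_f ?orbT.
Qed.

Lemma gle_total : total gle. Proof. by case; case. Qed.
Lemma gle_trans : transitive gle. Proof. by case; case; case. Qed.

Lemma place_complete k l : all (fun x => x != g0) (drop k l) -> k <= size l ->
  l \in place k [seq x <- l | x != g0].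
Proof.
elim: k l => [|k IH] l /=; first by rewrite drop0 => h _; rewrite mem_seq1 (all_filterP h).
case: l => // x l /= h lt; rewrite mem_cat; case: eqP => [->|nx] /=.
  by rewrite map_f ?IH.
by rewrite map_f ?orbT ?IH.
Qed.

(** * Bounding the support of a vector *)

Section SearchSound.
Variables (F4 : finFieldType) (cardF4 : #|F4| = 4) (a : F4).
Hypothesis a_def : (a ^+ 2 = a + 1)%R.
Local Notation gval := (gval a).
Local Notation gcof := (gcof a).
Local Notation emb := (emb a).
Local Open Scope ring_scope.
Variable V : finType.

Lemma gval_unit c : c \in gunits -> gval c != 0.
Proof. by rewrite (gval_eq0 a_def) !inE; case: c. Qed.

Lemma emb_cat (xs zs : seq V) l : (size l <= size xs)%N -> emb (xs ++ zs) l = emb xs l.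
Proof.
move=> sl; apply/ffunP=> x; rewrite !ffunE index_cat; case: ifP => // nx.
rewrite !nth_default //; first by rewrite (leq_trans sl) // leqNgt index_mem nx.
by rewrite (leq_trans sl) // leq_addr.
Qed.

Lemma emb_map (s : seq V) (g : V -> F4) (u : {ffun V -> F4^o}) :
  (forall x, x \in s -> g x = u x) -> (forall x, x \notin s -> u x = 0) ->
  emb s [seq gcof (g x) | x <- s] = u.
Proof.
move=> gs u0; apply/ffunP=> x; rewrite ffunE; have [xs|xs] := boolP (x \in s).
  by rewrite (nth_map x) ?index_mem // nth_index // (gcofK cardF4 a_def) gs.
by rewrite nth_default ?u0 // size_map leqNgt index_mem.
Qed.

Lemma gval_sum l : gval (gsum l) = \sum_(x <- l) gval x.
Proof.
by elim: l => [|x l IH] /=; rewrite ?big_nil ?big_cons // (gvalD cardF4 a_def) IH.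
Qed.

Section Fixed.
Variables (D : {set V}) (I : finType) (w : I -> {ffun V -> F4^o}).
Hypothesis cw : config a D w.

Lemma gsum_supp i (c : F4) s : uniq s -> s =i supp (w i) -> gsum [seq gcof (c * w i x) | x <- s] = g0.
Proof.
move=> U es; apply/eqP; rewrite -(gval_eq0 a_def) gval_sum big_map.
under eq_bigr => x _ do rewrite (gcofK cardF4 a_def).
rewrite -mulr_sumr; have := config_sum cw i; rewrite (bigID [in s]) /=.
rewrite [X in _ + X]big1 ?addr0; last by move=> x; rewrite es inE negbK => /eqP.
by rewrite -big_uniq //= => ->; rewrite mulr0.
Qed.

Lemma supp_D i : {subset supp (w i) <= D}.
Proof.
by move=> x; rewrite inE; apply: contraNT => xD; rewrite (config_supp cw).
Qed.

Definition single_bad e l := hasf (fun c => qmatch (e_m e) [:: vscale c l] (rows_of e)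
  (scols (e_m e) (rows_of e))) gunits.

Lemma single_badP e xs l : entry_ok e -> pattern_ok (pattern_of (e_m e) (rows_of e)) ->
  single_bad e l -> uniq xs -> {subset xs <= D} -> size xs = e_m e -> (size l <= e_m e)%N ->
  has_vec w (emb xs l) -> False.
Proof.
move=> eok pok; rewrite /single_bad hasfE => /hasP[c cu qm] U sD sx sl [i [k k0 wi]].
move: pok; rewrite /pattern_ok /= allfE; case: ifP => // sz psc.
have bd : Bad a D w (e_m e) (rows_of e) by apply: entry_bad cw _ eok.
apply: (match_bad bd sz psc qm U sD sx).
move=> r; rewrite inE => /eqP->; split; first by rewrite size_map.
have c0 := gval_unit cu.
exists i, (k / gval c); first by rewrite mulf_neq0 ?invr_eq0.
by rewrite wi (embZ cardF4 a_def) scalerA divfK.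
Qed.

Lemma emb_enum i : w i = emb (enum (supp (w i))) [seq gcof (w i x) | x <- enum (supp (w i))].
Proof.
rewrite (@emb_map _ (w i) (w i)) // => x.
by rewrite mem_enum inE negbK => /eqP.
Qed.

End Fixed.

Lemma single_entry n (P : pred (seq g4)) k :
  (let e := nth (Entry 0 6 [::] [::] [::] [::] [::]) table k in
   [&& entry_ok e, pattern_ok (pattern_of (e_m e) (rows_of e)), e_m e == n &
       all (fun l => P l ==> single_bad e l) (uvecs n)]) ->
  exists e, [/\ entry_ok e, pattern_ok (pattern_of (e_m e) (rows_of e)), e_m e = n &
    forall l, l \in uvecs n -> P l -> single_bad e l].
Proof.
by move=> /and4P[ok pok /eqP em /allP h]; exists (nth (Entry 0 6 [::] [::] [::] [::] [::]) table k);
  split=> // l /h /implyP.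
Qed.

Lemma entry0 : exists e, [/\ entry_ok e, pattern_ok (pattern_of (e_m e) (rows_of e)), e_m e = 4%N &
    forall l, l \in uvecs 4 -> constant l -> single_bad e l].
Proof. by apply: (@single_entry 4 constant 0); vm_compute. Qed.

Lemma entry1 : exists e, [/\ entry_ok e, pattern_ok (pattern_of (e_m e) (rows_of e)), e_m e = 5%N &
    forall l, l \in uvecs 5 -> gsum l == g0 -> single_bad e l].
Proof. by apply: (@single_entry 5 (fun l => gsum l == g0) 1); vm_compute. Qed.

(** The first two entries of [table] produce F7 from a constant vector on four vertices and from any
    zero-sum vector on five. Larger supports shrink by [config_merge]: an edge between different
    coefficients removes one vertex from the support; if all coefficients agree, any edge removes
    two and leaves a constant vector. *)
Lemma config_small (D : {set V}) (I : finType) (w : I -> {ffun V -> F4^o}) i : config a D w ->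
  (4 < #|supp (w i)|)%N || (#|supp (w i)| == 4) && constant [seq w i x | x <- enum (supp (w i))] ->
  False.
Proof.
have [n] := ubnP #|supp (w i)|; elim: n => // n IH in D I w i * => lt cw.
have [e0 [ok0 pok0 em0 h4]] := entry0.
have [e1 [ok1 pok1 em1 h5]] := entry1.
pose s := enum (supp (w i)); pose l := [seq gcof (w i x) | x <- s].
have Us : uniq s by apply: enum_uniq.
have sD : {subset s <= D} by move=> x; rewrite mem_enum; apply: (supp_D cw).
have sl : size l = #|supp (w i)| by rewrite size_map -cardE.
have hv : has_vec w (emb s l).
  by exists i, 1; rewrite ?oner_eq0 // scale1r -emb_enum.
have lu : l \in uvecs #|supp (w i)|.
  rewrite mem_uvecs sl eqxx /=; apply/allP=> _ /mapP[x + ->].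
  by rewrite mem_enum inE (gcof_eq0 cardF4 a_def).
have gs : gsum l == g0.
  apply/eqP; rewrite -(@gsum_supp D I w cw i 1 s Us); last by move=> x; rewrite mem_enum.
  by congr gsum; apply: eq_map => x; rewrite mul1r.
case/orP => [|/andP[/eqP c4 cst]]; last first.
  rewrite c4 in lu; apply: (single_badP cw ok0 pok0 (h4 _ lu _)) hv => //; rewrite ?em0.
  - by rewrite /l map_comp; case: {+}[seq w i x | x <- s] cst => //= y t /all_pred1P->; rewrite map_nseq all_nseq /= eqxx orbT.
  - by rewrite -cardE c4.
  - by rewrite sl c4.
rewrite leq_eqVlt => /orP[/eqP c5|c6].
  rewrite -c5 in lu; apply: (single_badP cw ok1 pok1 (h5 _ lu _)) hv => //; rewrite ?em1.
  - by rewrite -cardE -c5.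
  - by rewrite sl -c5.
have merge x y : x \in supp (w i) -> y \in supp (w i) -> x != y ->
    exists (I' : finType) (w' : I' -> {ffun V -> F4^o}) (i' : I'), config a (D :\ x) w' /\
    w' i' = w i + (w i x : F4) *: edgev F4 x y.
  move=> xs ys xy; have [xD yD] := (supp_D cw xs, supp_D cw ys).
  have [i1 [c1 c10 w1]] := config_clique cw xD yD xy.
  have ii1 : i != i1.
    apply: contraTneq c6 => ->; rewrite -leqNgt (@leq_trans 2) //.
    have <- : #|[set x; y]| = 2%N by rewrite cards2 xy.
    apply: subset_leq_card; apply/subsetP=> z; rewrite !inE w1 !ffunE.
    by case: (z == x) => //; case: (z == y) => //; rewrite addr0 scaler0 eqxx.
  exists {j | j != i1}, (mergev w (i1 := i1) x y), (exist _ i ii1); split=> //.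
  exact: (config_merge cardF4 a_def cw xD yD xy c10 w1).
have /card_gt0P[x xs] : (0 < #|supp (w i)|)%N by apply: leq_trans c6.
have wx : w i x != 0 by move: xs; rewrite inE.
have [|/existsPn eqall] := boolP [exists y in supp (w i), w i y != w i x].
  case/exists_inP=> y ys yx; have xy : x != y by apply: contraNneq yx => ->.
  have [I' [w' [i' [cw' wi']]]] := merge x y xs ys xy.
  have ss : supp (w' i') = supp (w i) :\ x.
    apply/setP=> z; rewrite !inE wi' !ffunE; have [->|zx] := eqVneq z x.
      by rewrite (negPf xy) addr0 /GRing.scale /= mulr1 (F4_addxx cardF4 a_def) eqxx.
    have [->|zy] := eqVneq z y; last by rewrite addr0 scaler0 addr0.
    rewrite add0r /GRing.scale /= mulr1; move: ys; rewrite inE => ->.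
    by rewrite -{1}(F4_opp cardF4 a_def (w i x)) subr_eq0.
  have cs : #|supp (w i)| = #|supp (w' i')|.+1 by rewrite (cardsD1 x) xs ss.
  by apply: (IH (D :\ x) I' w' i') => //; [rewrite -ltnS -cs | rewrite -ltnS -cs c6].
have alle y : y \in supp (w i) -> w i y = w i x.
  by move=> ys; have := eqall y; rewrite ys /= negbK => /eqP.
have [y ys yx] : exists2 y, y \in supp (w i) & y != x.
  have : (0 < #|supp (w i) :\ x|)%N by move: c6; rewrite (cardsD1 x) xs add1n ltnS; apply: leq_trans.
  by case/card_gt0P=> y; rewrite !inE => /andP[yx ys]; exists y; rewrite ?inE.
have xy : x != y by rewrite eq_sym.
have [I' [w' [i' [cw' wi']]]] := merge x y xs ys xy.
have wz z : w' i' z = if (z \in supp (w i)) && (z != x) && (z != y) then w i x else 0.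
  rewrite wi' !ffunE; have [->|zx] := eqVneq z x.
    by rewrite andbF (negPf xy) addr0 /GRing.scale /= mulr1 (F4_addxx cardF4 a_def).
  have [->|zy] := eqVneq z y.
    by rewrite andbF add0r /GRing.scale /= mulr1 alle // (F4_addxx cardF4 a_def).
  by rewrite addr0 scaler0 addr0 !andbT; case: ifP => [/alle //|]; rewrite inE => /negbFE/eqP.
have ss : supp (w' i') = supp (w i) :\ x :\ y.
  apply/setP=> z; rewrite !inE wz; move: (w i x) wx => k k0; rewrite inE.
  by case: (z == x); case: (z == y); case: (w i z == 0) => //=; rewrite ?andbF ?eqxx ?k0.
have cs : #|supp (w i)| = #|supp (w' i')|.+2.
  by rewrite (cardsD1 x) xs (cardsD1 y (_ :\ x)) !inE yx; move: ys; rewrite inE => ->; rewrite ss.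
apply: (IH (D :\ x) I' w' i') => //; first by rewrite -ltnS (leq_trans _ lt) // cs ltnS leqnSn.
have : (4 <= #|supp (w' i')|)%N by rewrite cs in c6.
rewrite leq_eqVlt => /orP[/eqP e4|->] //; rewrite -e4 eqxx andTb orFb.
have /all_pred1P-> : all (pred1 (w i x)) [seq w' i' z | z <- enum (supp (w' i'))].
  apply/allP=> _ /mapP[z + ->]; rewrite mem_enum ss wz !inE.
  by case: (z == x); case: (z == y) => //= ->; rewrite eqxx.
by rewrite size_map -cardE -e4 /= !eqxx.
Qed.


End SearchSound.

Lemma In_of_mem (T : eqType) (x : T) s : x \in s -> List.In x s.
Proof. by elim: s => //= y s IH; rewrite inE => /predU1P[->|/IH]; [left|right]. Qed.

Lemma uvecs_head n p : head g0 p = g1 -> p \in uvecs n.+1 -> p \in map (cons g1) (uvecs n).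
Proof.
rewrite mem_uvecs; case: p => [//|x t] /= -> /andP[sz /andP[_ al]].
by apply: map_f; rewrite mem_uvecs al andbT.
Qed.

(** * Soundness of the search *)

Section SearchFam.
Variables (F4 : finFieldType) (cardF4 : #|F4| = 4) (a : F4).
Hypothesis a_def : (a ^+ 2 = a + 1)%R.
Local Notation gval := (gval a).
Local Notation gcof := (gcof a).
Local Notation emb := (emb a).
Local Open Scope ring_scope.
Variable V : finType.

Definition famvec (f : fam) (ys : seq V) (u : {ffun V -> F4^o}) : bool :=
  [|| (#|supp u| <= 2)%N,
      [exists c : F4, has (fun l => u == c *: emb ys l) (fN f)] |
      [exists c : F4, [exists x in [predC ys],
         has (fun l => u == c *: (deltaf F4 x + emb ys l)) (fS f)]]].

Lemma infamP f pi l (xs : seq V) x0 : uniq xs -> size l = size xs -> uniq pi ->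
  all (fun i => (i < size xs)%N) pi -> infam f pi l ->
  forall c, famvec f (map (nth x0 xs) pi) (c *: emb xs l).
Proof.
move=> U sl Upi /allP pil; rewrite /infam; set core := map _ pi => h c.
set ys := map _ pi.
have yx x : x \in ys -> emb xs l x = emb ys core x.
  case/mapP=> i ipi ->; rewrite !ffunE index_uniq ?pil //; congr (gval _).
  have ii : (index i pi < size pi)%N by rewrite index_mem.
  have Uys : uniq ys.
    rewrite map_inj_in_uniq // => j j' /pil lj /pil lj' /eqP.
    by rewrite nth_uniq // => /eqP.
  have -> : index (nth x0 xs i) ys = index i pi.
    have -> : nth x0 xs i = nth x0 ys (index i pi) by rewrite (nth_map 0%N) // nth_index.
    by rewrite index_uniq // size_map.
  by rewrite (nth_map 0%N) // nth_index.
have yout x : x \notin ys -> emb ys core x = 0.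
  by move=> xy; rewrite ffunE nth_default // size_map -(size_map (nth x0 xs)) leqNgt index_mem.
have outE x : x \notin ys -> x \in xs -> index x xs \notin outs pi l -> emb xs l x = 0.
  move=> xy xx; rewrite mem_filter mem_iota /= add0n sl index_mem xx andbT negb_and !negbK.
  case/orP=> [ip|/eqP e]; last by rewrite ffunE e.
  by case/negP: xy; apply/mapP; exists (index x xs) => //; rewrite nth_index.
have out0 x : x \notin xs -> emb xs l x = 0.
  by move=> xx; rewrite ffunE nth_default // sl leqNgt index_mem.
move: h; case Do : (outs pi l) => [|i [|//]].
  rewrite hasfE => /hasP[k ku kc]; apply/or3P; constructor 2.
  apply/existsP; exists (c / gval k); apply/hasP; exists (vscale k core) => //.
  rewrite (embZ cardF4 a_def) scalerA divfK ?(gval_unit a_def) //; apply/eqP; congr (_ *: _).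
  apply/ffunP=> x; have [xy|xy] := boolP (x \in ys); first exact: yx.
  rewrite yout //; have [xx|/out0 //] := boolP (x \in xs).
  by apply: outE; rewrite ?Do.
rewrite hasfE => /hasP[k ku]; case: eqP => // ki kc; apply/or3P; constructor 3.
have : i \in outs pi l by rewrite Do mem_head.
rewrite mem_filter mem_iota /= add0n sl => /andP[/andP[ipi li0] il].
apply/existsP; exists (c / gval k); apply/existsP; exists (nth x0 xs i).
have niy : nth x0 xs i \notin ys.
  apply: contra ipi => /mapP[j jp /eqP]; rewrite nth_uniq // ?(pil j jp) // => /eqP->.
  by [].
rewrite inE /= niy; apply/hasP; exists (vscale k core) => //.
have k0 := gval_unit a_def ku.
have -> : deltaf F4 (nth x0 xs i) + emb ys (vscale k core) =
    gval k *: ((gval k)^-1 *: deltaf F4 (nth x0 xs i) + emb ys core).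
  by rewrite (embZ cardF4 a_def) scalerDr scalerA divff // scale1r.
rewrite scalerA divfK //; apply/eqP; congr (_ *: _).
have kv : (gval k)^-1 = gval (nth g0 l i).
  apply: (mulfI k0); rewrite divff // -(gvalM cardF4 a_def) ki //.
apply/ffunP=> x; rewrite [RHS]ffunE kv; have [xy|xy] := boolP (x \in ys).
  rewrite -yx // !ffunE (_ : (x == _) = false) ?scaler0 ?add0r //.
  by apply: contraNF niy => /eqP<-.
rewrite yout // addr0 !ffunE; have [->|xi] := eqVneq x (nth x0 xs i).
  by rewrite index_uniq // /GRing.scale /= mulr1.
rewrite /GRing.scale /= mulr0; have [xx|xx] := boolP (x \in xs); last first.
  by have := out0 x xx; rewrite ffunE.
have := outE x xy xx; rewrite ffunE; apply; rewrite Do inE.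
by apply: contra xi => /eqP<-; rewrite nth_index.
Qed.

Section Search2.
Variables (D : {set V}) (I : finType) (w : I -> {ffun V -> F4^o}).
Hypothesis cw : config a D w.

Lemma pattern_trieP q p : tfind q pattern_trie = Some p ->
  Bad a D w (pt_m p) (pt_q p) /\ pattern_ok p.
Proof.
pose P (t : trie pattern) := forall q p, tfind q t = Some p ->
  Bad a D w (pt_m p) (pt_q p) /\ pattern_ok p.
suff : P pattern_trie by apply.
rewrite /pattern_trie; apply: (foldl_inv (P := P)) => [t v Pt|{}q {}p]; last by rewrite tfind_TE.
set e := nth _ _ _; case: ifP => // eok; apply: (foldl_inv (P := P)) => // {}t v' {}Pt.
rewrite /add_variant; case: ifP => // pe; case: ifP => // sc; case: ifP => // pok.
apply: (tadd_inv (P := fun p => Bad a D w (pt_m p) (pt_q p) /\ pattern_ok p)) => //.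
split=> //=; apply: bad_variant => //; last by rewrite -allfE.
exact: entry_bad.
Qed.

Definition state (xs : seq V) (L : seq (seq g4)) := [/\ uniq xs, {subset xs <= D} &
  forall r, r \in L -> (size r <= size xs)%N /\ has_vec w (emb xs r)].

Lemma isbadP xs L l : state xs L -> (size l <= size xs)%N -> has_vec w (emb xs l) ->
  isbad pattern_trie (size xs) L l -> False.
Proof.
move=> [U sD hL] sl hl; rewrite /isbad hasfE => /hasP[n _]; rewrite hasfE => /hasP[s sL].
rewrite /bad_config; case E : tfind => [p|//].
have [bd] := pattern_trieP E; rewrite /pattern_ok allfE; case: ifP => // szp psc qm.
apply: (match_bad bd szp psc qm U sD) => // r; rewrite inE => /predU1P[->//|rs].
apply: hL; have [_ ss] := subs_In (In_of_mem sL).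
by apply/In_mem/ss/In_of_mem.
Qed.

Lemma gle_min p : sorted gle p -> all (fun x => x != g0) p -> g1 \in p -> head g0 p = g1.
Proof.
case: p => //= x p; rewrite (path_sortedE gle_trans) => /andP[/allP h _] /andP[x0 _].
by rewrite inE => /predU1P[->//|/h]; case: x x0 {h}.
Qed.

(** [config_small] bounds the support by four and excludes constant coefficients there, which leaves
    exactly the listed patterns once the first entry is 1. *)
Lemma norm_pats i s (c : F4) : uniq s -> s =i supp (w i) -> (2 < size s)%N ->
  c != 0 -> head g0 [seq gcof (c^-1 * w i x) | x <- s] = g1 ->
  [seq gcof (c^-1 * w i x) | x <- s] \in
    (if (#|supp (w i)| == 4)%N then pats4 else pats3).
Proof.
move=> U es s3 c0; set p := map _ s => hd.
have szs : size s = #|supp (w i)| by rewrite -(card_uniqP U); apply: eq_card.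
have gs : gsum p = g0 by apply: (gsum_supp cardF4 a_def cw).
have pu : p \in uvecs (size s).
  rewrite mem_uvecs size_map eqxx; apply/allP=> _ /mapP[x + ->].
  rewrite es inE (gcof_eq0 cardF4 a_def) mulf_eq0 invr_eq0 (negPf c0).
  by [].
have /negP : ~ ((4 < #|supp (w i)|)%N || (#|supp (w i)| == 4) &&
    constant [seq w i x | x <- enum (supp (w i))]) by apply: (config_small cardF4 a_def cw).
rewrite negb_or -leqNgt -szs => /andP[le4 nc].
case: ifP => e4.
  have ncp : ~~ constant p.
    move: nc; rewrite e4 andTb => nc; apply: contra nc => cp.
    have cE : forall x y, x \in s -> y \in s -> w i x = w i y.
      move=> x y xs ys; have : gcof (c^-1 * w i x) = gcof (c^-1 * w i y).
        have /(constantP g0)[z pz] := cp.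
        have pE y' : y' \in s -> gcof (c^-1 * w i y') = z.
          by move=> /(map_f (fun x => gcof (c^-1 * w i x))); rewrite -/p pz => /nseqP[].
        by rewrite !pE.
      by move/(congr1 gval); rewrite !(gcofK cardF4 a_def); apply: mulfI; rewrite invr_eq0.
    case En : (enum (supp (w i))) => [//|x t] /=.
    apply/allP=> _ /mapP[y yt ->] /=; apply/eqP; apply: cE; rewrite es -mem_enum En.
      by rewrite inE yt orbT.
    exact: mem_head.
  rewrite mem_filter gs eqxx ncp /=; move: pu; rewrite (eqP e4).
  exact: uvecs_head.
have e3 : size s = 3 by move: e4 s3 le4; case: (size s) => [|[|[|[|[|?]]]]].
rewrite mem_filter gs eqxx /=; move: pu; rewrite e3.
exact: uvecs_head.
Qed.

(** Puts an arbitrary vector into the form enumerated by [run]: first the known vertices [xs], then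
    the other vertices of its support in the order of their coefficients, scaled so that the first
    nonzero entry is 1. *)
Lemma candidate (xs : seq V) i : uniq xs -> {subset xs <= D} -> (2 < #|supp (w i)|)%N ->
  exists zs l, exists2 c : F4, c != 0 &
  [/\ uniq (xs ++ zs), {subset zs <= [predD supp (w i) & xs]}, size l = size (xs ++ zs),
      w i = c *: emb (xs ++ zs) l & sorted gle (drop (size xs) l) /\
      exists2 p, p \in (if (#|supp (w i)| == 4)%N then pats4 else pats3) & l \in place (size xs) p].
Proof.
move=> U sD s3.
pose s1 := [seq x <- xs | x \in supp (w i)].
pose zs0 := [seq x <- enum (supp (w i)) | x \notin xs].
have es0 : s1 ++ zs0 =i supp (w i).
  by move=> x; rewrite mem_cat mem_filter (mem_filter _ _ (enum _)) mem_enum; case: (x \in supp _); case: (x \in xs).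
have /card_gt0P[x1 x1s] : (0 < #|supp (w i)|)%N by apply: leq_trans s3.
(* The scaling is taken at the first known vertex in the support. If the support avoids [xs], it is
   taken at some new vertex, and after sorting the entry 1 comes first by [gle_min]. *)
pose c : F4 := w i (head x1 (s1 ++ zs0)).
have hs : head x1 (s1 ++ zs0) \in supp (w i).
  by rewrite -es0; move: x1s; rewrite -es0; case: (_ ++ _) => //= *; rewrite mem_head.
have c0 : c != 0 by move: hs; rewrite inE.
pose g x := gcof (c^-1 * w i x).
pose zs := sort (relpre g gle) zs0.
pose l := map g (xs ++ zs).
have zsE : zs =i zs0 by apply: mem_sort.
have sub : {subset zs <= [predD supp (w i) & xs]}.
  by move=> x; rewrite zsE mem_filter mem_enum => /andP[xx xs']; rewrite inE /= xx.
have U2 : uniq (xs ++ zs).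
  rewrite cat_uniq U sort_uniq filter_uniq ?enum_uniq // andbT /=.
  by apply/hasPn=> x /sub; rewrite inE => /andP[].
have es : s1 ++ zs =i supp (w i) by move=> x; rewrite -es0 !mem_cat zsE.
have U1 : uniq (s1 ++ zs).
  rewrite cat_uniq filter_uniq // sort_uniq filter_uniq ?enum_uniq // andbT /=.
  by apply/hasPn=> x /sub; rewrite inE mem_filter => /andP[/negPf-> _]; rewrite andbF.
have g0E x : (g x != g0) = (x \in supp (w i)).
  by rewrite (gcof_eq0 cardF4 a_def) mulf_eq0 invr_eq0 (negPf c0) inE.
have srt : sorted gle (map g zs) by rewrite sorted_map; apply: sort_sorted => x y; apply: gle_total.
exists zs, l, c => //; split=> //.
- by rewrite size_map.
- rewrite (@emb_map _ cardF4 _ a_def _ _ (fun x => c^-1 * w i x) (c^-1 *: w i)) ?scalerA ?divff ?scale1r //.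
    by move=> x _; rewrite ffunE.
  move=> x; rewrite ffunE mem_cat => nx.
  suff -> : w i x = 0 by rewrite scaler0.
  apply/eqP; apply: contraNT nx => wx; have : x \in s1 ++ zs by rewrite es inE.
  by rewrite mem_cat mem_filter => /orP[/andP[_ ->]|->]; rewrite ?orbT.
split; first by rewrite -map_drop drop_size_cat.
have szs : size (s1 ++ zs) = #|supp (w i)| by rewrite -(card_uniqP U1); apply: eq_card.
have fl : [seq x <- l | x != g0] = map g (s1 ++ zs).
  rewrite filter_map filter_cat; congr (map g (_ ++ _)).
    by apply: eq_filter => x /=; rewrite g0E.
  by apply/all_filterP/allP=> x /sub /=; rewrite g0E inE => /andP[].
exists (map g (s1 ++ zs)).
  apply: norm_pats; rewrite ?szs //.
  case E1 : s1 => [|x s1'] /=; last first.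
    by rewrite /c E1 /= mulVf; [rewrite -[1]/(gval g1) (gvalK cardF4 a_def)|move: c0; rewrite /c E1].
  apply: gle_min => //; first by apply/allP=> _ /mapP[x /sub + ->]; rewrite g0E inE => /andP[].
  have -> : g1 = g (head x1 (s1 ++ zs0)).
    by rewrite /g -/c mulVf //; apply/esym; rewrite -[1]/(gval g1) (gvalK cardF4 a_def).
  by apply: map_f; move: hs; rewrite -es E1.
rewrite -fl; apply: place_complete; last by rewrite size_map size_cat leq_addr.
by rewrite -map_drop drop_size_cat //; apply/allP=> _ /mapP[x /sub + ->]; rewrite g0E inE => /andP[].
Qed.

Lemma gcandP (xs : seq V) i rmax (pats : seq (seq g4)) (x0s : seq V) : uniq xs -> {subset xs <= D} -> {subset x0s <= xs} ->
  (forall i, (2 < #|supp (w i)|)%N ->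
     (#|[predD supp (w i) & x0s]| <= rmax)%N /\
     {subset (if (#|supp (w i)| == 4)%N then pats4 else pats3) <= pats}) ->
  (2 < #|supp (w i)|)%N ->
  exists zs l, exists2 c : F4, c != 0 &
  [/\ uniq (xs ++ zs), {subset xs ++ zs <= D}, size l = size (xs ++ zs),
      w i = c *: emb (xs ++ zs) l &
      (size l - size xs <= rmax)%N && sorted gle (drop (size xs) l) /\
      exists2 p, p \in pats & l \in place (size xs) p].
Proof.
move=> U sD s0 hr s3; have [zs [l [c c0 [U2 sub sl wi [srt [p pp lp]]]]]] := candidate U sD s3.
have [hr1 hr2] := hr i s3.
exists zs, l, c => //; split=> //.
- move=> x; rewrite mem_cat => /orP[/sD//|/sub]; rewrite inE => /andP[_ xs'].
  exact: (supp_D cw xs').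
split; last by exists p => //; apply: hr2.
rewrite srt andbT (leq_trans _ hr1) // sl size_cat addKn.
have Uz : uniq zs by move: U2; rewrite cat_uniq => /and3P[].
rewrite -(card_uniqP Uz); apply: subset_leq_card; apply/subsetP=> x /sub.
by rewrite !inE => /andP[nx ->]; rewrite andbT; apply: contra nx; apply: s0.
Qed.

(** Induction on the fuel. If a vector lies outside the family of the current node, [gcandP] shows
    that it is among those checked there; it then leads to a child with more vectors found, or to a
    stored pattern and a contradiction. *)
Lemma runP (x0 : V) rmax (pats : seq (seq g4)) (x0s : seq V) n t (xs : seq V) L :
  (forall i, (2 < #|supp (w i)|)%N ->
     (#|[predD supp (w i) & x0s]| <= rmax)%N /\
     {subset (if (#|supp (w i)| == 4)%N then pats4 else pats3) <= pats}) ->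
  {subset x0s <= xs} -> state xs L -> run pattern_trie rmax pats n t (size xs) L ->
  exists fi ys, [/\ uniq ys, size ys = f_m (nth fam0 families fi) &
    forall i, famvec (nth fam0 families fi) ys (w i)].
Proof.
move=> hr; elim: n t xs L => // n IH [fi pi ch] xs L s0 st /=; set f := nth _ _ _.
case: ifP => // /andP[/andP[Upi /allP pil] /eqP szpi].
rewrite allfE => /allP hrun; have [U sD hL] := st.
have [/forallP hall|] := boolP [forall i, famvec f (map (nth x0 xs) pi) (w i)].
  exists fi, (map (nth x0 xs) pi); split=> //; last by rewrite size_map.
  rewrite map_inj_in_uniq // => j j' /pil lj /pil lj' /eqP.
  by rewrite nth_uniq // => /eqP.
case/forallPn=> i nf.
have s3 : (2 < #|supp (w i)|)%N.
  by rewrite ltnNge; apply: contra nf => h; rewrite /famvec h.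
have [zs [l [c c0 [U2 sD2 sl wi [srt [p pp lp]]]]]] := gcandP U sD s0 hr s3.
have := hrun p pp; rewrite allfE => /allP/(_ l lp); rewrite srt.
case: ifP => [hf _|_].
  case/negP: nf; have := infamP x0 U2 sl Upi _ hf c; rewrite -wi.
  have -> : map (nth x0 (xs ++ zs)) pi = map (nth x0 xs) pi.
    by apply/eq_in_map=> j /pil lj; rewrite nth_cat lj.
  by apply; apply/allP=> j /pil lj; rewrite size_cat ltn_addr.
have st2 : state (xs ++ zs) (l :: L).
  split=> // r; rewrite inE => /predU1P[->|/hL[sr hr']].
    by rewrite sl; split=> //; exists i, c.
  by rewrite size_cat (leq_trans sr) ?leq_addr // emb_cat.
have [_ _ h2] := st2; rewrite sl; case El : lookup => [t'|] hh.
  by apply: (IH t' (xs ++ zs) (l :: L)) => // x xx; rewrite mem_cat s0.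
have [] // := @isbadP (xs ++ zs) L l.
- by split=> // r rL; apply: h2; rewrite inE rL orbT.
- by rewrite sl.
- by exists i, c.
Qed.

Lemma rootP rmax (pats : seq (seq g4)) start (xs : seq V) i : root_check pattern_trie rmax pats start ->
  state xs [:: start] -> size xs = size start -> (2 < #|supp (w i)|)%N ->
  {subset (if (#|supp (w i)| == 4)%N then pats4 else pats3) <= pats} ->
  (#|[predD supp (w i) & xs]| <= rmax)%N.
Proof.
rewrite /root_check allfE => /allP hroot st sx s3 hp; have [U sD hL] := st.
have [zs [l [c c0 [U2 sub sl wi [srt [p pp lp]]]]]] := candidate U sD s3.
have := hroot p (hp p pp); rewrite allfE => /allP; rewrite -sx => /(_ l lp).
case: ifP => [|_ hb].
  rewrite srt orbF sl size_cat addKn => le _; apply: leq_trans le.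
  have Uz : uniq zs by move: U2; rewrite cat_uniq => /and3P[].
  rewrite -(card_uniqP Uz); apply: subset_leq_card; apply/subsetP=> x.
  rewrite !inE => /andP[xx xs']; have : x \in xs ++ zs.
    have : emb (xs ++ zs) l x != 0.
      by move: xs'; rewrite wi ffunE scaler_eq0 (negPf c0).
    by apply: contraNT => nx; rewrite ffunE nth_default // sl leqNgt index_mem.
  by rewrite mem_cat (negPf xx).
rewrite sl in hb; have [] // := isbadP _ _ _ hb; last by exists i, c.
  split=> //.
    move=> x; rewrite mem_cat => /orP[/sD//|/sub]; rewrite inE => /andP[_ xs'].
    exact: (supp_D cw xs').
  move=> r rL; have [sr hr] := hL r rL.
  by rewrite size_cat (leq_trans sr) ?leq_addr // emb_cat.
by rewrite sl.
Qed.

(** Each admissible pattern becomes the chosen start after rescaling the vector and permuting its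
    vertices. *)
Lemma start_state i start pats : (2 < #|supp (w i)|)%N ->
  (if (#|supp (w i)| == 4)%N then pats4 else pats3) = pats ->
  all (fun p => has (fun k => sort gle (vscale k p) == start) gunits) pats ->
  exists xs, state xs [:: start] /\ size xs = size start.
Proof.
move=> s3 pE /allP hp.
have [zs [l [c c0 [U2 sub sl wi [srt [p pp /=]]]]]] := candidate (isT : uniq [::])
  (fun x (h : x \in [::]) => match notF h with end) s3.
rewrite mem_seq1 => /eqP Dl; rewrite pE in pp; have /hasP[k ku /eqP sk] := hp p pp.
rewrite /= in U2 sl wi.
have x0 : V by have /card_gt0P/sigW[] : (0 < #|supp (w i)|)%N by apply: leq_trans s3.
pose g x := nth g0 (vscale k p) (index x zs).
have szp : size p = size zs by rewrite -Dl sl.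
have vg : vscale k p = map g zs.
  apply: (@eq_from_nth _ g0); first by rewrite !size_map szp.
  move=> j; rewrite size_map szp => lj; rewrite (nth_map x0) // /g index_uniq //.
pose xs := sort (relpre g gle) zs.
have xz : xs =i zs by apply: mem_sort.
have Ux : uniq xs by rewrite sort_uniq.
have sx : size xs = size start.
  by rewrite size_sort -sk size_sort size_map szp.
exists xs; split=> //; split=> //.
  by move=> x; rewrite xz => /sub /andP[_ xs']; apply: (supp_D cw xs').
move=> r; rewrite inE => /eqP->; rewrite sx; split=> //.
have k0 := gval_unit a_def ku.
exists i, (c / gval k); first by rewrite mulf_neq0 ?invr_eq0.
suff -> : emb xs start = gval k *: emb zs p by rewrite scalerA divfK // -Dl.
rewrite -(embZ cardF4 a_def).
have -> : start = map g xs by rewrite -sk vg sort_map.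
apply/ffunP=> x; rewrite !ffunE; congr (gval _); have [xx|xx] := boolP (x \in xs).
  by rewrite (nth_map x0) ?index_mem // nth_index.
rewrite nth_default; last by rewrite size_map leqNgt index_mem.
by rewrite nth_default // size_map szp leqNgt index_mem -xz.
Qed.

Lemma startE4 : all (fun p => has (fun k => sort gle (vscale k p) == start4) gunits) pats4.
Proof. by vm_compute. Qed.

Lemma startE3 : all (fun p => has (fun k => sort gle (vscale k p) == start3) gunits) pats3.
Proof. by vm_compute. Qed.

Lemma search_family (x0 : V) rmax (pats : seq (seq g4)) start n t (xs : seq V) :
  root_check pattern_trie rmax pats start ->
  run pattern_trie rmax pats n t (size start) [:: start] ->
  state xs [:: start] -> size xs = size start ->
  (forall i, {subset (if (#|supp (w i)| == 4)%N then pats4 else pats3) <= pats}) ->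
  exists fi ys, [/\ uniq ys, size ys = f_m (nth fam0 families fi) &
    forall i, famvec (nth fam0 families fi) ys (w i)].
Proof.
move=> hroot hrun st sx hp; rewrite -sx in hrun.
apply: (runP x0 _ (fun x (h : x \in xs) => h) st hrun) => i i3.
by split=> //; apply: rootP hroot st sx i3 (hp i).
Qed.

(** The start is a vector with four nonzero entries if there is one, so that otherwise only patterns
    on three vertices have to be placed. If all supports have at most two elements, the last family
    applies. *)
Theorem config_family : exists fi ys, [/\ uniq ys, size ys = f_m (nth fam0 families fi) &
    forall i, famvec (nth fam0 families fi) ys (w i)].
Proof.
have x0P i : (2 < #|supp (w i)|)%N -> V.
  by move=> s3; have /card_gt0P/sigW[] : (0 < #|supp (w i)|)%N by apply: leq_trans s3.
have [/existsP[i /eqP i4]|/existsPn no4] := boolP [exists i, #|supp (w i)| == 4%N].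
  have s3 : (2 < #|supp (w i)|)%N by rewrite i4.
  have pE : (if (#|supp (w i)| == 4)%N then pats4 else pats3) = pats4 by rewrite i4.
  have [xs [st sx]] := start_state s3 pE startE4.
  apply: (search_family (x0P i s3) root4_ok run4_ok st sx).
  by move=> j p; rewrite mem_cat; case: ifP => _ ->; rewrite ?orbT.
have [/existsP[i i3]|/existsPn no3] := boolP [exists i, (2 < #|supp (w i)|)%N].
  have pE : (if (#|supp (w i)| == 4)%N then pats4 else pats3) = pats3 by rewrite (negPf (no4 i)).
  have [xs [st sx]] := start_state i3 pE startE3.
  apply: (search_family (x0P i i3) root3_ok run3_ok st sx).
  by move=> j; rewrite (negPf (no4 j)).
exists (size families).-1, [::]; split=> // i.
by rewrite /famvec leqNgt no3.
Qed.

End Search2.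
End SearchFam.

(** * Lifting the families to other fields *)

Definition padd (p q : zpoly) : zpoly :=
  (fix add p q := match p, q with
   | x :: p', y :: q' => Z.add x y :: add p' q'
   | [::], _ => q | _, [::] => p end) p q.
Definition pscl (c : BinNums.Z) (p : zpoly) : zpoly := map (Z.mul c) p.
Fixpoint pmul (p q : zpoly) : zpoly :=
  if p is x :: p' then padd (pscl x q) (BinNums.Z0 :: pmul p' q) else [::].
Definition psub p q : zpoly := padd p (pscl (BinNums.Zneg BinNums.xH) q).

(* Division by [t - r]: quotient and remainder. *)
Fixpoint pdiv (r : BinNums.Z) (p : zpoly) : zpoly * BinNums.Z :=
  if p is c :: p' then let: (q, s) := pdiv r p' in (s :: q, Z.add c (Z.mul r s))
  else ([::], BinNums.Z0).

Fixpoint ptrim (p : zpoly) : zpoly :=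
  if p is c :: p' then
    match c, ptrim p' with BinNums.Z0, [::] => [::] | _, p'' => c :: p'' end
  else [::].

(** The values 0, 1, -1 and 2, which [t] has to avoid for the factors [t - r] to be nonzero in the
    target field. *)
Definition roots : seq BinNums.Z := [:: BinNums.Z0; BinNums.Zpos BinNums.xH; BinNums.Zneg BinNums.xH; BinNums.Zpos (BinNums.xO BinNums.xH)].

Definition pzero (p : zpoly) : bool := if ptrim p is [::] then true else false.

Definition pone (p : zpoly) : bool :=
  match p with [:: BinNums.Zpos BinNums.xH] | [:: BinNums.Zneg BinNums.xH] => true | _ => false end.

(** Recognizes products of factors [t - r], up to sign, by trial division; [n] bounds the number of
    factors. *)
Fixpoint punit n (p : zpoly) : bool :=
  let p' := ptrim p in
  if pone p' then true else
  if n is n'.+1 then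
    hasf (fun r => let: (q, s) := pdiv r p' in if s is BinNums.Z0 then punit n' q else false) roots
  else false.

Definition pvdiv (r : BinNums.Z) (P : seq zpoly) : option (seq zpoly) :=
  let D := map (pdiv r) P in
  if allf (fun d : zpoly * BinNums.Z => if d.2 is BinNums.Z0 then true else false) D
  then Some [seq ptrim d.1 | d <- D] else None.

Fixpoint pvred n (r : BinNums.Z) (P : seq zpoly) : seq zpoly :=
  if n is n'.+1 then if pvdiv r P is Some Q then pvred n' r Q else P else P.

Definition psign (P : seq zpoly) : bool :=
  if last BinNums.Z0 (head [::] [seq p <- P | if p is [::] then false else true]) is BinNums.Zneg _
  then true else false.

(** Removes common factors [t - r] and fixes the sign, so that vectors equal up to a unit are
    usually identified and the lists in [chk] stay small. By [pvnormP] only nonzero scalars are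
    lost. *)
Definition pvnorm (P : seq zpoly) : seq zpoly :=
  let Q := foldl (fun P r => pvred 8 r P) (map ptrim P) roots in
  if psign Q then [seq pscl (BinNums.Zneg BinNums.xH) p | p <- Q] else Q.

(** In GF(4) the inverse of a nonzero [c] is [c * c], so the first nonzero entry becomes 1. *)
Definition gvnorm (g : seq g4) : seq g4 :=
  let c := head g1 [seq x <- g | if x is g0 then false else true] in vscale (gmul c c) g.

Definition gp := (seq g4 * seq zpoly)%type.

Definition gpnorm (x : gp) : gp := (gvnorm x.1, pvnorm x.2).

Definition gpzero (x : gp) : bool :=
  if nzl x.1 then false else allf pzero x.2.

Definition gadd_undup (x : gp) (C : seq gp) : seq gp :=
  if gpzero x then C else let y := gpnorm x in if y \in C then C else y :: C.

Definition normlist (C : seq gp) : seq gp := foldr gadd_undup [::] C.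

Definition padd2 (c d : zpoly) (P Q : seq zpoly) : seq zpoly :=
  [seq psub (pmul c x.2) (pmul d x.1) | x <- zip P Q].

Definition gptail (x : gp) : gp := (behead x.1, behead x.2).

(* p_0 q - q_0 p without its first coordinate *)
Definition gpelim (p q : gp) : gp :=
  (vadd (vscale (head g0 p.1) (behead q.1)) (vscale (head g0 q.1) (behead p.1)),
   padd2 (head [::] p.2) (head [::] q.2) (behead p.2) (behead q.2)).

Definition headnz (x : gp) : bool := if head g0 x.1 is g0 then false else true.

Definition headok (x : gp) : bool :=
  if headnz x then punit 12 (head [::] x.2) else pzero (head [::] x.2).

(** Gaussian elimination on both sides of the pairs at once, over all possible pivots. The leading
    entries must vanish on both sides, or be nonzero over GF(4) and a unit over Z[t]. The recursion
    covers lists without a pivot at this coordinate and, for each pivot, the vectors left after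
    elimination. *)
Fixpoint chk n (C : seq gp) : bool :=
  if n is n'.+1 then
    if allf headok C then
      if chk n' (normlist (map gptail (filter (fun x => ~~ headnz x) C))) then
        allf (fun p => if headnz p then chk n' (normlist (map (gpelim p) C)) else true) C
      else false
    else false
  else true.

Definition star := (seq g4 * zpoly * seq zpoly)%type.

(** The second part adds the edges from an outer vertex to the core vertices, written as stars. *)
Definition stars (f : fam) : seq star :=
  [seq (dec (f_m f) x.1.1, x.1.2, x.2) | x <- f_S f] ++
  [seq (mkseq (fun i => if i == j then g1 else g0) (f_m f), [:: BinNums.Zpos BinNums.xH],
        mkseq (fun i => if i == j then [:: BinNums.Zpos BinNums.xH] else [::]) (f_m f)) | j <- iota 0 (f_m f)].

Definition stardiff (s s' : star) : gp :=
  (vadd s.1.1 s'.1.1, padd2 s.1.2 s'.1.2 s.2 s'.2).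

(** Two stars at the same outer vertex differ, once that vertex is eliminated, by a vector on the
    core. All these differences are adjoined; those of unit stars are the edges within the core. *)
Definition core (f : fam) : seq gp :=
  normlist ([seq (dec (f_m f) x.1, x.2) | x <- f_N f] ++
            [seq stardiff s s' | s <- stars f, s' <- stars f]).

Definition fam_ok (f : fam) : bool :=
  let C := core f in
  if allf (fun s : star => punit 12 s.1.2) (stars f) then
    if allf (fun x => if size x.1 == f_m f then size x.2 == f_m f else false) C then chk (f_m f) C
    else false
  else false.

Lemma families_ok : all fam_ok families.
Proof. by vm_compute. Qed.

Lemma fam_okP fi : fam_ok (nth fam0 families fi).
Proof.
have [lt|le] := ltnP fi (size families); first exact: (all_nthP fam0 families_ok).
by rewrite nth_default.
Qed.

(** * Soundness of the polynomial check *)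

Section Lift.
Variables (F4 : finFieldType) (cardF4 : #|F4| = 4) (a : F4).
Hypothesis a_def : (a ^+ 2 = a + 1)%R.
Variables (K : fieldType) (t : K).
Local Open Scope ring_scope.

Definition zv (z : BinNums.Z) : K := (int_of_Z z)%:~R.

Hypothesis t_roots : forall r, r \in roots -> t != zv r.

Local Notation gval := (gval a).
Local Notation emb := (emb a).

Lemma zvD x y : zv (Z.add x y) = zv x + zv y.
Proof. by rewrite /zv -[Z.add x y]/(x + y) raddfD rmorphD. Qed.

Lemma zvM x y : zv (Z.mul x y) = zv x * zv y.
Proof. by rewrite /zv -[Z.mul x y]/(x * y) rmorphM rmorphM. Qed.

Definition pv (p : zpoly) : K := foldr (fun c r => zv c + t * r) 0 p.

Lemma pvD p q : pv (padd p q) = pv p + pv q.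
Proof.
elim: p q => [|x p IH] [|y q] /=; rewrite ?add0r ?addr0 // zvD.
by have /= -> := IH q; rewrite mulrDr addrACA.
Qed.

Lemma pv_scl c p : pv (pscl c p) = zv c * pv p.
Proof. by elim: p => [|x p IH] /=; rewrite ?mulr0 // zvM IH mulrDr mulrCA. Qed.

Lemma pvM p q : pv (pmul p q) = pv p * pv q.
Proof.
elim: p => [|x p IH] /=; first by rewrite mul0r.
by rewrite pvD pv_scl /= IH mulrDl add0r mulrA.
Qed.

Lemma zvN1 : zv (BinNums.Zneg BinNums.xH) = -1. Proof. by []. Qed.

Lemma pvB p q : pv (psub p q) = pv p - pv q.
Proof. by rewrite pvD pv_scl zvN1 mulN1r. Qed.

Lemma pv_div r p : pv p = (t - zv r) * pv (pdiv r p).1 + zv (pdiv r p).2.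
Proof.
elim: p => [|c p IH] /=; first by rewrite mulr0 addr0.
case: (pdiv r p) IH => q s /= ->; rewrite zvD zvM; move: (pv q) (zv r) (zv c) (zv s) => *.
by rewrite !(mulrDl, mulrDr, mulrBl, mulrBr, mulNr) [t * (_ * _)]mulrCA; ring.
Qed.

Lemma pv_trim p : pv (ptrim p) = pv p.
Proof.
elim: p => //= c p; case: (ptrim p) => [|y q] /= <-; case: c => //=.
by rewrite mulr0 addr0.
Qed.

Lemma pzeroP p : pzero p -> pv p = 0.
Proof. by rewrite /pzero -(pv_trim p); case: (ptrim p). Qed.

Lemma punitS n p : punit n.+1 p = if pone (ptrim p) then true else
  hasf (fun r => let: (q, s) := pdiv r (ptrim p) in if s is BinNums.Z0 then punit n q else false) roots.
Proof. by []. Qed.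

Lemma punitP n p : punit n p -> pv p != 0.
Proof.
have base q : pone q -> pv q != 0.
  case: q => [//|[|[?|?|]|[?|?|]] [|? ?]] //= _; rewrite mulr0 addr0; first exact: oner_neq0.
  by rewrite -[zv _]/(-1 : K) oppr_eq0 oner_eq0.
elim: n p => [|n IH] p; rewrite ?punitS -pv_trim; first by rewrite /punit; case: ifP => // /base.
move: (ptrim p) => q; case: ifP => [/base //|_].
rewrite hasfE => /hasP[r rr]; case E : (pdiv r q) => [q' [||]] // /IH q0.
by rewrite (pv_div r) E /= addr0 mulf_neq0 // subr_eq0 t_roots.
Qed.

Section Vectors.
Variable V : finType.
Local Notation vec4 := {ffun V -> F4^o}.
Local Notation vecK := {ffun V -> K^o}.

Definition embK (xs : seq V) (P : seq zpoly) : vecK := [ffun x => pv (nth [::] P (index x xs))].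

Lemma nth_mapp (g : zpoly -> zpoly) (P : seq zpoly) i : g [::] = [::] ->
  nth [::] (map g P) i = g (nth [::] P i).
Proof.
move=> g0; have [lt|le] := ltnP i (size P); first by rewrite (nth_map [::]).
by rewrite !nth_default ?size_map.
Qed.

Lemma embK_trim xs P : embK xs (map ptrim P) = embK xs P.
Proof. by apply/ffunP=> x; rewrite !ffunE nth_mapp // pv_trim. Qed.

Lemma pvdivP r P Q xs : pvdiv r P = Some Q -> embK xs P = (t - zv r) *: embK xs Q.
Proof.
rewrite /pvdiv allfE; case: ifP => // /allP h [<-]; apply/ffunP=> x; rewrite !ffunE.
move: (index x xs) => i; have [lt|le] := ltnP i (size P); last first.
  by rewrite !nth_default ?size_map ?scaler0.
have /h : pdiv r (nth [::] P i) \in map (pdiv r) P by apply/map_f/mem_nth.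
rewrite (nth_map ([::], BinNums.Z0)) ?size_map // (nth_map [::]) // pv_trim (pv_div r).
by case: (pdiv r _) => q [||] //= _; rewrite addr0.
Qed.

Lemma pvredP n r P xs : r \in roots -> exists2 c : K, c != 0 & embK xs P = c *: embK xs (pvred n r P).
Proof.
move=> rr; elim: n P => [|n IH] P /=; first by exists 1; rewrite ?oner_eq0 ?scale1r.
case E : pvdiv => [Q|]; last by exists 1; rewrite ?oner_eq0 ?scale1r.
have [c c0 e] := IH Q; exists ((t - zv r) * c); first by rewrite mulf_neq0 // subr_eq0 t_roots.
by rewrite (pvdivP xs E) e scalerA.
Qed.

Lemma pvnormP P xs : exists2 c : K, c != 0 & embK xs P = c *: embK xs (pvnorm P).
Proof.
rewrite /pvnorm -embK_trim; set Q := foldl _ _ _.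
have [c c0 e] : exists2 c : K, c != 0 & embK xs (map ptrim P) = c *: embK xs Q.
  rewrite /Q; move: (map ptrim P) => P0.
  have : {subset roots <= roots} by [].
  elim: {1 3}roots P0 => [|r rs IH] P0 sub /=; first by exists 1; rewrite ?oner_eq0 ?scale1r.
  have [c1 c10 ->] := @pvredP 8 r P0 xs (sub r (mem_head _ _)).
  have [|c2 c20 ->] := IH (pvred 8 r P0); first by move=> x xr; apply: sub; rewrite inE xr orbT.
  by exists (c1 * c2); rewrite ?mulf_neq0 // scalerA.
case: ifP => _; last by exists c.
exists (- c); rewrite ?oppr_eq0 // e; apply/ffunP=> x; rewrite !ffunE nth_mapp // pv_scl zvN1.
by rewrite /GRing.scale /= mulN1r mulrNN.
Qed.

Lemma gvnormP g (xs : seq V) : exists2 c : F4, c != 0 & emb xs g = c *: emb xs (gvnorm g).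
Proof.
rewrite /gvnorm; set c := head _ _.
have c0 : gval c != 0.
  rewrite (gval_eq0 a_def) /c; elim: g {c} => //= x g IH; by case: x.
exists (gval c); rewrite // (embZ cardF4 a_def) (gvalM cardF4 a_def) scalerA.
suff -> : gval c * (gval c * gval c) = 1 by rewrite scale1r.
by rewrite -!(gvalM cardF4 a_def); case: (c) c0; rewrite ?eqxx.
Qed.

Definition inR (C : seq gp) xs (p : vec4 * vecK) : Prop :=
  p = (0, 0) \/ exists x c c', [/\ x \in C, c != 0, c' != 0,
    p.1 = c *: emb xs x.1 & p.2 = c' *: embK xs x.2].

Lemma inRZ C xs p c c' : c != 0 -> c' != 0 -> inR C xs p -> inR C xs (c *: p.1, c' *: p.2).
Proof.
move=> c0 c0' [->|[x [d [d' [xC d0 d0' -> ->]]]]]; first by left; rewrite !scaler0.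
right; exists x, (c * d), (c' * d'); split=> //=; rewrite ?mulf_neq0 //; by rewrite scalerA.
Qed.

Lemma gpzeroP x xs : gpzero x -> emb xs x.1 = 0 /\ embK xs x.2 = 0.
Proof.
rewrite /gpzero nzlE; case: ifP => // /hasPn h1; rewrite allfE => /allP h2.
split; apply/ffunP=> y; rewrite !ffunE.
  have [lt|le] := ltnP (index y xs) (size x.1); last by rewrite nth_default.
  by have := h1 _ (mem_nth g0 lt); rewrite negbK => /eqP->.
have [lt|le] := ltnP (index y xs) (size x.2); last by rewrite nth_default.
by apply/pzeroP/h2/mem_nth.
Qed.

Lemma normlistP x C xs : x \in C -> inR (normlist C) xs (emb xs x.1, embK xs x.2).
Proof.
have step y C' p : inR C' xs p -> inR (gadd_undup y C') xs p.
  move=> [->|[z [c [c' [zC c0 c0' e e']]]]]; first by left.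
  right; exists z, c, c'; split=> //; rewrite /gadd_undup; case: ifP => // _.
  by case: ifP => // _; rewrite inE zC orbT.
elim: C => //= y C IH; rewrite inE => /predU1P[->|/IH h]; last exact: step.
rewrite /gadd_undup; case: ifP => [z0|_].
  by left; have [-> ->] := gpzeroP xs z0.
have [c c0 e] := gvnormP y.1 xs; have [c' c0' e'] := pvnormP y.2 xs.
right; exists (gpnorm y), c, c'; split=> //.
by case: ifP => // _; rewrite mem_head.
Qed.

Lemma size_pvred n r P : size (pvred n r P) = size P.
Proof.
elim: n P => //= n IH P; rewrite /pvdiv; case: ifP => // _.
by rewrite IH !size_map.
Qed.

Lemma size_norm (y : gp) : size (gpnorm y).1 = size y.1 /\ size (gpnorm y).2 = size y.2.
Proof.
split; first by rewrite /= /gvnorm size_map.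
rewrite /= /pvnorm; set Q := foldl _ _ _.
have -> : size y.2 = size Q; last by case: ifP; rewrite ?size_map.
rewrite /Q -(size_map ptrim); move: (map ptrim y.2) => P.
elim: roots P => [//|r rs IH] P.
by rewrite -[foldl _ _ (_ :: _)]/(foldl _ (pvred 8 r P) rs) -IH size_pvred.
Qed.

Definition SD (R : vec4 * vecK -> Prop) : Prop := forall L : seq (vec4 * vecK),
  (forall p, p \in L -> R p) -> \dim <<map fst L>> = \dim <<map snd L>>.

(** If some vector of the list is nonzero at [x], it is a pivot on both sides and both dimensions
    drop by one through [elim_dim]; otherwise the whole list already lies in [R']. *)
Lemma SD_elim (R R' : vec4 * vecK -> Prop) x :
  (forall p, R p -> (p.1 x == 0) = (p.2 x == 0)) ->
  (forall p, R p -> p.1 x = 0 -> R' p) ->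
  (forall p, R p -> p.1 x != 0 -> exists Rp : vec4 * vecK -> Prop, SD Rp /\
     forall q, R q -> Rp ((p.1 x : F4) *: q.1 - (q.1 x : F4) *: p.1,
                          (p.2 x : K) *: q.2 - (q.2 x : K) *: p.2)) ->
  SD R' -> SD R.
Proof.
move=> h1 h2 h3 sd' L hL.
have [/hasP[p pL px]|/hasPn no] := boolP (has (fun p : vec4 * vecK => p.1 x != 0) L); last first.
  by apply: sd' => p pL; apply: h2; [apply: hL|apply/eqP/negbNE/no].
have px' : p.2 x != 0 by rewrite -(h1 p (hL p pL)).
have e1 : <<map fst L>>%VS = <<p.1 :: map fst L>>%VS.
  by apply: eq_span => u; rewrite inE; case: eqP => // ->; rewrite map_f.
have e2 : <<map snd L>>%VS = <<p.2 :: map snd L>>%VS.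
  by apply: eq_span => u; rewrite inE; case: eqP => // ->; rewrite map_f.
rewrite e1 e2 (elim_dim _ px) (elim_dim _ px') -!map_comp.
have [Rp [sdp hp]] := h3 p (hL p pL) px.
have := sdp [seq ((p.1 x : F4) *: q.1 - (q.1 x : F4) *: p.1,
                  (p.2 x : K) *: q.2 - (q.2 x : K) *: p.2) | q : vec4 * vecK <- L].
rewrite -!map_comp => -> // _ /mapP[q qL ->].
exact/hp/hL.
Qed.

Lemma emb_head x (xs : seq V) l : emb (x :: xs) l x = gval (head g0 l).
Proof. by rewrite ffunE /= eqxx nth0. Qed.

Lemma embK_head x xs P : embK (x :: xs) P x = pv (head [::] P).
Proof. by rewrite ffunE /= eqxx nth0. Qed.

Lemma emb_behead x (xs : seq V) l y : x != y -> emb (x :: xs) l y = emb xs (behead l) y.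
Proof. by move=> xy; rewrite !ffunE /= (negPf xy) nth_behead. Qed.

Lemma embK_behead x xs P y : x != y -> embK (x :: xs) P y = embK xs (behead P) y.
Proof. by move=> xy; rewrite !ffunE /= (negPf xy) nth_behead. Qed.

Lemma emb_out (xs : seq V) (l : seq g4) x : x \notin xs -> (size l <= size xs)%N -> emb xs l x = 0.
Proof.
by move=> nx sl; rewrite ffunE nth_default // (leq_trans sl) // leqNgt index_mem.
Qed.

Lemma embK_out (xs : seq V) (P : seq zpoly) x : x \notin xs -> (size P <= size xs)%N -> embK xs P x = 0.
Proof.
by move=> nx sl; rewrite ffunE nth_default // (leq_trans sl) // leqNgt index_mem.
Qed.

Lemma padd2E c d P Q xs : size P = size Q ->
  embK xs (padd2 c d P Q) = pv c *: embK xs Q - pv d *: embK xs P.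
Proof.
move=> sz; apply/ffunP=> x; rewrite !ffunE; move: (index x xs) => i.
have [lt|le] := ltnP i (size P); last first.
  by rewrite !nth_default ?size_map ?size_zip ?sz ?minnn -?sz // !scaler0 subrr.
rewrite (nth_map ([::], [::])) ?size_zip -?sz ?minnn // nth_zip //= pvB !pvM.
by [].
Qed.

Definition bndE n (C : seq gp) := forall x, x \in C -> size x.1 = n /\ size x.2 = n.

Lemma bndE_norm n C : bndE n C -> bndE n (normlist C).
Proof.
elim: C => [//|y C IH] h x /=.
have hC : bndE n C by move=> z zC; apply: h; rewrite inE zC orbT.
rewrite /gadd_undup; case: ifP => _; first exact: IH.
case: ifP => _; first exact: IH.
rewrite inE => /predU1P[->|]; last exact: IH.
by have [-> ->] := size_norm y; apply: h; rewrite mem_head.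
Qed.

Lemma headokP x C v xs : allf headok C -> x \in C ->
  (emb (v :: xs) x.1 v == 0) = (embK (v :: xs) x.2 v == 0) /\
  headnz x = (emb (v :: xs) x.1 v != 0).
Proof.
rewrite allfE => /allP h /h; rewrite emb_head embK_head (gval_eq0 a_def) /headok /headnz.
by case: (head g0 x.1) => [/pzeroP->|/punitP/negPf->|/punitP/negPf->|/punitP/negPf->];
  rewrite ?eqxx.
Qed.

Lemma gpelimE v xs p q : v \notin xs -> size p.1 = (size xs).+1 -> size p.2 = (size xs).+1 ->
  size q.1 = (size xs).+1 -> size q.2 = (size xs).+1 ->
  emb xs (gpelim p q).1 = (emb (v :: xs) p.1 v : F4) *: emb (v :: xs) q.1
                        - (emb (v :: xs) q.1 v : F4) *: emb (v :: xs) p.1 /\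
  embK xs (gpelim p q).2 = (embK (v :: xs) p.2 v : K) *: embK (v :: xs) q.2
                         - (embK (v :: xs) q.2 v : K) *: embK (v :: xs) p.2.
Proof.
move=> vx s1 s2 s3 s4; rewrite /gpelim /= padd2E ?size_behead ?s2 ?s4 //.
rewrite (embD cardF4 a_def) !(embZ cardF4 a_def) !emb_head !embK_head.
split; apply/ffunP=> y; rewrite !ffunE /GRing.scale /=; case: (eqVneq v y) => [<-|vy].
- have ix : index v xs = size xs by apply/eqP; rewrite eqn_leq index_size leqNgt index_mem.
  have n1 : nth g0 (behead q.1) (size xs) = g0 by rewrite nth_default // size_behead s3.
  have n2 : nth g0 (behead p.1) (size xs) = g0 by rewrite nth_default // size_behead s1.
  have z0 : gval g0 = 0 by [].
  by rewrite ix n1 n2 z0 !mulr0 addr0 !nth0 [X in _ - X]mulrC subrr.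
- by rewrite /= !nth_behead (F4_opp cardF4 a_def).
- have ix : index v xs = size xs by apply/eqP; rewrite eqn_leq index_size leqNgt index_mem.
  have n1 : nth [::] (behead q.2) (size xs) = [::] by rewrite nth_default // size_behead s4.
  have n2 : nth [::] (behead p.2) (size xs) = [::] by rewrite nth_default // size_behead s2.
  by rewrite ix n1 n2 /= !mulr0 subr0 !nth0 [X in _ - X]mulrC subrr.
by rewrite /= !nth_behead.
Qed.

(** Induction following the recursion of [chk]. Normalization changes the two sides only by nonzero
    scalars, possibly different ones, and [inR] absorbs both. *)
Lemma chkP n C xs : uniq xs -> size xs = n -> bndE n C -> chk n C -> SD (inR C xs).
Proof.
elim: n C xs => [|n IH] C [|v xs] //=.
  move=> _ _ hC _ L hL; suff [-> ->] : map fst L = nseq (size L) 0 /\ map snd L = nseq (size L) 0.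
    have z (U : vectType _) m : \dim <<nseq m (0 : U)>> = 0%N.
      by apply/eqP; rewrite dimv_eq0 -subv0; apply/span_subvP=> u /nseqP[-> _]; rewrite mem0v.
    by rewrite !z.
  split; (apply: (@eq_from_nth _ 0); first by rewrite size_map size_nseq) => i;
    rewrite size_map => lt; rewrite nth_nseq lt (nth_map (0, 0)) //;
    have [->//|[x [c [c' [xC c0 c0' e e']]]]] := hL _ (mem_nth (0, 0) lt);
    have [/size0nil s1 /size0nil s2] := hC x xC.
    by rewrite e s1 emb_nil scaler0.
  by rewrite e' s2; apply/ffunP=> y; rewrite !ffunE nth_nil scaler0.
move=> /andP[vx U] [sx] hC; case: ifP => // hd; case: ifP => // cz.
rewrite allfE => /allP cp.
have bz : bndE n (map gptail (filter (fun x => ~~ headnz x) C)).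
  move=> _ /mapP[x + ->]; rewrite mem_filter => /andP[_ /hC[s1 s2]].
  by rewrite /= !size_behead s1 s2.
apply: (@SD_elim _ (inR (normlist (map gptail (filter (fun x => ~~ headnz x) C))) xs) v).
- move=> p [->|[x [c [c' [xC c0 c0' -> ->]]]]]; first by rewrite !ffunE !eqxx.
  have [h1 _] := headokP v xs hd xC.
  have e1 : (c *: emb (v :: xs) x.1) v = c * emb (v :: xs) x.1 v by rewrite ffunE.
  have e2 : (c' *: embK (v :: xs) x.2) v = c' * embK (v :: xs) x.2 v by rewrite ffunE.
  by rewrite e1 e2 !mulf_eq0 (negPf c0) (negPf c0') h1.
- move=> p [->|[x [c [c' [xC c0 c0' e e']]]]] px; first by left.
  have [h1 h2] := headokP v xs hd xC.
  have xv : emb (v :: xs) x.1 v = 0.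
    by apply/eqP; move/eqP: px; rewrite e ffunE scaler_eq0 (negPf c0).
  have xv' : embK (v :: xs) x.2 v = 0 by apply/eqP; rewrite -h1 xv.
  have [s1 s2] := hC x xC.
  have xz : gptail x \in map gptail (filter (fun x => ~~ headnz x) C).
    by apply: map_f; rewrite mem_filter xC h2 xv eqxx.
  have := inRZ c0 c0' (normlistP xs xz).
  suff [-> ->] : emb xs (gptail x).1 = emb (v :: xs) x.1 /\
      embK xs (gptail x).2 = embK (v :: xs) x.2 by rewrite /= -e -e'; case: (p).
  split; apply/ffunP=> y; case: (eqVneq v y) => [<-|vy].
  + by rewrite xv emb_out // size_behead s1 sx.
  + by rewrite emb_behead.
  + by rewrite xv' embK_out // size_behead s2 sx.
  by rewrite embK_behead.
- move=> p hp pv0; case: hp => [e|[x [c [c' [xC c0 c0' e e']]]]].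
    by move: pv0; rewrite e ffunE eqxx.
  have [h1 h2] := headokP v xs hd xC.
  have xn : headnz x.
    by rewrite h2; move: pv0; rewrite e ffunE scaler_eq0 negb_or => /andP[].
  have := cp x xC; rewrite xn => chx.
  have bx : bndE n (map (gpelim x) C).
    move=> _ /mapP[y yC ->]; have [s1 s2] := hC x xC; have [s3 s4] := hC y yC.
    rewrite /= size_map size_zip !size_behead s2 s4 minnn; split=> //.
    have sz (l l' : seq g4) : size l = size l' -> size (vadd l l') = size l.
      by elim: l l' => [|u l IHl] [|u' l'] //= [/IHl->].
    by rewrite sz !size_map !size_behead ?s1 ?s3.
  exists (inR (normlist (map (gpelim x) C)) xs); split.
    by apply: IH => //; apply: bndE_norm.
  move=> q [->|[y [d [d' [yC d0 d0' f f']]]]].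
    by left; rewrite /= !ffunE !scaler0 !scale0r !subr0.
  have cd : c * d != 0 by rewrite mulf_neq0.
  have cd' : c' * d' != 0 by rewrite mulf_neq0.
  have := inRZ cd cd' (normlistP xs (map_f (gpelim x) yC)).
  have [s1 s2] := hC x xC; have [s3 s4] := hC y yC; rewrite -sx in s1 s2 s3 s4.
  have [-> ->] := gpelimE vx s1 s2 s3 s4; rewrite /= e e' f f'.
  set A := emb _ x.1; set B := emb _ y.1; set A' := embK _ x.2; set B' := embK _ y.2.
  have E1 : (c * d) *: ((A v : F4) *: B - (B v : F4) *: A) =
      ((c *: A) v : F4) *: (d *: B) - ((d *: B) v : F4) *: (c *: A).
    by apply/ffunP=> z; rewrite !ffunE /GRing.scale /=; ring.
  have E2 : (c' * d') *: ((A' v : K) *: B' - (B' v : K) *: A') =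
      ((c' *: A') v : K) *: (d' *: B') - ((d' *: B') v : K) *: (c' *: A').
    by apply/ffunP=> z; rewrite !ffunE /GRing.scale /=; ring.
  by rewrite E1 E2.
by apply: IH => //; apply: bndE_norm.
Qed.

(** * Eliminating the vertices outside the core *)

Section Family.
Variables (f : fam) (ys : seq V).
Hypotheses (okf : fam_ok f) (Uys : uniq ys) (sys : size ys = f_m f).

Lemma star_unit s : s \in stars f -> pv s.1.2 != 0.
Proof. by move: okf; rewrite /fam_ok allfE; case: ifP => // /allP h _ /h /punitP. Qed.

Lemma core_SD : SD (inR (core f) ys).
Proof.
move: okf; rewrite /fam_ok allfE; case: ifP => // _; rewrite allfE; case: ifP => // /allP h.
apply: chkP => // x /h; case: ifP => // /eqP-> /eqP->.
by [].
Qed.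

Lemma mem_core x : x \in [seq (dec (f_m f) x.1, x.2) | x <- f_N f] ++
    [seq stardiff s s' | s <- stars f, s' <- stars f] ->
  inR (core f) ys (emb ys x.1, embK ys x.2).
Proof. exact: normlistP. Qed.

(** What may hang at an outer vertex: another outer vertex, giving an edge, or a star. [k] is the
    lift of the entry at the outer vertex, and [A'] is the lift of the rest with its sign
    reversed. *)
Definition attach (ds : seq V) (A : vec4) (k : K) (A' : vecK) : Prop :=
  (exists2 y, y \in ds & [/\ A = deltaf F4 y, k = 1 & A' = deltaf K y]) \/
  (exists2 s, s \in stars f & [/\ A = emb ys s.1.1, k = pv s.1.2 & A' = embK ys s.2]).

Definition RV (ds : seq V) (p : vec4 * vecK) : Prop :=
  inR (core f) ys p \/
  exists x A k A' c c', [/\ x \in ds, attach [seq y <- ds | y != x] A k A', c != 0, c' != 0 &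
    p = (c *: (deltaf F4 x + A), c' *: (k *: deltaf K x - A'))].

Lemma RVZ ds p c c' : c != 0 -> c' != 0 -> RV ds p -> RV ds (c *: p.1, c' *: p.2).
Proof.
move=> c0 c0' [h|[x [A [k [A' [d [d' [xd at_ d0 d0' ->]]]]]]]]; first by left; apply: inRZ.
right; exists x, A, k, A', (c * d), (c' * d'); split; rewrite ?mulf_neq0 //.
by rewrite /= !scalerA.
Qed.

Hypothesis star_sz : forall s, s \in stars f -> [/\ size s.1.1 = f_m f & size s.2 = f_m f].

(** Two vectors through the same outer vertex leave the combination of their attachments: two
    vertices give an edge or zero, a vertex and a star give that star at the vertex, two stars give
    a vector of [core]. So [RV] is closed under elimination. *)
Lemma attach_diff ds A k A' B k' B' : attach ds A k A' -> attach ds B k' B' ->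
  RV ds (A + B, k' *: A' - k *: B').
Proof.
move=> [[y yd [-> -> ->]]|[s ss [-> -> ->]]] [[z zd [-> -> ->]]|[s' ss' [-> -> ->]]].
- rewrite !scale1r; have [->|yz] := eqVneq y z.
    left; left; rewrite subrr; congr (_, _).
    by apply/ffunP=> x; rewrite !ffunE (F4_addxx cardF4 a_def).
  right; exists y, (deltaf F4 z), 1, (deltaf K z), 1, 1; split; rewrite ?oner_neq0 ?scale1r //.
  by left; exists z; rewrite // mem_filter eq_sym yz.
- right; exists y, (emb ys s'.1.1), (pv s'.1.2), (embK ys s'.2), 1, 1.
  by split; rewrite ?oner_neq0 ?scale1r //; right; exists s'.
- right; exists z, (emb ys s.1.1), (pv s.1.2), (embK ys s.2), 1, (-1).
  split; rewrite ?oppr_eq0 ?oner_neq0 ?scale1r //; first by right; exists s.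
  by rewrite addrC scaleN1r opprB.
left; have [_ sz] := star_sz ss; have [_ sz'] := star_sz ss'.
have : inR (core f) ys (emb ys (stardiff s s').1, embK ys (stardiff s s').2).
  by apply: mem_core; rewrite mem_cat allpairs_f ?orbT.
have n10 : (-1 : K) != 0 by rewrite oppr_eq0 oner_neq0.
move/(inRZ (oner_neq0 F4) n10); rewrite /= scale1r scaleN1r (embD cardF4 a_def).
by rewrite padd2E ?sz ?sz' // opprB.
Qed.

Lemma attach_unit ds A k A' : attach ds A k A' -> k != 0.
Proof. by move=> [[y _ [_ -> _]]|[s ss [_ -> _]]]; rewrite ?oner_neq0 ?star_unit. Qed.

Lemma attach_out ds A k A' x : x \notin ys -> x \notin ds -> attach ds A k A' ->
  A x = 0 /\ A' x = 0.
Proof.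
move=> nx nd [[y yd [-> _ ->]]|[s ss [-> _ ->]]].
  have xy : (x == y) = false by apply: contraNF nd => /eqP->.
  by rewrite !ffunE xy.
have [s1 s2] := star_sz ss.
by rewrite emb_out ?embK_out ?s1 ?s2 ?sys.
Qed.

Lemma inR_out p x : x \notin ys -> inR (core f) ys p -> p.1 x = 0 /\ p.2 x = 0.
Proof.
move=> nx [->|[y [c [c' [yC c0 c0' -> ->]]]]]; first by rewrite !ffunE.
move: okf; rewrite /fam_ok allfE; case: ifP => // _; rewrite allfE; case: ifP => // /allP h _.
have := h y yC; case: ifP => // /eqP s1 /eqP s2.
have z1 : emb ys y.1 x = 0 by rewrite emb_out // s1 sys.
have z2 : embK ys y.2 x = 0 by rewrite embK_out // s2 sys.
by split; rewrite ffunE ?z1 ?z2 scaler0.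
Qed.

Lemma RV_cases x ds p : x \notin ys -> x \notin ds -> RV (x :: ds) p ->
  [/\ RV ds p, p.1 x = 0 & p.2 x = 0] \/
  exists A k A' c c', [/\ attach ds A k A', c != 0, c' != 0 &
    p = (c *: (deltaf F4 x + A), c' *: (k *: deltaf K x - A'))].
Proof.
move=> nx nd [h|[y [A [k [A' [c [c' [+ at_ c0 c0' ->]]]]]]]].
  by left; have [h1 h2] := inR_out nx h; split=> //; left.
have fd : [seq z <- ds | z != x] = ds.
  by apply/all_filterP/allP=> z zd; apply: contraNneq nd => <-.
rewrite inE => /predU1P[Dy|yd].
  right; exists A, k, A', c, c'; split=> //; last by rewrite Dy.
  by move: at_; rewrite Dy /= eqxx /= fd.
have yx : y != x by apply: contraNneq nd => <-.
move: at_; rewrite /= eq_sym yx => at_.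
have [[z + [DA Dk DA']]|hs] := at_; last first.
  have at2 : attach [seq z <- ds | z != y] A k A' by right.
  have nd2 : x \notin [seq z <- ds | z != y] by rewrite mem_filter (negPf nd) andbF.
  left; have [e1 e2] := attach_out nx nd2 at2; split.
  - by right; exists y, A, k, A', c, c'.
  - by rewrite !ffunE eq_sym (negPf yx) e1 addr0 scaler0.
  by rewrite !ffunE eq_sym (negPf yx) e2 scaler0 subr0 scaler0.
rewrite inE => /predU1P[Dz|zd].
  right; exists (deltaf F4 y), 1, (deltaf K y), c, (- c').
  split; rewrite ?oppr_eq0 //; first by left; exists y.
  rewrite DA DA' Dk Dz !scale1r addrC; congr (_, _).
  by rewrite scaleNr -scalerN opprB.
left; split.
- by right; exists y, A, k, A', c, c'; split=> //; left; exists z.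
- have [e1 _] : A x = 0 /\ A' x = 0.
    apply: (@attach_out [seq z <- ds | z != y] A k A') => //; last by left; exists z.
    by rewrite mem_filter (negPf nd) andbF.
  by rewrite !ffunE eq_sym (negPf yx) e1 addr0 scaler0.
have [_ e2] : A x = 0 /\ A' x = 0.
  apply: (@attach_out [seq z <- ds | z != y] A k A') => //; last by left; exists z.
  by rewrite mem_filter (negPf nd) andbF.
by rewrite !ffunE eq_sym (negPf yx) e2 scaler0 subr0 scaler0.
Qed.

(** The outer vertices are eliminated one at a time with [attach_diff] until only core vectors are
    left. This reduces cliques of any size to the finite check [fam_ok]. *)
Lemma RV_SD ds : uniq ds -> (forall x, x \in ds -> x \notin ys) -> SD (RV ds).
Proof.
elim: ds => [_ _|x ds IH /andP[nd Ud] hd].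
  by move=> L hL; apply: core_SD => p /hL[//|[x [A [k [A' [c [c' []]]]]]]].
have nx : x \notin ys by apply: hd; rewrite mem_head.
have sd : SD (RV ds) by apply: IH => // y yd; apply: hd; rewrite inE yd orbT.
have valx A k A' c c' : attach ds A k A' -> c != 0 -> c' != 0 ->
    (c *: (deltaf F4 x + A)) x = c /\ (c' *: (k *: deltaf K x - A')) x = c' * k.
  move=> at_ _ _; have [e1 e2] := attach_out nx nd at_.
  by rewrite !ffunE eqxx e1 e2 addr0 subr0 /GRing.scale /= !mulr1.
apply: (@SD_elim _ (RV ds) x) => //.
- move=> p /(RV_cases nx nd)[[_ -> ->]|[A [k [A' [c [c' [at_ c0 c0' ->]]]]]]]; first by rewrite !eqxx.
  have [-> ->] := valx _ _ _ _ _ at_ c0 c0'.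
  by rewrite (negPf c0) mulf_eq0 (negPf c0') (negPf (attach_unit at_)).
- move=> p /(RV_cases nx nd)[[]//|[A [k [A' [c [c' [at_ c0 c0' ->]]]]]]].
  by have [-> _] := valx _ _ _ _ _ at_ c0 c0' => /= c00; rewrite c00 eqxx in c0.
move=> p /(RV_cases nx nd)[[_ -> _]|[A [k [A' [c [c' [at_ c0 c0' Dp]]]]]]]; first by rewrite eqxx.
move=> _; exists (RV ds); split=> // q.
have [v1 v2] := valx _ _ _ _ _ at_ c0 c0'; have k0 := attach_unit at_.
case/(RV_cases nx nd)=> [[hq q1 q2]|[B [l [B' [d [d' [at' d0 d0' ->]]]]]]].
  rewrite q1 q2 !scale0r !subr0 Dp /= v1 v2; apply: RVZ => //.
  by rewrite mulf_neq0.
have [w1 w2] := valx _ _ _ _ _ at' d0 d0'; rewrite Dp /= v1 v2 w1 w2.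
have cd : c * d != 0 by rewrite mulf_neq0.
have cd' : c' * d' != 0 by rewrite mulf_neq0.
have := RVZ cd cd' (attach_diff at_ at').
have E1 : (c * d) *: (A + B) =
    c *: (d *: (deltaf F4 x + B)) - d *: (c *: (deltaf F4 x + A)).
  rewrite !scalerA [d * c]mulrC -scalerBr; congr (_ *: _).
  by rewrite opprD addrACA subrr add0r addrC; congr (_ + _); apply/ffunP=> z; rewrite !ffunE (F4_opp cardF4 a_def).
have E2 : (c' * d') *: (l *: A' - k *: B') =
    (c' * k) *: (d' *: (l *: deltaf K x - B')) - (d' * l) *: (c' *: (k *: deltaf K x - A')).
  by apply/ffunP=> z; rewrite !ffunE /GRing.scale /=; ring.
by rewrite /= E1 E2.
Qed.

Definition outer : seq V := [seq x <- enum V | x \notin ys].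

Lemma unit_star y : y \in ys -> exists2 s, s \in stars f &
  [/\ emb ys s.1.1 = deltaf F4 y, pv s.1.2 = 1 & embK ys s.2 = deltaf K y].
Proof.
move=> yy; pose j := index y ys; have jl : (j < f_m f)%N by rewrite -sys index_mem.
exists (mkseq (fun i => if i == j then g1 else g0) (f_m f), [:: BinNums.Zpos BinNums.xH],
        mkseq (fun i => if i == j then [:: BinNums.Zpos BinNums.xH] else [::]) (f_m f)).
  rewrite mem_cat; apply/orP; right.
  by apply/mapP; exists j; rewrite // mem_iota.
have e1 : pv [:: BinNums.Zpos BinNums.xH] = 1 by rewrite /= mulr0 addr0.
have idx x : (index x ys == j) = (x == y).
  apply/eqP/eqP=> [e|->] //; have xx : x \in ys by rewrite -index_mem e index_mem.
  by rewrite -(nth_index y xx) e nth_index.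
split=> //; apply/ffunP=> x; rewrite !ffunE.
  have [xx|xx] := boolP (x \in ys); last first.
    rewrite nth_default; last by rewrite size_mkseq -sys leqNgt index_mem.
    by rewrite (_ : (x == y) = false) //; apply: contraNF xx => /eqP->.
  by rewrite nth_mkseq -?sys ?index_mem // idx; case: (x == y).
have [xx|xx] := boolP (x \in ys); last first.
  rewrite nth_default; last by rewrite size_mkseq -sys leqNgt index_mem.
  by rewrite (_ : (x == y) = false) //; apply: contraNF xx => /eqP->.
by rewrite nth_mkseq -?sys ?index_mem // idx; case: (x == y).
Qed.

Lemma attach_vertex y : exists k (A' : vecK),
  attach (outer) (deltaf F4 y) k A'.
Proof.
have [yy|yn] := boolP (y \in ys).
  have [s ss [e1 e2 e3]] := unit_star yy.
  by exists 1, (deltaf K y); right; exists s.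
by exists 1, (deltaf K y); left; exists y; rewrite // mem_filter yn mem_enum.
Qed.

Lemma famvec_lift (u : vec4) : \sum_x u x = 0 -> famvec a f ys u -> exists u', RV outer (u, u').
Proof.
have zero : exists u', RV outer (0, u') by exists 0; left; left.
have star_lift x s c : x \notin ys -> s \in stars f -> c != 0 ->
    exists u', RV outer (c *: (deltaf F4 x + emb ys s.1.1), u').
  move=> nx ss c0; exists (1 *: (pv s.1.2 *: deltaf K x - embK ys s.2)).
  right; exists x, (emb ys s.1.1), (pv s.1.2), (embK ys s.2), c, 1.
  have xo : x \in outer by rewrite mem_filter nx mem_enum.
  by split; rewrite ?oner_neq0 //; right; exists s.
move=> us /or3P[u2|/existsP[c /hasP[l /mapP[x xN ->] /eqP->]]|].
- have [->//|/existsP[x ux]] : u = 0 \/ [exists x, u x != 0].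
    have [_|/existsPn no] := boolP [exists x, u x != 0]; first by right.
    by left; apply/ffunP=> x; rewrite ffunE; apply/eqP/negbNE/no.
  (* Since the entries add up to 0, a second nonzero entry exists and equals the first. *)
  have [y [yx uE]] : exists y, y != x /\ u = (u x : F4) *: (deltaf F4 x + deltaf F4 y).
    have [y /andP[yx uy]] : exists y, (y != x) && (u y != 0).
      apply/existsP; apply: contraNT ux => /existsPn no; rewrite -us (bigD1 x) //= big1 ?addr0 //.
      by move=> y yx; have := no y; rewrite yx negbK => /eqP.
    have su : supp u = [set x; y].
      apply/esym/eqP; rewrite eqEcard cards2 eq_sym yx u2 andbT.
      by apply/subsetP=> z; rewrite !inE => /orP[/eqP->|/eqP->].
    have u0 z : z != x -> z != y -> u z = 0.
      move=> zx zy; apply/eqP; have : z \notin supp u by rewrite su !inE negb_or zx.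
      by rewrite inE negbK.
    have uxy : u y = u x.
      move: us; rewrite (bigD1 x) //= (bigD1 y) //= big1 ?addr0; last first.
        by move=> z /andP[zx zy]; apply: u0.
      by move/eqP; rewrite addr_eq0 (F4_opp cardF4 a_def) => /eqP.
    exists y; split=> //; apply/ffunP=> z; rewrite !ffunE /GRing.scale /=.
    have [->|zx] := eqVneq z x; first by rewrite eq_sym (negPf yx) addr0 mulr1.
    have [->|zy] := eqVneq z y; first by rewrite add0r mulr1.
    by rewrite addr0 mulr0 u0.
  have [xx|xn] := boolP (x \in ys); last first.
    have [yy|yn] := boolP (y \in ys).
      by have [s ss [e1 e2 e3]] := unit_star yy; rewrite uE -e1; apply: star_lift.
    exists (1 *: (1 *: deltaf K x - deltaf K y)).
    right; exists x, (deltaf F4 y), 1, (deltaf K y), (u x), 1; split=> //.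
    - by rewrite mem_filter xn mem_enum.
    - by left; exists y; rewrite // mem_filter yx mem_filter yn mem_enum.
    - exact: oner_neq0.
    by rewrite -uE.
  have [k [A' at_]] := attach_vertex x; have [l [B' bt]] := attach_vertex y.
  exists (1 *: (l *: A' - k *: B')); rewrite uE.
  exact: RVZ ux (oner_neq0 K) (attach_diff at_ bt).
- have [->|c0] := eqVneq c 0; first by rewrite scale0r.
  exists (1 *: embK ys x.2); left.
  apply: (inRZ c0 (oner_neq0 K) (p := (emb ys (dec (f_m f) x.1), embK ys x.2))).
  by apply: (@mem_core (dec (f_m f) x.1, x.2)); rewrite mem_cat; apply/orP; left; apply/mapP; exists x.
case/existsP=> c /existsP[x /andP[nx /hasP[l /mapP[s sS ->] /eqP->]]].
have [->|c0] := eqVneq c 0; first by rewrite scale0r.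
apply: (@star_lift x (dec (f_m f) s.1.1, s.1.2, s.2)) => //.
by rewrite mem_cat; apply/orP; left; apply/mapP; exists s.
Qed.

Lemma family_lift (I : finType) (w : I -> vec4) :
  (forall i, \sum_x w i x = 0) -> (forall i, famvec a f ys (w i)) ->
  exists w' : I -> vecK, forall X : {set I}, \dim (sp w X) = \dim (sp w' X).
Proof.
move=> ws wf.
have /fin_all_exists[w' hw] i : exists u', RV outer (w i, u') by apply: famvec_lift.
exists w' => X; have eX : X =i enum X by move=> i; rewrite mem_enum.
rewrite (sp_span w eX) (sp_span w' eX).
have Uo : uniq outer by rewrite filter_uniq ?enum_uniq.
have := @RV_SD outer Uo _ [seq (w i, w' i) | i <- enum X].
rewrite -!map_comp; apply; first by move=> x; rewrite mem_filter => /andP[].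
by move=> _ /mapP[i _ ->].
Qed.

End Family.
End Vectors.
End Lift.

Lemma stars_size fi s : s \in stars (nth fam0 families fi) ->
  size s.1.1 = f_m (nth fam0 families fi) /\ size s.2 = f_m (nth fam0 families fi).
Proof.
suff h : all (fun f => all (fun s : star => (size s.1.1 == f_m f) && (size s.2 == f_m f))
    (stars f)) families.
  have [lt|le] := ltnP fi (size families); last by rewrite nth_default.
  by move/(allP (all_nthP fam0 h fi lt)) => /andP[/eqP-> /eqP->].
by vm_compute.
Qed.

Section CoreTheorem.
Variables (F4 : finFieldType) (cardF4 : #|F4| = 4) (a : F4).
Hypothesis a_def : (a ^+ 2 = a + 1)%R.
Local Open Scope ring_scope.

(** Either one of the four given elements avoids 0, 1, -1 and 2, or these four values are distinct.
    In the latter case 3 avoids them; for instance 3 = -1 would give 2 * 2 = 0. *)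
Lemma good_parameter (K : fieldType) : (exists2 s : seq K, uniq s & size s = 4%N) ->
  exists t : K, forall r, r \in roots -> t != zv K r.
Proof.
move=> [s Us s4]; pose bads : seq K := [:: 0; 1; -1; 2%:R].
have sub (t : K) : t \notin bads -> forall r, r \in roots -> t != zv K r.
  rewrite !inE !negb_or => /and4P[h1 h2 h3 h4] r.
  by rewrite !inE => /or4P[] /eqP->.
have [/hasP[t ts tb]|/hasPn no] := boolP (has (fun t => t \notin bads) s).
  by exists t; apply: sub.
have sb : {subset s <= bads} by move=> x /no; rewrite negbK.
have Ub : uniq bads.
  by apply: leq_size_uniq Us sb _; rewrite s4.
exists 3%:R; apply: sub; move: Ub; rewrite /= !inE !negb_or.
move=> /and4P[/and3P[h01 h0m h02] /andP[h1m h12] hm2 _].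
have two : (2%:R : K) != 0 by rewrite eq_sym.
have three : (3%:R : K) != 0 by rewrite -[3%N]/(2 + 1)%N natrD addr_eq0 eq_sym.
rewrite three /=; apply/and3P; split.
- by rewrite -[3%N]/(1 + 2)%N natrD -subr_eq0 addrAC subrr add0r.
- rewrite -subr_eq0 opprK (_ : 3%:R + 1 = 2%:R * 2%:R :> K) ?mulf_neq0 //.
  by rewrite -natrM natr1.
by rewrite -[3%N]/(2 + 1)%N natrD -subr_eq0 addrAC subrr add0r oner_neq0.
Qed.

Theorem config_lift (V I : finType) (D : {set V}) (w : I -> {ffun V -> F4^o}) (K : fieldType) :
  config a D w -> (exists2 s : seq K, uniq s & size s = 4%N) ->
  exists w' : I -> {ffun V -> K^o}, forall X : {set I}, \dim (sp w X) = \dim (sp w' X).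
Proof.
move=> cw /good_parameter[t ht].
have [fi [ys [Uys sys hf]]] := config_family cardF4 a_def cw.
apply: (family_lift cardF4 a_def ht (fam_okP fi) Uys sys) => //.
  by move=> s ss; have [] := stars_size ss.
by move=> i; apply: config_sum cw i.
Qed.

End CoreTheorem.

(** * Frame templates *)

Section TemplateMatrices.
Variables (F : finFieldType) (Phi : template F).
Local Open Scope ring_scope.
Local Notation special := (tC Phi + tY0 Phi + tY1 Phi)%type.

Definition colC (c : tC Phi) : special := inl (inl c).
Definition colY0 (s : tY0 Phi) : special := inl (inr s).
Definition colY1 (j : tY1 Phi) : special := inr j.

Definition spec_type (B : finType) : Type :=
  (({ffun tX Phi -> F} * {ffun B -> F}) + (B * tY1 Phi))%type.

Section Build.
Variables (B E : finType) (d : B -> {ffun special -> F}) (sp_ : E -> spec_type B).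

(* [inl (l, c)] is a column with [X]-part [l] and frame part [c]; [inr (b, j)] is an element of
   [Z], i.e. the sum of the unit column of [b] and of the column [j] in [Y1]. *)
Definition mkA (r : tX Phi + B) (c : special + E) : F :=
  match r, c with
  | inl x, inl s => tA1 x s
  | inr b, inl s => d b s
  | inl x, inr e => match sp_ e with inl lc => lc.1 x | inr bj => tA1 x (inr bj.2) end
  | inr b, inr e =>
      match sp_ e with inl lc => lc.2 b | inr bj => (b == bj.1)%:R + d b (inr bj.2) end
  end.

Definition spec_ok : Prop := (forall b, d b \in tDelta Phi) /\
  (forall e lc, sp_ e = inl lc -> lc.1 \in tLambda Phi /\ frame_column (tG Phi) lc.2).

Lemma mkA_conforms : spec_ok -> matrix_conforms mkA.
Proof.
move=> [hd hs].
pose A' (r : tX Phi + B) (c : special + E) : F :=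
  match c with
  | inl s => mkA r (inl s)
  | inr e => match sp_ e with
    | inl _ => mkA r (inr e)
    | inr bj => if r is inr b then (b == bj.1)%:R else 0 end
  end.
exists A', [set e | if sp_ e is inr _ then true else false]; split=> //.
- split=> //=.
  + move=> z; rewrite inE; case Ez : (sp_ z) => [|[b j]] // _; split=> //.
    by exists b.
  + move=> e; rewrite inE; case Ee : (sp_ e) => [lc|//] _.
    by have [_] := hs e lc Ee.
  + move=> e; rewrite inE; case Ee : (sp_ e) => [lc|//] _.
    have -> : [ffun x => lc.1 x] = lc.1 by apply/ffunP=> x; rewrite ffunE.
    by have [] := hs e lc Ee.
  move=> b; have -> : [ffun s => d b s] = d b by apply/ffunP=> s; rewrite ffunE.
  exact: hd.
- by move=> r e; rewrite inE /A'; case: (sp_ e).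
move=> z; rewrite inE /A'; case Ez : (sp_ z) => [//|[b j]] _; exists j => -[x|b'] /=.
  by rewrite Ez add0r.
by rewrite Ez.
Qed.

End Build.

Lemma frame_column_ext (G : {set {unit F}}) (B : finType) (c c' : B -> F) : c =1 c' ->
  frame_column G c -> frame_column G c'.
Proof.
move=> e [h1 h2]; split.
  by move: h1; congr (_ <= _)%N; apply: eq_card => b; rewrite !inE e.
move=> [b cb]; have [|b0 c0 h] := h2; first by exists b; rewrite e.
by exists b0; rewrite -?e // => b' nb; rewrite -!e; apply: h.
Qed.

(** Together with [mkA_conforms], this replaces the matrices [A'] and the set [Z] by explicit data:
    an element of [Delta] for each frame row and a description of each column. Other members of
    M(Phi) are built by changing these data. *)
Lemma conforms_mkA (B E : finType) (A : tX Phi + B -> special + E -> F) :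
  matrix_conforms A -> exists d (s : E -> spec_type B), spec_ok d s /\
    forall r c, A r c = mkA d s r c.
Proof.
move=> [A' [Z [[h1 h2 h3 h4 h5] hs he hz]]].
pose d b : {ffun special -> F} := [ffun s => A (inr b) (inl s)].
have ex e : exists s : spec_type B,
    (forall lc, s = inl lc -> lc.1 \in tLambda Phi /\ frame_column (tG Phi) lc.2) /\
    (forall r, A r (inr e) = mkA d (fun _ : E => s) r (inr e)).
  have [eZ|eZ] := boolP (e \in Z).
    have [z1 [b0 z2]] := h2 e eZ; have [j hj] := hz e eZ.
    exists (inr (b0, j)); split=> // -[x|b] /=; rewrite hj ?z1 ?h1 ?add0r // z2.
    by rewrite ffunE hs.
  exists (inl ([ffun x => A (inl x) (inr e)], [ffun b => A (inr b) (inr e)])); split.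
    move=> _ [<-] /=; split.
      have -> : [ffun x => A (inl x) (inr e)] = [ffun x => A' (inl x) (inr e)].
        by apply/ffunP=> x; rewrite !ffunE he.
      exact: h4.
    by apply: frame_column_ext (h3 e eZ) => b; rewrite ffunE he.
  by move=> [x|b] /=; rewrite ffunE.
have /fin_all_exists[s hs'] := ex.
exists d, s; split.
  split=> [b|e lc Es]; last by have [h _] := hs' e; apply: h.
  have -> : d b = [ffun s => A' (inr b) (inl s)] by apply/ffunP=> z; rewrite !ffunE hs.
  exact: h5.
move=> r [z|e]; last by have [_ ->] := hs' e; case: r.
by case: r => [x|b] /=; rewrite ?ffunE ?hs ?h1.
Qed.

Lemma riso_refl (M : rmatroid F) : riso M M.
Proof.
exists id, (fun=> 1); split=> [|e|u]; [exact: (Bijective (g := id))|exact: oner_neq0|].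
have -> : [ffun e => 1 * u e : F^o] = u by apply/ffunP=> e; rewrite ffunE mul1r.
by [].
Qed.

Section Minor.
Variables (B E : finType) (A : tX Phi + B -> special + E -> F).
Local Notation W := {ffun tX Phi + B -> F^o}.

Lemma col_ground (T : finType) (h : T -> special + E) :
  (forall i, ~~ in_C (h i)) -> (forall i, ~~ in_Y1 (h i)) ->
  exists g : T -> underlying (contract_delete A), forall i, val (val (g i)) = h i.
Proof.
move=> hC hY; suff : forall i, exists x : underlying (contract_delete A), val (val x) = h i.
  by move/fin_all_exists.
move=> i.
have p1 : h i \in ~: [set e | in_C e] by rewrite !inE.
pose x1 : rground (@rcontract F (rmatroid_of A) [set e | in_C e]) := exist _ (h i) p1.
have p2 : x1 \in ~: [set e | in_Y1 (val e)] by rewrite in_setC inE; apply: hY.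
by exists (exist _ x1 p2).
Qed.

Lemma template_minor (T : matroid) (W' : vectType F) (w : T -> W') (h : T -> special + E)
    (C : {set E}) (f : 'Hom(W', W)) :
  (forall X : {set T}, rk X = \dim (sp w X)) -> injective h ->
  (forall i, ~~ in_C (h i)) -> (forall i, ~~ in_Y1 (h i)) ->
  (forall i e, h i = inr e -> e \notin C) ->
  (forall i, colvec A (h i) - f (w i) \in sp (colvec A) (Cset Phi E :|: inr @: C)) ->
  (forall x, x \in sp w setT -> f x \in sp (colvec A) (Cset Phi E :|: inr @: C) -> x = 0) ->
  has_minor (underlying (contract_delete A)) T.
Proof.
move=> rw ih hC hY hE hv hi; have [g gE] := col_ground hC hY.
pose v (x : underlying (contract_delete A)) : W := colvec A (val (val x)).
pose C' := [set x : underlying (contract_delete A) | val (val x) \in inr @: C].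
have spE : (sp (colvec A) (Cset Phi E) + sp v C')%VS = sp (colvec A) (Cset Phi E :|: inr @: C).
  rewrite spU; congr (_ + _)%VS; apply/eqP; rewrite eqEsubv; apply/andP; split.
    by apply: sp_sub => x; rewrite inE => xC; rewrite /v; apply: (mem_sp (colvec A)).
  apply: sp_sub => _ /imsetP[e eC ->].
  have [] := @col_ground unit (fun=> inr e); rewrite //= => k /(_ tt) ke.
  have kC : k tt \in C' by rewrite inE (_ : val (val (k tt)) = inr e) ?imset_f.
  have <- : v (k tt) = colvec A (inr e) by rewrite /v (_ : val (val (k tt)) = inr e).
  exact: mem_sp.
apply: (@repr_minor F _ T _ _ v (sp (colvec A) (Cset Phi E)) w g C' f).
- exact: contract_delete_repr.
- exact: rw.
- by move=> i j /(congr1 (fun x => val (val x))); rewrite !gE => /ih.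
- by move=> i; rewrite inE gE; apply/imsetP=> -[e eC he]; have := hE i e he; rewrite eC.
- by move=> i; exists 1; rewrite ?oner_neq0 // scale1r spE /v gE.
by rewrite spE.
Qed.

Lemma sp_vanish (J : finType) (D : {set J}) (v : J -> W) r u :
  (forall i, i \in D -> v i r = 0) -> u \in sp v D -> u r = 0.
Proof.
move=> v0 uD; pose ev (u : W) : F^o := u r.
have lev : linear ev by move=> c x y; rewrite /ev !ffunE.
pose eL := GRing.isLinear.Build F _ _ _ ev lev.
pose e : {linear W -> F^o} := HB.pack ev eL.
have /subvP/(_ _ uD) : (sp v D <= lker (linfun e))%VS.
  by apply: sp_sub => i iD; rewrite memv_ker lfunE /= /ev v0.
by rewrite memv_ker lfunE /= => /eqP.
Qed.

Lemma sp_coef u : u \in sp (colvec A) (Cset Phi E) ->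
  exists k : tC Phi -> F, forall r, u r = \sum_c k c * A r (inl (colC c)).
Proof.
have -> : Cset Phi E = (fun c => inl (colC c)) @: setT.
  apply/setP=> -[[[c|s]|j]|e]; rewrite !inE /=; symmetry;
    try by apply/imsetP=> -[].
  by apply/imsetP; exists c.
rewrite (sp_imset (colvec A)) /sp => /memv_sumP[u_ hu ->].
have /fin_all_exists[k hk] c : exists k : F, u_ c = k *: colvec A (inl (colC c)).
  by have /vlineP[k ->] := hu c (in_setT c); exists k.
exists k => r; rewrite sum_ffunE; apply: eq_big => [c|c _]; first by rewrite inE.
by rewrite hk !ffunE.
Qed.

Lemma coef_sp (k : tC Phi -> F) (u : W) :
  (forall r, u r = \sum_c k c * A r (inl (colC c))) -> u \in sp (colvec A) (Cset Phi E).
Proof.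
move=> hu; have -> : u = \sum_c k c *: colvec A (inl (colC c)).
  by apply/ffunP=> r; rewrite hu sum_ffunE; apply: eq_bigr => c _; rewrite !ffunE.
by apply: memv_suml => c _; apply/memvZ/mem_sp; rewrite inE.
Qed.

End Minor.
End TemplateMatrices.

(** * What the absence of F7 means for a template *)

Section TemplateTrivial.
Variables (F4 : finFieldType) (cardF4 : #|F4| = 4) (a : F4).
Hypothesis a_def : (a ^+ 2 = a + 1)%R.
Variable Phi : template F4.
Hypothesis avoidPhi : forall M, conforms Phi M -> avoids (rank3_excluded a) M.
Local Open Scope ring_scope.
Local Notation gval := (gval a).
Local Notation special := (tC Phi + tY0 Phi + tY1 Phi)%type.

Lemma mkA_avoids (B E : finType) d (s : E -> spec_type Phi B) : spec_ok d s ->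
  ~ has_minor_in (rank3_excluded a) (underlying (contract_delete (mkA d s))).
Proof.
move=> ok; apply: (avoidPhi (M := contract_delete (mkA d s))).
by exists B, E, (mkA d s); split; [apply: mkA_conforms|apply: riso_refl].
Qed.

Lemma zero_Delta : [ffun=> 0] \in tDelta Phi.
Proof. by have [h _] := tDelta_zmod Phi. Qed.

Lemma zero_Lambda : [ffun=> 0] \in tLambda Phi.
Proof. by have [h _] := tLambda_zmod Phi. Qed.

(** Entries 0 and 1 satisfy the frame condition for every group, since -1 = 1. The frame columns
    added to the auxiliary matrices are of this kind. *)
Lemma frame_small (B : finType) (c : B -> F4) b1 b2 :
  (forall b, b != b1 -> b != b2 -> c b = 0) -> (forall b, c b = 0 \/ c b = 1) ->
  frame_column (tG Phi) c.
Proof.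
move=> c0 c01; split.
  apply: leq_trans (_ : #|[set b1; b2]| <= 2)%N; last by rewrite cards2; case: (b1 != b2).
  apply: subset_leq_card; apply/subsetP=> b; rewrite !inE; apply: contraNT.
  by rewrite negb_or => /andP[n1 n2]; rewrite c0.
move=> [b cb]; exists b; first by have [e|] := c01 b; [rewrite e eqxx in cb|].
move=> b' _ cb'; exists 1%g; first exact: group1.
by rewrite (F4_opp cardF4 a_def); have [e|->] := c01 b'; [rewrite e eqxx in cb'|].
Qed.

Definition fmat (c : seq (seq g4)) n m : 'I_n -> 'I_m -> F4 :=
  fun i j => gval (nth g0 (nth [::] c i) j).

Lemma F7_minor (M : matroid) (N := col_matroid (@fmat F7c 3 7)) : has_minor M N -> has_minor_in (rank3_excluded a) M.
Proof.
move=> h; exists F7; first by left.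
apply: minor_trans h (iso_minor _); have [f bf rf] := F7_iso cardF4 a_def.
exists f => // X; rewrite -rf -[LHS]/(\dim (sp _ (f @: X))) -[RHS]/(\dim (sp _ (f @: X))).
congr (\dim _); apply: eq_bigr => j _; congr <[_]>%VS.
apply/ffunP=> i; rewrite !ffunE /fmat.
by case: i => [[|[|[|]]] //= ?]; case: j => [[|[|[|[|[|[|[|]]]]]]] //= ?].
Qed.

Lemma F7c01 (i : 'I_3) (j : 'I_7) : @fmat F7c 3 7 i j = 0 \/ @fmat F7c 3 7 i j = 1.
Proof.
rewrite /fmat; case: i => [[|[|[|]]] //= ?]; case: j => [[|[|[|[|[|[|[|]]]]]]] //= ?];
  by [left|right].
Qed.

Section LinMaps.
Variables (n : nat) (R : finType) (g : 'I_n -> {ffun R -> F4^o}).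

Definition lcomb (u : {ffun 'I_n -> F4^o}) : {ffun R -> F4^o} := \sum_i (u i : F4) *: g i.

Fact lcomb_linear : linear lcomb.
Proof.
move=> c u v; rewrite /lcomb scaler_sumr -big_split; apply: eq_bigr => i _ /=.
by rewrite !ffunE scalerDl scalerA.
Qed.
HB.instance Definition _ := GRing.isLinear.Build F4 _ _ _ lcomb lcomb_linear.

Lemma lcombE u r : linfun lcomb u r = \sum_i u i * g i r.
Proof. by rewrite lfunE /= sum_ffunE; apply: eq_bigr => i _; rewrite !ffunE. Qed.

End LinMaps.

Local Notation Delta_type := {d : {ffun special -> F4} | d \in tDelta Phi}.

(** If the column with [l] on [X] and zeros below were outside the span of [C], it could serve as a
    third coordinate beside two frame rows. As [Lambda] contains its multiples by 0 and 1, all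
    columns of F7 would occur in a conforming matrix. *)
Lemma Lambda_in_C l : l \in tLambda Phi -> exists k : tC Phi -> F4,
  (forall x, l x = \sum_c k c * tA1 x (colC c)) /\
  (forall d, d \in tDelta Phi -> \sum_c k c * d (colC c) = 0).
Proof.
move=> lL.
(* One row for every element of [Delta] makes the coefficients [k] valid for all of them at once;
   the two further rows carry the frame part of F7. *)
pose B : finType := ('I_2 + Delta_type)%type.
pose d (b : B) : {ffun special -> F4} := if b is inr d then val d else [ffun=> 0].
pose i3 (i : 'I_2) : 'I_3 := widen_ord (isT : 2 <= 3)%N i.
pose fm := @fmat F7c 3 7.
pose s (e : 'I_7) : spec_type Phi B :=
  inl ([ffun x => fm ord_max e * l x], [ffun b => if b is inl i then fm (i3 i) e else 0]).
have ok : spec_ok d s.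
  split=> [[b|[b bD]]|e _ [<-]] /=; [exact: zero_Delta|exact: bD|split].
    have := F7c01 ord_max e; rewrite -/fm => -[->|->].
      have -> : [ffun x => 0 * l x] = [ffun=> 0] by apply/ffunP=> x; rewrite !ffunE mul0r.
      exact: zero_Lambda.
    by have -> : [ffun x => 1 * l x] = l by apply/ffunP=> x; rewrite !ffunE mul1r.
  apply: (@frame_small _ _ (inl ord0) (inl ord_max)) => [[i|b]|[i|b]]; rewrite ffunE //.
  - by case: i => [[|[|]]] //= ?; rewrite -?val_eqE.
  - exact: F7c01.
  by left.
have [/sp_coef[k hk]|nin] := boolP ([ffun r : tX Phi + B => if r is inl x then l x else 0 : F4^o]
    \in sp (colvec (mkA d s)) (Cset Phi 'I_7)).
  exists k; split=> [x|e eD]; first by have := hk (inl x); rewrite ffunE.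
  by have := hk (inr (inr (exist _ e eD))); rewrite ffunE.
case: (mkA_avoids ok); apply: F7_minor.
pose g (i : 'I_3) : {ffun tX Phi + B -> F4^o} := [ffun r =>
  if i == ord_max then (if r is inl x then l x else 0) else
  if r is inr (inl j) then (i == i3 j)%:R else 0].
have gE (u : 'I_3 -> F4) r : \sum_i u i * g i r =
    match r with inl x => u ord_max * l x | inr (inl j) => u (i3 j) | inr (inr _) => 0 end.
  rewrite !big_ord_recl big_ord0 !ffunE /=.
  case: r => [x|[[[|[|]] // ?]|b]]; rewrite /= ?mulr0 ?mulr1 ?add0r ?addr0 //; congr (_ * _) || congr (u _);
    try congr (u _); exact: val_inj.
apply: (@template_minor F4 Phi _ _ (mkA d s) (col_matroid fm) _ (colvec fm)
  (fun j => inr j) set0 (linfun (lcomb g))) => //.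
- by move=> i j [].
- by move=> i e _; rewrite inE.
- move=> i; set u := _ - _; have -> : u = 0; last exact: mem0v.
  apply/ffunP=> r; rewrite !ffunE lcombE gE.
  by case: r => [x|[b|b]] /=; rewrite !ffunE subrr.
move=> x _; rewrite imset0 setU0 => xC.
have x0 (j : 'I_2) : x (i3 j) = 0.
  have := sp_vanish (r := inr (inl j)) _ xC; rewrite lcombE gE; apply.
  by move=> -[[[c|?]|?]|?]; rewrite inE //= => _; rewrite ffunE /= /d ffunE.
have xm : x ord_max = 0.
  apply/eqP; apply: contraNT nin => xm.
  set y := finfun _; have -> : y = (x ord_max)^-1 *: linfun (lcomb g) x; last exact: memvZ.
  apply/ffunP=> r; rewrite [RHS]ffunE lcombE gE ffunE; case: r => [z|[j|b]].
  - by rewrite /GRing.scale /= mulKf.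
  - by rewrite x0 scaler0.
  by rewrite scaler0.
apply/ffunP=> i; rewrite ffunE; have [->//|im] := eqVneq i ord_max.
have il : (i < 2)%N by move: im; rewrite -val_eqE; case: i => [[|[|[|]]]].
by have <- : i3 (Ordinal il) = i by apply: val_inj.
Qed.

(** Otherwise let four frame rows all be equal to [e]: the combination [k] of the columns of [C] is
    then a nonzero multiple of the all-ones vector on these rows. Modulo [C] the sum of three unit
    vectors equals the fourth, which turns the column of F7 with three ones into a legal frame
    column. *)
Lemma C_faithful (k : tC Phi -> F4) : (forall x, \sum_c k c * tA1 x (colC c) = 0) ->
  forall d, d \in tDelta Phi -> \sum_c k c * d (colC c) = 0.
Proof.
move=> k0 e eD; apply/eqP; apply: contraT => eta0.
pose d (b : 'I_4) : {ffun special -> F4} := e.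
pose fm := @fmat F7c 3 7.
(* Column 5 is the only column of [F7c] with three nonzero entries; the fourth unit vector takes its
   place. *)
pose full (j : 'I_7) : bool := (j == 5 :> nat).
have zero_entry j : ~~ full j -> exists b3 : 'I_3, fm b3 j = 0.
  rewrite /fm /fmat; case: j => [[|[|[|[|[|[|[|]]]]]]] //= ?] _;
  by [exists (inord 1); rewrite inordK | exists (inord 0); rewrite inordK
     | exists (inord 2); rewrite inordK].
pose i4 (i : 'I_3) : 'I_4 := widen_ord (isT : 3 <= 4)%N i.
pose s (j : 'I_7) : spec_type Phi 'I_4 := inl ([ffun=> 0],
  [ffun b : 'I_4 => if full j then (b == ord_max)%:R else
                    if b == ord_max then 0 else fm (inord b) j]).
have ok : spec_ok d s.
  split=> [b|j _ [<-]] /=; [exact: eD|split; first exact: zero_Lambda].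
  have fc (c : {ffun 'I_4 -> F4}) b1 b2 : (forall b, b != b1 -> b != b2 -> c b = 0) ->
      (forall b, c b = 0 \/ c b = 1) -> frame_column (tG Phi) c by apply: frame_small.
  have c01 b : ([ffun b : 'I_4 => if full j then (b == ord_max)%:R else
       if b == ord_max then 0 else fm (inord b) j] : {ffun 'I_4 -> F4}) b = 0 \/
     ([ffun b : 'I_4 => if full j then (b == ord_max)%:R else
       if b == ord_max then 0 else fm (inord b) j] : {ffun 'I_4 -> F4}) b = 1.
    rewrite ffunE; case: (full j); first by case: (b == _); [right|left].
    by case: (b == _); [left|apply: F7c01].
  have ex : exists b1 b2 : 'I_4, forall b, b != b1 -> b != b2 ->
     ([ffun b : 'I_4 => if full j then (b == ord_max)%:R else
       if b == ord_max then 0 else fm (inord b) j] : {ffun 'I_4 -> F4}) b = 0.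
    have [fj|nfj] := boolP (full j).
      by exists ord_max, ord_max => b nb _; rewrite ffunE (negPf nb).
    have [b3 hb3] := zero_entry j nfj.
    have [b1 [b2 hb]] : exists b1 b2 : 'I_3, forall b, b != b1 -> b != b2 -> b = b3.
      case: b3 {hb3} => [[|[|[|]]] // lb].
      - by exists (inord 1), (inord 2) => -[[|[|[|]]] // ?]; rewrite -!val_eqE /= !inordK //= => *; apply: val_inj.
      - by exists (inord 0), (inord 2) => -[[|[|[|]]] // ?]; rewrite -!val_eqE /= !inordK //= => *; apply: val_inj.
      by exists (inord 0), (inord 1) => -[[|[|[|]]] // ?]; rewrite -!val_eqE /= !inordK //= => *; apply: val_inj.
    exists (i4 b1), (i4 b2) => b n1 n2; rewrite ffunE; case: eqVneq => // nb.
    have bl : (b < 3)%N by move: nb; rewrite -val_eqE; case: b {n1 n2} => [[|[|[|[|]]]]].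
    rewrite (hb (inord b)) ?hb3 // -val_eqE /= inordK //.
  by have [b1 [b2 h]] := ex; apply: fc h c01.
case: (mkA_avoids ok); apply: F7_minor.
pose g (i : 'I_3) : {ffun tX Phi + 'I_4 -> F4^o} := deltaf F4 (inr (i4 i)).
have gE (u : 'I_3 -> F4) r : \sum_i u i * g i r =
    match r with inl x => 0 | inr b => if b == ord_max then 0 else u (inord b) end.
  case: r => [x|b]; first by rewrite big1 // => i _; rewrite !ffunE mulr0.
  have gb b' i : g i (inr b') = (b' == i4 i)%:R by rewrite !ffunE.
  case: eqP => [->|/eqP nb].
    rewrite big1 // => i _; rewrite gb (_ : (_ == _) = false) ?mulr0 //.
    by rewrite -val_eqE /= gtn_eqF.
  have bl : (b < 3)%N by move: nb; rewrite -val_eqE; case: b => [[|[|[|[|]]]]].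
  rewrite (bigD1 (inord b)) //= big1 => [|i ib]; rewrite gb.
    by rewrite -val_eqE /= inordK // eqxx mulr1 addr0.
  rewrite (_ : (_ == _) = false) ?mulr0 //; apply: contraNF ib => /eqP->.
  by apply/eqP/val_inj; rewrite /= inordK.
apply: (@template_minor F4 Phi _ _ (mkA d s) (col_matroid fm) _ (colvec fm)
  (fun j => inr j) set0 (linfun (lcomb g))) => //.
- by move=> i j [].
- by move=> i e' _; rewrite inE.
- move=> j; rewrite imset0 setU0; have [fj|nfj] := boolP (full j); last first.
    set u := _ - _; have -> : u = 0; last exact: mem0v.
    apply/ffunP=> r; rewrite !ffunE lcombE gE; case: r => [x|b] /=; rewrite !ffunE ?subrr //.
    by rewrite (negPf nfj); case: eqP; rewrite ?ffunE subrr.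
  apply: (coef_sp (k := fun c => (\sum_c k c * e (colC c))^-1 * k c)) => r.
  rewrite !ffunE lcombE gE; under eq_bigr => c _ do rewrite -mulrA; rewrite -mulr_sumr.
  case: r => [x|b] /=; first by rewrite ffunE k0 mulr0 subrr.
  rewrite mulVf // !ffunE fj; case: eqP => [_|nb]; rewrite ?subr0 // sub0r (F4_opp cardF4 a_def).
  have -> : j = inord 5 by apply: val_inj; rewrite /= inordK //; apply/eqP.
  have bl : (b < 3)%N by move: nb => /eqP; rewrite -val_eqE; case: b => [[|[|[|[|]]]]].
  rewrite /fm /fmat !inordK //; by case: (b : nat) bl => [|[|[|]]].
move=> x _; rewrite imset0 setU0 => /sp_coef[k' hk'].
have hb (b : 'I_4) : (if b == ord_max then 0 else x (inord b)) = \sum_c k' c * e (colC c).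
  by have := hk' (inr b); rewrite lcombE gE.
have z : \sum_c k' c * e (colC c) = 0 by rewrite -(hb ord_max) eqxx.
apply/ffunP=> i; rewrite ffunE; have := hb (i4 i); rewrite z.
rewrite (_ : (i4 i == ord_max) = false); last by rewrite -val_eqE /= ltn_eqF.
by move=> <-; congr (x _); apply: val_inj; rewrite /= inordK.
Qed.

End TemplateTrivial.

Lemma sp_coefs (K : fieldType) (W : vectType K) (I : finType) (v : I -> W) (X : {set I}) u :
  u \in sp v X -> exists k : I -> K, (u = \sum_(i in X) k i *: v i)%R.
Proof.
rewrite /sp => /memv_sumP[u_ hu ->].
have /fin_all_exists[k hk] i : exists k : K, i \in X -> u_ i = (k *: v i)%R.
  have [iX|iX] := boolP (i \in X); last by exists 0%R.
  by have /vlineP[k ->] := hu i iX; exists k.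
by exists k; apply: eq_bigr => i iX; rewrite hk.
Qed.

Lemma lin_sp_mem (K : fieldType) (W W' : vectType K) (I : finType) (v : I -> W) (X : {set I})
    (g : {linear W -> W'}) (U : {vspace W'}) u :
  (forall i, i \in X -> g (v i) \in U) -> u \in sp v X -> g u \in U.
Proof.
move=> h /sp_coefs[k ->]; rewrite linear_sum; apply: memv_suml => i iX.
by rewrite linearZ memvZ ?h.
Qed.

(** * From a conforming matrix to a clique with additional vectors *)

Section TemplateAF4.
Variables (F4 : finFieldType) (cardF4 : #|F4| = 4) (a : F4).
Hypothesis a_def : (a ^+ 2 = a + 1)%R.
Variable Phi : template F4.
Hypothesis avoidPhi : forall M, conforms Phi M -> avoids (rank3_excluded a) M.
Local Open Scope ring_scope.
Local Notation special := (tC Phi + tY0 Phi + tY1 Phi)%type.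
Local Notation Y1 := (tY1 Phi).
Local Notation Y0 := (tY0 Phi).

Variables (B E : finType) (d : B -> {ffun special -> F4}) (s : E -> spec_type Phi B).
Hypothesis ok : spec_ok d s.
Local Notation A := (mkA d s).
Local Notation W := {ffun tX Phi + B -> F4^o}.

Definition ebv (b : B) : W := deltaf F4 (inr b).
Definition Pcol (j : Y1) : W := colvec A (inl (colY1 j)).
Local Notation U0 := (sp (colvec A) (Cset Phi E)).
Local Notation S := (sp ebv setT).

Lemma units_capC v : v \in S -> v \in U0 -> v = 0.
Proof.
move=> vS /sp_coef[k hk]; have k0 x : \sum_c k c * tA1 x (colC c) = 0.
  rewrite -[LHS](hk (inl x)); apply: sp_vanish vS => b _.
  by rewrite ffunE.
apply/ffunP=> -[x|b]; rewrite ffunE hk; first exact: k0.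
by apply: (C_faithful cardF4 a_def avoidPhi k0); have [] := ok.
Qed.

Lemma frame_part (c : {ffun B -> F4}) :
  [ffun r => if r is inr b then c b else 0 : F4^o] \in S.
Proof.
have -> : [ffun r => if r is inr b then c b else 0 : F4^o] = \sum_b (c b : F4) *: ebv b :> W.
  apply/ffunP=> r; rewrite sum_ffunE ffunE; case: r => [x|b].
    by rewrite big1 // => b _; rewrite !ffunE scaler0.
  rewrite (bigD1 b) //= big1 => [|b' nb]; first by rewrite !ffunE eqxx addr0 /GRing.scale /= mulr1.
  rewrite !ffunE (_ : (inr b == inr b' :> tX Phi + B) = false) ?scaler0 //.
  by rewrite -[LHS]/(b == b') eq_sym (negPf nb).
by apply: memv_suml => b _; apply/memvZ/mem_sp.
Qed.

Lemma lambda_part l : l \in tLambda Phi ->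
  [ffun r => if r is inl x then l x else 0 : F4^o] \in U0.
Proof.
move=> /(Lambda_in_C cardF4 a_def avoidPhi)[k [h1 h2]]; apply: (coef_sp (k := k)) => -[x|b].
  by rewrite ffunE h1.
by rewrite ffunE /= h2 //; have [] := ok.
Qed.

Lemma element_span e : colvec A (inr e) \in (S + U0 + sp Pcol setT)%VS.
Proof.
case Es : (s e) => [[l c]|[b j]].
  have [lL _] : l \in tLambda Phi /\ _ := proj2 ok e _ Es.
  have -> : colvec A (inr e) = [ffun r => if r is inr b then c b else 0 : F4^o] +
      [ffun r => if r is inl x then l x else 0 : F4^o].
    by apply/ffunP=> -[x|b]; rewrite !ffunE /= Es ?add0r ?addr0.
  by rewrite memvE (subv_trans _ (addvSl _ _)) // -memvE memv_add ?frame_part ?lambda_part.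
have -> : colvec A (inr e) = ebv b + Pcol j.
  apply/ffunP=> -[x|b']; rewrite !ffunE /= Es ?add0r //.
apply: memv_add; last exact: mem_sp.
by rewrite memvE (subv_trans _ (addvSl _ _)) // -memvE; apply: mem_sp.
Qed.

(** A smallest set of columns of [Y1] spanning them all modulo the frame rows and [C] is independent
    there: an element with a nonzero coefficient in a relation could be dropped. *)
Lemma Y1_basis : exists J0 : {set Y1}, (sp Pcol setT <= S + U0 + sp Pcol J0)%VS /\
  forall k : Y1 -> F4, \sum_(j in J0) k j *: Pcol j \in (S + U0)%VS ->
    forall j, j \in J0 -> k j = 0.
Proof.
pose ok_ (J : {set Y1}) := (sp Pcol setT <= S + U0 + sp Pcol J)%VS.
have okT : ok_ setT by apply: addvSr.
case: (arg_minnP (fun J : {set Y1} => #|J|) okT) => J okJ minJ.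
exists J; split=> // k kS j jJ; apply/eqP; apply: contraT => kj.
suff /minJ : ok_ (J :\ j) by rewrite [#|J|](cardsD1 j) jJ ltnn.
apply: subv_trans okJ _; rewrite subv_add addvSl /=; apply: sp_sub => i iJ.
have [->|ij] := eqVneq i j; last first.
  by rewrite memvE (subv_trans _ (addvSr _ _)) // -memvE; apply: mem_sp; rewrite !inE ij.
have -> : Pcol j = (k j)^-1 *: (\sum_(j in J) k j *: Pcol j - \sum_(i in J :\ j) k i *: Pcol i).
  by rewrite (big_setD1 j) //= addrK scalerK.
apply/memvZ/memvB.
  by rewrite memvE (subv_trans _ (addvSl _ _)) // -memvE.
rewrite memvE (subv_trans _ (addvSr _ _)) // -memvE.
by apply: memv_suml => i' i'J; apply/memvZ/mem_sp.
Qed.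

Section Basis.
Variable J0 : {set Y1}.
Hypothesis Jspan : (sp Pcol setT <= S + U0 + sp Pcol J0)%VS.
Hypothesis Jind : forall k : Y1 -> F4, \sum_(j in J0) k j *: Pcol j \in (S + U0)%VS ->
    forall j, j \in J0 -> k j = 0.

Local Notation Bh := (B + Y1)%type.
Local Notation V := (option Bh).
Local Notation vec := {ffun V -> F4^o}.
Local Notation Wh := {ffun tX Phi + Bh -> F4^o}.

(** The vertex [None] is sent to 0. Its entry can therefore be chosen to make every vector zero-sum,
    and the unit vector of a row becomes an edge to [None]. *)
Definition realize (u : vec) : W :=
  \sum_b (u (Some (inl b)) : F4) *: ebv b + \sum_(j in J0) (u (Some (inr j)) : F4) *: Pcol j.

Fact realize_linear : linear realize.
Proof.
move=> c u v; rewrite /realize scalerDr !scaler_sumr addrACA -!big_split /=.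
by congr (_ + _); apply: eq_bigr => i _; rewrite !ffunE scalerDl scalerA.
Qed.
HB.instance Definition _ := GRing.isLinear.Build F4 _ _ _ realize realize_linear.

Definition tame (u : vec) : Prop := \sum_x u x = 0 /\ forall j, j \notin J0 -> u (Some (inr j)) = 0.

Lemma realize_ex v : v \in (S + U0 + sp Pcol setT)%VS -> exists u, tame u /\ v - realize u \in U0.
Proof.
move=> vS; have : v \in (S + U0 + sp Pcol J0)%VS.
  by move: v vS; apply/subvP; rewrite subv_add addvSl Jspan.
case/memv_addP=> x /memv_addP[x1 x1S [x2 x2U ->]] [x3 x3P ->].
have [k1 e1] := sp_coefs x1S; have [k3 e3] := sp_coefs x3P.
pose u0 (y : Bh) : F4 := match y with inl b => k1 b | inr j => if j \in J0 then k3 j else 0 end.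
pose u : vec := [ffun y => if y is Some z then u0 z else \sum_z u0 z].
exists u; split.
  split=> [|j jJ]; last by rewrite ffunE /= (negPf jJ).
  rewrite (bigD1 None) //= ffunE (reindex_omap Some id) /=; last by case.
  have -> : \sum_(j | (Some j != None) && (Some j == Some j)) u (Some j) = \sum_z u0 z.
    by apply: eq_big => [z|z _]; rewrite ?eqxx // ffunE.
  exact: (F4_addxx cardF4 a_def).
have -> : realize u = x1 + x3.
  rewrite /realize e1 e3; congr (_ + _).
    by apply: eq_big => [b|b _]; rewrite ?inE // ffunE.
  by apply: eq_bigr => j jJ; rewrite ffunE /= jJ.
by rewrite opprD addrACA [x1 + x2]addrC addrK subrr addr0.
Qed.

Lemma realize_inj u : tame u -> realize u \in U0 -> u = 0.
Proof.
move=> [us uJ] ru; pose k j : F4 := u (Some (inr j)).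
have xS : \sum_b (u (Some (inl b)) : F4) *: ebv b \in S.
  by apply: memv_suml => b _; apply/memvZ/mem_sp.
have kS : \sum_(j in J0) k j *: Pcol j \in (S + U0)%VS.
  have -> : \sum_(j in J0) k j *: Pcol j = - \sum_b (u (Some (inl b)) : F4) *: ebv b + realize u.
    by rewrite addKr.
  by rewrite memv_add // memvN.
have k0 j : u (Some (inr j)) = 0.
  by have [jJ|/uJ//] := boolP (j \in J0); apply: (Jind kS).
have b0 b : u (Some (inl b)) = 0.
  have : \sum_b (u (Some (inl b)) : F4) *: ebv b = 0.
    apply: units_capC => //; move: ru; rewrite /realize [X in _ + X]big1 ?addr0 // => j _.
    by rewrite k0 scale0r.
  move/ffunP/(_ (inr b)); rewrite sum_ffunE (bigD1 b) //= big1 => [|b' nb]; last first.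
    rewrite !ffunE (_ : (inr b == inr b' :> tX Phi + B) = false) ?scaler0 //.
    by rewrite -[LHS]/(b == b') eq_sym (negPf nb).
  by rewrite !ffunE eqxx addr0 /GRing.scale /= mulr1.
have s0 z : u (Some z) = 0 by case: z.
apply/ffunP=> -[z|]; rewrite ffunE // -[LHS]addr0 -[RHS]us (bigD1 None) //=; congr (_ + _).
by rewrite big1 // => -[z|].
Qed.

Definition dh (y : Bh) : {ffun special -> F4} := if y is inl b then d b else [ffun=> 0].
Definition Eh : finType := ((Bh * Bh) + Y1 + E)%type.
(** The enlarged matrix has a new row for each [j] in [Y1], all edges on the rows (a pair of equal
    rows giving an edge to [None]), and an element of [Z] made from the row of [j] and the column
    [j]. Contracting this element identifies the unit vector of that row with the column [j],
    although the columns of [Y1] themselves are deleted. *)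
Definition sh (e : Eh) : spec_type Phi Bh :=
  match e with
  | inl (inl p) => inl ([ffun=> 0], [ffun y => if (y == p.1) || (y == p.2) then 1 else 0])
  | inl (inr j) => inr (inr j, j)
  | inr e => match s e with
      | inl lc => inl (lc.1, [ffun y => if y is inl b then lc.2 b else 0])
      | inr bj => inr (inl bj.1, bj.2)
      end
  end.

Lemma frame_extend (c : {ffun B -> F4}) : frame_column (tG Phi) c ->
  frame_column (tG Phi) ([ffun y => if y is inl b then c b else 0] : {ffun Bh -> F4}).
Proof.
move=> [h1 h2]; split.
  apply: leq_trans h1; rewrite -(card_imset _ (@inl_inj B Y1)); apply: subset_leq_card.
  apply/subsetP=> -[b|j]; rewrite inE ffunE ?eqxx // => cb.
  by apply: imset_f; rewrite inE.
move=> [[b|j]]; rewrite ffunE ?eqxx // => cb.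
have [|b0 c0 h] := h2; first by exists b.
exists (inl b0); first by rewrite ffunE.
by move=> [b'|j] nb; rewrite ffunE ?eqxx //; apply: h.
Qed.

Lemma sh_ok : spec_ok dh sh.
Proof.
have [h1 h2] := ok; split=> [[b|j]|]; first exact: h1.
  exact: zero_Delta.
move=> [[p|j]|e] lc //=.
  move=> [<-] /=; split; first exact: zero_Lambda.
  apply: (@frame_small _ cardF4 _ a_def _ _ _ p.1 p.2) => y; rewrite ffunE.
    by move=> /negPf-> /negPf->.
  by case: ifP; [right|left].
case Es : (s e) => [[l c]|//] [<-] /=; have [lL fc] := h2 e _ Es.
by split=> //; apply: frame_extend.
Qed.

Local Notation Ah := (mkA dh sh).
Local Notation Uh := (sp (colvec Ah) (Cset Phi Eh)).

Definition iotaW (v : W) : Wh := [ffun r => match r with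
  | inl x => v (inl x) | inr (inl b) => v (inr b) | inr (inr _) => 0 end].

Lemma colh_special z : colvec Ah (inl z) = iotaW (colvec A (inl z)).
Proof. by apply/ffunP=> -[x|[b|j]]; rewrite !ffunE //= ffunE. Qed.

Lemma colh_E e : colvec Ah (inr (inr e)) = iotaW (colvec A (inr e)).
Proof.
apply/ffunP=> -[x|[b|j]]; rewrite !ffunE //=; case: (s e) => [lc|bj] //=; rewrite ?ffunE //.
by rewrite addr0.
Qed.

Definition contr (j : Y1) : Eh := inl (inr j).

Lemma colh_contr j : colvec Ah (inr (contr j)) = deltaf F4 (inr (inr j)) + iotaW (Pcol j).
Proof.
apply/ffunP=> -[x|[b|j']]; rewrite !ffunE //=; first by rewrite add0r.
by rewrite ffunE.
Qed.

Lemma iota_U0 v : v \in U0 -> iotaW v \in Uh.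
Proof.
move=> /sp_coef[k hk]; apply: (coef_sp (k := k)) => -[x|[b|j]]; rewrite ffunE ?hk //=.
by rewrite big1 // => c _; rewrite ffunE mulr0.
Qed.

(** Undoes the enlargement: the new rows in [J0] go to their columns in [Y1], which kills the
    contracted elements, and [iotaW] is inverted. *)
Definition retract (y : Wh) : W :=
  [ffun r => match r with inl x => y (inl x) | inr b => y (inr (inl b)) end]
  + \sum_(j in J0) (y (inr (inr j)) : F4) *: Pcol j.

Fact retract_linear : linear retract.
Proof.
move=> c u v; rewrite /retract scalerDr scaler_sumr addrACA -big_split /=; congr (_ + _).
  by apply/ffunP=> -[x|b]; rewrite !ffunE.
by apply: eq_bigr => j _; rewrite !ffunE scalerDl scalerA.
Qed.
HB.instance Definition _ := GRing.isLinear.Build F4 _ _ _ retract retract_linear.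

Lemma retract_iota v : retract (iotaW v) = v.
Proof.
rewrite /retract big1 ?addr0; last by move=> j _; rewrite ffunE scale0r.
by apply/ffunP=> -[x|b]; rewrite !ffunE.
Qed.

Lemma retract_contr j : j \in J0 -> retract (colvec Ah (inr (contr j))) = 0.
Proof.
move=> jJ; rewrite colh_contr linearD /= retract_iota /retract (bigD1 j) //= big1; last first.
  move=> i /andP[_ ij]; rewrite ffunE (_ : (_ == _) = false) ?scale0r //.
  by rewrite -[LHS]/(i == j) (negPf ij).
rewrite ffunE eqxx scale1r addr0 (_ : finfun _ = 0) ?add0r.
  by apply/ffunP=> r; rewrite !ffunE (F4_addxx cardF4 a_def).
by apply/ffunP=> -[x|b]; rewrite !ffunE.
Qed.

Definition place_vec (u : vec) : Wh := [ffun r => if r is inr y then u (Some y) else 0].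

Fact place_linear : linear place_vec.
Proof. by move=> c u v; apply/ffunP=> -[x|y]; rewrite !ffunE // scaler0 addr0. Qed.
HB.instance Definition _ := GRing.isLinear.Build F4 _ _ _ place_vec place_linear.

Lemma retract_place u : retract (place_vec u) = realize u.
Proof.
rewrite /retract /realize; congr (_ + _); last by apply: eq_bigr => j _; rewrite ffunE.
apply/ffunP=> r; rewrite sum_ffunE; case: r => [x|b]; rewrite !ffunE.
  by rewrite big1 // => b _; rewrite !ffunE scaler0.
rewrite (bigD1 b) //= big1 => [|b' nb]; first by rewrite !ffunE eqxx addr0 /GRing.scale /= mulr1.
rewrite !ffunE (_ : (inr b == inr b' :> tX Phi + B) = false) ?scaler0 //.
by rewrite -[LHS]/(b == b') eq_sym (negPf nb).
Qed.

Local Notation Ctr := (contr @: J0).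

Lemma place_realize (u : vec) : tame u -> iotaW (realize u) - place_vec u \in
  sp (colvec Ah) (Cset Phi Eh :|: inr @: Ctr).
Proof.
move=> [us uJ].
have -> : iotaW (realize u) - place_vec u =
    \sum_(j in J0) (u (Some (inr j)) : F4) *: colvec Ah (inr (contr j)).
  apply/ffunP=> r; rewrite sum_ffunE.
  under eq_bigr => j _ do rewrite colh_contr.
  case: r => [x|[b|j]]; rewrite !ffunE.
  - rewrite subr0 !sum_ffunE big1 ?add0r; last by move=> b _; rewrite !ffunE scaler0.
    by apply: eq_bigr => j _; rewrite !ffunE add0r.
  - rewrite !sum_ffunE (bigD1 b) //= big1 => [|b' nb]; last first.
      rewrite !ffunE (_ : (inr b == inr b' :> tX Phi + B) = false) ?scaler0 //.
      by rewrite -[LHS]/(b == b') eq_sym (negPf nb).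
    rewrite !ffunE eqxx addr0 [_ *: _]mulr1 addrAC subrr add0r.
    by apply: eq_bigr => j _; rewrite !ffunE add0r.
  rewrite sub0r (F4_opp cardF4 a_def); have [jJ|jJ] := boolP (j \in J0).
    rewrite (bigD1 j) //= big1 => [|i /andP[_ ij]].
      by rewrite !ffunE eqxx !addr0 [_ *: _]mulr1.
    by rewrite !ffunE -[inr (inr j) == _]/(j == i) eq_sym (negPf ij) addr0 scaler0.
  rewrite uJ // big1 // => i iJ; rewrite !ffunE -[inr (inr j) == _]/(j == i).
  have [ji|_] := eqVneq j i; first by rewrite ji iJ in jJ.
  by rewrite addr0 scaler0.
by apply: memv_suml => j jJ; apply/memvZ/mem_sp; rewrite inE; apply/orP; right; rewrite !imset_f.
Qed.

(** Through [retract], membership in the span contracted in the enlarged matrix becomes membership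
    in the span of [C] in the original one, where [realize_inj] applies. *)
Lemma place_inj (u : vec) : \sum_x u x = 0 ->
  place_vec u \in sp (colvec Ah) (Cset Phi Eh :|: inr @: Ctr) -> u = 0.
Proof.
move=> us pu; apply: realize_inj.
  split=> // j jJ; have := sp_vanish (r := inr (inr j)) _ pu; rewrite ffunE; apply.
  move=> i; rewrite inE => /orP[|/imsetP[_ /imsetP[j' jJ' ->] ->]].
    by case: i => [[[c|?]|?]|?]; rewrite inE //= => _; rewrite colh_special ffunE.
  rewrite colh_contr !ffunE addr0 -[inr (inr j) == _]/(j == j').
  by have [jj|] := eqVneq j j'; first by rewrite jj jJ' in jJ.
rewrite -retract_place; apply: lin_sp_mem pu => i; rewrite inE => /orP[|].
  case: i => [[[c|?]|?]|?]; rewrite inE //= => _.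
  by rewrite colh_special retract_iota; apply: mem_sp; rewrite inE.
case/imsetP=> _ /imsetP[j' jJ' ->] ->.
by rewrite -[X in X \in _]/(retract (colvec Ah (inr (contr j')))) retract_contr // mem0v.
Qed.

Definition elcol (i : E + Y0) : special + E :=
  match i with inl e => inr e | inr y => inl (colY0 y) end.

Hypothesis Y0_span : forall y : Y0, colvec A (inl (colY0 y)) \in (S + U0 + sp Pcol setT)%VS.

Lemma elements_ex : exists w0 : E + Y0 -> vec,
  forall i, tame (w0 i) /\ colvec A (elcol i) - realize (w0 i) \in U0.
Proof.
suff : forall i, exists u : vec, tame u /\ colvec A (elcol i) - realize u \in U0.
  by move/fin_all_exists.
by move=> [e|y]; apply: realize_ex; [apply: element_span|apply: Y0_span].
Qed.

Section Elements.
Variable w0 : E + Y0 -> vec.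
Hypothesis w0P : forall i, tame (w0 i) /\ colvec A (elcol i) - realize (w0 i) \in U0.

Local Notation I := ((Bh * Bh) + (E + Y0))%type.

Definition wall (i : I) : vec :=
  match i with
  | inl p => deltaf F4 (Some p.1) + deltaf F4 (if p.1 == p.2 then None else Some p.2)
  | inr i => w0 i
  end.

Lemma delta_sum (T : finType) (x : T) : \sum_y deltaf F4 x y = 1.
Proof.
rewrite (bigD1 x) //= big1 => [|y yx]; first by rewrite ffunE eqxx addr0.
by rewrite ffunE (negPf yx).
Qed.

Lemma wall_sum i : \sum_x wall i x = 0.
Proof.
case: i => [p|i]; last by have [[]] := w0P i.
under eq_bigr => x _ do rewrite ffunE.
by rewrite big_split /= !delta_sum (F4_addxx cardF4 a_def).
Qed.

(** The vectors of [wall] represent a minor of the matroid of the enlarged matrix, and this matrix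
    conforms to the same template; that is why they avoid the excluded matroids. *)
Lemma wall_config : config a setT wall.
Proof.
split=> [i x|i|x y _ _ xy|]; first by rewrite inE.
- exact: wall_sum.
- case: x y xy => [x|] [y|] // xy.
  + exists (inl (x, y)), 1; rewrite ?oner_neq0 // scale1r /= (_ : (x == y) = false) //.
    by apply: contraNF xy => /eqP->.
  + by exists (inl (x, x)), 1; rewrite ?oner_neq0 // scale1r /= eqxx.
  by exists (inl (y, y)), 1; rewrite ?oner_neq0 // scale1r /= eqxx /edgev addrC.
move=> h; apply: (mkA_avoids avoidPhi sh_ok); apply: has_minor_in_trans h.
pose h (i : vm wall) : special + Eh := match (i : I) with
  | inl p => inr (inl (inl p)) | inr (inl e) => inr (inr e) | inr (inr y) => inl (colY0 y) end.
apply: (@template_minor F4 Phi _ _ Ah (vm wall) _ (wall : vm wall -> _) h Ctr (linfun place_vec)).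
- exact: vm_rk.
- by move=> [p|[e|y]] [p'|[e'|y']] //= [->].
- by move=> [p|[e|y]].
- by move=> [p|[e|y]].
- by move=> [p|[e|y]] e' //= [<-]; apply/imsetP=> -[j _].
- move=> i; rewrite lfunE /=; case: i => [p|i].
    have -> : colvec Ah (h (inl p)) - place_vec (wall (inl p)) = 0; last exact: mem0v.
    apply/ffunP=> -[x|y]; rewrite !ffunE //= ?ffunE ?subr0 //= ?ffunE.
    case: p => p1 p2 /=; rewrite -[Some y == Some p1]/(y == p1).
    have [<-|p12] := eqVneq p1 p2; first by rewrite orbb addr0; case: (y == p1); rewrite subrr.
    rewrite -[Some y == Some p2]/(y == p2).
    have [->|yp] := eqVneq y p1; first by rewrite (negPf p12) addr0 subrr.
    by rewrite add0r; case: (y == p2); rewrite subrr.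
  have [tm wU] := w0P i.
  have -> : colvec Ah (h (inr i)) = iotaW (colvec A (elcol i)).
    by case: i {tm wU} => [e|y]; [apply: colh_E|apply: colh_special].
  have -> : iotaW (colvec A (elcol i)) - place_vec (w0 i) =
     iotaW (colvec A (elcol i) - realize (w0 i)) + (iotaW (realize (w0 i)) - place_vec (w0 i)).
    rewrite addrA; congr (_ - _); apply/ffunP=> -[x|[b|j]]; rewrite !ffunE ?addr0 ?subrK //.
  apply: memvD; last exact: place_realize.
  have := iota_U0 wU; apply/subvP; apply: spS; exact: subsetUl.
move=> u uw; rewrite lfunE /=; apply: place_inj.
pose sm (v : vec) : F4^o := \sum_x v x.
have lsm : linear sm.
  by move=> c v v'; rewrite /sm scaler_sumr -big_split; apply: eq_bigr => x _; rewrite !ffunE.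
pose sL := GRing.isLinear.Build F4 _ _ _ sm lsm.
pose smL : {linear vec -> F4^o} := HB.pack sm sL.
have := lin_sp_mem (g := smL) (U := 0%VS) _ uw; rewrite memv0 => h0.
by apply/eqP/h0 => i _; rewrite memv0; apply/eqP/wall_sum.
Qed.

(** Ranks are carried from the given matroid to [w0] by [realize], injective modulo [C] on tame
    vectors, and from [w0] to another field by [config_lift]. *)
Lemma elements_AF4 : AF4 (underlying (contract_delete A)).
Proof.
move=> K hK; have [w' hw'] := config_lift cardF4 a_def wall_config hK.
have /fin_all_exists[j jE] (x : underlying (contract_delete A)) :
    exists i : E + Y0, val (val x) = elcol i.
  have := valP (val x); have := valP x; rewrite !inE.
  by case: (val (val x)) => [[[c|y]|y]|e] //= _ _; [exists (inr y)|exists (inl e)].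
apply: (@representable_mod K _ _ (fun x => w' (inr (j x))) 0%VS) => X.
rewrite dimv0 addn0 add0v -(sp_imset w' (fun x => inr (j x))) -hw' (sp_imset wall (fun x => inr (j x))).
pose v (e : underlying (contract_delete A)) := colvec A (val (val e)).
have hr : repr_mod v U0 by apply: contract_delete_repr.
have := hr X.
have -> : (U0 + sp v X = U0 + linfun realize @: sp (fun x => wall (inr (j x))) X)%VS.
  rewrite sp_limg; apply/eqP; rewrite eqEsubv !subv_add !addvSl /=; apply/andP; split.
    apply: sp_sub => x xX; rewrite /v jE; have [_ h] := w0P (j x).
    rewrite -[colvec A _](subrK (realize (w0 (j x)))) memv_add //.
    rewrite -[realize _]lfunE; apply: (mem_sp (fun x => linfun realize (wall (inr (j x))))) xX.
  apply: sp_sub => x xX; rewrite lfunE /=; have [_ h] := w0P (j x).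
  have -> : realize (w0 (j x)) = - (colvec A (elcol (j x)) - realize (w0 (j x))) + v x.
    by rewrite /v jE opprB subrK.
  by rewrite memv_add ?memvN //; apply: mem_sp.
rewrite dim_add_inj; first by rewrite addnC => /addnI.
move=> u uw; rewrite lfunE; apply: realize_inj.
have tame_lin : forall u, u \in sp (fun x => wall (inr (j x))) X -> tame u.
  move=> y /sp_coefs[k ->]; split.
    under eq_bigr => x _ do rewrite sum_ffunE.
    rewrite exchange_big big1 //= => x _; under eq_bigr => z _ do rewrite ffunE.
    by rewrite -scaler_sumr /=; have [[-> _] _] := w0P (j x); rewrite scaler0.
  move=> i iJ; rewrite sum_ffunE big1 // => x _; rewrite ffunE.
  by have [[_ ->]] := w0P (j x); rewrite ?scaler0.
exact: tame_lin.
Qed.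

End Elements.
End Basis.

Hypothesis spanE : forall y : Y0, colvec A (inl (colY0 y)) \in
  (U0 + sp (fun e => colvec A (inr e)) setT)%VS.

Theorem template_AF4 : AF4 (underlying (contract_delete A)).
Proof.
have [J0 [Jspan Jind]] := Y1_basis.
have Y0s y : colvec A (inl (colY0 y)) \in (S + U0 + sp Pcol setT)%VS.
  move: (spanE y); apply/subvP; rewrite subv_add; apply/andP; split.
    by rewrite (subv_trans (addvSr S _)) // addvSl.
  by apply: sp_sub => e _; apply: element_span.
have [w0 w0P] := elements_ex Jspan Y0s.
by apply: (@elements_AF4 J0 Jind w0 w0P).
Qed.

End TemplateAF4.

(** * Connectivity, simplification, complete graphs *)

Section PlaneF2.
Local Open Scope ring_scope.

Definition F7b (i j : nat) : bool := nth g0 (nth [::] F7c i) j == g1.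

Let bval (b : bool) : 'F_2 := b%:R.

Lemma normalized_bool (c : 'I_3 -> bool) i0 : c i0 -> normalized (\row_i bval (c i)).
Proof.
move=> ci0; case: (arg_minnP (fun i : 'I_3 => i : nat) ci0) => i ci mini.
apply/existsP; exists i; rewrite mxE ci eqxx; apply/forallP=> j; apply/implyP=> ji.
by rewrite mxE; case cj : (c j) => //; move/mini: cj; rewrite leqNgt ji.
Qed.

Let brank := crank false andb addb negb 3 (iota 0 3).
Let bcol j := [seq F7b i j | i <- iota 0 3].

Lemma brankE L : \dim <<map (cvec bval false 3) L>> = brank L.
Proof.
apply: crank_dim => //.
- by move=> [] []; apply/eqP.
- by move=> [] []; apply/eqP.
- by move=> [].
- by move=> l i _ ltn; rewrite mem_iota ltn.
Qed.

(** [PG 2 3] is the Fano plane. A class avoiding F7 thus satisfies the condition on projective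
    geometries in both hypotheses with [m = 3]. *)
Lemma PG_F7 : has_minor (PG 2 3) F7.
Proof.
have nz (j : 'I_7) : exists i : 'I_3, F7b i j.
  suff /existsP : [exists i : 'I_3, F7b i j] by [].
  have /allP h : all (fun j => has (fun i => F7b i j) (iota 0 3)) (iota 0 7) by [].
  have jI : (j : nat) \in iota 0 7 by rewrite mem_iota /= ltn_ord.
  have /hasP[i] := h _ jI; rewrite mem_iota => /andP[_ il] fi.
  by apply/existsP; exists (Ordinal il).
have ptP (j : 'I_7) : normalized (\row_(i < 3) bval (F7b i j)).
  by have [i0 h] := nz j; apply: (normalized_bool (c := fun i => F7b i j) h).
pose g (j : F7) : PG 2 3 := exist _ (\row_(i < 3) bval (F7b i j)) (ptP j).
pose v (j : 'I_7) := cvec bval false 3 (bcol j).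
have vE j : colvec (fun i (x : {v : 'rV['F_2]_3 | normalized v}) => val x 0 i) (g j) = v j.
  apply/ffunP=> i; rewrite !ffunE mxE; congr bval.
  by case: i => [[|[|[|]]] ?].
have dE (s : seq 'I_7) (X : {set 'I_7}) : X =i s -> \dim (sp v X) = brank (map bcol (map val s)).
  by move/sp_span->; rewrite -brankE -!map_comp.
have inN (i : 'I_7) : val i \in iota 0 7 by rewrite mem_iota /= ltn_ord.
pose L := [:: [:: 0; 1; 3]; [:: 1; 2; 4]; [:: 2; 3; 5]; [:: 3; 4; 6];
    [:: 4; 5; 0]; [:: 5; 6; 1]; [:: 6; 0; 2]]%N.
have /and3P[/allP h1 /allP h2 /allP h3] :
  [&& all (fun i => brank [:: bcol i] == 1%N) (iota 0 7),
      all (fun i => all (fun j => (i == j) || (brank [:: bcol i; bcol j] == 2%N)) (iota 0 7))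
        (iota 0 7) &
      all (fun i => all (fun j => all (fun k => [|| i == j, i == k, j == k |
        brank [:: bcol i; bcol j; bcol k] ==
          if has (fun l => [&& i \in l, j \in l & k \in l]) L then 2%N else 3%N]) (iota 0 7))
        (iota 0 7)) (iota 0 7)] by vm_compute.
have d1 i : \dim (sp v [set i]) = 1%N.
  by rewrite (dE [:: i]) => [|x]; [apply/eqP/h1/inN|rewrite !inE].
have d2 i j : i != j -> \dim (sp v [set i; j]) = 2%N.
  move=> ij; rewrite (dE [:: i; j]) => [|x]; last by rewrite !inE.
  by have /allP/(_ _ (inN j)) := h2 _ (inN i); rewrite (inj_eq val_inj) (negPf ij) => /eqP.
have rkE : forall X, config_rk L X = \dim (sp v X).
  apply: config_vec => //.
  - move=> X; apply: leq_trans (dimvS (subvf _)) _.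
    by rewrite dimvf /dim /= card_ord muln1.
  move=> i j k ij ik jk; rewrite (dE [:: i; j; k]) => [|x]; last by rewrite !inE orbA.
  have /allP/(_ _ (inN j))/allP/(_ _ (inN k)) := h3 _ (inN i).
  rewrite !(inj_eq val_inj) (negPf ij) (negPf ik) (negPf jk) !orFb => /eqP->.
  congr (if _ then _ else _); apply: eq_has => l.
  apply/and3P/forall_inP=> [[li lj lk] x|h]; last by split; apply: h; rewrite !inE eqxx ?orbT.
  by rewrite !inE => /orP[/orP[]|] /eqP->.
apply/minorP; exists g, set0; split=> [i j gij|x|X]; last 2 first.
- by rewrite inE.
- rewrite setU0 rk0 addn0 -[rk X]/(config_rk L X) rkE.
  rewrite -[LHS]/(\dim (sp (colvec _) (g @: X))) (sp_imset (colvec _) g).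
  by congr (\dim _); apply: eq_bigr => j _; rewrite vE.
apply/eqP; apply: contraT => ij; have := d2 i j ij; have := d1 i.
have vij : v i = v j by rewrite -!vE gij.
have -> : sp v [set i; j] = sp v [set i]; last by move=> ->.
apply/eqP; rewrite eqEsubv; apply/andP; split; apply: sp_sub => x; rewrite !inE.
  by case/orP=> /eqP->; rewrite -?vij; apply: mem_sp; rewrite inE.
by move=> /eqP->; apply: mem_sp; rewrite !inE eqxx.
Qed.

End PlaneF2.

(** * Transport of connectivity along isomorphisms *)

Section Transport.
Variables (M N : matroid) (f : M -> N).
Hypotheses (bf : bijective f) (rf : forall X : {set M}, rk (f @: X) = rk X).

Lemma iso_imsetC (X : {set M}) : f @: (~: X) = ~: (f @: X).
Proof.
have [f' fK f'K] := bf; apply/setP=> y; rewrite -[y]f'K !inE.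
by rewrite !(mem_imset _ _ (can_inj fK)) inE.
Qed.

Lemma iso_imsetT : f @: setT = setT.
Proof.
by apply/setP=> y; have [f' fK f'K] := bf; rewrite -[y]f'K (mem_imset _ _ (can_inj fK)) !inE.
Qed.

Lemma iso_card (X : {set M}) : #|f @: X| = #|X|.
Proof. by apply: card_imset; apply: bij_inj. Qed.

Lemma iso_conn (X : {set M}) : conn (f @: X) = conn X.
Proof. by rewrite /conn -iso_imsetC !rf -iso_imsetT rf. Qed.

Lemma iso_kconnected k : kconnected N k -> kconnected M k.
Proof.
move=> cN j X jk [h1 h2 h3]; apply: (cN j (f @: X) jk).
by split; rewrite ?iso_conn -?iso_imsetC ?iso_card.
Qed.

Lemma iso_vert k : vert_kconnected N k -> vert_kconnected M k.
Proof.
move=> cN X cX; have := cN (f @: X); rewrite iso_conn => /(_ cX).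
by rewrite /spanning -iso_imsetC -iso_imsetT !rf.
Qed.

Lemma iso_simple : simple N -> simple M.
Proof. by move=> sN X cX; rewrite -rf sN ?iso_card. Qed.

End Transport.

(** At least as many elements lie outside [X] as inside, so a nonempty [X] would be a separation of
    order [#|X|] unless its connectivity were as large as its size. This forces [X] to be
    independent with spanning complement. *)
Lemma kconnected_small (M : matroid) k (X : {set M}) : kconnected M k -> 2 * k <= #|M| ->
  #|X| < k -> rk X = #|X| /\ rk (~: X) = rk [set: M].
Proof.
move=> cM sz Xk; have r1 := rk_card X; have r2 := rk_mono (subsetT (~: X)).
have [X0|Xn0] := posnP #|X|.
  have -> : X = set0 by apply/eqP; rewrite -cards_eq0 X0.
  by rewrite rk0 setC0 cards0.
have := cM #|X| X; rewrite Xn0 Xk => /(_ isT) ns.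
have cX : #|X| <= conn X.
  rewrite leqNgt; apply/negP=> lt; apply: ns; split=> //.
  by have cC := cardsC X; rewrite /= in cC sz *; lia.
by rewrite /conn in cX; lia.
Qed.

Section TemplateConclusion.
Variables (F4 : finFieldType) (cardF4 : #|F4| = 4) (a : F4).
Hypothesis a_def : (a ^+ 2 = a + 1)%R.
Variable Phi : template F4.
Hypothesis avoidPhi : forall M, conforms Phi M -> avoids (rank3_excluded a) M.

(** At most [#|Y0|] elements of [M] come from [Y0], so the others are spanning by hypothesis. Each
    column of [Y0] then lies in their span modulo [C], as [template_AF4] requires. *)
Lemma conforms_AF4 M : conforms Phi M ->
  (forall X : {set underlying M}, #|X| <= #|tY0 Phi| -> rk (~: X) = rk [set: underlying M]) ->
  AF4 (underlying M).
Proof.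
move=> [B [E [A0 [cA /riso_urk iM]]]] hsp.
have [d [s [ok eA]]] := conforms_mkA cA.
have eA0 : A0 = mkA d s.
  by apply: FunctionalExtensionality.functional_extensionality => r;
     apply: FunctionalExtensionality.functional_extensionality => c.
rewrite eA0 in iM; have [f bf rf] := iM.
apply: AF4_minor (iso_minor (matroid_iso_sym iM)) _.
apply: (template_AF4 cardF4 a_def avoidPhi ok) => y.
set M' := underlying (contract_delete (mkA d s)) in iM f bf rf *.
pose v (e : M') := colvec (mkA d s) (val (val e)).
have hr : repr_mod v (sp (colvec (mkA d s)) (Cset Phi E)) by apply: contract_delete_repr.
pose Y := [set x : M' | if val (val x) is inr _ then false else true].
have cY : #|Y| <= #|tY0 Phi|.
  have [y0 _|none] := pickP (mem Y); last by rewrite (eq_card none) card0.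
  have /fin_all_exists[q qE] (x : M') : exists y' : tY0 Phi,
      x \in Y -> val (val x) = inl (colY0 y').
    have := valP (val x); have := valP x; rewrite !inE.
    case: (val (val x)) => [[[c|y']|j]|e] //= _ _; first by exists y'.
    by exists y.
  apply: (@leq_card_in _ _ q) => x x' xY xY' qx.
  by apply/val_inj/val_inj; rewrite !qE ?qx.
have rY : rk (~: Y) = rk [set: M'].
  by rewrite -!rf iso_imsetC // (iso_imsetT bf) hsp // (iso_card bf).
have sub : (sp (colvec (mkA d s)) (Cset Phi E) + sp v (~: Y) =
            sp (colvec (mkA d s)) (Cset Phi E) + sp v setT)%VS.
  apply/eqP; rewrite eqEdim; apply/andP; split.
    by apply: addvS => //; apply: spS; apply: subsetT.
  by rewrite -!hr rY.
have [] := @col_ground F4 Phi B E (mkA d s) unit (fun=> inl (colY0 y)); rewrite //= => gy /(_ tt) gyE.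
have : v (gy tt) \in (sp (colvec (mkA d s)) (Cset Phi E) + sp v setT)%VS.
  by rewrite memvE (subv_trans _ (addvSr _ _)) // -memvE; apply: mem_sp.
rewrite /v (_ : val (val (gy tt)) = inl (colY0 y)) // -sub.
apply/subvP/addvS => //; apply: sp_sub => x; rewrite !inE /v.
case: (val (val x)) => [//|e] _.
exact: (mem_sp (fun e => colvec (mkA d s) (inr e))).
Qed.

End TemplateConclusion.

(** * Simplification of a matroid *)

Section Simplification.
Variable M : matroid.
Implicit Types (X Y S : {set M}) (e : M).

Lemma rk_ext X S e : S \subset X -> rk (e |: S) = rk S -> rk (e |: X) = rk X.
Proof.
move=> SX eS; have := rk_submod X (e |: S).
have -> : X :|: (e |: S) = e |: X by rewrite setUCA (setUidPl SX).
have := @rk_mono M S (X :&: (e |: S)); rewrite subsetI SX subsetUr => /(_ isT).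
by have := @rk_mono M X (e |: X) (subsetUr _ _); lia.
Qed.

Lemma rk_closure X Y : (forall e, e \in Y -> rk (e |: X) = rk X) -> rk (X :|: Y) = rk X.
Proof.
have [n] := ubnP #|Y|; elim: n Y => // n IH Y lt h.
have [->|[y yY]] := set_0Vmem Y; first by rewrite setU0.
rewrite -(setD1K yY) setUCA (rk_ext (S := X)) ?subsetUl ?h //.
apply: IH => [|e]; first by move: lt; rewrite (cardsD1 y) yY.
by rewrite !inE => /andP[_ eY]; apply: h.
Qed.

Definition simple_set (T : {set M}) : bool :=
  [forall X : {set M}, (X \subset T) && (#|X| <= 2) ==> (rk X == #|X|)].

(** [T] is a largest simple set. By maximality an element outside it is a loop, with [sg e] empty,
    or parallel to an element of [T], which then forms [sg e]. *)
Lemma max_simple : exists (T : {set M}) (sg : M -> {set M}), simple_set T /\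
  forall e, [/\ sg e \subset T, #|sg e| <= 1, rk (e |: sg e) = rk (sg e),
    forall t, t \in sg e -> rk (t |: [set e]) = rk [set e] & e \in T -> sg e = [set e]].
Proof.
have s0 : simple_set set0.
  by apply/forallP=> X; apply/implyP=> /andP[]; rewrite subset0 => /eqP-> _; rewrite rk0 cards0.
case: (arg_maxnP (fun T : {set M} => #|T|) s0) => T sT maxT.
exists T; suff /fin_all_exists[sg h] e : exists S : {set M}, [/\ S \subset T, #|S| <= 1,
    rk (e |: S) = rk S, forall t, t \in S -> rk (t |: [set e]) = rk [set e] & e \in T -> S = [set e]].
  by exists sg.
have sTP X : X \subset T -> #|X| <= 2 -> rk X = #|X|.
  by move=> XT X2; apply/eqP; move/forallP/(_ X)/implyP: sT; apply; rewrite XT.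
have [eT|eT] := boolP (e \in T).
  exists [set e]; split; rewrite ?sub1set ?cards1 ?setUid //.
  by move=> t; rewrite inE => /eqP->; rewrite setUid.
have [e0|e1] := posnP (rk [set e]).
  exists set0; split; rewrite ?sub0set ?cards0 ?setU0 ?rk0 // => t.
  by rewrite inE.
have : ~~ simple_set (e |: T).
  by apply/negP=> /maxT; rewrite cardsU1 eT /=; lia.
case/forallPn=> X; rewrite negb_imply => /andP[/andP[XT X2] rX].
have eX : e \in X.
  apply: contraR rX => eX; rewrite sTP //; apply/subsetP=> x xX.
  have := subsetP XT x xX; rewrite !inE => /predU1P[xe|//].
  by rewrite xe (negPf eX) in xX.
have ST : X :\ e \subset T.
  by apply/subsetP=> x; rewrite !inE => /andP[xe /(subsetP XT)]; rewrite !inE (negPf xe).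
have cX := cardsD1 e X; rewrite eX add1n in cX.
have rS : rk (X :\ e) = #|X :\ e| by apply: sTP => //; lia.
have eS : e |: (X :\ e) = X by rewrite setD1K.
have mS := @rk_mono M (X :\ e) X (subD1set _ _).
have rX' : rk X = rk (X :\ e).
  by have := rk_card X; move: rX; rewrite cX => /eqP; lia.
have r1 : rk [set e] = 1 by have := rk_card [set e]; rewrite cards1; lia.
exists (X :\ e); split; rewrite ?eS //; first by lia.
move=> t tS; have S1 : X :\ e = [set t].
  by apply/eqP; rewrite eq_sym eqEcard sub1set tS cards1; lia.
by rewrite r1 setUC -S1 eS rX' rS S1 cards1.
Qed.

Variables (T : {set M}) (sg : M -> {set M}).
Hypothesis sT : simple_set T.
Hypothesis sgP : forall e, [/\ sg e \subset T, #|sg e| <= 1, rk (e |: sg e) = rk (sg e),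
    forall t, t \in sg e -> rk (t |: [set e]) = rk [set e] & e \in T -> sg e = [set e]].

Definition Sg X : {set M} := \bigcup_(e in X) sg e.

Lemma rk_Sg X : rk (Sg X) = rk X.
Proof.
rewrite -(@rk_closure X (Sg X)) => [|t /bigcupP[e eX te]].
  rewrite setUC rk_closure // => e eX; have [_ _ h _ _] := sgP e.
  by apply: rk_ext h; apply: bigcup_sup.
have [_ _ _ h _] := sgP e; apply: rk_ext (h t te).
by rewrite sub1set.
Qed.

Lemma Sg_sub X : Sg X \subset T.
Proof. by apply/bigcupsP=> e _; have [] := sgP e. Qed.

Lemma sg_eq e t : t \in sg e -> sg e = [set t].
Proof.
have [_ c1 _ _ _] := sgP e; move=> te.
by apply/eqP; rewrite eq_sym eqEcard sub1set te cards1.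
Qed.

Lemma sg_T t : t \in T -> sg t = [set t].
Proof. by have [_ _ _ _ h] := sgP t. Qed.

Definition si : matroid := @delete M (~: T).

Lemma si_in (x : si) : val x \in T.
Proof. by have := valP x; rewrite inE negbK. Qed.

Lemma si_ex t : t \in T -> exists x : si, val x = t.
Proof.
move=> tT; have p : t \notin ~: T by rewrite inE negbK.
by exists (exist _ t p).
Qed.

Lemma si_rk (X : {set si}) : rk X = rk (val @: X : {set M}).
Proof. by []. Qed.

Lemma si_simple : simple si.
Proof.
move=> X X2; rewrite si_rk -(card_imset (mem X) val_inj); apply/eqP.
move/forallP/(_ (val @: X))/implyP: sT; apply; rewrite card_imset ?X2 ?andbT; last exact: val_inj.
by apply/subsetP=> _ /imsetP[x _ ->]; apply: si_in.
Qed.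

Lemma si_val_eq (X : {set M}) : X \subset T -> val @: [set x : si | val x \in X] = X.
Proof.
move=> XT; apply/setP=> t; apply/imsetP/idP=> [[x]|tX]; first by rewrite inE => xX ->.
by have [x xt] := si_ex (subsetP XT t tX); exists x; rewrite ?inE xt.
Qed.

Lemma SgT : Sg setT = T.
Proof.
apply/eqP; rewrite eqEsubset Sg_sub; apply/subsetP=> t tT.
by apply/bigcupP; exists t; rewrite ?inE // sg_T // inE.
Qed.

Lemma si_rkT : rk [set: si] = rk [set: M].
Proof.
have -> : [set: si] = [set x : si | val x \in T] by apply/setP=> x; rewrite !inE si_in.
by rewrite si_rk si_val_eq // -[RHS]rk_Sg SgT.
Qed.

(** A set in the simplification is enlarged to all elements whose representative it contains, loops
    going to the complement; no rank changes. *)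
Lemma si_vert k : vert_kconnected M k -> vert_kconnected si k.
Proof.
move=> cM X; pose Xv : {set M} := val @: X.
pose X' : {set M} := [set e | sg e :&: Xv != set0].
have XvT : Xv \subset T by apply/subsetP=> _ /imsetP[x _ ->]; apply: si_in.
have S1 : Sg X' = Xv.
  apply/setP=> t; apply/bigcupP/idP=> [[e]|tX].
    rewrite inE => /set0Pn[x /setIP[xe xX]] te.
    by move: xe; rewrite (sg_eq te) inE => /eqP<-.
  exists t; last by rewrite sg_T ?inE // (subsetP XvT).
  rewrite inE sg_T ?(subsetP XvT) //; apply/set0Pn; exists t.
  by rewrite !inE eqxx tX.
have S2 : Sg (~: X') = val @: (~: X).
  apply/setP=> t; apply/bigcupP/imsetP=> [[e]|[x xX ->]].
    rewrite !inE negbK => /eqP e0 te; have tT : t \in T.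
      by apply: (subsetP (Sg_sub [set e])); apply/bigcupP; exists e; rewrite ?inE.
    have [x xt] := si_ex tT; exists x => //; rewrite inE; apply/negP=> xX.
    have : t \in sg e :&: Xv by rewrite inE te -xt imset_f.
    by rewrite e0 inE.
  exists (val x); last by rewrite sg_T ?si_in // inE.
  rewrite !inE negbK sg_T ?si_in //; apply/eqP/setP=> t'; rewrite !inE.
  apply/negP=> /andP[/eqP->]; rewrite (mem_imset _ _ val_inj).
  by move: xX; rewrite inE => /negPf->.
have r1 : rk X' = rk X by rewrite -rk_Sg S1.
have r2 : rk (~: X') = rk (~: X) by rewrite -rk_Sg S2.
move=> cX; have := cM X'; rewrite /conn r1 r2 -si_rkT => /(_ cX).
by rewrite /spanning r1 r2 si_rkT.
Qed.

(** Elements of a simple minor have rank 1 over the contracted set, so they are not loops and have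
    representatives. These are distinct because pairs have rank 2. *)
Lemma si_minor K : simple K -> has_minor M K -> has_minor si K.
Proof.
move=> sK /minorP[g [C [ig gC rg]]].
have r1 (i : K) : rk [set i] = 1 by rewrite sK cards1.
have /fin_all_exists[u uP] (i : K) : exists x : si, val x \in sg (g i).
  have [s0|[t tg]] := set_0Vmem (sg (g i)); last first.
    have tT : t \in T.
      by apply: (subsetP (Sg_sub [set g i])); apply/bigcupP; exists (g i); rewrite ?inE.
    by have [x xt] := si_ex tT; exists x; rewrite xt.
  have [_ _ + _ _] := sgP (g i); rewrite s0 => h.
  have := rg [set i]; rewrite imset_set1 (rk_ext (sub0set C) h) r1; lia.
have uE i : sg (g i) = [set val (u i)] by apply: sg_eq.
pose C' := [set x : si | val x \in Sg C].
have imE (X : {set K}) : val @: (u @: X :|: C') = Sg (g @: X :|: C).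
  rewrite imsetU si_val_eq ?Sg_sub // /Sg bigcup_setU; congr (_ :|: _).
  apply/setP=> t; apply/imsetP/bigcupP=> [[_ /imsetP[i iX ->] ->]|[_ /imsetP[i iX ->]]].
    by exists (g i); rewrite ?imset_f.
  by rewrite uE inE => /eqP->; exists (u i); rewrite ?imset_f.
have rC : rk C' = rk C by rewrite si_rk si_val_eq ?Sg_sub // rk_Sg.
have rX (X : {set K}) : rk (u @: X :|: C') = rk X + rk C'.
  by rewrite si_rk imE rk_Sg rg rC.
apply/minorP; exists u, C'; split=> // [i j uij|i].
  apply/eqP; apply: contraT => ij; have := rX [set i; j]; have := rX [set i].
  by rewrite imsetU !imset_set1 -uij setUid r1 sK ?cards2 ?ij //; lia.
apply/negP=> iC; have := rX [set i]; rewrite imset_set1 r1.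
by rewrite (setUidPr _) ?sub1set //; lia.
Qed.

(** Loops receive the zero vector and parallel elements the vector of their representative. *)
Lemma si_AF4 : AF4 si -> AF4 M.
Proof.
move=> AS F hF; have [n [A rA]] := AS F hF.
pose v (e : M) : {ffun 'I_n -> F^o} :=
  if [pick x : si | val x \in sg e] is Some x then colvec A x else 0%R.
have vE e (x : si) : val x \in sg e -> v e = colvec A x.
  move=> xe; rewrite /v; case: pickP => [y ye|/(_ x)]; last by rewrite xe.
  by congr (colvec A _); apply: val_inj; move: ye; rewrite (sg_eq xe) inE => /eqP.
apply: (@representable_mod F M _ v 0%VS) => X; rewrite dimv0 addn0 add0v -rk_Sg.
have -> : sp v X = sp (colvec A) [set x : si | val x \in Sg X].
  apply/eqP; rewrite eqEsubv; apply/andP; split; apply: sp_sub => e.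
    move=> eX; rewrite /v; case: pickP => [x xe|_]; last exact: mem0v.
    by apply: mem_sp; rewrite inE; apply/bigcupP; exists e.
  rewrite inE => /bigcupP[e' eX xe]; rewrite -(vE _ _ xe).
  exact: mem_sp.
rewrite -{1}(si_val_eq (Sg_sub X)) -si_rk; exact: rA.
Qed.

End Simplification.

(** * Cycle matroids of complete graphs *)

Section CompleteGraphs.

Lemma MK_rkT n : n.-1 <= rk [set: MK n].
Proof.
rewrite -[rk _]/(graphic_rk setT) /graphic_rk.
suff : ncomp [set: edge n] <= 1 by lia.
apply/card_le1P=> x; rewrite !inE andbT => rx y; rewrite !inE andbT.
apply/idP/eqP=> [ry|->//].
have [//|xy] := eqVneq y x.
have c2 : #|[set x; y]| == 2 by rewrite cards2 (eq_sym x) xy.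
have cxy : connect (adj [set: edge n]) x y.
  by apply/connect1/exists_inP; exists (exist _ [set x; y] c2); rewrite ?inE.
by move: cxy; rewrite -(root_connect (@adj_csym n _)) (eqP rx) (eqP ry) => /eqP.
Qed.

Lemma connect_single n (f : edge n) u v :
  connect (adj [set f]) u v -> u = v \/ val f = [set u; v].
Proof.
case/connectP=> p; elim: p u => [|z p IH] u /=; first by move=> _ ->; left.
case/andP=> /exists_inP[f']; rewrite inE => /eqP-> /eqP fu pz Dv.
have [zv|fz] := IH z pz Dv; first by right; rewrite -zv.
have : v \in [set u; z] by rewrite -fu fz !inE eqxx orbT.
by rewrite !inE => /orP[]/eqP vE; [left|right; rewrite vE].
Qed.

Lemma MK_simple n : simple (MK n).
Proof.
have rk1 (e : edge n) : graphic_rk [set e] = 1.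
  rewrite -[[set e]]setU0 graphic_rkU1 graphic_rk0 add0n; suff -> : spanned set0 e = false by [].
  apply/negP=> /forallP h; have [u [v De]] := edgeP e.
  have := forallP (h u) v; rewrite De eqxx /= => /connectP[[|z p]] /=.
    by move=> _ uv; have := valP e; rewrite De uv setUid cards1.
  by case/andP=> /exists_inP[e']; rewrite inE.
move=> X X2; rewrite -[rk X]/(graphic_rk X).
case: (posnP #|X|) => [/eqP|X0]; first by rewrite cards_eq0 => /eqP->; rewrite graphic_rk0 cards0.
have [/eqP/cards1P[e ->]|] := eqVneq #|X| 1%N; first by rewrite rk1 cards1.
move=> X1; have /eqP/cards2P[e [f [ef ->]]] : #|X| = 2 by lia.
rewrite cards2 ef graphic_rkU1 rk1; suff -> : spanned [set f] e = false by [].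
apply/negP=> /forallP h; have [u [v De]] := edgeP e.
have := forallP (h u) v; rewrite De eqxx /= => /connect_single[uv|fE].
  by have := valP e; rewrite De uv setUid cards1.
by case/eqP: ef; apply: val_inj; rewrite De fE.
Qed.

Variables (m n : nat) (mn : m <= n).
Let io (x : 'I_m) : 'I_n := widen_ord mn x.

Lemma io_inj : injective io.
Proof. by move=> x y /(congr1 val) /= /val_inj. Qed.

Fact io_edge (e : edge m) : #|io @: val e| == 2.
Proof. by rewrite card_imset ?(valP e) //; apply: io_inj. Qed.

Definition widen_edge (e : edge m) : edge n := 
  exist (fun e : {set 'I_n} => #|e| == 2) (io @: val e) (io_edge e).

Lemma widen_edge_inj : injective widen_edge.
Proof. by move=> e f /(congr1 val) /= /(imset_inj io_inj) /val_inj. Qed.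

Lemma adj_widen (X : {set edge m}) u v : adj (widen_edge @: X) (io u) (io v) = adj X u v.
Proof.
apply/exists_inP/exists_inP=> [[_ /imsetP[e eX ->]]|[e eX /eqP De]].
  rewrite /= -imset_set1 => /eqP; rewrite -[X in _ = _ :|: X]imset_set1 -imsetU => /(imset_inj io_inj) De.
  by exists e => //; rewrite De.
by exists (widen_edge e); rewrite ?imset_f //= De imsetU !imset_set1.
Qed.

Lemma connect_widen (X : {set edge m}) u v : connect (adj (widen_edge @: X)) (io u) (io v) = connect (adj X) u v.
Proof.
apply/connectP/connectP=> [[p pp Dv]|[p pp Dv]].
  have [q qq Dq] : exists2 q, p = map io q & path (adj X) u q.
    elim: p u pp {Dv} => [|z p IH] u /=; first by exists [::].
    case/andP=> uz pz; have [w Dz] : exists w, z = io w.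
      case/exists_inP: uz => _ /imsetP[e eX ->] /eqP /= De.
      have : z \in io @: val e by rewrite De !inE eqxx orbT.
      by case/imsetP=> w _ ->; exists w.
    move: uz pz; rewrite Dz adj_widen => uw /IH[q -> qw].
    by exists (w :: q); rewrite //= uw.
  exists q => //; apply: io_inj; rewrite Dv qq last_map //.
exists (map io p); last by rewrite Dv last_map.
elim: p u pp {Dv} => //= z p IH u /andP[uz pz]; by rewrite adj_widen uz IH.
Qed.

Lemma MK_widen : has_minor (MK n) (MK m).
Proof.
apply/minorP; exists widen_edge, set0; split=> [|e|X]; first exact: widen_edge_inj.
  by rewrite inE.
rewrite setU0 rk0 addn0 -[LHS]/(graphic_rk (widen_edge @: X)) -[RHS]/(graphic_rk X).
have [k] := ubnP #|X|; elim: k X => // k IH X lt.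
have [->|[e eX]] := set_0Vmem X; first by rewrite imset0 !graphic_rk0.
rewrite -(setD1K eX) imsetU imset_set1 !graphic_rkU1 IH; last first.
  by move: lt; rewrite (cardsD1 e) eX.
congr (_ + ~~ _); apply/forallP/forallP=> h u; apply/forallP=> v; apply/implyP=> /eqP De.
  have := forallP (h (io u)) (io v).
  by rewrite /= De imsetU !imset_set1 eqxx /= connect_widen.
have : u \in io @: val e by rewrite [io @: _]De !inE eqxx.
have : v \in io @: val e by rewrite [io @: _]De !inE eqxx orbT.
case/imsetP=> v' _ Dv /imsetP[u' _ Du]; rewrite Du Dv connect_widen.
have := forallP (h u') v'; suff -> : val e = [set u'; v'] by rewrite eqxx.
by apply: (imset_inj io_inj); rewrite imsetU !imset_set1 -Du -Dv.
Qed.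

End CompleteGraphs.

(** * The two equivalences *)

Section Final.
Variables (F4 : finFieldType) (cardF4 : #|F4| = 4) (a : F4).
Hypothesis a_def : (a ^+ 2 = a + 1)%R.

Lemma excluded_not_AF4 N : List.In N (excluded_highly_connected a) -> ~ AF4 N.
Proof.
have h1 := not_AF4_F7 cardF4 a_def; have h2 := not_AF4_V1 cardF4 a_def.
have h3 := not_AF4_V2 cardF4 a_def; have h4 := not_AF4_V3 cardF4 a_def.
have h5 := not_AF4_P1 cardF4 a_def; have h6 := not_AF4_P2 cardF4 a_def.
have h7 := not_AF4_P3 cardF4 a_def; have h8 := not_AF4_Y9 cardF4 a_def.
have h9 := not_AF4_Pap cardF4 a_def.
have d (L : matroid) : ~ AF4 L -> ~ AF4 (dual L) by move=> h /AF4_undual.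
case=> [<-|]; first exact: h1.
case=> [<-|]; first exact: (d _ h1).
case=> [<-|]; first exact: h2.
case=> [<-|]; first exact: (d _ h2).
case=> [<-|]; first exact: h3.
case=> [<-|]; first exact: h4.
case=> [<-|]; first exact: (d _ h4).
case=> [<-|]; first exact: h5.
case=> [<-|]; first exact: (d _ h5).
case=> [<-|]; first exact: h6.
case=> [<-|]; first exact: h7.
case=> [<-|]; first exact: (d _ h7).
case=> [<-|]; first exact: h8.
case=> [<-|]; first exact: (d _ h8).
case=> [<-|]; first exact: h9.
case=> [<-|]; first exact: (d _ h9).
by [].
Qed.

Lemma vert_sub_high N : List.In N (excluded_vertically_connected a) ->
  List.In N (excluded_highly_connected a).
Proof. by move=> /=; tauto. Qed.

Lemma rank3_sub_vert N : List.In N (rank3_excluded a) ->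
  List.In N (excluded_vertically_connected a).
Proof. by move=> /=; tauto. Qed.

(** This opens the dual templates to the same argument: the duals of the members of M(Psi) lie in
    the class, so the members themselves avoid the rank-3 matroids. *)
Lemma rank3_dual_high N : List.In N (rank3_excluded a) ->
  List.In (dual N) (excluded_highly_connected a).
Proof. by move=> /=; repeat (case=> [<-|]; first by tauto). Qed.

Lemma AF4_no_minor (L : seq matroid) (M : matroid) :
  (forall N, List.In N L -> ~ AF4 N) -> AF4 M -> ~ has_minor_in L M.
Proof. by move=> hL AM [N LN MN]; apply: (hL N LN); apply: AF4_minor AM. Qed.

Lemma avoids_sub (L L' : seq matroid) (M : rmatroid F4) :
  (forall N, List.In N L' -> List.In N L) -> avoids L M -> avoids L' M.
Proof. by move=> sub aM [N LN MN]; apply: aM; exists N => //; apply: sub. Qed.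

Lemma pchar2 : 2 \in [pchar F4]%R.
Proof. by rewrite inE /= mulr2n (F4_addxx cardF4 a_def) eqxx. Qed.

Lemma sum_ge s (f : 'I_s -> nat) i : f i <= \sum_j f j.
Proof. by rewrite (bigD1 i) //= leq_addr. Qed.

Lemma avoids_noPG (L : seq matroid) (M : matroid) :
  List.In F7 L -> ~ has_minor_in L M -> ~ has_minor M (PG 2 3).
Proof. by move=> LF aM h; apply: aM; exists F7 => //; apply: minor_trans PG_F7. Qed.

Lemma highly_connected_part : HypothesisA ->
  exists2 k : nat, 0 < k &
    forall M : matroid,
      representable F4 M -> kconnected M k -> 2 * k <= #|M| ->
      (AF4 M <-> ~ has_minor_in (excluded_highly_connected a) M).
Proof.
move=> HA; have [k [s [t [Phi [Psi [k0 hPhi hPsi hM]]]]]] :=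
  HA F4 2 3 (avoids (excluded_highly_connected a)) pchar2 isT (avoids_minor_closed _ _).
(* The summand 3 makes sets of two elements independent, hence the matroid simple; the sums dominate
   the size of every [Y0], so that [kconnected_small] applies to sets of that size. *)
pose K := k + 3 + \sum_i #|tY0 (Phi i)| + \sum_j #|tY0 (Psi j)|.
exists K => [|M rM cM szM]; first by rewrite /K; lia.
split; first exact: AF4_no_minor excluded_not_AF4.
move=> hno; have [R iR] := representable_rmatroid rM.
have iR' := matroid_iso_sym iR; have [g bg rg] := iR'.
apply: AF4_minor (iso_minor iR) _.
have cR : kconnected (underlying R) K by apply: iso_kconnected bg rg _ cM.
have szR : 2 * K <= #|underlying R| by rewrite (bij_eq_card bg).
have aR : avoids (excluded_highly_connected a) R.
  by move=> h; apply: hno; apply: has_minor_in_trans (iso_minor iR') h.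
have small (X : {set underlying R}) : #|X| < K -> rk X = #|X| /\ rk (~: X) = rk [set: underlying R].
  exact: kconnected_small cR szR.
case: (hM R aR).
- by move=> X X2; have [] // := small X; rewrite /K; lia.
- by move=> j X /andP[j0 jk]; apply: cR; rewrite j0 /K; lia.
- by move: szR; rewrite /K; lia.
- by apply: avoids_noPG aR; left.
- move=> [i ci]; apply: (conforms_AF4 cardF4 a_def _ ci).
    by move=> N /hPhi; apply: avoids_sub => L /rank3_sub_vert/vert_sub_high.
  move=> X cX; have [] // := small X.
  by have := sum_ge (fun i => #|tY0 (Phi i)|) i; rewrite /K; lia.
move=> [j cj]; apply: AF4_undual.
apply: AF4_minor (iso_minor (matroid_iso_sym (underlying_rdual R))) _.
apply: (conforms_AF4 cardF4 a_def _ cj).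
  move=> N /hPsi aN [L LL NL]; apply: aN; exists (dual L); first exact: rank3_dual_high.
  apply: minor_trans (minor_dual NL); apply: iso_minor.
  exact/matroid_iso_sym/underlying_rdual.
(* In the dual, the complement of [X] is spanning exactly when [X] is independent in [R], and small
   sets are. *)
move=> X cX.
have rd (Y : {set rground R}) :
    rk (Y : {set underlying (rdual R)}) = @dual_rk (underlying R) Y by apply: urk_rdual.
have Xs : #|X| < K by have := sum_ge (fun i => #|tY0 (Psi i)|) j; rewrite /K; lia.
have [rX _] := small X Xs.
rewrite !rd; have := @dual_rkE (underlying R) (~: X); have := @dual_rkE (underlying R) setT.
rewrite setCK setCT rX rk0; have := cardsC X; rewrite -cardsT.
move=> h1 h2 h3; apply/eqP; rewrite -(eqn_add2r (rk [set: underlying R])); apply/eqP.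
by apply: (etrans h3); apply: (etrans _ (esym h2)); rewrite addn0 addnC; apply: h1.
Qed.

Lemma vertically_connected_part : HypothesisB ->
  exists k n : nat, [/\ 0 < k, 0 < n &
    forall M : matroid,
      representable F4 M -> vert_kconnected M k -> has_minor M (MK n) ->
      (AF4 M <-> ~ has_minor_in (excluded_vertically_connected a) M)].
Proof.
move=> HB; have [k [n [s [t [Phi [Psi [[k0 n0] hPhi _ hM _]]]]]]] :=
  HB F4 2 3 (avoids (excluded_vertically_connected a)) pchar2 isT (avoids_minor_closed _ _).
pose Y := \sum_i #|tY0 (Phi i)|.
(* A set of at most [Y] elements has connectivity at most [Y], below the new bound, so the set or
   its complement spans. The clique on [n + Y + 2] vertices has rank above [Y], which leaves the
   complement. *)
exists (k + Y + 1), (n + Y + 2); split; [lia|lia|move=> M rM cM mM].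
split; first by apply: AF4_no_minor => N /vert_sub_high/excluded_not_AF4.
(* Hypothesis B speaks of simple matroids, so the simplification takes the place of [M]. *)
move=> hno; have [T [sg [sT sgP]]] := max_simple M.
apply: (si_AF4 sgP).
have mS : has_minor M (si T).
  apply/minorP; exists val, set0; split=> [||X]; [exact: val_inj|by move=> x; rewrite inE|].
  by rewrite setU0 rk0 addn0.
have mN : has_minor (si T) (MK (n + Y + 2)) by apply: si_minor sgP _ (@MK_simple _) mM.
have [R iR] := representable_rmatroid (representable_minor mS rM).
have iR' := matroid_iso_sym iR; have [g bg rg] := iR'.
apply: AF4_minor (iso_minor iR) _.
have cR : vert_kconnected (underlying R) (k + Y + 1).
  by apply: iso_vert bg rg _ _; apply: si_vert.
have aR : avoids (excluded_vertically_connected a) R.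
  move=> h; apply: hno; apply: has_minor_in_trans mS _.
  exact: has_minor_in_trans (iso_minor iR') h.
have mR : has_minor (underlying R) (MK (n + Y + 2)) by apply: minor_trans (iso_minor iR) mN.
have [] := hM R aR.
- by apply: iso_simple bg rg _; apply: si_simple sT.
- by move=> X cX; apply: cR; lia.
- by apply: minor_trans mR (MK_widen _); lia.
- by apply: avoids_noPG aR; left.
move=> i ci; apply: (conforms_AF4 cardF4 a_def _ ci).
  by move=> N /hPhi; apply: avoids_sub => L /rank3_sub_vert.
move=> X cX; have XY : #|X| <= Y by apply: leq_trans cX (sum_ge (fun i => #|tY0 (Phi i)|) i).
have r1 := rk_card X; have r2 := rk_mono (subsetT (~: X)).
have [|rX|//] := cR X; first by rewrite /conn; lia.
rewrite /spanning in rX; have := minor_rk mR; have := MK_rkT (n + Y + 2).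
by lia.
Qed.

End Final.

Theorem theorem1p6 (F4 : finFieldType) (cardF4 : #|F4| = 4)
    (a : F4) (a_def : (a ^+ 2 = a + 1)%R) :
  (HypothesisA ->
    exists2 k : nat, 0 < k &
      forall M : matroid,
        representable F4 M -> kconnected M k -> 2 * k <= #|M| ->
        (AF4 M <-> ~ has_minor_in (excluded_highly_connected a) M)) /\
  (HypothesisB ->
    exists k n : nat, [/\ 0 < k, 0 < n &
      forall M : matroid,
        representable F4 M -> vert_kconnected M k -> has_minor M (MK n) ->
        (AF4 M <-> ~ has_minor_in (excluded_vertically_connected a) M)]).
Proof.
by split; [apply: highly_connected_part|apply: vertically_connected_part].
Qed.
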